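(* Let $a\in\{1,3,5\}$ and let $s_0\in\mathbb{C}$. Let $\sigma$ be a real number with $\sigma>\Re(s_0)$ and $\sigma>\Re(1-s_0)$; if $a=5$ assume in addition that $\sigma>3$. Then $$\xi(s_0)\,\xi(s_0-a)=\frac{1}{2\pi i}\sum_{n=1}^\infty\int_{\Re(s)=\sigma}\sigma_a(n)\left[\frac{g(s)g(s-a)}{s-s_0}\,\frac{1}{n^s}+\frac{g(s)g(s+a)}{s-1+s_0}\,\frac{1}{n^{s+a}}\right]ds .$$
   Context: $\sigma_a(n)=\sum_{d\mid n}d^a$ is the divisor function (not to be confused with the real number $\sigma$). $g(s)=\pi^{-s/2}(s-1)\Gamma\left(\frac s2+1\right)$, where $\Gamma$ is the Euler Gamma function, and $\xi(s)=g(s)\zeta(s)=\frac12 s(s-1)\pi^{-s/2}\Gamma\left(\frac s2\right)\zeta(s)$ is the Riemann Xi function (an entire function with $\xi(s)=\xi(1-s)$), $\zeta$ being the Riemann zeta function. The integral over $\Re(s)=\sigma$ is taken along the vertical line from $\sigma-i\infty$ to $\sigma+i\infty$. *)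

(* Defs.v *)
(* Stdlib reals with Coquelicot's complex numbers [C = R * R]. *)
From Stdlib Require Export Reals List ClassicalEpsilon.
From Coquelicot Require Export Coquelicot.

Open Scope C_scope.

Definition Cexp (z : C) : C :=
  RtoC (exp (Re z)) * (cos (Im z), sin (Im z)).

(* Principal value; meaningful only for [0 < x]. *)
Definition Rcpow (x : R) (s : C) : C := Cexp (s * RtoC (ln x)).

(* Euler's integral of t^(z-1) e^(-t) over (0, +oo); convergent iff [0 < Re z]. *)
Definition Euler_integral (z : C) : C :=
  RInt_gen (V := C_R_CompleteNormedModule)
    (fun t : R => RtoC (exp (- t)) * Rcpow t (z - 1))
    (at_right 0) (Rbar_locally p_infty).

Fixpoint rising (z : C) (n : nat) : C :=
  match n with
  | O => 1
  | S m => rising z m * (z + RtoC (INR m))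
  end.

(* The number of unit steps to the right taking [z] into the half-plane
   [0 < Re z]; it is 0 when [z] is already there. *)
Definition Gamma_shift (z : C) : nat := Z.to_nat (up (- Re z)).

(* Gamma, continued to the left by Gamma (z + 1) = z Gamma z. The values at the
   poles 0, -1, -2, ... carry no meaning. *)
Definition Gamma (z : C) : C :=
  Euler_integral (z + RtoC (INR (Gamma_shift z))) / rising z (Gamma_shift z).

Definition holomorphic_at (f : C -> C) (z : C) : Prop :=
  ex_derive (K := C_AbsRing) (V := C_NormedModule) f z.

Definition is_zeta (f : C -> C) : Prop :=
  (forall s : C, (1 < Re s)%R ->
     is_series (K := C_AbsRing) (V := C_NormedModule)
       (fun k : nat => / Rcpow (INR (S k)) s) (f s)) /\
  (forall s : C, s <> 1 -> holomorphic_at f s).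

(* [is_zeta] determines a function everywhere except at its pole 1, where
   the value carries no meaning. *)
Definition zeta : C -> C := epsilon (inhabits (fun _ : C => RtoC 0)) is_zeta.

Definition g (s : C) : C :=
  Rcpow PI (- (s / 2)) * (s - 1) * Gamma (s / 2 + 1).

(* The product [g s * zeta s] has removable singularities at 1 (pole of zeta)
   and at -2, -4, ... (poles of Gamma (s / 2 + 1)); the limit over the punctured
   neighbourhoods of [s] gives the entire function. *)
Definition xi (s : C) : C :=
  iota (T := C_R_CompleteNormedModule) (fun l : C =>
    filterlim (fun w : C => g w * zeta w) (locally' s) (locally l)).

Definition divisor_sigma (a n : nat) : nat :=
  list_sum (map (fun d => Nat.pow d a)
    (filter (fun d => Nat.eqb (Nat.modulo n d) 0) (seq 1 n))).

(* [l] is the integral of [f] from [c - i oo] to [c + i oo] (improper, with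
   [s = c + i t] and [ds = i dt]). *)
Definition is_vertical_integral (f : C -> C) (c : R) (l : C) : Prop :=
  is_RInt_gen (V := C_R_NormedModule)
    (fun t : R => f (RtoC c + Ci * RtoC t) * Ci)
    (Rbar_locally m_infty) (Rbar_locally p_infty) l.

(* Main.v *)
Require Import Defs.
From Stdlib Require Import Lra Lia Psatz ZArith.

(* For fixed n the integrand is holomorphic and decays faster than any power to the right of the given
   line, so that line may be moved to [Re s = c] with [c > a + 1], where summation and integration
   commute and [sum_n sigma_a(n) n^(-s) = zeta(s) zeta(s - a)]. With [F(s) = xi(s) xi(s - a)] the two
   summands become [F(s) / (s - s0)] and [F(1 - s) / (s - 1 + s0)], and the substitution [s -> 1 - s]
   turns the total into the difference of the integrals of [F(s) / (s - s0)] over [Re s = c] and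
   [Re s = 1 - c], which is [2 pi i F(s0)] by Cauchy's formula.

   The functional equation of xi comes from that of theta, itself a residue computation. The zeta of the
   statement is only characterised by its series and by holomorphy off 1; that [g * zeta] equals Riemann's
   entire function then follows from uniqueness of analytic continuation along horizontal strips. *)

(** * Complex differentiation *)

(** For [a = 1] and [a = 3] the given line may come arbitrarily close to [Re s = 1 / 2], where the
    Dirichlet series diverges; only the single integrals can be moved. In their way stand the poles
    of [g (s - a)], which come from [Gamma ((s - a) / 2 + 1)]: to the right of 1/2 there is none for
    [a = 1], one at 1 for [a = 3], and two at 1 and 3 for [a = 5]. The zero of [g s] cancels the one
    at 1, and [3 < sigma] keeps clear of the one at 3. For [a = 3] and [sigma = 1] the line runs
    through the cancelled pole, where the value of [Gamma] is arbitrary; hence the integrands are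
    identified only off height 0. The decay of [g] is drawn from the recursion of Gamma rather than
    from Stirling's formula. Every absolutely convergent integral over a line is controlled by a
    multiple of [1 / (1 + t^2)]. *)

Definition is_cderiv (f : C -> C) (z l : C) : Prop :=
  forall eps : R, (0 < eps)%R -> exists d : R, (0 < d)%R /\
    forall w : C, (Cmod (w - z) < d)%R ->
      (Cmod (f w - f z - l * (w - z)) <= eps * Cmod (w - z))%R.

Definition cdiff (f : C -> C) (z : C) : Prop := exists l, is_cderiv f z l.

Lemma is_derive_cderiv (f : C -> C) (z l : C) :
  is_derive (K := C_AbsRing) (V := C_NormedModule) f z l <-> is_cderiv f z l.
Proof.
  split.
  - intros [_ H] eps He.
    destruct (H z (fun P HP => HP) (mkposreal eps He)) as [d Hd].
    exists d. split. apply cond_pos.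
    intros w Hw. specialize (Hd w Hw).
    replace (l * (w - z)) with ((w - z) * l) by ring. exact Hd.
  - intros H. split. apply is_linear_scal_l.
    intros x Hx. 
    assert (x = z) as ->.
    { symmetry. apply (is_filter_lim_locally_unique (K := C_AbsRing) (V := C_NormedModule) z x).
      intros P HP. apply locally_C. apply Hx. apply locally_C. exact HP. }
    intros eps. destruct (H eps (cond_pos eps)) as [d [Hd1 Hd2]].
    exists (mkposreal d Hd1). intros w Hw. specialize (Hd2 w Hw).
    replace (l * (w - z)) with ((w - z) * l) in Hd2 by ring. exact Hd2.
Qed.

(* [C_NormedModule] and [AbsRing_NormedModule C_AbsRing] carry different uniform structures (squares
   and discs); Coquelicot's rules for sums use the first, those for products and composites the second. *)
Lemma is_derive_cderiv' (f : C -> C) (z l : C) :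
  is_derive (K := C_AbsRing) (V := AbsRing_NormedModule C_AbsRing) f z l <-> is_cderiv f z l.
Proof.
  split.
  - intros [_ H] eps He.
    destruct (H z (fun P HP => HP) (mkposreal eps He)) as [d Hd].
    exists d. split. apply cond_pos.
    intros w Hw. specialize (Hd w Hw).
    replace (l * (w - z)) with ((w - z) * l) by ring. exact Hd.
  - intros H. split. apply is_linear_scal_l.
    intros x Hx.
    assert (x = z) as ->.
    { symmetry. apply (is_filter_lim_locally_unique (K := C_AbsRing) (V := AbsRing_NormedModule C_AbsRing) z x).
      exact Hx. }
    intros eps. destruct (H eps (cond_pos eps)) as [d [Hd1 Hd2]].
    exists (mkposreal d Hd1). intros w Hw. specialize (Hd2 w Hw).
    replace (l * (w - z)) with ((w - z) * l) in Hd2 by ring. exact Hd2.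
Qed.

Lemma cdiff_holomorphic (f : C -> C) (z : C) : holomorphic_at f z <-> cdiff f z.
Proof.
  split; intros [l H]; exists l; now apply is_derive_cderiv.
Qed.

Lemma Cmod_sub_sym (x y : C) : Cmod (x - y) = Cmod (y - x).
Proof. rewrite <- Cmod_opp. f_equal. ring. Qed.

Lemma Cmod_le_sum (x y : C) : (Cmod (x - y) <= Cmod x + Cmod y)%R.
Proof.
  unfold Cminus. rewrite <- (Cmod_opp y). apply Cmod_triangle.
Qed.

Lemma Cmod_rev_triangle (x y : C) : (Cmod x - Cmod y <= Cmod (x - y))%R.
Proof.
  pose proof (Cmod_triangle (x - y) y). replace (x - y + y) with x in H by ring. lra.
Qed.

Lemma is_cderiv_ext_loc (f h : C -> C) (z l : C) (r : R) : (0 < r)%R ->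
  (forall w, (Cmod (w - z) < r)%R -> f w = h w) ->
  is_cderiv f z l -> is_cderiv h z l.
Proof.
  intros Hr E H eps He. destruct (H eps He) as [d [Hd Hf]].
  exists (Rmin d r). split. apply Rmin_pos; auto.
  intros w Hw. rewrite <- !E.
  - apply Hf. eapply Rlt_le_trans; [exact Hw|apply Rmin_l].
  - replace (z - z) with (RtoC 0) by ring. rewrite Cmod_0. exact Hr.
  - eapply Rlt_le_trans; [exact Hw|apply Rmin_r].
Qed.

Lemma cdiff_ext_loc (f h : C -> C) (z : C) (r : R) : (0 < r)%R ->
  (forall w, (Cmod (w - z) < r)%R -> f w = h w) -> cdiff f z -> cdiff h z.
Proof. intros Hr E [l H]. exists l. eapply is_cderiv_ext_loc; eauto. Qed.

Lemma cdiff_ext (f h : C -> C) (z : C) : (forall w, f w = h w) -> cdiff f z -> cdiff h z.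
Proof. intros E. apply (cdiff_ext_loc _ _ _ 1); auto. lra. Qed.

Lemma is_cderiv_const (c z : C) : is_cderiv (fun _ => c) z 0.
Proof.
  intros eps He. exists 1%R. split. lra. intros w _.
  replace (c - c - 0 * (w - z)) with (RtoC 0) by ring. rewrite Cmod_0.
  apply Rmult_le_pos. lra. apply Cmod_ge_0.
Qed.

Lemma is_cderiv_id (z : C) : is_cderiv (fun w => w) z 1.
Proof.
  intros eps He. exists 1%R. split. lra. intros w _.
  replace (w - z - 1 * (w - z)) with (RtoC 0) by ring. rewrite Cmod_0.
  apply Rmult_le_pos. lra. apply Cmod_ge_0.
Qed.

Lemma is_cderiv_plus (f h : C -> C) (z l m : C) :
  is_cderiv f z l -> is_cderiv h z m -> is_cderiv (fun w => f w + h w) z (l + m).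
Proof.
  intros H1 H2. apply is_derive_cderiv in H1, H2. apply is_derive_cderiv.
  exact (is_derive_plus (K := C_AbsRing) (V := C_NormedModule) f h z l m H1 H2).
Qed.

Lemma is_cderiv_mult (f h : C -> C) (z l m : C) :
  is_cderiv f z l -> is_cderiv h z m ->
  is_cderiv (fun w => f w * h w) z (l * h z + f z * m).
Proof.
  intros H1 H2. apply is_derive_cderiv' in H1, H2. apply is_derive_cderiv'.
  exact (is_derive_mult (K := C_AbsRing) f h z l m H1 H2 Cmult_comm).
Qed.

Lemma is_cderiv_comp (f h : C -> C) (z l m : C) :
  is_cderiv f (h z) l -> is_cderiv h z m ->
  is_cderiv (fun w => f (h w)) z (m * l).
Proof.
  intros H1 H2. apply is_derive_cderiv' in H1, H2. apply is_derive_cderiv'.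
  exact (is_derive_comp (K := C_AbsRing) (V := AbsRing_NormedModule C_AbsRing) f h z l m H1 H2).
Qed.

Lemma cderiv_cont (f : C -> C) (z : C) : cdiff f z ->
  forall eps, (0 < eps)%R -> exists d, (0 < d)%R /\
    forall w, (Cmod (w - z) < d)%R -> (Cmod (f w - f z) < eps)%R.
Proof.
  intros [l H] eps He. destruct (H 1%R Rlt_0_1) as [d [Hd Hf]].
  pose proof (Cmod_ge_0 l) as Hl.
  exists (Rmin d (eps / (2 * (Cmod l + 1)))). split.
  { apply Rmin_pos; auto. apply Rdiv_lt_0_compat; lra. }
  intros w Hw.
  assert (H1 := Rlt_le_trans _ _ _ Hw (Rmin_l _ _)).
  assert (H2 := Rlt_le_trans _ _ _ Hw (Rmin_r _ _)).
  specialize (Hf w H1).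
  replace (f w - f z) with ((f w - f z - l * (w - z)) + l * (w - z)) by ring.
  eapply Rle_lt_trans. apply Cmod_triangle. rewrite Cmod_mult.
  assert (Cmod (w - z) * (2 * (Cmod l + 1)) < eps)%R.
  { apply Rmult_lt_reg_r with (/ (2 * (Cmod l + 1)))%R.
    apply Rinv_0_lt_compat; lra. rewrite Rmult_assoc, Rinv_r by lra. lra. }
  pose proof (Cmod_ge_0 (w - z)). nra.
Qed.

Lemma is_cderiv_inv (z : C) : z <> 0 -> is_cderiv (fun w => / w) z (- (/ z * / z)).
Proof.
  intros Hz eps He. 
  assert (Hm : (0 < Cmod z)%R) by now apply Cmod_gt_0.
  set (M := Cmod z) in *.
  (* Within [M / 2] of [z] one has [|w| > M / 2], so the error [|w - z|^2 / (|w| M^2)] is at most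
     [2 |w - z|^2 / M^3]; the second bound turns this into [eps |w - z|]. *)
  exists (Rmin (M / 2) (eps * (M * M * M) / 2)). split.
  { apply Rmin_pos. lra. apply Rdiv_lt_0_compat; [|lra].
    repeat apply Rmult_lt_0_compat; auto. }
  intros w Hw.
  assert (H1 := Rlt_le_trans _ _ _ Hw (Rmin_l _ _)).
  assert (H2 := Rlt_le_trans _ _ _ Hw (Rmin_r _ _)).
  assert (Hwm : (M / 2 < Cmod w)%R).
  { pose proof (Cmod_rev_triangle z w). rewrite Cmod_sub_sym in H. fold M in H. lra. }
  assert (Hw0 : w <> 0). { apply Cmod_gt_0. lra. }
  replace (/ w - / z - - (/ z * / z) * (w - z)) with ((w - z) * ((w - z) * / (w * (z * z)))).
  2: { field. auto. }
  rewrite !Cmod_mult, Cmod_inv, !Cmod_mult. fold M.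
  2: { repeat apply Cmult_neq_0; auto. }
  pose proof (Cmod_ge_0 (w - z)) as H0.
  rewrite Rmult_comm. apply Rmult_le_compat_r; auto.
  apply Rmult_le_reg_r with (Cmod w * (M * M))%R.
  { repeat apply Rmult_lt_0_compat; lra. }
  rewrite Rmult_assoc, Rinv_l, Rmult_1_r.
  2: { apply Rgt_not_eq. repeat apply Rmult_lt_0_compat; lra. }
  apply Rle_trans with (eps * (M / 2 * (M * M)))%R. nra.
  apply Rmult_le_compat_l. lra. apply Rmult_le_compat_r. nra. lra.
Qed.

Lemma cdiff_const (c z : C) : cdiff (fun _ => c) z.
Proof. eexists. apply is_cderiv_const. Qed.
Lemma cdiff_id (z : C) : cdiff (fun w => w) z.
Proof. eexists. apply is_cderiv_id. Qed.
Lemma cdiff_plus (f h : C -> C) (z : C) :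
  cdiff f z -> cdiff h z -> cdiff (fun w => f w + h w) z.
Proof. intros [l H] [m K]. eexists. apply is_cderiv_plus; eauto. Qed.
Lemma cdiff_mult (f h : C -> C) (z : C) :
  cdiff f z -> cdiff h z -> cdiff (fun w => f w * h w) z.
Proof. intros [l H] [m K]. eexists. apply is_cderiv_mult; eauto. Qed.
Lemma cdiff_opp (f : C -> C) (z : C) : cdiff f z -> cdiff (fun w => - f w) z.
Proof.
  intros H. apply (cdiff_ext (fun w => (- (1)) * f w)). intros; ring.
  apply cdiff_mult; auto. apply cdiff_const.
Qed.
Lemma cdiff_minus (f h : C -> C) (z : C) :
  cdiff f z -> cdiff h z -> cdiff (fun w => f w - h w) z.
Proof. intros H K. unfold Cminus. apply cdiff_plus; auto. now apply cdiff_opp. Qed.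
Lemma cdiff_comp (f h : C -> C) (z : C) :
  cdiff f (h z) -> cdiff h z -> cdiff (fun w => f (h w)) z.
Proof. intros [l H] [m K]. eexists. apply is_cderiv_comp; eauto. Qed.
Lemma cdiff_inv (f : C -> C) (z : C) : f z <> 0 -> cdiff f z -> cdiff (fun w => / f w) z.
Proof.
  intros H0 H. apply (cdiff_comp (fun w => / w) f); auto.
  eexists. now apply is_cderiv_inv.
Qed.
Lemma cdiff_div (f h : C -> C) (z : C) : h z <> 0 ->
  cdiff f z -> cdiff h z -> cdiff (fun w => f w / h w) z.
Proof. intros H0 H K. unfold Cdiv. apply cdiff_mult; auto. now apply cdiff_inv. Qed.

Lemma C_eq (x y : C) : Re x = Re y -> Im x = Im y -> x = y.
Proof. destruct x, y; simpl. intros -> ->. reflexivity. Qed.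

(** * The complex exponential *)

Lemma Cexp_plus (x y : C) : Cexp (x + y) = Cexp x * Cexp y.
Proof.
  unfold Cexp. destruct x as [a b], y as [c d]. simpl.
  rewrite exp_plus. apply C_eq; simpl; rewrite ?cos_plus, ?sin_plus; ring.
Qed.

Lemma Cexp_0 : Cexp 0 = 1.
Proof. unfold Cexp. simpl. rewrite exp_0, cos_0, sin_0. apply C_eq; simpl; ring. Qed.

Lemma Cmod_cis (b : R) : Cmod (cos b, sin b) = 1%R.
Proof.
  unfold Cmod; simpl.
  replace (cos b * (cos b * 1) + sin b * (sin b * 1))%R with 1%R.
  apply sqrt_1. generalize (sin2_cos2 b); unfold Rsqr; lra.
Qed.

Lemma Cmod_Cexp (z : C) : Cmod (Cexp z) = exp (Re z).
Proof.
  unfold Cexp. rewrite Cmod_mult, Cmod_R, Rabs_pos_eq by (left; apply exp_pos).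
  rewrite Cmod_cis. ring.
Qed.

Lemma Cexp_neq_0 (z : C) : Cexp z <> 0.
Proof. apply Cmod_gt_0. rewrite Cmod_Cexp. apply exp_pos. Qed.

Lemma Cexp_opp (z : C) : Cexp (- z) = / Cexp z.
Proof.
  assert (Cexp (- z) * Cexp z = 1).
  { rewrite <- Cexp_plus. replace (- z + z) with (RtoC 0) by ring. apply Cexp_0. }
  rewrite <- (Cmult_1_l (/ Cexp z)), <- H. field. apply Cexp_neq_0.
Qed.

Lemma Cexp_RtoC (x : R) : Cexp (RtoC x) = RtoC (exp x).
Proof. unfold Cexp; simpl. rewrite cos_0, sin_0. apply C_eq; simpl; ring. Qed.

(** Convexity in the form [1 + x <= exp x], taken at [a] and at [- a], yields
    [exp a - 1 <= a exp a]; the bound follows from these two. *)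
Lemma exp_taylor1 (a : R) : (Rabs (exp a - 1 - a) <= Rabs a * Rabs a * exp (Rabs a))%R.
Proof.
  assert (H : forall x, (1 + x <= exp x)%R) by apply exp_ineq1_le.
  assert (Hp := H a). rewrite Rabs_pos_eq by lra.
  assert (Hn := H (- a)%R).
  assert (He : (exp a * exp (- a) = 1)%R) by (rewrite <- exp_plus, Rplus_opp_r; apply exp_0).
  pose proof (exp_pos a). pose proof (exp_pos (- a)).
  assert (K : (exp a - 1 <= a * exp a)%R) by nra.
  destruct (Rle_dec 0 a).
  - rewrite Rabs_pos_eq by lra. nra.
  - rewrite Rabs_left by lra. nra.
Qed.

Lemma sin_taylor1 (b : R) : (Rabs (sin b - b) <= b * b)%R /\ (Rabs (cos b - 1) <= b * b)%R.
Proof.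
  assert (H : forall x, (Rabs (cos x - 1) <= Rabs x)%R /\ (Rabs (cos x - 1) <= x * x)%R).
  { intros x. assert (cos x - 1 = - 2 * (sin (x/2) * sin (x/2)))%R.
    { replace x with (2 * (x / 2))%R at 1 by field. rewrite cos_2a_sin. ring. }
    assert (Rabs (sin (x / 2)) <= Rabs (x / 2))%R.
    { destruct (Req_dec x 0) as [->|Hx].
      { replace (0/2)%R with 0%R by field. rewrite sin_0, Rabs_R0. lra. }
      destruct (MVT_gen sin 0 (x/2) cos) as [c [_ Hc]].
      { intros; apply is_derive_Reals, derivable_pt_lim_sin. }
      { intros. apply continuity_sin. }
      rewrite sin_0, !Rminus_0_r in Hc. rewrite Hc, Rabs_mult.
      pose proof (COS_bound c). assert (Rabs (cos c) <= 1)%R by (apply Rabs_le; lra).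
      pose proof (Rabs_pos (x/2)). nra. }
    assert (Rabs (sin (x / 2)) <= 1)%R by (apply Rabs_le; generalize (SIN_bound (x/2)); lra).
    rewrite H, !Rabs_mult.
    replace (Rabs (-2)) with 2%R by (rewrite Rabs_left; lra).
    assert (Rabs (x / 2) = Rabs x / 2)%R.
    { unfold Rdiv. rewrite Rabs_mult, (Rabs_pos_eq (/ 2)) by lra. reflexivity. }
    assert (x * x = Rabs x * Rabs x)%R.
    { rewrite <- Rabs_mult. rewrite Rabs_pos_eq; nra. }
    pose proof (Rabs_pos (sin (x/2))). pose proof (Rabs_pos x). split; nra. }
  split; [|apply H].
  destruct (MVT_gen (fun x => sin x - x)%R 0 b (fun x => cos x - 1)%R) as [c [Hc1 Hc]].
  { intros. auto_derive; [exact I|ring]. }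
  { intros. apply continuity_pt_minus. apply continuity_sin. apply derivable_continuous_pt, derivable_pt_id. }
  rewrite sin_0, !Rminus_0_r in Hc. rewrite Hc, Rabs_mult.
  replace (b * b)%R with (Rabs b * Rabs b)%R by (rewrite <- Rabs_mult; apply Rabs_pos_eq; nra).
  apply Rmult_le_compat_r. apply Rabs_pos.
  eapply Rle_trans. apply (proj1 (H c)).
  unfold Rmin, Rmax in Hc1. destruct (Rle_dec 0 b).
  - rewrite !Rabs_pos_eq by lra. lra.
  - rewrite !Rabs_left1 by lra. lra.
Qed.

Lemma im_le_Cmod (z : C) : (Rabs (Im z) <= Cmod z)%R.
Proof. eapply Rle_trans; [|apply Rmax_Cmod]. apply Rmax_r. Qed.

Lemma Cmod_le_abs (z : C) : (Cmod z <= Rabs (Re z) + Rabs (Im z))%R.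
Proof.
  replace z with (RtoC (Re z) + Ci * RtoC (Im z)).
  2: { apply C_eq; simpl; ring. }
  eapply Rle_trans. apply Cmod_triangle.
  rewrite Cmod_mult, Cmod_Ci, !Cmod_R. simpl.
  rewrite !Rmult_0_l, !Rmult_0_r, !Rmult_1_l, !Rplus_0_l, !Rminus_0_r, !Rplus_0_r. lra.
Qed.

(** The quadratic remainder serves twice: for the derivative of [Cexp] and for differentiation under
    an integral sign. *)
Lemma Cexp_taylor1 (h : C) :
  (Cmod (Cexp h - 1 - h) <= 4 * (Cmod h * Cmod h) * exp (Cmod h))%R.
Proof.
  destruct h as [a b]. set (h := (a, b) : C).
  assert (Ha : (Rabs a <= Cmod h)%R) by apply (re_le_Cmod h).
  assert (Hb : (Rabs b <= Cmod h)%R) by apply (im_le_Cmod h).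
  set (m := Cmod h) in *. pose proof (Rabs_pos a). pose proof (Rabs_pos b).
  set (e := (cos b, sin b) : C).
  assert (He : Cmod e = 1%R).
  { exact (Cmod_cis b). }
  (* Real and imaginary direction are expanded one after the other; the three terms contribute 1, 2
     and 1 to the constant 4. *)
  assert (E : Cexp h - 1 - h = RtoC (exp a - 1 - a) * e
     + RtoC (1 + a) * (e - 1 - Ci * RtoC b) + Ci * RtoC (a * b)).
  { unfold Cexp, h, e. apply C_eq; simpl; ring. }
  rewrite E.
  assert (E1 : (exp (Rabs a) <= exp m)%R).
  { destruct Ha as [Ha| ->]. left; now apply exp_increasing. lra. }
  assert (E2 : (1 + m <= exp m)%R) by apply exp_ineq1_le.
  eapply Rle_trans. apply Cmod_triangle.
  eapply Rle_trans. apply Rplus_le_compat_r, Cmod_triangle.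
  rewrite !Cmod_mult, He, !Cmod_R, Cmod_Ci, Rabs_mult.
  assert (B1 := exp_taylor1 a).
  assert (B2 : (Cmod (e - 1 - Ci * RtoC b) <= 2 * (b * b))%R).
  { eapply Rle_trans. apply Cmod_le_abs. unfold e; simpl.
    destruct (sin_taylor1 b) as [S1 S2].
    replace (cos b + - (1) + - (0 * b - 1 * 0))%R with (cos b - 1)%R by ring.
    replace (sin b + - 0 + - (0 * 0 + 1 * b))%R with (sin b - b)%R by ring. lra. }
  assert (B3 : (Rabs (1 + a) <= 1 + m)%R).
  { eapply Rle_trans. apply Rabs_triang. rewrite Rabs_R1. lra. }
  assert (B4 : (b * b <= m * m)%R).
  { replace (b * b)%R with (Rabs b * Rabs b)%R by (rewrite <- Rabs_mult; apply Rabs_pos_eq; nra). nra. }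
  assert (B5 : (Rabs (exp a - 1 - a) <= m * m * exp m)%R).
  { eapply Rle_trans. apply B1. apply Rmult_le_compat; try nra. left; apply exp_pos. }
  assert (B6 : (Rabs (1 + a) * Cmod (e - 1 - Ci * RtoC b) <= exp m * (2 * (m * m)))%R).
  { apply Rmult_le_compat; try lra. apply Rabs_pos. apply Cmod_ge_0. }
  assert (B7 : (Rabs a * Rabs b <= m * m * exp m)%R).
  { assert (Rabs a * Rabs b <= m * m)%R by nra. nra. }
  nra.
Qed.

Lemma is_cderiv_Cexp (z : C) : is_cderiv Cexp z (Cexp z).
Proof.
  intros eps He. set (K := (4 * (exp 1 * Cmod (Cexp z)))%R).
  assert (HK : (0 < K)%R).
  { unfold K. rewrite Cmod_Cexp. pose proof (exp_pos 1). pose proof (exp_pos (Re z)). nra. }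
  exists (Rmin 1 (eps / K)). split.
  { apply Rmin_pos. lra. now apply Rdiv_lt_0_compat. }
  intros w Hw. 
  assert (H1 := Rlt_le_trans _ _ _ Hw (Rmin_l _ _)).
  assert (H2 := Rlt_le_trans _ _ _ Hw (Rmin_r _ _)).
  replace (Cexp w - Cexp z - Cexp z * (w - z)) with (Cexp z * (Cexp (w - z) - 1 - (w - z))).
  2: { replace w with (z + (w - z)) at 3 by ring. rewrite Cexp_plus. ring. }
  rewrite Cmod_mult. set (m := Cmod (w - z)) in *.
  assert (B := Cexp_taylor1 (w - z)). fold m in B.
  assert (0 <= m)%R by apply Cmod_ge_0.
  assert (exp m <= exp 1)%R by (left; apply exp_increasing; lra).
  assert (K * m <= eps)%R.
  { apply Rmult_lt_compat_l with (r := K) in H2; auto.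
    replace (K * (eps / K))%R with eps in H2 by (field; lra). lra. }
  pose proof (Cmod_ge_0 (Cexp z)).
  apply Rle_trans with (Cmod (Cexp z) * (4 * (m * m) * exp 1))%R.
  { apply Rmult_le_compat_l; auto. eapply Rle_trans. apply B.
    apply Rmult_le_compat_l; nra. }
  replace (Cmod (Cexp z) * (4 * (m * m) * exp 1))%R with (K * m * m)%R by (unfold K; ring).
  apply Rmult_le_compat_r; lra.
Qed.

Lemma cdiff_Cexp (f : C -> C) (z : C) : cdiff f z -> cdiff (fun w => Cexp (f w)) z.
Proof.
  intros H. apply (cdiff_comp Cexp f); auto. eexists. apply is_cderiv_Cexp.
Qed.

Ltac cdiff_tac :=
  try assumption;
  lazymatch goal with
  | |- cdiff (fun _ => ?c) _ => apply cdiff_const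
  | |- cdiff (fun w => w) _ => apply cdiff_id
  | |- cdiff (fun w => @?f w + @?h w) _ => apply (cdiff_plus f h); cdiff_tac
  | |- cdiff (fun w => @?f w - @?h w) _ => apply (cdiff_minus f h); cdiff_tac
  | |- cdiff (fun w => - @?f w) _ => apply (cdiff_opp f); cdiff_tac
  | |- cdiff (fun w => @?f w * @?h w) _ => apply (cdiff_mult f h); cdiff_tac
  | |- cdiff (fun w => @?f w / @?h w) _ => apply (cdiff_div f h); cdiff_tac
  | |- cdiff (fun w => / @?f w) _ => apply (cdiff_inv f); cdiff_tac
  | |- cdiff (fun w => Cexp (@?f w)) _ => apply (cdiff_Cexp f); cdiff_tac
  | |- _ => idtac
  end.

Lemma Re_plus (x y : C) : Re (x + y) = (Re x + Re y)%R. Proof. reflexivity. Qed.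
Lemma Im_plus (x y : C) : Im (x + y) = (Im x + Im y)%R. Proof. reflexivity. Qed.
Lemma Re_opp (x : C) : Re (- x) = (- Re x)%R. Proof. reflexivity. Qed.
Lemma Im_opp (x : C) : Im (- x) = (- Im x)%R. Proof. reflexivity. Qed.
Lemma Re_minus (x y : C) : Re (x - y) = (Re x - Re y)%R. Proof. reflexivity. Qed.
Lemma Im_minus (x y : C) : Im (x - y) = (Im x - Im y)%R. Proof. reflexivity. Qed.
Lemma Re_RtoC (x : R) : Re (RtoC x) = x. Proof. reflexivity. Qed.
Lemma Im_RtoC (x : R) : Im (RtoC x) = 0%R. Proof. reflexivity. Qed.
Lemma Re_pair (x y : R) : Re (x, y) = x. Proof. reflexivity. Qed.
Lemma Im_pair (x y : R) : Im (x, y) = y. Proof. reflexivity. Qed.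
Lemma Re_scal_r (z : C) (x : R) : Re (z * RtoC x) = (Re z * x)%R.
Proof. destruct z; simpl. ring. Qed.
Lemma Im_scal_r (z : C) (x : R) : Im (z * RtoC x) = (Im z * x)%R.
Proof. destruct z; simpl. ring. Qed.
Lemma Re_half (z : C) : Re (z / 2) = (Re z / 2)%R.
Proof. destruct z; simpl. field. Qed.
Lemma Im_half (z : C) : Im (z / 2) = (Im z / 2)%R.
Proof. destruct z; simpl. field. Qed.

Ltac reim := rewrite ?Re_half, ?Im_half, ?Re_plus, ?Im_plus, ?Re_minus, ?Im_minus, ?Re_opp, ?Im_opp,
  ?Re_half, ?Im_half, ?Re_plus, ?Im_plus, ?Re_minus, ?Im_minus,
  ?Re_RtoC, ?Im_RtoC, ?Re_pair, ?Im_pair.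

Ltac Ceq := match goal with |- @eq _ ?x ?y => change (@eq C x y) end.

(** * Integrals of complex functions on segments *)

Definition ccont (f : R -> C) (t : R) : Prop :=
  forall eps : R, (0 < eps)%R -> exists d : R, (0 < d)%R /\
    forall u : R, (Rabs (u - t) < d)%R -> (Cmod (f u - f t) < eps)%R.

Definition cintble (f : R -> C) (a b : R) : Prop := ex_RInt (V := C_R_NormedModule) f a b.
Definition CInt (f : R -> C) (a b : R) : C := RInt (V := C_R_CompleteNormedModule) f a b.


(** The norm that the real module structure puts on pairs is the Euclidean one, so the norm
    inequalities for integrals apply to [Cmod]. *)
Lemma norm_C_R (z : C) : norm (V := C_R_NormedModule) z = Cmod z.
Proof.
  change (sqrt (Rabs (fst z) ^ 2 + Rabs (snd z) ^ 2) = Cmod z).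
  rewrite !pow2_abs. reflexivity.
Qed.

Lemma ccont_continuous (f : R -> C) (t : R) :
  ccont f t -> continuous (T := R_UniformSpace) (U := C_UniformSpace) f t.
Proof.
  intros H P [eps HP]. destruct (H eps (cond_pos eps)) as [d [Hd Hf]].
  exists (mkposreal d Hd). intros u Hu. apply HP.
  apply C_NormedModule_mixin_compat1. apply Hf. exact Hu.
Qed.

Lemma continuous_ccont (f : R -> C) (t : R) :
  continuous (T := R_UniformSpace) (U := C_UniformSpace) f t -> ccont f t.
Proof.
  intros H eps He.
  (* Balls of [C_UniformSpace] are squares; one of half side [eps / 2] lies in the disc of radius
     [sqrt 2 * (eps / 2)]. *)
  assert (He2 : (0 < eps / 2)%R) by lra.
  destruct (H (fun z => ball (M := C_UniformSpace) (f t) (mkposreal _ He2) z)) as [d Hd].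
  { exists (mkposreal _ He2). auto. }
  exists d. split. apply cond_pos. intros u Hu. specialize (Hd u Hu).
  eapply Rlt_le_trans. apply (C_NormedModule_mixin_compat2 _ _ (mkposreal _ He2) Hd).
  simpl. assert (sqrt 2 <= 2)%R.
  { rewrite <- (sqrt_Rsqr 2) at 2 by lra. apply sqrt_le_1_alt. unfold Rsqr; lra. }
  nra.
Qed.

Lemma ccont_const (c : C) (t : R) : ccont (fun _ => c) t.
Proof. apply continuous_ccont. apply continuous_const. Qed.

Lemma ccont_comp_holo (F : C -> C) (f : R -> C) (t : R) :
  cdiff F (f t) -> ccont f t -> ccont (fun u => F (f u)) t.
Proof.
  intros HF Hf eps He. destruct (cderiv_cont F _ HF eps He) as [d [Hd H]].
  destruct (Hf d Hd) as [d' [Hd' H']]. exists d'. split; auto.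
Qed.

Lemma ccont_plus (f h : R -> C) (t : R) :
  ccont f t -> ccont h t -> ccont (fun u => f u + h u) t.
Proof.
  intros H K. apply ccont_continuous in H, K. apply continuous_ccont.
  exact (continuous_plus (K := R_AbsRing) (V := C_R_NormedModule) f h t H K).
Qed.

Lemma ccont_mult (f h : R -> C) (t : R) :
  ccont f t -> ccont h t -> ccont (fun u => f u * h u) t.
Proof.
  intros H K eps He.
  pose proof (Cmod_ge_0 (f t)) as P1. pose proof (Cmod_ge_0 (h t)) as P2.
  set (M := (Cmod (f t) + Cmod (h t) + 1)%R) in *.
  assert (HM : (1 <= M)%R) by (unfold M; lra).
  set (e := Rmin 1 (eps / (3 * M))).
  assert (Hep : (0 < e)%R). { apply Rmin_pos. lra. apply Rdiv_lt_0_compat; lra. }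
  destruct (H e Hep) as [d1 [Hd1 H1]]. destruct (K e Hep) as [d2 [Hd2 H2]].
  exists (Rmin d1 d2). split. now apply Rmin_pos.
  intros u Hu.
  specialize (H1 u (Rlt_le_trans _ _ _ Hu (Rmin_l _ _))).
  specialize (H2 u (Rlt_le_trans _ _ _ Hu (Rmin_r _ _))).
  replace (f u * h u - f t * h t) with
    ((f u - f t) * (h u - h t) + (f t * (h u - h t) + (f u - f t) * h t)) by ring.
  eapply Rle_lt_trans. apply Cmod_triangle.
  eapply Rle_lt_trans. apply Rplus_le_compat_l, Cmod_triangle.
  rewrite !Cmod_mult.
  assert (e <= 1)%R by apply Rmin_l.
  assert (e <= eps / (3 * M))%R by apply Rmin_r.
  assert (e * (3 * M) <= eps)%R.
  { replace eps with (eps / (3 * M) * (3 * M))%R by (field; lra). apply Rmult_le_compat_r; lra. }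
  pose proof (Cmod_ge_0 (f u - f t)). pose proof (Cmod_ge_0 (h u - h t)).
  assert (Cmod (f t) <= M)%R by (unfold M; lra). assert (Cmod (h t) <= M)%R by (unfold M; lra).
  assert (Cmod (f u - f t) * Cmod (h u - h t) <= e)%R by nra.
  assert (Cmod (f t) * Cmod (h u - h t) <= M * e)%R by nra.
  assert (Cmod (f u - f t) * Cmod (h t) <= M * e)%R by nra.
  nra.
Qed.

Lemma ccont_opp (f : R -> C) (t : R) : ccont f t -> ccont (fun u => - f u) t.
Proof.
  intros H. apply (ccont_comp_holo (fun z => - z) f); auto. cdiff_tac.
Qed.

Lemma ccont_minus (f h : R -> C) (t : R) :
  ccont f t -> ccont h t -> ccont (fun u => f u - h u) t.
Proof. intros H K. apply ccont_plus; auto. now apply ccont_opp. Qed.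

Lemma ccont_RtoC (f : R -> R) (t : R) : continuous f t -> ccont (fun u => RtoC (f u)) t.
Proof.
  intros H eps He.
  destruct (H (fun y => ball (f t) (mkposreal _ He) y)) as [d Hd].
  { exists (mkposreal _ He). auto. }
  exists d. split. apply cond_pos. intros u Hu. specialize (Hd u Hu).
  rewrite <- RtoC_minus, Cmod_R. exact Hd.
Qed.

Lemma ccont_comp_real (f : R -> C) (p : R -> R) (t : R) :
  ccont f (p t) -> continuous p t -> ccont (fun u => f (p u)) t.
Proof.
  intros H K. apply ccont_continuous in H. apply continuous_ccont.
  now apply (continuous_comp p f).
Qed.

Lemma ccont_ext (f h : R -> C) (t : R) : (forall u, f u = h u) -> ccont f t -> ccont h t.
Proof. intros E H eps He. destruct (H eps He) as [d [Hd Hf]]. exists d. split; auto.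
  intros. rewrite <- !E. auto. Qed.

Lemma ccont_Cmod (f : R -> C) (t : R) : ccont f t -> continuous (fun u => Cmod (f u)) t.
Proof.
  intros H P [eps HP]. destruct (H eps (cond_pos eps)) as [d [Hd Hf]].
  exists (mkposreal d Hd). intros u Hu. apply HP.
  specialize (Hf u Hu). change (Rabs (Cmod (f u) - Cmod (f t)) < eps)%R.
  eapply Rle_lt_trans; [|exact Hf].
  pose proof (Cmod_rev_triangle (f u) (f t)). pose proof (Cmod_rev_triangle (f t) (f u)).
  rewrite (Cmod_sub_sym (f t)) in H1. apply Rabs_le. lra.
Qed.

Lemma ccont_line (p v : C) (t : R) : ccont (fun u => p + v * RtoC u) t.
Proof.
  apply ccont_plus. apply ccont_const. apply ccont_mult. apply ccont_const.
  apply ccont_RtoC. apply continuous_id.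
Qed.

Lemma cintble_cont (f : R -> C) (a b : R) :
  (forall t, (Rmin a b <= t <= Rmax a b)%R -> ccont f t) -> cintble f a b.
Proof.
  intros H. apply (ex_RInt_continuous (V := C_R_CompleteNormedModule)).
  intros t Ht. now apply ccont_continuous, H.
Qed.

Lemma cintble_cont' (f : R -> C) (a b : R) : (forall t, ccont f t) -> cintble f a b.
Proof. intros H. apply cintble_cont. auto. Qed.

Lemma CInt_correct (f : R -> C) (a b : R) :
  cintble f a b -> is_RInt (V := C_R_NormedModule) f a b (CInt f a b).
Proof. apply (RInt_correct (V := C_R_CompleteNormedModule)). Qed.

Lemma CInt_unique (f : R -> C) (a b : R) (l : C) :
  is_RInt (V := C_R_NormedModule) f a b l -> CInt f a b = l.
Proof. apply (is_RInt_unique (V := C_R_CompleteNormedModule)). Qed.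

Lemma CInt_ext (f h : R -> C) (a b : R) :
  (forall t, (Rmin a b < t < Rmax a b)%R -> f t = h t) -> CInt f a b = CInt h a b.
Proof. apply (RInt_ext (V := C_R_CompleteNormedModule)). Qed.

(** The library's integral is linear over the reals; multiplication by a complex constant is done on
    the two components. *)
Lemma is_CInt_scal (f : R -> C) (a b : R) (c l : C) :
  is_RInt (V := C_R_NormedModule) f a b l ->
  is_RInt (V := C_R_NormedModule) (fun t => c * f t) a b (c * l).
Proof.
  intros H.
  assert (H1 := is_RInt_fct_extend_fst (U := R_NormedModule) (V := R_NormedModule) f a b l H).
  assert (H2 := is_RInt_fct_extend_snd (U := R_NormedModule) (V := R_NormedModule) f a b l H).
  apply (is_RInt_fct_extend_pair (U := R_NormedModule) (V := R_NormedModule)).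
  - exact (is_RInt_minus _ _ a b _ _ (is_RInt_scal _ a b (fst c) _ H1) (is_RInt_scal _ a b (snd c) _ H2)).
  - exact (is_RInt_plus _ _ a b _ _ (is_RInt_scal _ a b (fst c) _ H2) (is_RInt_scal _ a b (snd c) _ H1)).
Qed.

Lemma cintble_scal (f : R -> C) (a b : R) (c : C) :
  cintble f a b -> cintble (fun t => c * f t) a b.
Proof. intros [l H]. exists (c * l). now apply is_CInt_scal. Qed.

Lemma CInt_scal (f : R -> C) (a b : R) (c : C) :
  cintble f a b -> CInt (fun t => c * f t) a b = c * CInt f a b.
Proof. intros H. apply CInt_unique, is_CInt_scal, CInt_correct, H. Qed.

Lemma CInt_plus (f h : R -> C) (a b : R) : cintble f a b -> cintble h a b ->
  CInt (fun t => f t + h t) a b = CInt f a b + CInt h a b.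
Proof. apply (RInt_plus (V := C_R_CompleteNormedModule)). Qed.

Lemma cintble_minus (f h : R -> C) (a b : R) :
  cintble f a b -> cintble h a b -> cintble (fun t => f t - h t) a b.
Proof. apply (ex_RInt_minus (V := C_R_NormedModule)). Qed.

Lemma CInt_minus (f h : R -> C) (a b : R) : cintble f a b -> cintble h a b ->
  CInt (fun t => f t - h t) a b = CInt f a b - CInt h a b.
Proof. apply (RInt_minus (V := C_R_CompleteNormedModule)). Qed.

Lemma CInt_Chasles (f : R -> C) (a b c : R) : cintble f a b -> cintble f b c ->
  CInt f a b + CInt f b c = CInt f a c.
Proof. apply (RInt_Chasles (V := C_R_CompleteNormedModule)). Qed.

Lemma CInt_swap (f : R -> C) (a b : R) : cintble f a b -> CInt f b a = - CInt f a b.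
Proof. intros H. symmetry. now apply (opp_RInt_swap (V := C_R_CompleteNormedModule)). Qed.

Lemma CInt_const (c : C) (a b : R) : CInt (fun _ => c) a b = RtoC (b - a) * c.
Proof.
  unfold CInt. rewrite (RInt_const (V := C_R_CompleteNormedModule)).
  apply C_eq; simpl; unfold scal; simpl; unfold mult; simpl; ring.
Qed.

Lemma CInt_le (f : R -> C) (h : R -> R) (a b : R) : (a <= b)%R ->
  cintble f a b -> ex_RInt h a b ->
  (forall t, (a <= t <= b)%R -> (Cmod (f t) <= h t)%R) ->
  (Cmod (CInt f a b) <= RInt h a b)%R.
Proof.
  intros Hab Hf Hh H. rewrite <- norm_C_R.
  apply (norm_RInt_le (V := C_R_NormedModule) f h a b); auto.
  - intros. rewrite norm_C_R. auto.
  - now apply CInt_correct.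
  - now apply (RInt_correct (V := R_CompleteNormedModule)).
Qed.

Lemma CInt_bound (f : R -> C) (M a b : R) : (a <= b)%R -> cintble f a b ->
  (forall t, (a <= t <= b)%R -> (Cmod (f t) <= M)%R) ->
  (Cmod (CInt f a b) <= (b - a) * M)%R.
Proof.
  intros Hab Hf H. rewrite <- norm_C_R.
  apply (norm_RInt_le_const (V := C_R_NormedModule) f a b); auto.
  - intros. rewrite norm_C_R. auto.
  - now apply CInt_correct.
Qed.

Lemma CInt_comp_lin (f : R -> C) (u v a b : R) : cintble f (u * a + v) (u * b + v) ->
  RtoC u * CInt (fun t => f (u * t + v)%R) a b = CInt f (u * a + v) (u * b + v).
Proof.
  (* For [u = 0] both sides vanish; otherwise the substitution rule, which has the factor inside the
     integral, is divided by [u]. *)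
  intros H. destruct (Req_dec u 0) as [->|Hu].
  { replace (0 * a + v)%R with v by ring. replace (0 * b + v)%R with v by ring.
    unfold CInt at 2. rewrite (RInt_point (V := C_R_CompleteNormedModule)).
    change (RtoC 0 * CInt (fun t => f (0 * t + v)%R) a b = 0). ring. }
  assert (K := is_RInt_comp_lin (V := C_R_NormedModule) f u v a b _ (CInt_correct _ _ _ H)).
  assert (K2 := is_CInt_scal _ _ _ (/ RtoC u) _ K).
  assert (Hu' : RtoC u <> 0). { intros E. apply Hu. now apply RtoC_inj. }
  cut (CInt (fun t => f (u * t + v)%R) a b = / RtoC u * CInt f (u * a + v) (u * b + v)).
  { intros ->. field. auto. }
  apply CInt_unique.
  eapply is_RInt_ext; [|exact K2]. intros t _. cbv beta.
  destruct (f (u * t + v)%R) as [x y].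
  change (/ RtoC u * (u * x, u * y)%R = ((x, y) : C)).
  replace ((u * x, u * y)%R : C) with (RtoC u * ((x, y) : C)) by (apply C_eq; simpl; ring).
  field. auto.
Qed.

Lemma CInt_shift (f : R -> C) (v a b : R) : cintble f (a + v) (b + v) ->
  CInt (fun t => f (t + v)%R) a b = CInt f (a + v) (b + v).
Proof.
  intros H. pose proof (CInt_comp_lin f 1 v a b) as K.
  rewrite !Rmult_1_l in K. rewrite <- (K H), Cmult_1_l.
  apply CInt_ext. intros. now rewrite Rmult_1_l.
Qed.

Lemma CInt_reflect (f : R -> C) (a b : R) : cintble f (- b) (- a) ->
  CInt (fun t => f (- t)%R) a b = CInt f (- b) (- a).
Proof.
  intros H. pose proof (CInt_comp_lin f (-1) 0 a b) as K.
  replace (-1 * a + 0)%R with (- a)%R in K by ring. replace (-1 * b + 0)%R with (- b)%R in K by ring.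
  rewrite (CInt_swap f (- a)), <- K.
  - rewrite (CInt_ext (fun t => f (-1 * t + 0)%R) (fun t => f (- t)%R)). 
    replace (RtoC (-1)) with (- (1)) by (apply C_eq; simpl; ring). ring.
    intros; f_equal; ring.
  - apply (ex_RInt_swap (V := C_R_NormedModule)). exact H.
  - apply (ex_RInt_swap (V := C_R_NormedModule)). exact H.
Qed.

(** Passes from complex differentiability to the real variable of a parametrised line, with the
    speed [v] as factor. *)
Lemma is_derive_line (F : C -> C) (p v l : C) (t : R) :
  is_cderiv F (p + v * RtoC t) l ->
  is_derive (K := R_AbsRing) (V := C_R_NormedModule) (fun u : R => F (p + v * RtoC u)) t (v * l).
Proof.
  intros H. split. apply is_linear_scal_l.
  intros x Hx.
  assert (x = t) as ->.
  { symmetry. apply (is_filter_lim_locally_unique (K := R_AbsRing) (V := R_NormedModule) t x). exact Hx. }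
  (* [Cmod v + 1] instead of [Cmod v] admits [v = 0]. *)
  intros eps. destruct (H (eps / (Cmod v + 1))%R) as [d [Hd Hf]].
  { pose proof (Cmod_ge_0 v). pose proof (cond_pos eps). apply Rdiv_lt_0_compat; lra. }
  pose proof (Cmod_ge_0 v) as Hv.
  assert (Hd' : (0 < d / (Cmod v + 1))%R) by (apply Rdiv_lt_0_compat; lra).
  exists (mkposreal _ Hd'). intros u Hu. change (Rabs (u - t) < d / (Cmod v + 1))%R in Hu.
  rewrite norm_C_R.
  set (w := p + v * RtoC u). 
  assert (Ew : w - (p + v * RtoC t) = v * RtoC (u - t)). { unfold w. rewrite RtoC_minus. ring. }
  assert (Em : (Cmod (w - (p + v * RtoC t)) = Cmod v * Rabs (u - t))%R).
  { rewrite Ew, Cmod_mult, Cmod_R. reflexivity. }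
  pose proof (Rabs_pos (u - t)).
  assert (Hb : (Cmod v * Rabs (u - t) <= (Cmod v + 1) * Rabs (u - t))%R) by nra.
  assert (Hlt : ((Cmod v + 1) * Rabs (u - t) < d)%R).
  { apply Rmult_lt_compat_l with (r := (Cmod v + 1)%R) in Hu; [|lra].
    replace ((Cmod v + 1) * (d / (Cmod v + 1)))%R with d in Hu by (field; lra). exact Hu. }
  specialize (Hf w ltac:(rewrite Em; lra)).
  change (minus (minus (F w) (F (p + v * RtoC t))) (scal (minus u t) (v * l)))
    with (F w - F (p + v * RtoC t) - scal (V := C_R_NormedModule) (u - t)%R (v * l)).
  replace (scal (V := C_R_NormedModule) (u - t)%R (v * l)) with (l * (w - (p + v * RtoC t))).
  2: { rewrite Ew. apply C_eq; simpl; unfold scal; simpl; unfold mult; simpl; ring. }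
  eapply Rle_trans. apply Hf. rewrite Em. change (norm (minus u t)) with (Rabs (u - t)).
  apply Rle_trans with (eps / (Cmod v + 1) * ((Cmod v + 1) * Rabs (u - t)))%R.
  - apply Rmult_le_compat_l; auto. left. apply Rdiv_lt_0_compat. apply cond_pos. lra.
  - right. field. lra.
Qed.

Lemma CInt_derive (F f : R -> C) (a b : R) :
  (forall t, (Rmin a b <= t <= Rmax a b)%R ->
     is_derive (K := R_AbsRing) (V := C_R_NormedModule) F t (f t)) ->
  (forall t, (Rmin a b <= t <= Rmax a b)%R -> ccont f t) ->
  CInt f a b = F b - F a.
Proof.
  intros H K. apply CInt_unique.
  apply (is_RInt_derive (V := C_R_CompleteNormedModule) F f a b); auto.
  intros. now apply ccont_continuous, K.
Qed.

Lemma CInt_primitive_line (F f : C -> C) (p v : C) (a b : R) :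
  (forall t, (Rmin a b <= t <= Rmax a b)%R -> is_cderiv F (p + v * RtoC t) (f (p + v * RtoC t))) ->
  (forall t, (Rmin a b <= t <= Rmax a b)%R -> ccont (fun t => f (p + v * RtoC t)) t) ->
  v * CInt (fun t => f (p + v * RtoC t)) a b = F (p + v * RtoC b) - F (p + v * RtoC a).
Proof.
  intros H K. rewrite <- CInt_scal.
  2: { apply cintble_cont; auto. }
  apply (CInt_derive (fun t => F (p + v * RtoC t))).
  - intros. apply is_derive_line. auto.
  - intros. apply ccont_mult. apply ccont_const. auto.
Qed.

(** * Goursat's theorem *)

(** The counterclockwise contour integral round the rectangle: [dz] is [dx] on the horizontal sides
    and [i dy] on the vertical ones. *)
Definition rect_integral (f : C -> C) (x1 x2 y1 y2 : R) : C :=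
  CInt (fun x => f (x, y1)) x1 x2 - CInt (fun x => f (x, y2)) x1 x2
  + Ci * (CInt (fun y => f (x2, y)) y1 y2 - CInt (fun y => f (x1, y)) y1 y2).


Definition in_rect (x1 x2 y1 y2 : R) (z : C) : Prop :=
  (x1 <= Re z <= x2)%R /\ (y1 <= Im z <= y2)%R.

Lemma hline_eq (x y : R) : (x, y) = Ci * RtoC y + 1 * RtoC x.
Proof. apply C_eq; simpl; ring. Qed.
Lemma vline_eq (x y : R) : (x, y) = RtoC x + Ci * RtoC y.
Proof. apply C_eq; simpl; ring. Qed.

Lemma ccont_hline (f : C -> C) (x y : R) : cdiff f (x, y) -> ccont (fun t => f (t, y)) x.
Proof.
  intros H. apply (ccont_comp_holo f (fun t => (t, y))); auto.
  eapply ccont_ext. 2: apply (ccont_line (Ci * RtoC y) 1). intros; simpl. now rewrite hline_eq.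
Qed.
Lemma ccont_vline (f : C -> C) (x y : R) : cdiff f (x, y) -> ccont (fun t => f (x, t)) y.
Proof.
  intros H. apply (ccont_comp_holo f (fun t => (x, t))); auto.
  eapply ccont_ext. 2: apply (ccont_line (RtoC x) Ci). intros; simpl. now rewrite vline_eq.
Qed.

Lemma cintble_hline (f : C -> C) (a b y : R) : (a <= b)%R ->
  (forall x, (a <= x <= b)%R -> cdiff f (x, y)) -> cintble (fun x => f (x, y)) a b.
Proof.
  intros Hab H. apply cintble_cont. rewrite Rmin_left, Rmax_right by auto.
  intros. apply ccont_hline; auto.
Qed.
Lemma cintble_vline (f : C -> C) (x a b : R) : (a <= b)%R ->
  (forall y, (a <= y <= b)%R -> cdiff f (x, y)) -> cintble (fun y => f (x, y)) a b.
Proof.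
  intros Hab H. apply cintble_cont. rewrite Rmin_left, Rmax_right by auto.
  intros. apply ccont_vline; auto.
Qed.

(** Integrands with a pole inside are differentiable on the boundary only, hence a predicate for the
    four sides beside [in_rect]. *)
Definition on_edges (P : C -> Prop) (x1 x2 y1 y2 : R) : Prop :=
  (forall x, (x1 <= x <= x2)%R -> P (x, y1) /\ P (x, y2)) /\
  (forall y, (y1 <= y <= y2)%R -> P (x1, y) /\ P (x2, y)).

Lemma on_edges_in_rect (P : C -> Prop) (x1 x2 y1 y2 : R) : (x1 <= x2)%R -> (y1 <= y2)%R ->
  (forall z, in_rect x1 x2 y1 y2 z -> P z) -> on_edges P x1 x2 y1 y2.
Proof. intros Hx Hy H. split; intros; split; apply H; split; simpl; lra. Qed.

Lemma on_edges_impl (P Q : C -> Prop) (x1 x2 y1 y2 : R) :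
  (forall z, P z -> Q z) -> on_edges P x1 x2 y1 y2 -> on_edges Q x1 x2 y1 y2.
Proof. intros H [H1 H2]. split; intros t Ht; split; apply H; apply H1 || apply H2; auto. Qed.

Lemma on_edges_cintble (f : C -> C) (x1 x2 y1 y2 : R) : (x1 <= x2)%R -> (y1 <= y2)%R ->
  on_edges (cdiff f) x1 x2 y1 y2 ->
  cintble (fun x => f (x, y1)) x1 x2 /\ cintble (fun x => f (x, y2)) x1 x2 /\
  cintble (fun y => f (x1, y)) y1 y2 /\ cintble (fun y => f (x2, y)) y1 y2.
Proof.
  intros Hx Hy [H1 H2]. repeat split.
  - apply (cintble_hline f); auto. intros t Ht; exact (proj1 (H1 t Ht)).
  - apply (cintble_hline f); auto. intros t Ht; exact (proj2 (H1 t Ht)).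
  - apply (cintble_vline f); auto. intros t Ht; exact (proj1 (H2 t Ht)).
  - apply (cintble_vline f); auto. intros t Ht; exact (proj2 (H2 t Ht)).
Qed.

Lemma rect_minus (f h : C -> C) (x1 x2 y1 y2 : R) : (x1 <= x2)%R -> (y1 <= y2)%R ->
  on_edges (cdiff f) x1 x2 y1 y2 -> on_edges (cdiff h) x1 x2 y1 y2 ->
  rect_integral (fun z => f z - h z) x1 x2 y1 y2 = rect_integral f x1 x2 y1 y2 - rect_integral h x1 x2 y1 y2.
Proof.
  intros Hx Hy F H.
  destruct (on_edges_cintble f _ _ _ _ Hx Hy F) as (F1 & F2 & F3 & F4).
  destruct (on_edges_cintble h _ _ _ _ Hx Hy H) as (H1 & H2 & H3 & H4).
  unfold rect_integral. rewrite !CInt_minus by assumption. ring.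
Qed.

Lemma rect_bound (f : C -> C) (M x1 x2 y1 y2 : R) : (x1 <= x2)%R -> (y1 <= y2)%R ->
  on_edges (cdiff f) x1 x2 y1 y2 -> on_edges (fun z => (Cmod (f z) <= M)%R) x1 x2 y1 y2 ->
  (Cmod (rect_integral f x1 x2 y1 y2) <= 2 * ((x2 - x1) + (y2 - y1)) * M)%R.
Proof.
  intros Hx Hy F [H1 H2].
  destruct (on_edges_cintble f _ _ _ _ Hx Hy F) as (F1 & F2 & F3 & F4). unfold rect_integral.
  eapply Rle_trans. apply Cmod_triangle. rewrite Cmod_mult, Cmod_Ci, Rmult_1_l.
  eapply Rle_trans. apply Rplus_le_compat; apply Cmod_le_sum.
  assert (B1 : (Cmod (CInt (fun x => f (x, y1)) x1 x2) <= (x2 - x1) * M)%R).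
  { apply CInt_bound; auto. intros t Ht; apply (H1 t Ht). }
  assert (B2 : (Cmod (CInt (fun x => f (x, y2)) x1 x2) <= (x2 - x1) * M)%R).
  { apply CInt_bound; auto. intros t Ht; apply (H1 t Ht). }
  assert (B3 : (Cmod (CInt (fun y => f (x1, y)) y1 y2) <= (y2 - y1) * M)%R).
  { apply CInt_bound; auto. intros t Ht; apply (H2 t Ht). }
  assert (B4 : (Cmod (CInt (fun y => f (x2, y)) y1 y2) <= (y2 - y1) * M)%R).
  { apply CInt_bound; auto. intros t Ht; apply (H2 t Ht). }
  lra.
Qed.

Lemma rect_split_x (f : C -> C) (x1 x x2 y1 y2 : R) : (x1 <= x <= x2)%R ->
  (forall t, (x1 <= t <= x2)%R -> cdiff f (t, y1) /\ cdiff f (t, y2)) ->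
  rect_integral f x1 x2 y1 y2 = rect_integral f x1 x y1 y2 + rect_integral f x x2 y1 y2.
Proof.
  intros Hx H. unfold rect_integral.
  rewrite <- (CInt_Chasles (fun x => f (x, y1)) x1 x x2), <- (CInt_Chasles (fun x => f (x, y2)) x1 x x2).
  ring. all: (apply (cintble_hline f); [lra|]); intros t Ht; apply (H t); lra.
Qed.

Lemma rect_split_y (f : C -> C) (x1 x2 y1 y y2 : R) : (y1 <= y <= y2)%R ->
  (forall t, (y1 <= t <= y2)%R -> cdiff f (x1, t) /\ cdiff f (x2, t)) ->
  rect_integral f x1 x2 y1 y2 = rect_integral f x1 x2 y1 y + rect_integral f x1 x2 y y2.
Proof.
  intros Hx H. unfold rect_integral.
  rewrite <- (CInt_Chasles (fun y => f (x1, y)) y1 y y2), <- (CInt_Chasles (fun y => f (x2, y)) y1 y y2).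
  ring. all: (apply (cintble_vline f); [lra|]); intros t Ht; apply (H t); lra.
Qed.

Lemma rect_primitive (F f : C -> C) (x1 x2 y1 y2 : R) : (x1 <= x2)%R -> (y1 <= y2)%R ->
  on_edges (fun z => is_cderiv F z (f z)) x1 x2 y1 y2 -> on_edges (cdiff f) x1 x2 y1 y2 ->
  rect_integral f x1 x2 y1 y2 = 0.
Proof.
  intros Hx Hy [F1 F2] [H1 H2].
  assert (A : forall y, (forall x, (x1 <= x <= x2)%R -> is_cderiv F (x, y) (f (x, y)) /\ cdiff f (x, y)) ->
     CInt (fun x => f (x, y)) x1 x2 = F (x2, y) - F (x1, y)).
  { intros y H. rewrite !(hline_eq _ y).
    rewrite <- (CInt_primitive_line F f (Ci * RtoC y) 1 x1 x2).
    - rewrite Cmult_1_l. apply CInt_ext. intros. now rewrite hline_eq.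
    - rewrite Rmin_left, Rmax_right by auto. intros. rewrite <- hline_eq. now apply H.
    - rewrite Rmin_left, Rmax_right by auto. intros.
      eapply ccont_ext; [|apply (ccont_hline f t y); now apply H].
      intros. simpl. now rewrite hline_eq. }
  assert (A' : forall x, (forall y, (y1 <= y <= y2)%R -> is_cderiv F (x, y) (f (x, y)) /\ cdiff f (x, y)) ->
     Ci * CInt (fun y => f (x, y)) y1 y2 = F (x, y2) - F (x, y1)).
  { intros x H. rewrite !(vline_eq x).
    rewrite <- (CInt_primitive_line F f (RtoC x) Ci y1 y2).
    - f_equal. apply CInt_ext. intros. now rewrite vline_eq.
    - rewrite Rmin_left, Rmax_right by auto. intros. rewrite <- vline_eq. now apply H.
    - rewrite Rmin_left, Rmax_right by auto. intros.
      eapply ccont_ext; [|apply (ccont_vline f x t); now apply H].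
      intros. simpl. now rewrite vline_eq. }
  transitivity (CInt (fun x => f (x, y1)) x1 x2 - CInt (fun x => f (x, y2)) x1 x2
    + (Ci * CInt (fun y => f (x2, y)) y1 y2 - Ci * CInt (fun y => f (x1, y)) y1 y2)).
  { unfold rect_integral. ring. }
  rewrite (A y1 (fun t Ht => conj (proj1 (F1 t Ht)) (proj1 (H1 t Ht)))).
  rewrite (A y2 (fun t Ht => conj (proj2 (F1 t Ht)) (proj2 (H1 t Ht)))).
  rewrite (A' x1 (fun t Ht => conj (proj1 (F2 t Ht)) (proj1 (H2 t Ht)))).
  rewrite (A' x2 (fun t Ht => conj (proj2 (F2 t Ht)) (proj2 (H2 t Ht)))).
  ring.
Qed.

(** A quadratic primitive exists. This removes the tangent of [f] in Goursat's argument. *)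
Lemma rect_affine (a b : C) (x1 x2 y1 y2 : R) : (x1 <= x2)%R -> (y1 <= y2)%R ->
  rect_integral (fun z => a + b * z) x1 x2 y1 y2 = 0.
Proof.
  intros Hx Hy. apply (rect_primitive (fun z => a * z + (b / 2) * (z * z))); auto.
  - apply on_edges_in_rect; auto. intros z _.
    replace (a + b * z) with ((0 * z + a * 1) + (0 * (z * z) + (b / 2) * (1 * z + z * 1))).
    2: { field. }
    apply is_cderiv_plus.
    + apply (is_cderiv_mult (fun _ => a) (fun z => z)). apply is_cderiv_const. apply is_cderiv_id.
    + apply (is_cderiv_mult (fun _ => b / 2) (fun z => z * z)). apply is_cderiv_const.
      apply (is_cderiv_mult (fun z => z) (fun z => z)); apply is_cderiv_id.
  - apply on_edges_in_rect; auto. intros z _. cdiff_tac.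
Qed.

Lemma pow_half_small (W d : R) : (0 < d)%R -> exists n, (W * (/ 2) ^ n < d)%R.
Proof.
  intros Hd. destruct (pow_lt_1_zero (/ 2)) with (y := (d / (Rabs W + 1))%R) as [N HN].
  - rewrite Rabs_pos_eq; lra.
  - apply Rdiv_lt_0_compat; auto. pose proof (Rabs_pos W). lra.
  - exists N. specialize (HN N (le_n N)). pose proof (Rabs_pos W).
    rewrite Rabs_pos_eq in HN by (apply pow_le; lra).
    assert (0 < (/ 2) ^ N)%R by (apply pow_lt; lra).
    apply Rmult_lt_compat_l with (r := (Rabs W + 1)%R) in HN; [|lra].
    replace ((Rabs W + 1) * (d / (Rabs W + 1)))%R with d in HN by (field; lra).
    pose proof (Rle_abs W). nra.
Qed.

Lemma Cmod_4_lt (a b c d : C) (e : R) :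
  (Cmod a < e)%R -> (Cmod b < e)%R -> (Cmod c < e)%R -> (Cmod d < e)%R ->
  (Cmod (a + b + (c + d)) < 4 * e)%R.
Proof.
  intros. eapply Rle_lt_trans. apply Cmod_triangle.
  pose proof (Cmod_triangle a b). pose proof (Cmod_triangle c d). lra.
Qed.

Section Goursat.
Variables (f : C -> C) (x1 x2 y1 y2 : R).
Hypotheses (Hx : (x1 <= x2)%R) (Hy : (y1 <= y2)%R).
Hypothesis Hf : forall z, in_rect x1 x2 y1 y2 z -> cdiff f z.
Let w (n : nat) := ((x2 - x1) * (/ 2) ^ n)%R.
Let h (n : nat) := ((y2 - y1) * (/ 2) ^ n)%R.
Let delta := Cmod (rect_integral f x1 x2 y1 y2).

(** [p] is the lower left corner of a rectangle of the [n]-th bisection whose integral has lost at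
    most a factor 4 per step. *)
Definition bad_subrect (n : nat) (p : R * R) : Prop :=
  (x1 <= fst p)%R /\ (fst p + w n <= x2)%R /\ (y1 <= snd p)%R /\ (snd p + h n <= y2)%R /\
  (delta * (/ 4) ^ n <= Cmod (rect_integral f (fst p) (fst p + w n) (snd p) (snd p + h n)))%R.

Definition subrect_child (n : nat) (p q : R * R) : Prop :=
  (fst p <= fst q)%R /\ (fst q + w (S n) <= fst p + w n)%R /\
  (snd p <= snd q)%R /\ (snd q + h (S n) <= snd p + h n)%R /\ bad_subrect (S n) q.

Lemma subrect_width_pos n : (0 <= w n)%R.
Proof. unfold w. assert (0 < (/ 2) ^ n)%R by (apply pow_lt; lra). nra. Qed.
Lemma subrect_height_pos n : (0 <= h n)%R.
Proof. unfold h. assert (0 < (/ 2) ^ n)%R by (apply pow_lt; lra). nra. Qed.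
Lemma subrect_width_S n : w n = (2 * w (S n))%R.
Proof. unfold w; simpl. field. Qed.
Lemma subrect_height_S n : h n = (2 * h (S n))%R.
Proof. unfold h; simpl. field. Qed.

(** Pigeonhole: the integrals over the four quarters add up to that over the whole, so they cannot
    all fall below a quarter of its lower bound. *)
Lemma bad_subrect_step n p : bad_subrect n p -> exists q, subrect_child n p q.
Proof.
  intros (B1 & B2 & B3 & B4 & B5). destruct p as [x y]. simpl in *.
  pose proof (subrect_width_pos (S n)) as Pw. pose proof (subrect_height_pos (S n)) as Ph.
  assert (Ew := subrect_width_S n). assert (Eh := subrect_height_S n).
  set (ww := w (S n)) in *. set (hh := h (S n)) in *.
  destruct (classic (exists q, subrect_child n (x, y) q)) as [|No]; auto. exfalso.
  assert (D : forall a b, (a = x \/ a = x + ww)%R -> (b = y \/ b = y + hh)%R ->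
     (Cmod (rect_integral f a (a + ww) b (b + hh)) < delta * (/ 4) ^ (S n))%R).
  { intros a b Ha Hb. apply Rnot_le_lt. intros K. apply No. exists (a, b).
    unfold subrect_child, bad_subrect; simpl. fold ww hh.
    repeat split; try (destruct Ha; lra); try (destruct Hb; lra). exact K. }
  assert (E : rect_integral f x (x + w n) y (y + h n) =
     rect_integral f x (x + ww) y (y + hh) + rect_integral f x (x + ww) (y + hh) (y + hh + hh)
     + (rect_integral f (x + ww) (x + ww + ww) y (y + hh) + rect_integral f (x + ww) (x + ww + ww) (y + hh) (y + hh + hh))).
  { rewrite Ew, Eh. replace (x + 2 * ww)%R with (x + ww + ww)%R by ring.
    replace (y + 2 * hh)%R with (y + hh + hh)%R by ring.
    rewrite (rect_split_x f x (x + ww) (x + ww + ww)); [|lra|].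
    rewrite (rect_split_y f x (x + ww) y (y + hh) (y + hh + hh)); [|lra|].
    rewrite (rect_split_y f (x + ww) (x + ww + ww) y (y + hh) (y + hh + hh)); [|lra|]. reflexivity.
    all: intros t Ht; split; apply Hf; split; simpl; lra. }
  rewrite E in B5.
  assert (K := Cmod_4_lt _ _ _ _ _ (D x y (or_introl eq_refl) (or_introl eq_refl))
    (D x (y + hh)%R (or_introl eq_refl) (or_intror eq_refl))
    (D (x + ww)%R y (or_intror eq_refl) (or_introl eq_refl))
    (D (x + ww)%R (y + hh)%R (or_intror eq_refl) (or_intror eq_refl))).
  simpl pow in K. lra.
Qed.

Fixpoint subrect_seq (n : nat) : R * R :=
  match n with
  | O => (x1, y1)
  | S m => epsilon (inhabits (0%R, 0%R)) (subrect_child m (subrect_seq m))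
  end.

Lemma subrect_seq_bad n : bad_subrect n (subrect_seq n).
Proof.
  induction n as [|n IH].
  - unfold bad_subrect, w, h; simpl.
    replace (x1 + (x2 - x1) * 1)%R with x2 by ring. replace (y1 + (y2 - y1) * 1)%R with y2 by ring.
    fold delta. repeat split; lra.
  - simpl. destruct (epsilon_spec (inhabits (0%R, 0%R)) _ (bad_subrect_step n _ IH)) as (_ & _ & _ & _ & H). exact H.
Qed.

Lemma subrect_seq_child n : subrect_child n (subrect_seq n) (subrect_seq (S n)).
Proof. simpl. apply epsilon_spec. apply bad_subrect_step, subrect_seq_bad. Qed.

Lemma nested_point (u v : nat -> R) :
  (forall n, (u n <= u (S n))%R) -> (forall n, (v (S n) <= v n)%R) -> (forall n, (u n <= v n)%R) ->
  exists l, forall n, (u n <= l <= v n)%R.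
Proof.
  intros Hu Hv Huv.
  assert (Hu' : forall n k, (u n <= u (n + k)%nat)%R).
  { intros n k. induction k. rewrite Nat.add_0_r; lra. rewrite Nat.add_succ_r. specialize (Hu (n + k)%nat). lra. }
  assert (Hv' : forall n k, (v (n + k)%nat <= v n)%R).
  { intros n k. induction k. rewrite Nat.add_0_r; lra. rewrite Nat.add_succ_r. specialize (Hv (n + k)%nat). lra. }
  assert (H : forall n m, (u n <= v m)%R).
  { intros n m. specialize (Hu' n m). specialize (Hv' m n). specialize (Huv (n + m)%nat).
    rewrite (Nat.add_comm m n) in Hv'. lra. }
  destruct (completeness (fun x => exists n, x = u n)) as [l [L1 L2]].
  - exists (v O). intros x [n ->]. auto.
  - exists (u O). now exists O.
  - exists l. intros n. split. apply L1. now exists n. apply L2. intros x [m ->]. auto.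
Qed.

(** Near the common point [z] of the nested rectangles [f] is affine up to [eps |u - z|], so the
    [n]-th integral is at most perimeter times diameter times [eps], of order [eps 4^(-n)]; the
    bisection keeps it at least [delta 4^(-n)]. *)
Lemma goursat_rect : rect_integral f x1 x2 y1 y2 = 0.
Proof.
  destruct (nested_point (fun n => fst (subrect_seq n)) (fun n => fst (subrect_seq n) + w n)%R) as [lx Lx].
  { intros n. apply subrect_seq_child. } { intros n. apply subrect_seq_child. }
  { intros n. pose proof (subrect_width_pos n). lra. }
  destruct (nested_point (fun n => snd (subrect_seq n)) (fun n => snd (subrect_seq n) + h n)%R) as [ly Ly].
  { intros n. apply subrect_seq_child. } { intros n. apply subrect_seq_child. }
  { intros n. pose proof (subrect_height_pos n). lra. }
  set (z := (lx, ly) : C).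
  assert (Hz : in_rect x1 x2 y1 y2 z).
  { specialize (Lx O). specialize (Ly O). unfold w, h in *. simpl in *. split; simpl; lra. }
  destruct (Hf z Hz) as [l Hl].
  apply NNPP. intros Hne. apply Cmod_gt_0 in Hne. fold delta in Hne.
  set (W := ((x2 - x1) + (y2 - y1))%R). assert (HW : (0 <= W)%R) by (unfold W; lra).
  (* Chosen so that [2 eps W^2 < delta], also when [W = 0]. *)
  set (eps := (delta / (4 * (W * W) + 1))%R).
  assert (Heps : (0 < eps)%R). { apply Rdiv_lt_0_compat; auto. nra. }
  assert (HepsE : (eps * (4 * (W * W) + 1) = delta)%R). { unfold eps. field. nra. }
  destruct (Hl eps Heps) as [d [Hd Hloc]].
  destruct (pow_half_small W d Hd) as [n Hn].
  destruct (subrect_seq_bad n) as (B1 & B2 & B3 & B4 & B5).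
  specialize (Lx n). specialize (Ly n). simpl in Lx, Ly.
  pose proof (subrect_width_pos n) as Pw. pose proof (subrect_height_pos n) as Ph.
  set (x := fst (subrect_seq n)) in *. set (y := snd (subrect_seq n)) in *.
  assert (EW : (w n + h n = W * (/ 2) ^ n)%R) by (unfold w, h, W; ring).
  set (q := ((/ 2) ^ n)%R) in *.
  assert (Hq : (0 < q)%R) by (apply pow_lt; lra).
  assert (Eq4 : ((/ 4) ^ n = q * q)%R).
  { unfold q. rewrite <- Rpow_mult_distr. f_equal. field. }
  assert (Hsub : forall u, in_rect x (x + w n) y (y + h n) u -> cdiff f u).
  { intros u [U1 U2]. apply Hf. split; lra. }
  assert (Hb : (Cmod (rect_integral (fun u => f u - ((f z - l * z) + l * u))%C x (x + w n) y (y + h n))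
      <= 2 * ((x + w n - x) + (y + h n - y)) * (eps * (W * q)))%R).
  { apply rect_bound; try lra.
    - apply on_edges_in_rect; try lra. intros u Hu. apply cdiff_minus; auto. cdiff_tac.
    - apply on_edges_in_rect; try lra. intros [ux uy] [U1 U2].
      set (u := (ux, uy) : C). simpl in U1, U2.
      assert (Hdist : (Cmod (u - z) <= W * q)%R).
      { eapply Rle_trans. apply Cmod_le_abs. rewrite <- EW. unfold z; simpl.
        apply Rplus_le_compat; apply Rabs_le; lra. }
      replace (f u - (f z - l * z + l * u)) with (f u - f z - l * (u - z)) by ring.
      eapply Rle_trans. apply Hloc. lra. apply Rmult_le_compat_l; lra. }
  rewrite rect_minus, rect_affine in Hb; try lra.
  2: { apply on_edges_in_rect; auto; lra. }
  2: { apply on_edges_in_rect; try lra. intros u Hu. cdiff_tac. }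
  replace (rect_integral f x (x + w n) y (y + h n) - 0) with (rect_integral f x (x + w n) y (y + h n)) in Hb by ring.
  replace (x + w n - x + (y + h n - y))%R with (W * q)%R in Hb by (rewrite <- EW; ring).
  rewrite Eq4 in B5.
  assert (delta * (q * q) <= 2 * (W * q) * (eps * (W * q)))%R by lra.
  assert (delta * (q * q) <= eps * 2 * (W * W) * (q * q))%R by nra.
  assert (0 < q * q)%R by nra.
  assert (delta <= eps * 2 * (W * W))%R by (apply Rmult_le_reg_r with (q * q)%R; auto).
  nra.
Qed.
End Goursat.

(** * Residues on rectangles *)

Lemma Cneq_by_re (z w : C) : Re z <> Re w -> z <> w.
Proof. intros H E. now subst. Qed.
Lemma Cneq_by_im (z w : C) : Im z <> Im w -> z <> w.
Proof. intros H E. now subst. Qed.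

Lemma Cminus_neq_0 (z w : C) : z <> w -> z - w <> 0.
Proof. intros H E. apply H. replace z with (z - w + w) by ring. rewrite E. ring. Qed.

(** A quarter of the integral of [1 / z] round a square. The primitives of the two components are a
    logarithm, which cancels, and an arctangent. *)
Lemma CInt_inv_minus_i : CInt (fun t => / (RtoC t - Ci)) (-1) 1 = Ci * RtoC (PI / 2).
Proof.
  replace (Ci * RtoC (PI / 2)) with
    ((minus (ln (1 + 1 * 1) / 2) (ln (1 + (-1) * (-1)) / 2), minus (atan 1) (atan (-1)))%R : C).
  2: { apply C_eq; simpl; unfold minus, plus, opp; simpl.
    - replace (1 + -1 * -1)%R with (1 + 1 * 1)%R by ring. ring.
    - replace (atan (-1)) with (- atan 1)%R by (rewrite <- atan_opp; f_equal; ring).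
      rewrite atan_1. field. }
  apply CInt_unique.
  apply (is_RInt_fct_extend_pair (U := R_NormedModule) (V := R_NormedModule)).
  - apply (is_RInt_derive (V := R_CompleteNormedModule) (fun t => ln (1 + t * t) / 2)%R).
    + intros t _. auto_derive. nra. simpl. field; repeat split; nra.
    + intros t _. simpl. apply (continuous_ext (fun t : R => t * / (t * t + 1))%R).
      { intros s. simpl. field; repeat split; nra. }
      apply (ex_derive_continuous (K := R_AbsRing) (V := R_NormedModule)). auto_derive. nra.
  - apply (is_RInt_derive (V := R_CompleteNormedModule) atan).
    + intros t _. simpl. apply is_derive_Reals.
      match goal with |- derivable_pt_lim _ _ ?x => replace x with (/ (1 + t ^ 2))%R end.
      apply derivable_pt_lim_atan. simpl. field; repeat split; nra.
    + intros t _. simpl. apply (continuous_ext (fun t : R => / (t * t + 1))%R).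
      { intros s. simpl. field; repeat split; nra. }
      apply (ex_derive_continuous (K := R_AbsRing) (V := R_NormedModule)). auto_derive. nra.
Qed.

(** After scaling, each side contributes the integral along [t - i], up to a rotation that cancels
    against [dz]; hence four times [i pi / 2]. *)
Lemma rect_square_inv (z0 : C) (r : R) : (0 < r)%R ->
  rect_integral (fun w => / (w - z0)) (Re z0 - r) (Re z0 + r) (Im z0 - r) (Im z0 + r)
  = RtoC (2 * PI) * Ci.
Proof.
  intros Hr. destruct z0 as [x0 y0]. simpl Re. simpl Im. set (z0 := (x0, y0) : C).
  assert (Hr' : RtoC r <> 0) by (intros E; apply RtoC_inj in E; lra).
  set (K := CInt (fun t => / (RtoC t - Ci)) (-1) 1).
  assert (HD : forall w : C, w <> z0 -> cdiff (fun w => / (w - z0)) w).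
  { intros w Hw. apply cdiff_inv. now apply Cminus_neq_0. cdiff_tac. }
  assert (Hti : forall t : R, RtoC t - Ci <> 0).
  { intros t E. apply (f_equal Im) in E. simpl in E. lra. }
  assert (Hti' : forall t : R, RtoC t + Ci <> 0).
  { intros t E. apply (f_equal Im) in E. simpl in E. lra. }
  assert (Hint : forall t, ccont (fun t => / (RtoC t - Ci)) t).
  { intros t. apply (ccont_comp_holo (fun w => / (w - Ci)) RtoC).
    apply cdiff_inv. apply Hti. cdiff_tac. apply ccont_RtoC, continuous_id. }
  assert (HKr : CInt (fun t => / (RtoC (- t) - Ci)) (-1) 1 = K).
  { pose proof (CInt_reflect (fun t => / (RtoC t - Ci)) (-1) 1) as E.
    replace (- -1)%R with 1%R in E by ring. apply E. apply cintble_cont'. auto. }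
  assert (Bot : CInt (fun x => / ((x, (y0 - r)%R) - z0)) (x0 - r) (x0 + r) = K).
  { pose proof (CInt_comp_lin (fun x => / ((x, (y0 - r)%R) - z0)) r x0 (-1) 1) as E.
    replace (r * -1 + x0)%R with (x0 - r)%R in E by ring. replace (r * 1 + x0)%R with (x0 + r)%R in E by ring.
    rewrite <- E.
    - rewrite <- CInt_scal. apply CInt_ext. intros t _.
      replace (((r * t + x0)%R, (y0 - r)%R) - z0) with (RtoC r * (RtoC t - Ci)).
      field; auto. apply C_eq; simpl; ring.
      apply (cintble_cont' (fun t => / (((r * t + x0)%R, (y0 - r)%R) - z0))). intros t.
      eapply ccont_ext; [|apply ccont_mult; [apply (ccont_const (/ RtoC r))|apply (Hint t)]].
      intros u. simpl. replace (((r * u + x0)%R, (y0 - r)%R) - z0) with (RtoC r * (RtoC u - Ci)).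
      field; auto. apply C_eq; simpl; ring.
    - apply (cintble_hline (fun w => / (w - z0))). lra. intros. apply HD. apply Cneq_by_im. simpl. lra. }
  assert (Top : CInt (fun x => / ((x, (y0 + r)%R) - z0)) (x0 - r) (x0 + r) = - K).
  { pose proof (CInt_comp_lin (fun x => / ((x, (y0 + r)%R) - z0)) r x0 (-1) 1) as E.
    replace (r * -1 + x0)%R with (x0 - r)%R in E by ring. replace (r * 1 + x0)%R with (x0 + r)%R in E by ring.
    assert (Hint2 : forall t, ccont (fun t => / (RtoC (- t) - Ci)) t).
    { intros t. apply (ccont_comp_real (fun t => / (RtoC t - Ci)) Ropp); auto.
      apply (continuous_opp (V := R_NormedModule)), continuous_id. }
    rewrite <- E.
    - rewrite <- HKr. replace (- CInt (fun t : R => / (RtoC (- t) - Ci)) (-1) 1) with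
        ((- (1)) * CInt (fun t : R => / (RtoC (- t) - Ci)) (-1) 1) by ring.
      rewrite <- !CInt_scal. apply CInt_ext. intros t _.
      replace (((r * t + x0)%R, (y0 + r)%R) - z0) with (RtoC r * (RtoC t + Ci)).
      rewrite RtoC_opp. field. repeat split; auto.
      replace (- RtoC t - Ci) with (- (RtoC t + Ci)) by ring. intros E0. apply (Hti' t).
      replace (RtoC t + Ci) with (- - (RtoC t + Ci)) by ring. rewrite E0. ring.
      apply C_eq; simpl; ring.
      apply cintble_cont'. auto.
      apply (cintble_cont' (fun t => / (((r * t + x0)%R, (y0 + r)%R) - z0))). intros t.
      eapply ccont_ext; [|apply ccont_mult; [apply (ccont_const (- / RtoC r))|apply (Hint2 t)]].
      intros u. simpl. replace (((r * u + x0)%R, (y0 + r)%R) - z0) with (RtoC r * (RtoC u + Ci)).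
      replace (RtoC (- u) - Ci) with (- (RtoC u + Ci)) by (rewrite RtoC_opp; ring).
      field; auto. apply C_eq; simpl; ring.
    - apply (cintble_hline (fun w => / (w - z0))). lra. intros. apply HD. apply Cneq_by_im. simpl. lra. }
  assert (Rgt : Ci * CInt (fun y => / (((x0 + r)%R, y) - z0)) (y0 - r) (y0 + r) = K).
  { pose proof (CInt_comp_lin (fun y => / (((x0 + r)%R, y) - z0)) r y0 (-1) 1) as E.
    replace (r * -1 + y0)%R with (y0 - r)%R in E by ring. replace (r * 1 + y0)%R with (y0 + r)%R in E by ring.
    assert (HX : forall t, / (((x0 + r)%R, (r * t + y0)%R) - z0) = (/ RtoC r * / Ci) * / (RtoC t - Ci)).
    { intros t. replace (((x0 + r)%R, (r * t + y0)%R) - z0) with (RtoC r * Ci * (RtoC t - Ci)).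
      field. repeat split; auto. intros E0. apply (f_equal Im) in E0. simpl in E0. lra.
      apply C_eq; simpl; ring. }
    rewrite <- E.
    - rewrite (CInt_ext _ (fun t => (/ RtoC r * / Ci) * / (RtoC t - Ci))) by (intros; apply HX).
      rewrite CInt_scal by (apply cintble_cont'; auto). fold K. field.
      split; auto. intros E0. apply (f_equal Im) in E0. simpl in E0. lra.
    - apply (cintble_vline (fun w => / (w - z0))). lra. intros. apply HD. apply Cneq_by_re. simpl. lra. }
  assert (Lft : Ci * CInt (fun y => / (((x0 - r)%R, y) - z0)) (y0 - r) (y0 + r) = - K).
  { pose proof (CInt_comp_lin (fun y => / (((x0 - r)%R, y) - z0)) r y0 (-1) 1) as E.
    replace (r * -1 + y0)%R with (y0 - r)%R in E by ring. replace (r * 1 + y0)%R with (y0 + r)%R in E by ring.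
    assert (Hint2 : forall t, ccont (fun t => / (RtoC (- t) - Ci)) t).
    { intros t. apply (ccont_comp_real (fun t => / (RtoC t - Ci)) Ropp); auto.
      apply (continuous_opp (V := R_NormedModule)), continuous_id. }
    assert (HX : forall t, / (((x0 - r)%R, (r * t + y0)%R) - z0) = (- / RtoC r * / Ci) * / (RtoC (- t) - Ci)).
    { intros t. replace (((x0 - r)%R, (r * t + y0)%R) - z0) with (- (RtoC r * Ci * (RtoC (- t) - Ci))).
      field. repeat split; auto. intros E0. apply (f_equal Im) in E0. simpl in E0. lra.
      apply C_eq; simpl; ring. }
    rewrite <- E.
    - rewrite (CInt_ext _ (fun t => (- / RtoC r * / Ci) * / (RtoC (- t) - Ci))) by (intros; apply HX).
      rewrite CInt_scal by (apply cintble_cont'; auto). rewrite HKr. field.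
      split; auto. intros E0. apply (f_equal Im) in E0. simpl in E0. lra.
    - apply (cintble_vline (fun w => / (w - z0))). lra. intros. apply HD. apply Cneq_by_re. simpl. lra. }
  transitivity (K - - K + (K - - K)).
  { rewrite <- Rgt at 3. rewrite <- Lft at 1. unfold rect_integral. rewrite Bot, Top. ring. }
  unfold K. rewrite CInt_inv_minus_i. apply C_eq; simpl; field.
Qed.

(** The value at [z0] is left out: applied to [(w - z0) * q w], the number [a] is the residue of [q]
    at a simple pole, or 0 at a removable singularity. *)
Definition punctured_limit (q : C -> C) (z0 a : C) : Prop :=
  forall eps, (0 < eps)%R -> exists d, (0 < d)%R /\
    forall w, w <> z0 -> (Cmod (w - z0) < d)%R -> (Cmod (q w - a) <= eps)%R.

(** Goursat's theorem on the four rectangles around a small square moves the contour to that square.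
    There [q] differs from [a / (w - z0)] by at most [eps / r], on a contour of length [8 r]. *)
Lemma rect_residue (q : C -> C) (x1 x2 y1 y2 : R) (z0 a : C) :
  (x1 < Re z0 < x2)%R -> (y1 < Im z0 < y2)%R ->
  (forall z, in_rect x1 x2 y1 y2 z -> z <> z0 -> cdiff q z) ->
  punctured_limit (fun w => (w - z0) * q w) z0 a ->
  rect_integral q x1 x2 y1 y2 = RtoC (2 * PI) * Ci * a.
Proof.
  intros Hx Hy Hq Hlim. destruct z0 as [x0 y0]. simpl in Hx, Hy. set (z0 := (x0, y0) : C) in *.
  set (R0 := Rmin (Rmin (x0 - x1) (x2 - x0)) (Rmin (y0 - y1) (y2 - y0))).
  assert (HR0 : (0 < R0)%R) by (repeat apply Rmin_pos; lra).
  assert (HR1 : (R0 <= x0 - x1 /\ R0 <= x2 - x0 /\ R0 <= y0 - y1 /\ R0 <= y2 - y0)%R).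
  { unfold R0. pose proof (Rmin_l (Rmin (x0 - x1) (x2 - x0)) (Rmin (y0 - y1) (y2 - y0))).
    pose proof (Rmin_r (Rmin (x0 - x1) (x2 - x0)) (Rmin (y0 - y1) (y2 - y0))).
    pose proof (Rmin_l (x0 - x1) (x2 - x0)). pose proof (Rmin_r (x0 - x1) (x2 - x0)).
    pose proof (Rmin_l (y0 - y1) (y2 - y0)). pose proof (Rmin_r (y0 - y1) (y2 - y0)). lra. }
  assert (Shrink : forall r, (0 < r < R0)%R ->
     rect_integral q x1 x2 y1 y2 = rect_integral q (x0 - r) (x0 + r) (y0 - r) (y0 + r)).
  { intros r Hr.
    rewrite (rect_split_x q x1 (x0 - r) x2); [|lra|].
    rewrite (rect_split_x q (x0 - r) (x0 + r) x2); [|lra|].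
    rewrite (rect_split_y q (x0 - r) (x0 + r) y1 (y0 - r) y2); [|lra|].
    rewrite (rect_split_y q (x0 - r) (x0 + r) (y0 - r) (y0 + r) y2); [|lra|].
    rewrite (goursat_rect q x1), (goursat_rect q (x0 + r)),
      (goursat_rect q (x0 - r) (x0 + r) y1 (y0 - r)), (goursat_rect q (x0 - r) (x0 + r) (y0 + r) y2);
      try lra. ring.
    - intros z [Z1 Z2]. apply Hq. split; lra. apply Cneq_by_im. simpl. lra.
    - intros z [Z1 Z2]. apply Hq. split; lra. apply Cneq_by_im. simpl. lra.
    - intros z [Z1 Z2]. apply Hq. split; lra. apply Cneq_by_re. simpl. lra.
    - intros z [Z1 Z2]. apply Hq. split; lra. apply Cneq_by_re. simpl. lra.
    - intros t Ht. split; apply Hq; try (split; simpl; lra); apply Cneq_by_re; simpl; lra.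
    - intros t Ht. split; apply Hq; try (split; simpl; lra); apply Cneq_by_re; simpl; lra.
    - intros t Ht. split; apply Hq; try (split; simpl; lra); apply Cneq_by_im; simpl; lra.
    - intros t Ht. split; apply Hq; try (split; simpl; lra); apply Cneq_by_im; simpl; lra. }
  assert (Close : forall eps, (0 < eps)%R ->
     (Cmod (rect_integral q x1 x2 y1 y2 - RtoC (2 * PI) * Ci * a) <= 8 * eps)%R).
  { intros eps He. destruct (Hlim eps He) as [d [Hd Hclose]].
    (* [R0 / 2] keeps the square inside the rectangle; [d / 4] keeps its boundary, at distance at
       most [2 r], inside the punctured disc. *)
    set (r := (Rmin (R0 / 2) (d / 4))%R).
    assert (Hr : (0 < r)%R) by (apply Rmin_pos; lra).
    assert (Hr1 : (r <= R0 / 2)%R) by apply Rmin_l. assert (Hr2 : (r <= d / 4)%R) by apply Rmin_r.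
    rewrite (Shrink r) by lra.
    assert (Edge : forall P : C -> Prop,
       (forall w, in_rect (x0 - r) (x0 + r) (y0 - r) (y0 + r) w -> w <> z0 -> (r <= Cmod (w - z0) <= 2 * r)%R -> P w) ->
       on_edges P (x0 - r) (x0 + r) (y0 - r) (y0 + r)).
    { intros P HP. 
      assert (Hup : forall u v : R, (x0 - r <= u <= x0 + r)%R -> (y0 - r <= v <= y0 + r)%R ->
         (Cmod ((u, v) - z0) <= 2 * r)%R).
      { intros u v Hu Hv. eapply Rle_trans. apply Cmod_le_abs. simpl.
        assert (Rabs (u + - x0) <= r)%R by (apply Rabs_le; lra).
        assert (Rabs (v + - y0) <= r)%R by (apply Rabs_le; lra). lra. }
      assert (LoI : forall u v : R, (v = y0 - r \/ v = y0 + r)%R -> (r <= Cmod ((u, v) - z0))%R).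
      { intros u v Hv. eapply Rle_trans; [|apply im_le_Cmod]. simpl.
        destruct Hv as [-> | ->].
        rewrite Rabs_left by lra. lra. rewrite Rabs_pos_eq by lra. lra. }
      assert (LoR : forall u v : R, (u = x0 - r \/ u = x0 + r)%R -> (r <= Cmod ((u, v) - z0))%R).
      { intros u v Hv. eapply Rle_trans; [|apply re_le_Cmod]. simpl.
        destruct Hv as [-> | ->].
        rewrite Rabs_left by lra. lra. rewrite Rabs_pos_eq by lra. lra. }
      split; intros t Ht; split; apply HP; try (split; simpl; lra);
        try (apply Cneq_by_re; simpl; lra); try (apply Cneq_by_im; simpl; lra);
        (split; [ first [solve [apply LoI; auto] | solve [apply LoR; auto]] | apply Hup; lra ]). }
    replace (RtoC (2 * PI) * Ci * a) with
      (rect_integral (fun w => a * / (w - z0)) (x0 - r) (x0 + r) (y0 - r) (y0 + r)).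
    2: { pose proof (rect_square_inv z0 r Hr) as E. simpl Re in E. simpl Im in E. rewrite <- E.
      unfold rect_integral. 
      assert (EI := on_edges_cintble (fun w => / (w - z0)) (x0 - r) (x0 + r) (y0 - r) (y0 + r)).
      destruct EI as (I1 & I2 & I3 & I4); try lra.
      { apply Edge. intros w _ Hw _. apply cdiff_inv. now apply Cminus_neq_0. cdiff_tac. }
      rewrite (CInt_scal _ _ _ _ I1), (CInt_scal _ _ _ _ I2), (CInt_scal _ _ _ _ I3), (CInt_scal _ _ _ _ I4).
      ring. }
    assert (Da : forall w, w <> z0 -> cdiff (fun w => a * / (w - z0)) w).
    { intros w Hw. apply cdiff_mult. apply cdiff_const.
      apply cdiff_inv. now apply Cminus_neq_0. cdiff_tac. }
    assert (Dq : on_edges (cdiff q) (x0 - r) (x0 + r) (y0 - r) (y0 + r)).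
    { apply Edge. intros w [W1 W2] Hw _. apply Hq; auto. split; lra. }
    rewrite <- rect_minus; try lra; auto.
    eapply Rle_trans. apply rect_bound with (M := (eps / r)%R); try lra.
    + apply Edge. intros w [W1 W2] Hw _. apply cdiff_minus; auto. apply Hq; auto. split; lra.
    + apply Edge. intros w [W1 W2] Hw Hm.
      specialize (Hclose w Hw ltac:(lra)).
      assert (Hw0 := Cminus_neq_0 _ _ Hw).
      replace (q w - a * / (w - z0)) with (((w - z0) * q w - a) * / (w - z0)) by (field; auto).
      rewrite Cmod_mult, Cmod_inv by auto. unfold Rdiv.
      apply Rmult_le_compat; auto. apply Cmod_ge_0.
      left; apply Rinv_0_lt_compat; lra. apply Rinv_le_contravar; lra.
    + right. field. lra. }
  set (D := rect_integral q x1 x2 y1 y2 - RtoC (2 * PI) * Ci * a) in *.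
  assert (D = 0).
  { apply Cmod_eq_0. apply Rle_antisym; [|apply Cmod_ge_0].
    apply le_epsilon. intros e He. specialize (Close (e / 16)%R ltac:(lra)). lra. }
  replace (rect_integral q x1 x2 y1 y2) with (D + RtoC (2 * PI) * Ci * a) by (unfold D; ring).
  rewrite H. ring.
Qed.

Lemma cdiff_punctured (f : C -> C) (z0 : C) : cdiff f z0 -> punctured_limit f z0 (f z0).
Proof.
  intros H eps He. destruct (cderiv_cont f z0 H eps He) as [d [Hd Hf]].
  exists d. split; auto. intros. left. auto.
Qed.

Lemma rect_cauchy (f : C -> C) (x1 x2 y1 y2 : R) (z0 : C) :
  (x1 < Re z0 < x2)%R -> (y1 < Im z0 < y2)%R ->
  (forall z, in_rect x1 x2 y1 y2 z -> cdiff f z) ->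
  rect_integral (fun w => f w / (w - z0)) x1 x2 y1 y2 = RtoC (2 * PI) * Ci * f z0.
Proof.
  intros Hx Hy Hf. apply rect_residue with (z0 := z0); auto.
  - intros z Hz Hne. apply cdiff_div. now apply Cminus_neq_0. auto. cdiff_tac.
  - intros eps He. destruct (cdiff_punctured f z0 (Hf z0 ltac:(split; lra)) eps He) as [d [Hd H]].
    exists d. split; auto. intros w Hw Hwd.
    replace ((w - z0) * (f w / (w - z0))) with (f w). now apply H.
    field. now apply Cminus_neq_0.
Qed.

(** * Uniqueness and limits of holomorphic functions *)

Lemma ccont_bounded (f : R -> C) (a b : R) : (a <= b)%R ->
  (forall t, (a <= t <= b)%R -> ccont f t) ->
  exists M, forall t, (a <= t <= b)%R -> (Cmod (f t) <= M)%R.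
Proof.
  intros Hab H.
  destruct (continuity_ab_maj (fun t => Cmod (f t)) a b Hab) as [m [Hm _]].
  - intros t Ht. apply continuity_pt_filterlim. apply ccont_Cmod. auto.
  - exists (Cmod (f m)). exact Hm.
Qed.

Lemma on_edges_bounded (f : C -> C) (x1 x2 y1 y2 : R) : (x1 <= x2)%R -> (y1 <= y2)%R ->
  on_edges (cdiff f) x1 x2 y1 y2 ->
  exists M, on_edges (fun z => (Cmod (f z) <= M)%R) x1 x2 y1 y2.
Proof.
  intros Hx Hy [H1 H2].
  destruct (ccont_bounded (fun x => f (x, y1)) x1 x2 Hx) as [M1 B1].
  { intros t Ht. apply (ccont_hline f), H1, Ht. }
  destruct (ccont_bounded (fun x => f (x, y2)) x1 x2 Hx) as [M2 B2].
  { intros t Ht. apply (ccont_hline f), H1, Ht. }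
  destruct (ccont_bounded (fun y => f (x1, y)) y1 y2 Hy) as [M3 B3].
  { intros t Ht. apply (ccont_vline f), H2, Ht. }
  destruct (ccont_bounded (fun y => f (x2, y)) y1 y2 Hy) as [M4 B4].
  { intros t Ht. apply (ccont_vline f), H2, Ht. }
  exists (Rmax (Rmax M1 M2) (Rmax M3 M4)).
  pose proof (Rmax_l M1 M2). pose proof (Rmax_r M1 M2).
  pose proof (Rmax_l M3 M4). pose proof (Rmax_r M3 M4).
  pose proof (Rmax_l (Rmax M1 M2) (Rmax M3 M4)). pose proof (Rmax_r (Rmax M1 M2) (Rmax M3 M4)).
  split; intros t Ht; split.
  - specialize (B1 t Ht). lra.
  - specialize (B2 t Ht). lra.
  - specialize (B3 t Ht). lra.
  - specialize (B4 t Ht). lra.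
Qed.

Lemma le_exp_decay_0 (x K eta : R) : (0 < eta)%R -> (0 <= K)%R ->
  (forall n : nat, (x <= K * exp (- (INR n * eta)))%R) -> (x <= 0)%R.
Proof.
  intros He HK H. apply Rnot_lt_le. intros Hx.
  destruct (INR_archimed (x * eta) K) as [n Hn]. { nra. }
  specialize (H n). 
  assert (B : (1 + INR n * eta <= exp (INR n * eta))%R) by apply exp_ineq1_le.
  rewrite exp_Ropp in H.
  assert (0 <= INR n)%R by apply pos_INR.
  assert (P : (0 < exp (INR n * eta))%R) by apply exp_pos.
  apply Rmult_le_compat_r with (r := exp (INR n * eta)) in H; [|lra].
  rewrite Rmult_assoc, Rinv_l, Rmult_1_r in H by lra.
  assert (x * (INR n * eta) <= x * exp (INR n * eta))%R by nra.
  nra.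
Qed.

(* The weight [exp (N (phi - 1))] with [phi = exp (kappa (w - z))] is 1 at [z] and tends to 0 as
   [N -> oo] on all edges but the right one. *)
Lemma vanish_from_right_edge (D : C -> C) (x1 x x2 y0 h : R) :
  (x1 < x < x2)%R -> (0 < h)%R ->
  (forall w, in_rect x1 x2 (y0 - h) (y0 + h) w -> cdiff D w) ->
  (forall y, (y0 - h <= y <= y0 + h)%R -> D (x2, y) = 0) ->
  D (x, y0) = 0.
Proof.
  intros Hx Hh HD H0. set (z := (x, y0) : C).
  (* With [k h = pi / 2] the real part of [phi] vanishes on the horizontal edges; on the left edge
     it is at most [rho < 1]. The weight is therefore at most [exp (- N (1 - rho))] on these three
     edges. *)
  set (k := (PI / (2 * h))%R).
  assert (Hk : (0 < k)%R) by (apply Rdiv_lt_0_compat; [apply PI_RGT_0|lra]).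
  assert (Ekh : (k * h = PI / 2)%R) by (unfold k; field; lra).
  set (phi := fun w : C => Cexp (RtoC k * (w - z))).
  set (rho := exp (- (k * (x - x1)))).
  assert (Hrho : (rho < 1)%R).
  { unfold rho. rewrite <- exp_0. apply exp_increasing. nra. }
  assert (Hrho0 : (0 < rho)%R) by apply exp_pos.
  set (f := fun (N : nat) (w : C) => D w * Cexp (RtoC (INR N) * (phi w - 1))).
  set (d := Rmin h (x - x1)). assert (Hd : (0 < d)%R) by (apply Rmin_pos; lra).
  assert (Hd1 : (d <= h)%R) by apply Rmin_l. assert (Hd2 : (d <= x - x1)%R) by apply Rmin_r.
  destruct (on_edges_bounded D x1 x2 (y0 - h) (y0 + h)) as [M HM]; try lra.
  { apply on_edges_in_rect; auto; lra. }
  assert (HM0 : (0 <= M)%R).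
  { destruct HM as [HM _]. destruct (HM x1 ltac:(lra)) as [HM' _]. pose proof (Cmod_ge_0 (D (x1, (y0 - h)%R))). lra. }
  assert (Hf : forall N w, in_rect x1 x2 (y0 - h) (y0 + h) w -> cdiff (f N) w).
  { intros N w Hw. unfold f, phi. cdiff_tac. now apply HD. }
  assert (Hfz : forall N, f N z = D z).
  { intros N. unfold f, phi. replace (RtoC k * (z - z)) with (RtoC 0) by ring. rewrite Cexp_0.
    replace (RtoC (INR N) * (1 - 1)) with (RtoC 0) by ring. rewrite Cexp_0. ring. }
  assert (Hmod : forall N w, Cmod (f N w) = (Cmod (D w) * exp (INR N * (exp (k * (Re w - x)) * cos (k * (Im w - y0)) - 1)))%R).
  { intros N [u v]. unfold f. rewrite Cmod_mult, Cmod_Cexp. f_equal. f_equal.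
    unfold phi, Cexp, z. simpl.
    replace (k * (u + - x) - 0 * (v + - y0))%R with (k * (u - x))%R by ring.
    replace (k * (v + - y0) + 0 * (u + - x))%R with (k * (v - y0))%R by ring. ring. }
  assert (HZ : D z = 0); [|exact HZ].
  apply Cmod_eq_0. apply Rle_antisym; [|apply Cmod_ge_0].
  set (K := (2 * ((x2 - x1) + (y0 + h - (y0 - h))) * (M / d) / (2 * PI))%R).
  apply le_exp_decay_0 with (K := K) (eta := (1 - rho)%R). lra.
  { pose proof PI_RGT_0. assert (0 <= M / d)%R by (apply Rdiv_le_0_compat; lra).
    apply Rdiv_le_0_compat; [|lra]. apply Rmult_le_pos; lra. }
  intros N. 
  assert (C1 := rect_cauchy (f N) x1 x2 (y0 - h) (y0 + h) z).
  specialize (C1 ltac:(simpl; lra) ltac:(simpl; lra) (Hf N)). rewrite Hfz in C1.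
  assert (Hexp : forall s, (s <= - (1 - rho))%R -> (exp (INR N * s) <= exp (- (INR N * (1 - rho))))%R).
  { intros s Hs. assert (INR N * s <= - (INR N * (1 - rho)))%R by (pose proof (pos_INR N); nra).
    destruct H as [H|H]. left; now apply exp_increasing. rewrite H; lra. }
  set (E := exp (- (INR N * (1 - rho)))) in *. assert (HE : (0 < E)%R) by apply exp_pos.
  assert (B : (Cmod (rect_integral (fun w => f N w / (w - z))%C x1 x2 (y0 - h) (y0 + h)) <=
     2 * ((x2 - x1) + (y0 + h - (y0 - h))) * (M / d * E))%R).
  { assert (Key : forall w, w <> z -> (d <= Cmod (w - z))%R -> (Cmod (D w) <= M)%R ->
      (exp (k * (Re w - x)) * cos (k * (Im w - y0)) <= rho)%R ->
      (Cmod (f N w / (w - z)) <= M / d * E)%R).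
    { intros w Hw Hdw HDw Hc. rewrite Cmod_div by now apply Cminus_neq_0.
      rewrite Hmod. replace (M / d * E)%R with ((M * E) * / d)%R by (field; lra). unfold Rdiv.
      apply Rmult_le_compat.
      - apply Rmult_le_pos. apply Cmod_ge_0. left; apply exp_pos.
      - left; apply Rinv_0_lt_compat; lra.
      - apply Rmult_le_compat; auto. apply Cmod_ge_0. left; apply exp_pos. apply Hexp. lra.
      - apply Rinv_le_contravar; lra. }
    destruct HM as [HM1 HM2].
    apply rect_bound; try lra.
    - split; intros t Ht; split; apply cdiff_div; try (apply Hf; split; simpl; lra); try cdiff_tac;
        apply Cminus_neq_0; first [solve [apply Cneq_by_im; simpl; lra] | solve [apply Cneq_by_re; simpl; lra]].
    - split; intros t Ht; split.
      + apply Key. apply Cneq_by_im; simpl; lra. 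
        eapply Rle_trans; [|apply im_le_Cmod]; simpl. rewrite Rabs_left; lra.
        apply HM1; auto. simpl. replace (k * (y0 - h - y0))%R with (- (k * h))%R by ring.
        rewrite Ekh, cos_neg, cos_PI2. lra.
      + apply Key. apply Cneq_by_im; simpl; lra. 
        eapply Rle_trans; [|apply im_le_Cmod]; simpl. rewrite Rabs_pos_eq; lra.
        apply HM1; auto. simpl. replace (k * (y0 + h - y0))%R with (k * h)%R by ring.
        rewrite Ekh, cos_PI2. lra.
      + apply Key. apply Cneq_by_re; simpl; lra. 
        eapply Rle_trans; [|apply re_le_Cmod]; simpl. rewrite Rabs_left; lra.
        apply HM2; auto. simpl. replace (k * (x1 - x))%R with (- (k * (x - x1)))%R by ring.
        fold rho. pose proof (COS_bound (k * (t - y0))). nra.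
      + unfold f. rewrite H0 by auto. rewrite Cmult_0_l. unfold Cdiv. rewrite Cmult_0_l, Cmod_0.
        apply Rmult_le_pos; [|lra]. apply Rmult_le_pos; auto. left; apply Rinv_0_lt_compat; lra. }
  rewrite C1, !Cmod_mult, Cmod_Ci, Cmod_R in B. pose proof PI_RGT_0.
  rewrite Rabs_pos_eq in B by lra.
  unfold K. apply Rmult_le_reg_l with (2 * PI)%R. lra.
  eapply Rle_trans. 2: { eapply Rle_trans. exact B. right. field. lra. }
  right; ring.
Qed.

(** * Limits of complex sequences and of holomorphic functions *)

Definition Clim (u : nat -> C) (l : C) : Prop :=
  forall eps, (0 < eps)%R -> exists N, forall n, (N <= n)%nat -> (Cmod (u n - l) < eps)%R.

Lemma Clim_unique (u : nat -> C) (l m : C) : Clim u l -> Clim u m -> l = m.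
Proof.
  intros Hl Hm. assert (l - m = 0).
  { apply Cmod_eq_0. apply Rle_antisym; [|apply Cmod_ge_0]. apply le_epsilon. intros e He.
    destruct (Hl (e / 2)%R ltac:(lra)) as [N1 H1]. destruct (Hm (e / 2)%R ltac:(lra)) as [N2 H2].
    specialize (H1 (N1 + N2)%nat ltac:(lia)). specialize (H2 (N1 + N2)%nat ltac:(lia)).
    replace (l - m) with ((u (N1 + N2)%nat - m) - (u (N1 + N2)%nat - l)) by ring.
    pose proof (Cmod_le_sum (u (N1 + N2)%nat - m) (u (N1 + N2)%nat - l)). lra. }
  replace l with (l - m + m) by ring. rewrite H. ring.
Qed.

Lemma Clim_bound (u : nat -> C) (l : C) (M : R) : Clim u l ->
  (forall n, (Cmod (u n) <= M)%R) -> (Cmod l <= M)%R.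
Proof.
  intros Hl Hb. apply le_epsilon. intros e He. destruct (Hl e He) as [N HN].
  specialize (HN N (le_n N)). specialize (Hb N).
  replace l with (u N - (u N - l)) by ring. pose proof (Cmod_le_sum (u N) (u N - l)). lra.
Qed.

Lemma Clim_ext (u v : nat -> C) (l : C) : (forall n, u n = v n) -> Clim u l -> Clim v l.
Proof. intros E H eps He. destruct (H eps He) as [N HN]. exists N. intros. rewrite <- E. auto. Qed.

Lemma Clim_const (c : C) : Clim (fun _ => c) c.
Proof. intros eps He. exists O. intros. replace (c - c) with (RtoC 0) by ring. rewrite Cmod_0; auto. Qed.

Lemma Clim_plus (u v : nat -> C) (l m : C) : Clim u l -> Clim v m -> Clim (fun n => u n + v n) (l + m).
Proof.
  intros Hl Hm eps He.
  destruct (Hl (eps / 2)%R ltac:(lra)) as [N1 H1]. destruct (Hm (eps / 2)%R ltac:(lra)) as [N2 H2].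
  exists (N1 + N2)%nat. intros n Hn. specialize (H1 n ltac:(lia)). specialize (H2 n ltac:(lia)).
  replace (u n + v n - (l + m)) with ((u n - l) + (v n - m)) by ring.
  pose proof (Cmod_triangle (u n - l) (v n - m)). lra.
Qed.

Lemma Clim_scal (u : nat -> C) (l c : C) : Clim u l -> Clim (fun n => c * u n) (c * l).
Proof.
  intros Hl eps He. pose proof (Cmod_ge_0 c).
  destruct (Hl (eps / (Cmod c + 1))%R) as [N HN]. { apply Rdiv_lt_0_compat; lra. }
  exists N. intros n Hn. specialize (HN n Hn).
  replace (c * u n - c * l) with (c * (u n - l)) by ring. rewrite Cmod_mult.
  apply Rmult_lt_compat_l with (r := (Cmod c + 1)%R) in HN; [|lra].
  replace ((Cmod c + 1) * (eps / (Cmod c + 1)))%R with eps in HN by (field; lra).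
  pose proof (Cmod_ge_0 (u n - l)). nra.
Qed.

Lemma Clim_minus (u v : nat -> C) (l m : C) : Clim u l -> Clim v m -> Clim (fun n => u n - v n) (l - m).
Proof.
  intros Hl Hm. apply (Clim_ext (fun n => u n + (- (1)) * v n)). intros; ring.
  replace (l - m) with (l + (- (1)) * m) by ring. apply Clim_plus; auto. now apply Clim_scal.
Qed.

Lemma Clim_squeeze (u : nat -> C) (l : C) (b : nat -> R) :
  (forall n, (Cmod (u n - l) <= b n)%R) -> is_lim_seq b 0%R -> Clim u l.
Proof.
  intros H Hb eps He. apply is_lim_seq_spec in Hb.
  destruct (Hb (mkposreal eps He)) as [N HN]. exists N. intros n Hn. specialize (HN n Hn). simpl in HN.
  specialize (H n). rewrite Rminus_0_r in HN. pose proof (Rle_abs (b n)). lra.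
Qed.

Lemma Clim_complete (u : nat -> C) :
  (forall eps, (0 < eps)%R -> exists N, forall n m, (N <= n)%nat -> (N <= m)%nat ->
     (Cmod (u n - u m) < eps)%R) -> exists l, Clim u l.
Proof.
  intros H.
  assert (HR : ex_finite_lim_seq (fun n => Re (u n))).
  { apply ex_lim_seq_cauchy_corr. intros eps. destruct (H eps (cond_pos eps)) as [N HN].
    exists N. intros n m Hn Hm. eapply Rle_lt_trans; [|apply (HN n m Hn Hm)].
    apply (re_le_Cmod (u n - u m)). }
  assert (HI : ex_finite_lim_seq (fun n => Im (u n))).
  { apply ex_lim_seq_cauchy_corr. intros eps. destruct (H eps (cond_pos eps)) as [N HN].
    exists N. intros n m Hn Hm. eapply Rle_lt_trans; [|apply (HN n m Hn Hm)].
    apply (im_le_Cmod (u n - u m)). }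
  destruct HR as [a Ha]. destruct HI as [b Hb]. exists (a, b).
  intros eps He. apply is_lim_seq_spec in Ha, Hb.
  assert (He2 : (0 < eps / 2)%R) by lra.
  destruct (Ha (mkposreal _ He2)) as [N1 H1]. destruct (Hb (mkposreal _ He2)) as [N2 H2].
  exists (N1 + N2)%nat. intros n Hn. specialize (H1 n ltac:(lia)). specialize (H2 n ltac:(lia)).
  simpl in H1, H2. eapply Rle_lt_trans. apply Cmod_le_abs. 
  change (Re (u n - (a, b))) with (Re (u n) - a)%R. change (Im (u n - (a, b))) with (Im (u n) - b)%R. lra.
Qed.

Lemma rect_scal (f : C -> C) (c : C) (x1 x2 y1 y2 : R) : (x1 <= x2)%R -> (y1 <= y2)%R ->
  on_edges (cdiff f) x1 x2 y1 y2 ->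
  rect_integral (fun z => c * f z) x1 x2 y1 y2 = c * rect_integral f x1 x2 y1 y2.
Proof.
  intros Hx Hy F. destruct (on_edges_cintble f _ _ _ _ Hx Hy F) as (F1 & F2 & F3 & F4).
  unfold rect_integral. rewrite !CInt_scal by assumption. ring.
Qed.

Lemma square_on_edges (P : C -> Prop) (z : C) (r : R) : (0 < r)%R ->
  (forall w, in_rect (Re z - r) (Re z + r) (Im z - r) (Im z + r) w -> (r <= Cmod (w - z))%R -> P w) ->
  on_edges P (Re z - r) (Re z + r) (Im z - r) (Im z + r).
Proof.
  intros Hr H. destruct z as [x0 y0]. simpl in *.
  split; intros t Ht; split; apply H; try (split; simpl; lra).
  - eapply Rle_trans; [|apply im_le_Cmod]; simpl. rewrite Rabs_left; lra.
  - eapply Rle_trans; [|apply im_le_Cmod]; simpl. rewrite Rabs_pos_eq; lra.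
  - eapply Rle_trans; [|apply re_le_Cmod]; simpl. rewrite Rabs_left; lra.
  - eapply Rle_trans; [|apply re_le_Cmod]; simpl. rewrite Rabs_pos_eq; lra.
Qed.

(** Cauchy's formula for [f (z + h)], [f z] and the derivative [A] combines into one integral with
    the kernel [h^2 / ((w - z)^2 (w - z - h))]. The constant depends on [f] through [M] alone, so it
    is common to a bounded family. *)
Lemma cauchy_taylor2 (f : C -> C) (z : C) (r M : R) : (0 < r)%R ->
  (forall w, in_rect (Re z - r) (Re z + r) (Im z - r) (Im z + r) w -> cdiff f w /\ (Cmod (f w) <= M)%R) ->
  exists A : C, forall h, (Cmod h <= r / 2)%R ->
    (Cmod (f (z + h)%C - f z - A * h) <= 8 * M / (r * r) * (Cmod h * Cmod h))%R.
Proof.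
  intros Hr Hf.
  set (x1 := (Re z - r)%R). set (x2 := (Re z + r)%R). set (y1 := (Im z - r)%R). set (y2 := (Im z + r)%R).
  assert (Hx : (x1 <= x2)%R) by (unfold x1, x2; lra). assert (Hy : (y1 <= y2)%R) by (unfold y1, y2; lra).
  set (P := RtoC (2 * PI) * Ci).
  assert (HPm : Cmod P = (2 * PI)%R).
  { unfold P. rewrite Cmod_mult, Cmod_Ci, Cmod_R, Rabs_pos_eq. ring. pose proof PI_RGT_0; lra. }
  assert (HP : P <> 0). { apply Cmod_gt_0. rewrite HPm. pose proof PI_RGT_0; lra. }
  assert (Hne : forall w, (r <= Cmod (w - z))%R -> forall h, (Cmod h <= r / 2)%R -> w - (z + h) <> 0 /\ (r / 2 <= Cmod (w - (z + h)))%R).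
  { intros w Hw h Hh. assert (r / 2 <= Cmod (w - (z + h)))%R.
    { replace (w - (z + h)) with ((w - z) - h) by ring. pose proof (Cmod_rev_triangle (w - z) h). lra. }
    split; auto. apply Cmod_gt_0. lra. }
  set (A := / P * rect_integral (fun w => f w / ((w - z) * (w - z))) x1 x2 y1 y2).
  exists A. intros h Hh.
  assert (Hzero : (Cmod 0 <= r / 2)%R) by (rewrite Cmod_0; lra).
  assert (Hnz : forall w, (r <= Cmod (w - z))%R -> w - z <> 0).
  { intros w Hw. apply Cmod_gt_0. lra. }
  assert (E1 : rect_integral (fun w => f w / (w - (z + h))) x1 x2 y1 y2 = P * f (z + h)).
  { unfold P. apply rect_cauchy.
    - pose proof (re_le_Cmod h). apply Rabs_le_between in H. unfold x1, x2. 
      change (Re (z + h)) with (Re z + Re h)%R. lra.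
    - pose proof (im_le_Cmod h). apply Rabs_le_between in H. unfold y1, y2. 
      change (Im (z + h)) with (Im z + Im h)%R. lra.
    - intros w Hw. apply (Hf w Hw). }
  assert (E2 : rect_integral (fun w => f w / (w - z)) x1 x2 y1 y2 = P * f z).
  { unfold P. apply rect_cauchy. unfold x1, x2; lra. unfold y1, y2; lra. intros w Hw. apply (Hf w Hw). }
  assert (D1 : on_edges (cdiff (fun w => f w / (w - (z + h)))) x1 x2 y1 y2).
  { apply square_on_edges; auto. intros w Hw Hm. apply cdiff_div. now apply Hne. now apply Hf. cdiff_tac. }
  assert (D2 : on_edges (cdiff (fun w => f w / (w - z))) x1 x2 y1 y2).
  { apply square_on_edges; auto. intros w Hw Hm. apply cdiff_div. now apply Hnz. now apply Hf. cdiff_tac. }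
  assert (D3 : on_edges (cdiff (fun w => f w / ((w - z) * (w - z)))) x1 x2 y1 y2).
  { apply square_on_edges; auto. intros w Hw Hm. apply cdiff_div. apply Cmult_neq_0; now apply Hnz. now apply Hf. cdiff_tac. }
  assert (D3' : on_edges (cdiff (fun w => h * (f w / ((w - z) * (w - z))))) x1 x2 y1 y2).
  { revert D3. apply on_edges_impl. intros w Hw. apply cdiff_mult; auto. apply cdiff_const. }
  assert (D12 : on_edges (cdiff (fun w => f w / (w - (z + h)) - f w / (w - z))) x1 x2 y1 y2).
  { destruct D1 as [D1 D1']. destruct D2 as [D2 D2'].
    split; intros t Ht; split; apply cdiff_minus.
    apply D1; auto. apply D2; auto. apply D1; auto. apply D2; auto.
    apply D1'; auto. apply D2'; auto. apply D1'; auto. apply D2'; auto. }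
  assert (E : f (z + h) - f z - A * h = / P *
    rect_integral (fun w => (f w / (w - (z + h)) - f w / (w - z)) - h * (f w / ((w - z) * (w - z))))%C x1 x2 y1 y2).
  { rewrite rect_minus, rect_minus, rect_scal, E1, E2 by assumption. unfold A. field. auto. }
  rewrite E, Cmod_mult, Cmod_inv, HPm by auto.
  assert (B : (Cmod (rect_integral (fun w => (f w / (w - (z + h)) - f w / (w - z)) - h * (f w / ((w - z) * (w - z))))%C x1 x2 y1 y2)
     <= 2 * ((x2 - x1) + (y2 - y1)) * (M * (Cmod h * Cmod h) * (2 / (r * r * r))))%R).
  { apply rect_bound; auto.
    - destruct D12 as [D1' D1'']. destruct D3' as [D2' D2''].
      split; intros t Ht; split; apply cdiff_minus.
      apply D1'; auto. apply D2'; auto. apply D1'; auto. apply D2'; auto.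
      apply D1''; auto. apply D2''; auto. apply D1''; auto. apply D2''; auto.
    - apply square_on_edges; auto. intros w Hw Hm. destruct (Hne w Hm h Hh) as [N1 N2]. assert (N3 := Hnz w Hm).
      destruct (Hf w Hw) as [_ HM].
      replace (f w / (w - (z + h)) - f w / (w - z) - h * (f w / ((w - z) * (w - z)))) with
        (f w * (h * h) * / ((w - z) * (w - z) * (w - (z + h)))) by (field; auto).
      rewrite !Cmod_mult, Cmod_inv, !Cmod_mult by (repeat apply Cmult_neq_0; auto).
      pose proof (Cmod_ge_0 (f w)). pose proof (Cmod_ge_0 h).
      apply Rmult_le_compat.
      + apply Rmult_le_pos; nra.
      + left. apply Rinv_0_lt_compat. repeat apply Rmult_lt_0_compat; lra.
      + apply Rmult_le_compat_r; nra.
      + replace (2 / (r * r * r))%R with (/ (r * r * (r / 2)))%R by (field; lra).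
        apply Rinv_le_contravar. repeat apply Rmult_lt_0_compat; lra.
        apply Rmult_le_compat; nra. }
  assert (HM0 : (0 <= M)%R).
  { destruct (Hf z ltac:(split; lra)) as [_ HM]. pose proof (Cmod_ge_0 (f z)). lra. }
  (* Replacing [2 pi] by 2 gives the round constant 8, from the perimeter [8 r] and the kernel bound
     [2 / r^3]. *)
  assert (PI2 : (2 < 2 * PI)%R) by (pose proof PI2_1; lra).
  apply Rle_trans with (/ 2 * (2 * (x2 - x1 + (y2 - y1)) * (M * (Cmod h * Cmod h) * (2 / (r * r * r)))))%R.
  - apply Rmult_le_compat; auto. left; apply Rinv_0_lt_compat; lra. apply Cmod_ge_0.
    apply Rinv_le_contravar; lra.
  - right. unfold x1, x2, y1, y2. field. lra.
Qed.

(** All [fn n] have the same quadratic remainder at [z]. Difference quotients with one fixed small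
    step then show that the derivatives [A n] form a Cauchy sequence, and the remainder estimate
    passes to the limit. *)
Lemma cdiff_limit (fn : nat -> C -> C) (f : C -> C) (z : C) (r M : R) : (0 < r)%R ->
  (forall n w, in_rect (Re z - r) (Re z + r) (Im z - r) (Im z + r) w -> cdiff (fn n) w) ->
  (forall n w, in_rect (Re z - r) (Re z + r) (Im z - r) (Im z + r) w -> (Cmod (fn n w) <= M)%R) ->
  (forall w, in_rect (Re z - r) (Re z + r) (Im z - r) (Im z + r) w -> Clim (fun n => fn n w) (f w)) ->
  cdiff f z.
Proof.
  intros Hr Hd Hb Hl.
  assert (Hin : forall h, (Cmod h <= r / 2)%R -> in_rect (Re z - r) (Re z + r) (Im z - r) (Im z + r) (z + h)).
  { intros h Hh. pose proof (re_le_Cmod h) as H1. pose proof (im_le_Cmod h) as H2.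
    apply Rabs_le_between in H1, H2. split.
    change (Re (z + h)) with (Re z + Re h)%R; lra. change (Im (z + h)) with (Im z + Im h)%R; lra. }
  assert (Hz : in_rect (Re z - r) (Re z + r) (Im z - r) (Im z + r) z) by (split; lra).
  set (K := (8 * M / (r * r))%R).
  assert (HM0 : (0 <= M)%R). { specialize (Hb O z Hz). pose proof (Cmod_ge_0 (fn O z)). lra. }
  assert (HK : (0 <= K)%R).
  { apply Rmult_le_pos. lra. left. apply Rinv_0_lt_compat. nra. }
  assert (HA : forall n, exists A : C, forall h, (Cmod h <= r / 2)%R ->
    (Cmod (fn n (z + h)%C - fn n z - A * h) <= K * (Cmod h * Cmod h))%R).
  { intros n. apply cauchy_taylor2; auto. }
  set (A := fun n => epsilon (inhabits (RtoC 0)) (fun A : C => forall h, (Cmod h <= r / 2)%R ->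
    (Cmod (fn n (z + h)%C - fn n z - A * h) <= K * (Cmod h * Cmod h))%R)).
  assert (HA' : forall n h, (Cmod h <= r / 2)%R ->
    (Cmod (fn n (z + h)%C - fn n z - A n * h) <= K * (Cmod h * Cmod h))%R).
  { intros n. unfold A. apply epsilon_spec. apply HA. }
  destruct (Clim_complete A) as [L HL].
  { intros eps He.
    (* The step [t] makes the two remainders at most [eps t / 2] together; [e] below makes the four
       differences from the limit at most [2 eps t / 5]. *)
    set (t := Rmin (r / 2) (eps / (4 * (K + 1)))).
    assert (Ht : (0 < t)%R). { apply Rmin_pos. lra. apply Rdiv_lt_0_compat; lra. }
    assert (Ht1 : (t <= r / 2)%R) by apply Rmin_l.
    assert (Ht2 : (t * (4 * (K + 1)) <= eps)%R).
    { replace eps with (eps / (4 * (K + 1)) * (4 * (K + 1)))%R by (field; lra).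
      apply Rmult_le_compat_r. lra. apply Rmin_r. }
    assert (Hht : Cmod (RtoC t) = t). { rewrite Cmod_R, Rabs_pos_eq; lra. }
    set (e := (eps * t / 10)%R). assert (He' : (0 < e)%R) by (unfold e; nra).
    destruct (Hl (z + RtoC t) (Hin (RtoC t) ltac:(rewrite Hht; exact Ht1)) e He') as [N1 H1].
    destruct (Hl z Hz e He') as [N2 H2].
    exists (N1 + N2)%nat. intros n m Hn Hm.
    assert (a1 := H1 n ltac:(lia)). assert (a2 := H1 m ltac:(lia)).
    assert (b1 := H2 n ltac:(lia)). assert (b2 := H2 m ltac:(lia)).
    assert (c1 := HA' n (RtoC t) ltac:(lra)). assert (c2 := HA' m (RtoC t) ltac:(lra)).
    rewrite Hht in c1, c2.
    set (X := fn n (z + RtoC t)) in *. set (X' := fn m (z + RtoC t)) in *.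
    set (Y := fn n z) in *. set (Y' := fn m z) in *. set (F := f (z + RtoC t)) in *. set (G := f z) in *.
    assert (E : (A n - A m) * RtoC t = (X' - Y' - A m * RtoC t) - (X - Y - A n * RtoC t)
       + ((X - F) - (X' - F) - ((Y - G) - (Y' - G)))) by ring.
    assert (Bd : (Cmod ((A n - A m) * RtoC t) <= 2 * (K * (t * t)) + 4 * e)%R).
    { rewrite E. eapply Rle_trans. apply Cmod_triangle.
      pose proof (Cmod_le_sum (X' - Y' - A m * RtoC t) (X - Y - A n * RtoC t)).
      pose proof (Cmod_le_sum (X - F - (X' - F)) (Y - G - (Y' - G))).
      pose proof (Cmod_le_sum (X - F) (X' - F)). pose proof (Cmod_le_sum (Y - G) (Y' - G)). lra. }
    rewrite Cmod_mult, Hht in Bd. apply Rmult_lt_reg_r with t; auto.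
    eapply Rle_lt_trans. exact Bd. unfold e. 
    assert (K * (t * t) <= eps / 4 * t)%R by nra. nra. }
  exists L. intros eps He.
  exists (Rmin (r / 2) (eps / (K + 1))). split.
  { apply Rmin_pos. lra. apply Rdiv_lt_0_compat; lra. }
  intros w Hw. set (h := w - z) in *.
  assert (Hh1 := Rlt_le_trans _ _ _ Hw (Rmin_l _ _)).
  assert (Hh2 := Rlt_le_trans _ _ _ Hw (Rmin_r _ _)).
  replace w with (z + h) by (unfold h; ring).
  assert (Lim : Clim (fun n => fn n (z + h) - fn n z - A n * h) (f (z + h) - f z - L * h)).
  { apply Clim_minus. apply Clim_minus. apply Hl, Hin; lra. apply Hl, Hz.
    apply (Clim_ext (fun n => h * A n)). intros; ring. rewrite (Cmult_comm L). now apply Clim_scal. }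
  eapply Rle_trans. apply (Clim_bound _ _ (K * (Cmod h * Cmod h))%R Lim). intros n. apply HA'. lra.
  pose proof (Cmod_ge_0 h).
  assert (Cmod h * (K + 1) <= eps)%R.
  { apply Rmult_lt_compat_r with (r := (K + 1)%R) in Hh2; [|lra].
    replace (eps / (K + 1) * (K + 1))%R with eps in Hh2 by (field; lra). lra. }
  nra.
Qed.

(** * Integrals over the real line *)

(** Both ends tend to infinity independently, as [is_RInt_gen] over two filters demands; this is not
    a principal value. *)
Definition is_line (f : R -> C) (l : C) : Prop :=
  forall eps, (0 < eps)%R -> exists M, forall a b, (a <= - M)%R -> (M <= b)%R ->
    (Cmod (CInt f a b - l) <= eps)%R.

(* Carries no meaning when the improper integral diverges. *)
Definition LInt (f : R -> C) : C := epsilon (inhabits (RtoC 0)) (is_line f).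

(** The majorant has the primitive [K atan t]; its integral over the line is [K pi], rounded up to
    [4 K] in [LInt_bound]. *)
Definition dominated (f : R -> C) (K : R) : Prop :=
  (forall t, ccont f t) /\ (forall t, (Cmod (f t) <= K / (1 + t * t))%R).

Lemma is_line_unique (f : R -> C) (l m : C) : is_line f l -> is_line f m -> l = m.
Proof.
  intros Hl Hm. apply (Clim_unique (fun n => CInt f (- INR n) (INR n))).
  - intros e He. destruct (Hl (e / 2)%R ltac:(lra)) as [M HM].
    destruct (INR_unbounded M) as [N HN]. exists N. intros n Hn. apply le_INR in Hn.
    eapply Rle_lt_trans. apply HM; lra. lra.
  - intros e He. destruct (Hm (e / 2)%R ltac:(lra)) as [M HM].
    destruct (INR_unbounded M) as [N HN]. exists N. intros n Hn. apply le_INR in Hn.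
    eapply Rle_lt_trans. apply HM; lra. lra.
Qed.

Lemma LInt_unique (f : R -> C) (l : C) : is_line f l -> LInt f = l.
Proof.
  intros H. apply (is_line_unique f); auto. unfold LInt. apply epsilon_spec. now exists l.
Qed.

Lemma RInt_inv_quad (K a b : R) : (a <= b)%R ->
  is_RInt (fun t => K / (1 + t * t))%R a b (K * (atan b - atan a))%R.
Proof.
  intros Hab. replace (K * (atan b - atan a))%R with (minus (K * atan b) (K * atan a))%R.
  2: { unfold minus, plus, opp; simpl. ring. }
  apply (is_RInt_derive (V := R_CompleteNormedModule) (fun t => K * atan t)%R).
  - intros t _. apply is_derive_Reals.
    match goal with |- derivable_pt_lim _ _ ?x => replace x with (K * / (1 + t ^ 2))%R end.
    apply derivable_pt_lim_scal, derivable_pt_lim_atan. simpl. field. nra.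
  - intros t _. apply (ex_derive_continuous (K := R_AbsRing) (V := R_NormedModule)). auto_derive. nra.
Qed.

Lemma dominated_CInt (f : R -> C) (K a b : R) : dominated f K -> (a <= b)%R ->
  (Cmod (CInt f a b) <= K * (atan b - atan a))%R.
Proof.
  intros [Hc Hb] Hab.
  rewrite <- (is_RInt_unique (V := R_CompleteNormedModule) _ _ _ _ (RInt_inv_quad K a b Hab)).
  apply CInt_le; auto. now apply cintble_cont'. eexists. now apply RInt_inv_quad.
Qed.

Lemma dominated_K_pos (f : R -> C) (K : R) : dominated f K -> (0 <= K)%R.
Proof.
  intros [_ Hb]. specialize (Hb 0%R). pose proof (Cmod_ge_0 (f 0%R)).
  replace (K / (1 + 0 * 0))%R with K in Hb by field. lra.
Qed.

Lemma atan_lt_PI2 (b : R) : (- (PI / 2) < atan b < PI / 2)%R.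
Proof. pose proof (atan_bound b). lra. Qed.

Lemma atan_le (a b : R) : (a <= b)%R -> (atan a <= atan b)%R.
Proof. intros [H|H]. left. now apply atan_increasing. rewrite H; lra. Qed.

Lemma atan_tail (eps : R) : (0 < eps)%R -> exists M, (0 < M)%R /\ forall b, (M <= b)%R -> (PI / 2 - atan b <= eps)%R.
Proof.
  intros He. pose proof PI_RGT_0. set (e := Rmin eps (PI / 4)).
  assert (0 < e)%R by (apply Rmin_pos; lra). assert (e <= eps)%R by apply Rmin_l.
  assert (e <= PI / 4)%R by apply Rmin_r.
  exists (tan (PI / 2 - e)). split. apply tan_gt_0; lra.
  intros b Hb. apply atan_le in Hb. rewrite atan_tan in Hb; lra.
Qed.

Lemma dominated_tail (f : R -> C) (K eps : R) : dominated f K -> (0 < eps)%R ->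
  exists M, (0 < M)%R /\ forall a b a' b', (a <= - M)%R -> (M <= b)%R -> (a' <= - M)%R -> (M <= b')%R ->
    (Cmod (CInt f a b - CInt f a' b') <= eps)%R.
Proof.
  intros Hd He. assert (HK := dominated_K_pos f K Hd).
  destruct (atan_tail (eps / (4 * (K + 1)))) as [M [HM0 HM]]. apply Rdiv_lt_0_compat; lra.
  exists M. split; auto.
  set (e := (eps / (4 * (K + 1)))%R) in *.
  assert (Ee : (e * (4 * (K + 1)) = eps)%R) by (unfold e; field; lra).
  assert (He' : (0 < e)%R) by (apply Rdiv_lt_0_compat; lra).
  assert (HI : forall a b, cintble f a b) by (intros; apply cintble_cont'; apply Hd).
  assert (Half : forall a b, (a <= - M)%R -> (M <= b)%R -> (Cmod (CInt f a b - CInt f (- M) M) <= 2 * (K * e))%R).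
  { intros a b Ha Hb.
    assert (CInt f a b - CInt f (- M) M = CInt f a (- M) + CInt f M b).
    { rewrite <- (CInt_Chasles f a (- M) b), <- (CInt_Chasles f (- M) M b) by auto. ring. }
    rewrite H. eapply Rle_trans. apply Cmod_triangle.
    pose proof (dominated_CInt f K a (- M) Hd Ha). pose proof (dominated_CInt f K M b Hd Hb).
    pose proof (HM M ltac:(lra)). pose proof (HM (- a)%R ltac:(lra)) as H3.
    rewrite atan_opp in *. pose proof (atan_lt_PI2 a). pose proof (atan_lt_PI2 b).
    assert (K * (- atan M - atan a) <= K * e)%R by (apply Rmult_le_compat_l; lra).
    assert (K * (atan b - atan M) <= K * e)%R by (apply Rmult_le_compat_l; lra). lra. }
  intros a b a' b' H1 H2 H3 H4.
  replace (CInt f a b - CInt f a' b') with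
    ((CInt f a b - CInt f (- M) M) - (CInt f a' b' - CInt f (- M) M)) by ring.
  eapply Rle_trans. apply Cmod_le_sum. pose proof (Half a b H1 H2). pose proof (Half a' b' H3 H4). nra.
Qed.

Lemma dominated_line (f : R -> C) (K : R) : dominated f K -> exists l, is_line f l.
Proof.
  intros Hd. destruct (Clim_complete (fun n => CInt f (- INR n) (INR n))) as [l Hl].
  { intros eps He. destruct (dominated_tail f K (eps / 2) Hd) as [M [HM0 HM]]. lra.
    destruct (INR_unbounded M) as [N HN]. exists N. intros n m Hn Hm. apply le_INR in Hn, Hm.
    eapply Rle_lt_trans. apply HM; lra. lra. }
  exists l. intros eps He.
  destruct (dominated_tail f K (eps / 2) Hd) as [M [HM0 HM]]. lra.
  destruct (Hl (eps / 2)%R ltac:(lra)) as [N1 H1]. destruct (INR_unbounded M) as [N2 H2].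
  exists M. intros a b Ha Hb.
  specialize (H1 (N1 + N2)%nat ltac:(lia)). set (n := (N1 + N2)%nat) in *.
  assert (INR N2 <= INR n)%R by (apply le_INR; unfold n; lia).
  specialize (HM a b (- INR n)%R (INR n) Ha Hb ltac:(lra) ltac:(lra)).
  replace (CInt f a b - l) with ((CInt f a b - CInt f (- INR n) (INR n)) + (CInt f (- INR n) (INR n) - l)) by ring.
  eapply Rle_trans. apply Cmod_triangle. lra.
Qed.

Lemma LInt_correct (f : R -> C) (K : R) : dominated f K -> is_line f (LInt f).
Proof. intros H. unfold LInt. apply epsilon_spec. now apply (dominated_line f K). Qed.

Lemma is_line_seq (f : R -> C) (l : C) : is_line f l -> Clim (fun n => CInt f (- INR n) (INR n)) l.
Proof.
  intros H e He. destruct (H (e / 2)%R ltac:(lra)) as [M HM].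
  destruct (INR_unbounded M) as [N HN]. exists N. intros n Hn. apply le_INR in Hn.
  eapply Rle_lt_trans. apply HM; lra. lra.
Qed.

Lemma LInt_bound (f : R -> C) (K : R) : dominated f K -> (Cmod (LInt f) <= 4 * K)%R.
Proof.
  intros Hd. apply (Clim_bound _ _ _ (is_line_seq f _ (LInt_correct f K Hd))).
  intros n. pose proof (pos_INR n). eapply Rle_trans. apply (dominated_CInt f K); auto. lra.
  pose proof (dominated_K_pos f K Hd). pose proof PI_4.
  pose proof (atan_lt_PI2 (INR n)). pose proof (atan_lt_PI2 (- INR n)).
  rewrite (Rmult_comm 4). apply Rmult_le_compat_l; lra.
Qed.

Lemma is_line_plus (f h : R -> C) (l m : C) : (forall t, ccont f t) -> (forall t, ccont h t) ->
  is_line f l -> is_line h m -> is_line (fun t => f t + h t) (l + m).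
Proof.
  intros Cf Ch Hf Hh eps He.
  destruct (Hf (eps / 2)%R ltac:(lra)) as [M1 H1]. destruct (Hh (eps / 2)%R ltac:(lra)) as [M2 H2].
  exists (Rmax M1 M2). intros a b Ha Hb. pose proof (Rmax_l M1 M2). pose proof (Rmax_r M1 M2).
  rewrite CInt_plus by (apply cintble_cont'; auto).
  replace (CInt f a b + CInt h a b - (l + m)) with ((CInt f a b - l) + (CInt h a b - m)) by ring.
  eapply Rle_trans. apply Cmod_triangle.
  specialize (H1 a b ltac:(lra) ltac:(lra)). specialize (H2 a b ltac:(lra) ltac:(lra)). lra.
Qed.

Lemma is_line_scal (f : R -> C) (l c : C) : (forall t, ccont f t) ->
  is_line f l -> is_line (fun t => c * f t) (c * l).
Proof.
  intros Cf Hf eps He. pose proof (Cmod_ge_0 c).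
  destruct (Hf (eps / (Cmod c + 1))%R) as [M HM]. apply Rdiv_lt_0_compat; lra.
  exists M. intros a b Ha Hb. specialize (HM a b Ha Hb).
  rewrite CInt_scal by (apply cintble_cont'; auto).
  replace (c * CInt f a b - c * l) with (c * (CInt f a b - l)) by ring. rewrite Cmod_mult.
  apply Rmult_le_compat_l with (r := (Cmod c + 1)%R) in HM; [|lra].
  replace ((Cmod c + 1) * (eps / (Cmod c + 1)))%R with eps in HM by (field; lra).
  pose proof (Cmod_ge_0 (CInt f a b - l)). nra.
Qed.

Lemma is_line_ext (f h : R -> C) (l : C) : (forall t, f t = h t) -> is_line f l -> is_line h l.
Proof.
  intros E Hf eps He. destruct (Hf eps He) as [M HM]. exists M. intros a b Ha Hb.
  rewrite <- (CInt_ext f h); auto.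
Qed.

Lemma LInt_ext (f h : R -> C) : (forall t, f t = h t) -> LInt f = LInt h.
Proof.
  intros E. f_equal. now apply FunctionalExtensionality.functional_extensionality.
Qed.

Lemma is_line_shift (f : R -> C) (l : C) (v : R) : (forall t, ccont f t) ->
  is_line f l -> is_line (fun t => f (t + v)%R) l.
Proof.
  intros Cf Hf eps He. destruct (Hf eps He) as [M HM]. exists (M + Rabs v)%R. intros a b Ha Hb.
  rewrite CInt_shift by (apply cintble_cont'; auto).
  pose proof (Rle_abs v). pose proof (Rabs_maj2 v). apply HM; lra.
Qed.

Lemma is_line_reflect (f : R -> C) (l : C) : (forall t, ccont f t) ->
  is_line f l -> is_line (fun t => f (- t)%R) l.
Proof.
  intros Cf Hf eps He. destruct (Hf eps He) as [M HM]. exists M. intros a b Ha Hb.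
  rewrite CInt_reflect by (apply cintble_cont'; auto). apply HM; lra.
Qed.

Lemma dominated_plus (f h : R -> C) (K L : R) : dominated f K -> dominated h L -> dominated (fun t => f t + h t) (K + L).
Proof.
  intros [Cf Bf] [Ch Bh]. split. intros t. apply ccont_plus; auto.
  intros t. eapply Rle_trans. apply Cmod_triangle. specialize (Bf t). specialize (Bh t).
  unfold Rdiv in *. lra.
Qed.

Lemma dominated_scal (f : R -> C) (K : R) (c : C) : dominated f K -> dominated (fun t => c * f t) (Cmod c * K).
Proof.
  intros [Cf Bf]. split. intros t. apply ccont_mult; auto. apply ccont_const.
  intros t. rewrite Cmod_mult. unfold Rdiv. rewrite Rmult_assoc. apply Rmult_le_compat_l.
  apply Cmod_ge_0. apply Bf.
Qed.

Lemma LInt_plus (f h : R -> C) (K L : R) : dominated f K -> dominated h L ->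
  LInt (fun t => f t + h t) = LInt f + LInt h.
Proof.
  intros Hf Hh. apply LInt_unique. apply is_line_plus; try apply Hf; try apply Hh.
  now apply (LInt_correct f K). now apply (LInt_correct h L).
Qed.

Lemma LInt_scal (f : R -> C) (K : R) (c : C) : dominated f K -> LInt (fun t => c * f t) = c * LInt f.
Proof.
  intros Hf. apply LInt_unique. apply is_line_scal; try apply Hf. now apply (LInt_correct f K).
Qed.

(** * Finite sums, summable majorants and termwise integration *)

(** The index [n] is excluded, whereas [sum_n] includes it; hence the shift in [csum_sum_n]. *)
Fixpoint csum (f : nat -> C) (n : nat) : C :=
  match n with O => 0 | S m => csum f m + f m end.
Fixpoint rsum (f : nat -> R) (n : nat) : R :=
  match n with O => 0%R | S m => (rsum f m + f m)%R end.

Lemma csum_ext (f h : nat -> C) (n : nat) : (forall k, (k < n)%nat -> f k = h k) -> csum f n = csum h n.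
Proof. induction n; intros H; simpl; auto. rewrite IHn, H; auto. Qed.

Lemma csum_plus (f h : nat -> C) (n : nat) : csum (fun k => f k + h k) n = csum f n + csum h n.
Proof. induction n; simpl. ring. rewrite IHn. ring. Qed.

Lemma csum_scal (f : nat -> C) (c : C) (n : nat) : csum (fun k => c * f k) n = c * csum f n.
Proof. induction n; simpl. ring. rewrite IHn. ring. Qed.

Lemma csum_le (f : nat -> C) (a : nat -> R) (N M : nat) : (forall n, (Cmod (f n) <= a n)%R) ->
  (N <= M)%nat -> (Cmod (csum f M - csum f N) <= rsum a M - rsum a N)%R.
Proof.
  intros H HNM. induction HNM.
  - replace (csum f N - csum f N) with (RtoC 0) by ring. rewrite Cmod_0. lra.
  - simpl. replace (csum f m + f m - csum f N) with ((csum f m - csum f N) + f m) by ring.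
    pose proof (Cmod_triangle (csum f m - csum f N) (f m)). specialize (H m). lra.
Qed.

Lemma csum_sum_n (f : nat -> C) (n : nat) :
  sum_n (G := C_AbelianMonoid) f n = csum f (S n).
Proof.
  induction n. rewrite sum_O. simpl. match goal with |- @eq _ ?x ?y => change (@eq C x y) end. ring.
  rewrite sum_Sn, IHn. simpl. reflexivity.
Qed.

Lemma rsum_incr (a : nat -> R) (N M : nat) : (forall n, (0 <= a n)%R) -> (N <= M)%nat -> (rsum a N <= rsum a M)%R.
Proof. intros H. induction 1. lra. simpl. specialize (H m). lra. Qed.

Definition summable (a : nat -> R) : Prop :=
  (forall n, (0 <= a n)%R) /\ exists B, forall n, (rsum a n <= B)%R.

Lemma summable_tail (a : nat -> R) : summable a -> forall eps, (0 < eps)%R ->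
  exists N, forall n m, (N <= n)%nat -> (n <= m)%nat -> (rsum a m - rsum a n <= eps)%R.
Proof.
  intros [Ha [B HB]] eps He.
  destruct (completeness (fun x => exists n, x = rsum a n)) as [l [L1 L2]].
  { exists B. intros x [n ->]. auto. } { exists 0%R. now exists O. }
  assert (exists N, (l - eps < rsum a N)%R) as [N HN].
  { apply NNPP. intros H. assert (l <= l - eps)%R; [|lra]. apply L2. intros x [n ->].
    apply Rnot_lt_le. intros H'. apply H. now exists n. }
  exists N. intros n m Hn Hm. 
  assert (rsum a m <= l)%R by (apply L1; now exists m). pose proof (rsum_incr a N n Ha Hn). lra.
Qed.

Lemma csum_converges (f : nat -> C) (a : nat -> R) : summable a -> (forall n, (Cmod (f n) <= a n)%R) ->
  exists l, Clim (csum f) l.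
Proof.
  intros Hs H. apply Clim_complete. intros eps He.
  destruct (summable_tail a Hs (eps / 2)%R) as [N HN]. lra. exists N. intros n m Hn Hm.
  destruct (Nat.le_ge_cases n m) as [Hnm|Hnm].
  - rewrite Cmod_sub_sym. pose proof (csum_le f a n m H Hnm). pose proof (HN n m Hn Hnm). lra.
  - pose proof (csum_le f a m n H Hnm). pose proof (HN m n Hm Hnm). lra.
Qed.

Lemma csum_tail (f : nat -> C) (a : nat -> R) (l : C) (N : nat) (e : R) : Clim (csum f) l ->
  (forall n, (Cmod (f n) <= a n)%R) ->
  (forall m, (N <= m)%nat -> (rsum a m - rsum a N <= e)%R) -> (Cmod (l - csum f N) <= e)%R.
Proof.
  intros Hl H HN. apply le_epsilon. intros d Hd. destruct (Hl d Hd) as [M HM].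
  specialize (HM (M + N)%nat ltac:(lia)).
  pose proof (csum_le f a N (M + N) H ltac:(lia)). specialize (HN (M + N)%nat ltac:(lia)).
  replace (l - csum f N) with ((csum f (M + N) - csum f N) - (csum f (M + N) - l)) by ring.
  eapply Rle_trans. apply Cmod_le_sum. lra.
Qed.

Lemma csum_bound (f : nat -> C) (a : nat -> R) (n : nat) : (forall n, (Cmod (f n) <= a n)%R) ->
  (Cmod (csum f n) <= rsum a n)%R.
Proof.
  intros H. pose proof (csum_le f a 0 n H ltac:(lia)). simpl in H0.
  replace (csum f n - 0) with (csum f n) in H0 by ring. lra.
Qed.

Lemma rsum_scal_r (a : nat -> R) (c : R) (n : nat) : rsum (fun k => a k * c)%R n = (rsum a n * c)%R.
Proof. induction n; simpl. ring. rewrite IHn. ring. Qed.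

Lemma dominated_csum (T : nat -> R -> C) (a : nat -> R) (n : nat) : (forall n, dominated (T n) (a n)) ->
  dominated (fun t => csum (fun k => T k t) n) (rsum a n).
Proof.
  intros H. induction n; simpl.
  - split. intros. apply ccont_const. intros. rewrite Cmod_0. unfold Rdiv. rewrite Rmult_0_l. lra.
  - apply (dominated_plus (fun t => csum (fun k => T k t) n) (T n)); auto.
Qed.

Lemma LInt_csum (T : nat -> R -> C) (a : nat -> R) (n : nat) : (forall n, dominated (T n) (a n)) ->
  LInt (fun t => csum (fun k => T k t) n) = csum (fun k => LInt (T k)) n.
Proof.
  intros H. induction n; simpl.
  - apply LInt_unique. intros eps He. exists 0%R. intros a' b _ _.
    rewrite CInt_const, Cmult_0_r. replace (0 - 0) with (RtoC 0) by ring. rewrite Cmod_0. lra.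
  - rewrite (LInt_plus (fun t => csum (fun k => T k t) n) (T n) (rsum a n) (a n)); auto.
    now rewrite IHn. now apply dominated_csum.
Qed.

(** The factor [1 / (1 + t^2)] is common to all majorants, so the tails of the series are at most
    [eps / (1 + t^2)] for all [t] at once. This gives the continuity of [S] and bounds the integral
    of the tail by [4 eps]. *)
Lemma LInt_series (T : nat -> R -> C) (S : R -> C) (a : nat -> R) : summable a ->
  (forall n, dominated (T n) (a n)) -> (forall t, Clim (csum (fun n => T n t)) (S t)) ->
  (exists K, dominated S K) /\ Clim (csum (fun n => LInt (T n))) (LInt S).
Proof.
  intros Hs HT HS.
  assert (Hb : forall n t, (Cmod (T n t) <= a n * / (1 + t * t))%R) by (intros n t; apply (HT n)).
  assert (Tail : forall eps, (0 < eps)%R -> exists N, forall n, (N <= n)%nat -> forall t,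
     (Cmod (S t - csum (fun k => T k t) n) <= eps / (1 + t * t))%R).
  { intros eps He. destruct (summable_tail a Hs eps He) as [N HN]. exists N. intros n Hn t.
    apply (csum_tail _ _ _ n _ (HS t) (fun k => Hb k t)).
    intros m Hm. rewrite !rsum_scal_r. specialize (HN n m Hn Hm).
    assert (0 < / (1 + t * t))%R by (apply Rinv_0_lt_compat; nra). unfold Rdiv. nra. }
  assert (Cont : forall t, ccont S t).
  { intros t eps He. destruct (Tail (eps / 3)%R ltac:(lra)) as [N HN]. specialize (HN N (le_n N)).
    destruct (dominated_csum T a N HT) as [Cs _]. destruct (Cs t (eps / 3)%R ltac:(lra)) as [d [Hd Hc]].
    assert (Hq : forall u, (Cmod (S u - csum (fun k => T k u) N) <= eps / 3)%R).
    { intros u. eapply Rle_trans. apply HN. unfold Rdiv at 1.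
      assert (/ (1 + u * u) <= 1)%R. { rewrite <- Rinv_1. apply Rinv_le_contravar; nra. } nra. }
    exists d. split; auto. intros u Hu. specialize (Hc u Hu).
    replace (S u - S t) with ((S u - csum (fun k => T k u) N) - (S t - csum (fun k => T k t) N)
      + (csum (fun k => T k u) N - csum (fun k => T k t) N)) by ring.
    eapply Rle_lt_trans. apply Cmod_triangle.
    pose proof (Cmod_le_sum (S u - csum (fun k => T k u) N) (S t - csum (fun k => T k t) N)).
    pose proof (Hq u). pose proof (Hq t). lra. }
  destruct Hs as [Ha [B HB]].
  assert (DS : dominated S B).
  { split; auto. intros t. apply (Clim_bound _ _ _ (HS t)). intros n.
    eapply Rle_trans. apply (csum_bound _ _ _ (fun k => Hb k t)). rewrite rsum_scal_r.
    assert (0 < / (1 + t * t))%R by (apply Rinv_0_lt_compat; nra). unfold Rdiv.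
    specialize (HB n). nra. }
  split. now exists B.
  intros eps He. destruct (Tail (eps / 8)%R ltac:(lra)) as [N HN]. exists N. intros n Hn.
  rewrite <- (LInt_csum T a n HT).
  set (Pn := fun t => csum (fun k => T k t) n).
  assert (DP : dominated Pn (rsum a n)) by (apply dominated_csum; auto).
  assert (E : LInt S = LInt (fun t => S t - Pn t) + LInt Pn).
  { rewrite <- (LInt_plus _ _ (eps / 8) (rsum a n)); auto.
    - apply LInt_ext. intros t. ring.
    - split. intros t. apply ccont_minus; auto. apply DP. intros t. now apply HN. }
  rewrite E. replace (LInt Pn - (LInt (fun t => S t - Pn t) + LInt Pn)) with (- LInt (fun t => S t - Pn t)) by ring.
  rewrite Cmod_opp. eapply Rle_lt_trans. apply (LInt_bound _ (eps / 8)).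
  - split. intros t. apply ccont_minus; auto. apply DP. intros t. now apply HN.
  - lra.
Qed.

(** * Contour integrals over vertical strips *)

Definition strip_small (f : C -> C) (s1 s2 : R) : Prop :=
  forall eps, (0 < eps)%R -> exists M, forall x y, (s1 <= x <= s2)%R -> (M <= Rabs y)%R ->
    (Cmod (f (x, y)) <= eps)%R.

(** The residue theorem on rectangles of growing height. The lines are parametrised by the height,
    without the factor [i] of [ds], so [2 pi i] becomes [2 pi]. *)
Lemma strip_residue (f : C -> C) (s1 s2 : R) (z0 a l1 l2 : C) : (s1 < Re z0 < s2)%R ->
  (forall z, (s1 <= Re z <= s2)%R -> z <> z0 -> cdiff f z) ->
  punctured_limit (fun w => (w - z0) * f w) z0 a -> strip_small f s1 s2 ->
  is_line (fun t => f (s1, t)) l1 -> is_line (fun t => f (s2, t)) l2 ->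
  l2 - l1 = RtoC (2 * PI) * a.
Proof.
  intros Hs Hd Hl Hsm H1 H2.
  assert (Z : Ci * (l2 - l1) - RtoC (2 * PI) * Ci * a = 0).
  { apply Cmod_eq_0. apply Rle_antisym; [|apply Cmod_ge_0]. apply le_epsilon. intros eps He.
    set (W := (s2 - s1)%R). assert (HW : (0 < W)%R) by (unfold W; lra).
    destruct (Hsm (eps / (4 * W))%R) as [M0 H0]. { apply Rdiv_lt_0_compat; lra. }
    destruct (H1 (eps / 4)%R ltac:(lra)) as [M1 HM1]. destruct (H2 (eps / 4)%R ltac:(lra)) as [M2 HM2].
    (* Beyond all three thresholds, and high enough for [z0] to lie inside. *)
    set (T := (Rabs M0 + Rabs M1 + Rabs M2 + Rabs (Im z0) + 1)%R).
    pose proof (Rle_abs M0). pose proof (Rle_abs M1). pose proof (Rle_abs M2).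
    pose proof (Rle_abs (Im z0)). pose proof (Rabs_maj2 (Im z0)).
    pose proof (Rabs_pos M0). pose proof (Rabs_pos M1). pose proof (Rabs_pos M2). pose proof (Rabs_pos (Im z0)).
    assert (HT : (0 < T)%R) by (unfold T; lra).
    specialize (HM1 (- T)%R T ltac:(unfold T; lra) ltac:(unfold T; lra)).
    specialize (HM2 (- T)%R T ltac:(unfold T; lra) ltac:(unfold T; lra)).
    assert (E := rect_residue f s1 s2 (- T) T z0 a Hs ltac:(unfold T; lra)).
    rewrite <- E; auto.
    2: { intros z [Z1 _]. auto. }
    assert (Hor : forall y, Rabs y = T -> (Cmod (CInt (fun x => f (x, y)) s1 s2) <= eps / 4)%R).
    { intros y Hy. replace (eps / 4)%R with ((s2 - s1) * (eps / (4 * W)))%R by (unfold W; field; lra).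
      apply CInt_bound. lra.
      - apply (cintble_hline f). lra. intros x Hx. apply Hd; auto. apply Cneq_by_im. simpl. intros Ey.
        rewrite Ey in Hy. unfold T in Hy. lra.
      - intros x Hx. apply H0; auto. rewrite Hy. unfold T; lra. }
    unfold rect_integral.
    replace (Ci * (l2 - l1) - (CInt (fun x => f (x, (- T)%R)) s1 s2 - CInt (fun x => f (x, T)) s1 s2
       + Ci * (CInt (fun y => f (s2, y)) (- T) T - CInt (fun y => f (s1, y)) (- T) T))) with
      ((CInt (fun x => f (x, T)) s1 s2 - CInt (fun x => f (x, (- T)%R)) s1 s2)
       + Ci * ((CInt (fun y => f (s1, y)) (- T) T - l1) - (CInt (fun y => f (s2, y)) (- T) T - l2))) by ring.
    eapply Rle_trans. apply Cmod_triangle. rewrite Cmod_mult, Cmod_Ci, Rmult_1_l.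
    eapply Rle_trans. apply Rplus_le_compat; apply Cmod_le_sum.
    pose proof (Hor T ltac:(apply Rabs_pos_eq; lra)).
    pose proof (Hor (- T)%R ltac:(rewrite Rabs_Ropp; apply Rabs_pos_eq; lra)). lra. }
  assert (HCi : Ci <> 0). { intros E. apply (f_equal Im) in E. simpl in E. lra. }
  replace (l2 - l1) with (/ Ci * (Ci * (l2 - l1) - RtoC (2 * PI) * Ci * a) + RtoC (2 * PI) * a) by (field; auto).
  rewrite Z. ring.
Qed.

(** The case of residue 0, at an arbitrarily chosen point of the strip. *)
Lemma strip_shift (f : C -> C) (s1 s2 : R) (l1 l2 : C) : (s1 < s2)%R ->
  (forall z, (s1 <= Re z <= s2)%R -> cdiff f z) -> strip_small f s1 s2 ->
  is_line (fun t => f (s1, t)) l1 -> is_line (fun t => f (s2, t)) l2 -> l1 = l2.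
Proof.
  intros Hs Hd Hsm H1 H2. set (z0 := (((s1 + s2) / 2)%R, 0%R) : C).
  assert (E : l2 - l1 = RtoC (2 * PI) * 0).
  { apply (strip_residue f s1 s2 z0); auto. simpl; lra.
    replace (RtoC 0) with ((z0 - z0) * f z0) by ring.
    apply (cdiff_punctured (fun w => (w - z0) * f w)).
    apply cdiff_mult. cdiff_tac. apply Hd. simpl; lra. }
  replace l1 with (l2 - (l2 - l1)) by ring. rewrite E. ring.
Qed.

(** * Euler's integral and Gamma *)

Lemma ccont_exp_kernel (c : R -> C) (lam : R -> R) (z : C) (t : R) :
  ccont c t -> continuous lam t -> ccont (fun t => c t * Cexp (z * RtoC (lam t))) t.
Proof.
  intros Hc Hl. apply ccont_mult; auto.
  apply (ccont_comp_holo (fun w => Cexp (z * w)) (fun t => RtoC (lam t))). cdiff_tac.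
  now apply ccont_RtoC.
Qed.

(** The quadratic remainder of [Cexp] is integrated over a compact interval. The exponent [lam] is
    general because of two kernels: [lam u = u] in Laplace integrals and [lam u = - ln (n + 1 + u)]
    in the continuation of zeta. *)
Lemma CInt_exp_cdiff (c : R -> C) (lam : R -> R) (a b : R) (z : C) : (a <= b)%R ->
  (forall t, (a <= t <= b)%R -> ccont c t) -> (forall t, (a <= t <= b)%R -> continuous lam t) ->
  cdiff (fun z => CInt (fun t => c t * Cexp (z * RtoC (lam t))) a b) z.
Proof.
  intros Hab Hc Hl.
  assert (Hi : forall z, cintble (fun t => c t * Cexp (z * RtoC (lam t))) a b).
  { intros w. apply cintble_cont. rewrite Rmin_left, Rmax_right by auto.
    intros. apply ccont_exp_kernel; auto. }
  assert (Hi2 : cintble (fun t => c t * RtoC (lam t) * Cexp (z * RtoC (lam t))) a b).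
  { apply cintble_cont. rewrite Rmin_left, Rmax_right by auto. intros t Ht.
    apply (ccont_exp_kernel (fun t => c t * RtoC (lam t))); auto. apply ccont_mult; auto.
    apply ccont_RtoC; auto. }
  destruct (ccont_bounded (fun t => c t * Cexp (z * RtoC (lam t))) a b Hab) as [M HM].
  { intros. apply ccont_exp_kernel; auto. }
  destruct (ccont_bounded (fun t => RtoC (lam t)) a b Hab) as [L HL].
  { intros. apply ccont_RtoC; auto. }
  assert (HM0 : (0 <= M)%R).
  { pose proof (HM a ltac:(lra)). pose proof (Cmod_ge_0 (c a * Cexp (z * RtoC (lam a)))). lra. }
  assert (HL0 : (0 <= L)%R).
  { pose proof (HL a ltac:(lra)). pose proof (Cmod_ge_0 (RtoC (lam a))). lra. }
  set (Q := ((b - a) * (M * (4 * (L * L) * exp L)))%R).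
  assert (HQ : (0 <= Q)%R).
  { unfold Q. pose proof (exp_pos L). repeat apply Rmult_le_pos; try lra. }
  exists (CInt (fun t => c t * RtoC (lam t) * Cexp (z * RtoC (lam t))) a b).
  intros eps He. exists (Rmin 1 (eps / (Q + 1))). split.
  { apply Rmin_pos. lra. apply Rdiv_lt_0_compat; lra. }
  intros w Hw. set (h := w - z) in *.
  assert (Hh1 := Rlt_le_trans _ _ _ Hw (Rmin_l _ _)).
  assert (Hh2 := Rlt_le_trans _ _ _ Hw (Rmin_r _ _)).
  pose proof (Cmod_ge_0 h) as Hh0.
  rewrite (Cmult_comm _ h), <- CInt_scal by auto.
  rewrite <- CInt_minus by auto. rewrite <- CInt_minus.
  2: { apply cintble_minus; auto. } 2: { now apply cintble_scal. }
  apply Rle_trans with ((b - a) * (M * (4 * (L * L) * exp L) * (Cmod h * Cmod h)))%R.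
  - apply CInt_bound; auto.
    { apply cintble_minus. apply cintble_minus; auto. now apply cintble_scal. }
    intros t Ht.
    replace (c t * Cexp (w * RtoC (lam t)) - c t * Cexp (z * RtoC (lam t)) -
        h * (c t * RtoC (lam t) * Cexp (z * RtoC (lam t)))) with
      (c t * Cexp (z * RtoC (lam t)) * (Cexp (h * RtoC (lam t)) - 1 - h * RtoC (lam t))).
    2: { replace w with (z + h) by (unfold h; ring).
      replace ((z + h) * RtoC (lam t)) with (z * RtoC (lam t) + h * RtoC (lam t)) by ring.
      rewrite Cexp_plus. ring. }
    rewrite Cmod_mult. rewrite Rmult_assoc. apply Rmult_le_compat; try apply Cmod_ge_0; auto.
    eapply Rle_trans. apply Cexp_taylor1. rewrite Cmod_mult.
    specialize (HL t Ht). set (l := Cmod (RtoC (lam t))) in *.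
    assert (0 <= l)%R by apply Cmod_ge_0.
    assert (exp (Cmod h * l) <= exp L)%R.
    { destruct (Rle_lt_or_eq_dec (Cmod h * l) L) as [H1|H1]. nra.
      left; now apply exp_increasing. rewrite H1; lra. }
    apply Rle_trans with (4 * (Cmod h * l * (Cmod h * l)) * exp L)%R.
    + apply Rmult_le_compat_l; auto. assert (0 <= Cmod h * l)%R by nra. nra.
    + replace (4 * (L * L) * exp L * (Cmod h * Cmod h))%R with (4 * (Cmod h * Cmod h * (L * L)) * exp L)%R by ring.
      apply Rmult_le_compat_r. left; apply exp_pos.
      replace (Cmod h * l * (Cmod h * l))%R with (Cmod h * Cmod h * (l * l))%R by ring.
      apply Rmult_le_compat_l. lra. apply Rmult_le_compat_l; nra.
  - replace ((b - a) * (M * (4 * (L * L) * exp L) * (Cmod h * Cmod h)))%R with (Q * Cmod h * Cmod h)%R by (unfold Q; ring).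
    apply Rmult_le_compat_r; auto.
    apply Rmult_lt_compat_r with (r := (Q + 1)%R) in Hh2; [|lra].
    replace (eps / (Q + 1) * (Q + 1))%R with eps in Hh2 by (field; lra). nra.
Qed.

(** Gives one majorant for a whole strip, whatever the sign of [u]. *)
Lemma exp_convex_bound (al be x u : R) : (al <= x <= be)%R ->
  (exp (x * u) <= exp (al * u) + exp (be * u))%R.
Proof.
  intros Hx. pose proof (exp_pos (al * u)). pose proof (exp_pos (be * u)).
  destruct (Rle_dec 0 u).
  - assert (x * u <= be * u)%R by nra. assert (exp (x * u) <= exp (be * u))%R; [|lra].
    destruct H1 as [H1|H1]. left; now apply exp_increasing. rewrite H1; lra.
  - assert (x * u <= al * u)%R by nra. assert (exp (x * u) <= exp (al * u))%R; [|lra].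
    destruct H1 as [H1|H1]. left; now apply exp_increasing. rewrite H1; lra.
Qed.

(** A majorant for the two-sided Laplace integral of [c], uniform for [al <= Re z <= be]. *)
Definition laplace_dominated (c : R -> C) (al be K : R) : Prop :=
  (forall t, ccont c t) /\
  (forall u, (Cmod (c u) * (exp (al * u) + exp (be * u)) <= K / (1 + u * u))%R).

Lemma laplace_kernel_dominated (c : R -> C) (al be K : R) (z : C) : laplace_dominated c al be K ->
  (al <= Re z <= be)%R -> dominated (fun u => c u * Cexp (z * RtoC u)) K.
Proof.
  intros [Hc Hb] Hz. split.
  - intros t. apply (ccont_exp_kernel c (fun u => u)); auto. apply continuous_id.
  - intros u. rewrite Cmod_mult, Cmod_Cexp, Re_scal_r.
    eapply Rle_trans; [|apply Hb]. apply Rmult_le_compat_l. apply Cmod_ge_0.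
    now apply exp_convex_bound.
Qed.

(** The integrals over [[- n, n]] are holomorphic and bounded by [K pi] on the strip, so
    [cdiff_limit] applies. *)
Lemma laplace_cdiff (c : R -> C) (al be K : R) (z : C) : laplace_dominated c al be K ->
  (al < Re z < be)%R -> cdiff (fun z => LInt (fun u => c u * Cexp (z * RtoC u))) z.
Proof.
  intros Hd Hz. set (r := Rmin (Re z - al) (be - Re z)).
  assert (Hr : (0 < r)%R) by (apply Rmin_pos; lra).
  assert (Hr1 : (r <= Re z - al)%R) by apply Rmin_l. assert (Hr2 : (r <= be - Re z)%R) by apply Rmin_r.
  pose proof Hd as [Hc _].
  apply (cdiff_limit (fun n z => CInt (fun u => c u * Cexp (z * RtoC u)) (- INR n) (INR n)) _ z r (K * PI)); auto.
  - intros n w _. pose proof (pos_INR n). apply (CInt_exp_cdiff c (fun u => u)); auto. lra.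
    intros; apply continuous_id.
  - intros n w [Hw _]. pose proof (pos_INR n).
    assert (D := laplace_kernel_dominated c al be K w Hd ltac:(lra)).
    eapply Rle_trans. apply (dominated_CInt _ K); auto. lra. apply Rmult_le_compat_l. now apply dominated_K_pos in D.
    pose proof (atan_lt_PI2 (INR n)). pose proof (atan_lt_PI2 (- INR n)). lra.
  - intros w [Hw _]. apply is_line_seq. apply (LInt_correct _ K). apply (laplace_kernel_dominated c al be K); auto. lra.
Qed.

Lemma sq_le_exp (v : R) : (0 <= v)%R -> (v * v <= 4 * exp v)%R.
Proof.
  intros Hv. assert (H : (1 + v / 2 <= exp (v / 2))%R) by apply exp_ineq1_le.
  replace v with (v / 2 + v / 2)%R at 3 by field. rewrite exp_plus. nra.
Qed.

(** The constant joins [1 <= exp (d v)] and [v^2 <= 4 exp (d v) / d^2], the latter being [sq_le_exp]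
    at [d v]. *)
Lemma exp_abs_dominated (d u : R) : (0 < d)%R -> (exp (- (d * Rabs u)) <= (1 + 4 / (d * d)) / (1 + u * u))%R.
Proof.
  intros Hd. pose proof (Rabs_pos u).
  assert (Hu : (u * u = Rabs u * Rabs u)%R). { rewrite <- Rabs_mult. symmetry. apply Rabs_pos_eq. nra. }
  rewrite Hu. set (v := Rabs u) in *.
  apply Rmult_le_reg_r with (1 + v * v)%R. nra.
  unfold Rdiv. rewrite Rmult_assoc, Rinv_l, Rmult_1_r by nra.
  rewrite exp_Ropp. apply Rmult_le_reg_l with (exp (d * v)). apply exp_pos.
  rewrite <- Rmult_assoc, Rinv_r, Rmult_1_l by (pose proof (exp_pos (d * v)); lra).
  assert (0 <= d * v)%R by nra. pose proof (sq_le_exp (d * v) H0).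
  assert (1 + d * v <= exp (d * v))%R by apply exp_ineq1_le.
  assert (v * v <= exp (d * v) * (4 * / (d * d)))%R.
  { apply Rmult_le_reg_l with (d * d)%R. nra.
    replace (d * d * (exp (d * v) * (4 * / (d * d))))%R with (4 * exp (d * v))%R by (field; lra). nra. }
  nra.
Qed.

(** Towards [- oo] the factor [exp (al u)] decays by itself, towards [+ oo] the double exponential
    wins; the rate [Rmin al 1] covers both. *)
Lemma exp_exp_bound (al : R) : (0 < al)%R -> exists K, forall u,
  (exp (- exp u) * exp (al * u) <= K * exp (- (Rmin al 1 * Rabs u)))%R.
Proof.
  (* [exp] lies above its tangent at [p], whose slope is [al + 1]; up to a constant this leaves
     [exp (- u)] for [u >= 0]. *)
  intros Ha. set (p := ln (al + 1)). exists (exp ((al + 1) * Rabs p)). intros u.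
  assert (1 <= exp ((al + 1) * Rabs p))%R.
  { pose proof (exp_ineq1_le ((al + 1) * Rabs p)). pose proof (Rabs_pos p). nra. }
  rewrite <- !exp_plus.
  assert (Hm1 : (Rmin al 1 <= al)%R) by apply Rmin_l. assert (Hm2 : (Rmin al 1 <= 1)%R) by apply Rmin_r.
  assert (Hle : forall x y, (x <= y)%R -> (exp x <= exp y)%R).
  { intros x y [Hxy|Hxy]. left; now apply exp_increasing. rewrite Hxy; lra. }
  apply Hle. pose proof (Rabs_pos p). pose proof (exp_pos u).
  destruct (Rle_dec 0 u).
  - rewrite (Rabs_pos_eq u) by auto.
    assert (E : (exp u >= (al + 1) * (1 + (u - p)))%R).
    { replace u with (p + (u - p))%R at 1 by ring. rewrite exp_plus. unfold p at 1. rewrite exp_ln by lra.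
      pose proof (exp_ineq1_le (u - p)). nra. }
    pose proof (Rle_abs p). nra.
  - rewrite (Rabs_left u) by lra. nra.
Qed.

Lemma exp_exp_dominated (al : R) : (0 < al)%R -> exists K, forall u,
  (exp (- exp u) * exp (al * u) <= K / (1 + u * u))%R.
Proof.
  intros Ha. destruct (exp_exp_bound al Ha) as [K HK].
  assert (Hm : (0 < Rmin al 1)%R) by (apply Rmin_pos; lra).
  set (d := Rmin al 1) in *.
  assert (0 <= K)%R.
  { specialize (HK 0%R). rewrite Rabs_R0, !Rmult_0_r, Ropp_0, exp_0, !Rmult_1_r in HK.
    pose proof (exp_pos (- exp 0)). rewrite exp_0 in *. lra. }
  exists (K * (1 + 4 / (d * d)))%R. intros u. eapply Rle_trans. apply HK.
  unfold Rdiv. rewrite Rmult_assoc. apply Rmult_le_compat_l; auto. now apply exp_abs_dominated.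
Qed.

(* Euler's integral after the substitution [t = e^u]. *)
Definition euler_kernel (u : R) : C := RtoC (exp (- exp u)).
Definition Euler_laplace (z : C) : C := LInt (fun u => euler_kernel u * Cexp (z * RtoC u)).

Lemma continuous_exp_exp (u : R) : continuous (fun u => exp (- exp u)) u.
Proof.
  apply (ex_derive_continuous (K := R_AbsRing) (V := R_NormedModule)). auto_derive. auto.
Qed.

Lemma euler_kernel_laplace (al be : R) : (0 < al)%R -> (0 < be)%R -> exists K, laplace_dominated euler_kernel al be K.
Proof.
  intros Ha Hb. destruct (exp_exp_dominated al Ha) as [K1 H1]. destruct (exp_exp_dominated be Hb) as [K2 H2].
  exists (K1 + K2)%R. split.
  - intros t. apply ccont_RtoC. apply continuous_exp_exp.
  - intros u. unfold euler_kernel. rewrite Cmod_R, Rabs_pos_eq by (left; apply exp_pos).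
    specialize (H1 u). specialize (H2 u). unfold Rdiv in *. lra.
Qed.

Lemma Euler_laplace_dominated (z : C) : (0 < Re z)%R -> exists K, dominated (fun u => euler_kernel u * Cexp (z * RtoC u)) K.
Proof.
  intros Hz. destruct (euler_kernel_laplace (Re z) (Re z) Hz Hz) as [K HK]. exists K.
  apply (laplace_kernel_dominated euler_kernel (Re z) (Re z)); auto. lra.
Qed.

Lemma Euler_laplace_cdiff (z : C) : (0 < Re z)%R -> cdiff Euler_laplace z.
Proof.
  intros Hz. destruct (euler_kernel_laplace (Re z / 2) (Re z + 1)) as [K HK]; try lra.
  apply (laplace_cdiff euler_kernel (Re z / 2) (Re z + 1) K); auto. lra.
Qed.

Lemma Euler_laplace_bound (al be : R) : (0 < al)%R -> exists K, (0 <= K)%R /\ forall z, (al <= Re z <= be)%R -> (Cmod (Euler_laplace z) <= K)%R.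
Proof.
  intros Ha. destruct (Rle_dec al be) as [Hab|Hab].
  - destruct (euler_kernel_laplace al be) as [K HK]; try lra. exists (4 * K)%R. split.
    + assert (D := laplace_kernel_dominated euler_kernel al be K (RtoC al) HK ltac:(simpl; lra)). apply dominated_K_pos in D. lra.
    + intros z Hz. apply LInt_bound. now apply (laplace_kernel_dominated euler_kernel al be).
  - exists 0%R. split. lra. intros z Hz. lra.
Qed.

(** The boundary terms [h (n)] and [h (- n)] are [O(1 / n)]. This is integration by parts on the
    whole line. *)
Lemma LInt_derive_0 (h f : R -> C) (K L : R) :
  (forall t, is_derive (K := R_AbsRing) (V := C_R_NormedModule) h t (f t)) ->
  dominated h K -> dominated f L -> LInt f = 0.
Proof.
  intros Hh Dh Df. apply (Clim_unique (fun n => CInt f (- INR n) (INR n))).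
  - apply is_line_seq. now apply (LInt_correct f L).
  - assert (HK := dominated_K_pos h K Dh). destruct Dh as [_ Bh].
    apply (Clim_squeeze _ _ (fun n => (2 * K) * / INR (S n))%R).
    + intros n. rewrite (CInt_derive h f); auto. 2: { intros; apply Df. }
      replace (h (INR n) - h (- INR n)%R - 0) with (h (INR n) - h (- INR n)%R) by ring.
      eapply Rle_trans. apply Cmod_le_sum.
      pose proof (Bh (INR n)). pose proof (Bh (- INR n)%R).
      replace (- INR n * - INR n)%R with (INR n * INR n)%R in H0 by ring.
      assert (K / (1 + INR n * INR n) <= K * / INR (S n))%R; [|lra].
      unfold Rdiv. apply Rmult_le_compat_l; auto. apply Rinv_le_contravar.
      apply lt_0_INR; lia. rewrite S_INR. destruct n. simpl; lra.
      assert (1 <= INR (S n))%R by (apply (le_INR 1); lia). nra.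
    + replace (Finite 0) with (Rbar_mult (2 * K)%R (Finite 0)) by (simpl; f_equal; ring).
      apply is_lim_seq_scal_l. apply (is_lim_seq_incr_1 (fun n => / INR n)%R).
      replace (Finite 0) with (Rbar_inv p_infty) by reflexivity.
      apply is_lim_seq_inv. apply is_lim_seq_INR. discriminate.
Qed.

(** The derivative of [exp (z u - e^u)] integrates to 0, and it equals [z] times the integrand at
    [z] minus the integrand at [z + 1]. *)
Lemma Euler_laplace_rec (z : C) : (0 < Re z)%R -> Euler_laplace (z + 1) = z * Euler_laplace z.
Proof.
  intros Hz. destruct (Euler_laplace_dominated z Hz) as [K DK].
  destruct (Euler_laplace_dominated (z + 1) ltac:(reim; lra)) as [L DL].
  assert (E : LInt (fun u => z * (euler_kernel u * Cexp (z * RtoC u)) + (- (1)) * (euler_kernel u * Cexp ((z + 1) * RtoC u))) = 0).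
  { apply (LInt_derive_0 (fun u => euler_kernel u * Cexp (z * RtoC u)) _ K (Cmod z * K + Cmod (- (1)) * L)); auto.
    2: { apply dominated_plus; now apply dominated_scal. }
    intros t.
    set (F := fun w : C => Cexp (z * w - Cexp w)).
    set (w := 0 + 1 * RtoC t).
    assert (EF : forall u : R, F (0 + 1 * RtoC u) = euler_kernel u * Cexp (z * RtoC u)).
    { intros u. unfold F, euler_kernel. rewrite Cplus_0_l, Cmult_1_l, Cexp_RtoC. unfold Cminus.
      rewrite Cexp_plus, <- RtoC_opp, Cexp_RtoC. ring. }
    apply (is_derive_ext (fun u : R => F (0 + 1 * RtoC u))). { exact EF. }
    replace (z * (euler_kernel t * Cexp (z * RtoC t)) + (- (1)) * (euler_kernel t * Cexp ((z + 1) * RtoC t)))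
      with (1 * ((z - Cexp w) * F w)).
    2: { replace ((z + 1) * RtoC t) with (z * RtoC t + RtoC t) by ring. rewrite Cexp_plus.
      unfold w. rewrite EF. rewrite Cplus_0_l, !Cmult_1_l. Ceq. ring. }
    apply is_derive_line. fold w. unfold F.
    apply (is_cderiv_comp Cexp (fun w => z * w - Cexp w)). apply is_cderiv_Cexp.
    apply (is_cderiv_ext_loc (fun w => z * w + (- (1)) * Cexp w) _ _ _ 1). lra. { intros; cbv beta; ring. }
    replace (z - Cexp w) with ((0 * w + z * 1) + (0 * Cexp w + (- (1)) * Cexp w)) by ring.
    apply is_cderiv_plus.
    apply (is_cderiv_mult (fun _ => z) (fun w => w)). apply is_cderiv_const. apply is_cderiv_id.
    apply (is_cderiv_mult (fun _ => - (1)) Cexp). apply is_cderiv_const. apply is_cderiv_Cexp. }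
  rewrite (LInt_plus _ _ (Cmod z * K) (Cmod (- (1)) * L)) in E by now apply dominated_scal.
  rewrite (LInt_scal _ K), (LInt_scal _ L) in E by auto. fold (Euler_laplace z) in E. fold (Euler_laplace (z + 1)) in E.
  replace (Euler_laplace (z + 1)) with (z * Euler_laplace z - (z * Euler_laplace z + (- (1)) * Euler_laplace (z + 1))) by ring.
  rewrite E. ring.
Qed.

(* Each double use of [Gamma (z + 1) = z Gamma z] gains a factor [|z (z + 1)|]. *)
Lemma Euler_laplace_decay (m : nat) : forall al be : R, (0 < al)%R -> exists K, (0 <= K)%R /\
  forall z, (al <= Re z <= be)%R -> (Cmod (Euler_laplace z) <= K / (1 + Im z * Im z) ^ m)%R.
Proof.
  induction m as [|m IH]; intros al be Ha.
  - destruct (Euler_laplace_bound al be Ha) as [K [HK H]]. exists K. split; auto. intros z Hz.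
    simpl. unfold Rdiv. rewrite Rinv_1, Rmult_1_r. auto.
  - destruct (IH (al + 2)%R (be + 2)%R ltac:(lra)) as [K [HK H]].
    (* [|z|^2 >= al^2 + (Im z)^2 >= c (1 + (Im z)^2)], and [|z + 1| >= |z|]. *)
    set (c := Rmin 1 (al * al)). assert (Hc : (0 < c)%R) by (apply Rmin_pos; nra).
    assert (Hc1 : (c <= 1)%R) by apply Rmin_l. assert (Hc2 : (c <= al * al)%R) by apply Rmin_r.
    exists (K / c)%R. split. { apply Rdiv_le_0_compat; auto. }
    intros z Hz. specialize (H (z + 1 + 1)).
    change (Re (z + 1 + 1)) with (Re z + 1 + 1)%R in H.
    replace (Im (z + 1 + 1)) with (Im z) in H by (reim; ring).
    specialize (H ltac:(lra)). rewrite !Euler_laplace_rec in H by (reim; lra).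
    rewrite !Cmod_mult in H. set (y := Im z) in *.
    assert (Hz2 : (c * (1 + y * y) <= Cmod z * Cmod z)%R).
    { replace (Cmod z * Cmod z)%R with (Re z * Re z + y * y)%R.
      2: { pose proof (Cmod2_alt z). unfold y. simpl in H0. rewrite !Rmult_1_r in H0. rewrite H0. ring. }
      nra. }
    assert (Hz1 : (Cmod z <= Cmod (z + 1))%R).
    { unfold Cmod. apply sqrt_le_1_alt. destruct z as [x0 y0]. simpl in *. nra. }
    pose proof (Cmod_ge_0 z). pose proof (Cmod_ge_0 (Euler_laplace z)).
    assert (P : (0 < (1 + y * y) ^ m)%R) by (apply pow_lt; nra).
    simpl pow. apply Rmult_le_reg_r with (c * (1 + y * y))%R. nra.
    replace (K / c / ((1 + y * y) * (1 + y * y) ^ m) * (c * (1 + y * y)))%R with (K / (1 + y * y) ^ m)%R.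
    2: { field. repeat split; try lra. nra. }
    eapply Rle_trans; [|exact H].
    replace (Cmod (z + 1) * (Cmod z * Cmod (Euler_laplace z)))%R with (Cmod (Euler_laplace z) * (Cmod z * Cmod (z + 1)))%R by ring.
    apply Rmult_le_compat_l; auto. eapply Rle_trans. apply Hz2. apply Rmult_le_compat_l; auto.
Qed.

(** With [t = e^u] the factor [1 / t] in [t^(z - 1)] cancels against [dt]; [ln] carries the filters
    at [0+] and at infinity to the two ends of the line. *)
Lemma Euler_integral_Euler_laplace (z : C) : (0 < Re z)%R -> Euler_integral z = Euler_laplace z.
Proof.
  intros Hz. unfold Euler_integral. apply (is_RInt_gen_unique (V := C_R_CompleteNormedModule)).
  destruct (Euler_laplace_dominated z Hz) as [K DK]. assert (L := LInt_correct _ K DK). fold (Euler_laplace z) in L.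
  set (F := fun u => euler_kernel u * Cexp (z * RtoC u)) in *.
  assert (Sub : forall a b, (0 < a)%R -> (0 < b)%R ->
     is_RInt (V := C_R_NormedModule) (fun t => RtoC (exp (- t)) * Rcpow t (z - 1)) a b (CInt F (ln a) (ln b))).
  { intros a b Ha Hb.
    assert (Hpos : forall x, (Rmin a b <= x <= Rmax a b)%R -> (0 < x)%R).
    { intros x [Hx _]. assert (0 < Rmin a b)%R by now apply Rmin_pos. lra. }
    eapply is_RInt_ext.
    2: { apply (is_RInt_comp (V := C_R_CompleteNormedModule) F ln (fun t => / t)%R a b).
      - intros x Hx. apply ccont_continuous, DK.
      - intros x Hx. apply Hpos in Hx. split. auto_derive; auto. field; lra.
        apply (ex_derive_continuous (K := R_AbsRing) (V := R_NormedModule)). auto_derive. lra. }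
    intros x Hx. assert (Hx0 : (0 < x)%R) by (apply Hpos; lra).
    unfold F, euler_kernel, Rcpow. rewrite exp_ln by auto.
    replace ((z - 1) * RtoC (ln x)) with (z * RtoC (ln x) + RtoC (- ln x)) by (rewrite RtoC_opp; ring).
    rewrite Cexp_plus, Cexp_RtoC, (exp_Ropp (ln x)), exp_ln by auto.
    destruct (Cexp (z * RtoC (ln x))) as [p q]. unfold scal; simpl. unfold prod_scal, scal; simpl.
    unfold mult; simpl. apply C_eq; simpl; ring. }
  intros P [eps HP].
  destruct (L (eps / 2)%R) as [M HM]. { pose proof (cond_pos eps). lra. }
  exists (fun a => (0 < a < exp (- M))%R) (fun b => (exp M < b)%R).
  { exists (mkposreal _ (exp_pos (- M))). intros y Hy Hy0. split; auto.
    apply Rabs_lt_between in Hy. change (minus y 0%R) with (y + - 0)%R in Hy. simpl in Hy. lra. }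
  { exists (exp M). auto. }
  intros a b Ha Hb. simpl. pose proof (exp_pos M).
  exists (CInt F (ln a) (ln b)). split. apply Sub; lra.
  apply HP. apply C_NormedModule_mixin_compat1. change (Cmod (CInt F (ln a) (ln b) - Euler_laplace z) < eps)%R.
  eapply Rle_lt_trans. apply HM.
  - rewrite <- (ln_exp (- M)). left. apply ln_increasing; lra.
  - rewrite <- (ln_exp M). left. apply ln_increasing; lra.
  - pose proof (cond_pos eps). lra.
Qed.

(** * Gamma and g in the whole plane *)

(** [up] rounds up strictly, so integral values of [- Re z] also reach a positive real part.
    Minimality lets any admissible shift be compared with this one. *)
Lemma Gamma_shift_spec (z : C) :
  (0 < Re z + INR (Gamma_shift z))%R /\
  (forall n, (0 < Re z + INR n)%R -> (Gamma_shift z <= n)%nat).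
Proof.
  unfold Gamma_shift. destruct (archimed (- Re z)) as [H1 H2]. set (m := up (- Re z)) in *.
  destruct (Z.le_gt_cases 0 m) as [Hm|Hm].
  - rewrite INR_IZR_INZ, Z2Nat.id by auto. split. lra.
    intros n Hn. rewrite INR_IZR_INZ in Hn. apply Nat2Z.inj_le. rewrite Z2Nat.id by auto.
    assert (m - 1 < Z.of_nat n)%Z; [|lia]. apply lt_IZR. rewrite minus_IZR. lra.
  - assert (Z.to_nat m = O) as -> by lia. split; [|lia].
    assert (m <= -1)%Z by lia. apply IZR_le in H. simpl. lra.
Qed.

Lemma rising_add (z : C) (n k : nat) :
  rising z (n + k) = rising z n * rising (z + RtoC (INR n)) k.
Proof.
  induction k. rewrite Nat.add_0_r. simpl. ring.
  rewrite Nat.add_succ_r. simpl. rewrite IHk, plus_INR, RtoC_plus. ring.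
Qed.

Lemma Euler_laplace_rising (z : C) (n : nat) : (0 < Re z)%R -> Euler_laplace (z + RtoC (INR n)) = rising z n * Euler_laplace z.
Proof.
  intros Hz. induction n. simpl. replace (z + 0) with z by ring. ring.
  rewrite S_INR, RtoC_plus. replace (z + (RtoC (INR n) + 1)) with (z + RtoC (INR n) + 1) by ring.
  rewrite Euler_laplace_rec, IHn. simpl. ring. reim. pose proof (pos_INR n). lra.
Qed.

(** The shift in [Gamma] jumps as [Re z] varies. Surplus steps cancel by the recursion, so one fixed
    shift can be used near a point, which is what differentiability requires. *)
Lemma Gamma_eq (z : C) (n : nat) : (0 < Re z + INR n)%R -> rising z n <> 0 ->
  Gamma z = Euler_laplace (z + RtoC (INR n)) / rising z n.
Proof.
  intros Hn Hr. destruct (Gamma_shift_spec z) as [H1 H2]. specialize (H2 n Hn).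
  unfold Gamma. set (s := Gamma_shift z) in *.
  rewrite Euler_integral_Euler_laplace by (reim; lra).
  replace n with (s + (n - s))%nat in * by lia. set (k := (n - s)%nat) in *.
  rewrite rising_add in *. rewrite plus_INR, RtoC_plus.
  replace (z + (RtoC (INR s) + RtoC (INR k))) with (z + RtoC (INR s) + RtoC (INR k)) by ring.
  rewrite (Euler_laplace_rising (z + RtoC (INR s)) k) by (reim; lra).
  field. split; intros E; apply Hr; rewrite E; ring.
Qed.

Lemma Gamma_right (z : C) : (0 < Re z)%R -> Gamma z = Euler_laplace z.
Proof.
  intros Hz. rewrite (Gamma_eq z 0); simpl. replace (z + 0) with z by ring. field. lra.
  intros E; apply RtoC_inj in E; lra.
Qed.

Lemma rising_cdiff (n : nat) (z : C) : cdiff (fun z => rising z n) z.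
Proof. induction n; simpl; cdiff_tac. Qed.

Lemma rising_neq_0 (z : C) (n : nat) : (forall k : nat, z <> - RtoC (INR k)) -> rising z n <> 0.
Proof.
  intros H. induction n; simpl. intros E; apply RtoC_inj in E; lra.
  apply Cmult_neq_0; auto. intros E. apply (H n).
  replace z with ((z + RtoC (INR n)) - RtoC (INR n)) by ring. rewrite E. ring.
Qed.

Lemma Gamma_cdiff (z : C) : (forall k : nat, z <> - RtoC (INR k)) -> cdiff Gamma z.
Proof.
  intros Hz. destruct (INR_unbounded (1 - Re z)) as [n Hn].
  assert (Hr := rising_neq_0 z n Hz).
  destruct (cderiv_cont _ z (rising_cdiff n z) (Cmod (rising z n))) as [d [Hd Hc]].
  { now apply Cmod_gt_0. }
  apply (cdiff_ext_loc (fun z => Euler_laplace (z + RtoC (INR n)) / rising z n) _ z (Rmin 1 d)).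
  { apply Rmin_pos; lra. }
  - intros w Hw. symmetry. apply Gamma_eq.
    + pose proof (Rlt_le_trans _ _ _ Hw (Rmin_l _ _)). pose proof (re_le_Cmod (w - z)).
      apply Rabs_le_between in H0. change (Re (w - z)) with (Re w - Re z)%R in H0. lra.
    + intros E. pose proof (Hc w (Rlt_le_trans _ _ _ Hw (Rmin_r _ _))). rewrite E in H.
      replace (0 - rising z n) with (- rising z n) in H by ring. rewrite Cmod_opp in H. lra.
  - apply (cdiff_div (fun z => Euler_laplace (z + RtoC (INR n))) (fun z => rising z n)); auto.
    + apply (cdiff_comp Euler_laplace (fun z => z + RtoC (INR n))). apply Euler_laplace_cdiff. reim. lra. cdiff_tac.
    + apply rising_cdiff.
Qed.

Lemma Rcpow_cdiff (x : R) (f : C -> C) (z : C) : cdiff f z -> cdiff (fun w => Rcpow x (f w)) z.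
Proof. intros H. unfold Rcpow. cdiff_tac. Qed.

Lemma Cmod_Rcpow (x : R) (s : C) : Cmod (Rcpow x s) = exp (Re s * ln x).
Proof. unfold Rcpow. now rewrite Cmod_Cexp, Re_scal_r. Qed.

Lemma g_cdiff (s : C) : (forall k : nat, s / 2 + 1 <> - RtoC (INR k)) -> cdiff g s.
Proof.
  intros H. unfold g. apply (cdiff_mult (fun s => Rcpow PI (- (s / 2)) * (s - 1)) (fun s => Gamma (s / 2 + 1))).
  - apply (cdiff_mult (fun s => Rcpow PI (- (s / 2)))). apply Rcpow_cdiff. cdiff_tac.
    intros E; apply RtoC_inj in E; lra. cdiff_tac.
  - apply (cdiff_comp Gamma (fun s => s / 2 + 1)). now apply Gamma_cdiff. cdiff_tac.
    intros E; apply RtoC_inj in E; lra.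
Qed.

(** * Analytic continuation of zeta *)

(** Complex functions of a real variable are differentiated through their components, which makes
    the real product rule available. *)
Lemma is_derive_C_components (F : R -> C) (t : R) (l : C) :
  is_derive (fun u => Re (F u)) t (Re l) -> is_derive (fun u => Im (F u)) t (Im l) ->
  is_derive (K := R_AbsRing) (V := C_R_NormedModule) F t l.
Proof.
  intros [_ H1] [_ H2]. split. apply is_linear_scal_l.
  intros x Hx eps.
  assert (He : (0 < eps / 2)%R) by (pose proof (cond_pos eps); lra).
  destruct (H1 x Hx (mkposreal _ He)) as [d1 D1]. destruct (H2 x Hx (mkposreal _ He)) as [d2 D2].
  assert (Hd : (0 < Rmin d1 d2)%R) by (apply Rmin_pos; apply cond_pos).
  exists (mkposreal _ Hd). intros u Hu.
  assert (U1 : ball t d1 u) by (eapply Rlt_le_trans; [exact Hu|apply Rmin_l]).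
  assert (U2 : ball t d2 u) by (eapply Rlt_le_trans; [exact Hu|apply Rmin_r]).
  specialize (D1 u U1). specialize (D2 u U2). simpl in D1, D2.
  rewrite norm_C_R. eapply Rle_trans. apply Cmod_le_abs.
  eapply Rle_trans. exact (Rplus_le_compat _ _ _ _ D1 D2). right. field.
Qed.

Lemma is_derive_C_Re (F : R -> C) (t : R) (l : C) :
  is_derive (K := R_AbsRing) (V := C_R_NormedModule) F t l -> is_derive (fun u => Re (F u)) t (Re l).
Proof.
  intros [_ H]. split. apply is_linear_scal_l.
  intros x Hx eps. destruct (H x Hx eps) as [d D]. exists d. intros u Hu. specialize (D u Hu).
  rewrite norm_C_R in D. eapply Rle_trans; [|exact D].
  match goal with |- (_ <= Cmod ?z)%R => exact (re_le_Cmod z) end.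
Qed.
Lemma is_derive_C_Im (F : R -> C) (t : R) (l : C) :
  is_derive (K := R_AbsRing) (V := C_R_NormedModule) F t l -> is_derive (fun u => Im (F u)) t (Im l).
Proof.
  intros [_ H]. split. apply is_linear_scal_l.
  intros x Hx eps. destruct (H x Hx eps) as [d D]. exists d. intros u Hu. specialize (D u Hu).
  rewrite norm_C_R in D. eapply Rle_trans; [|exact D].
  match goal with |- (_ <= Cmod ?z)%R => exact (im_le_Cmod z) end.
Qed.

Lemma is_derive_RtoC_mult (p : R -> R) (F : R -> C) (t p' : R) (l : C) :
  is_derive p t p' -> is_derive (K := R_AbsRing) (V := C_R_NormedModule) F t l ->
  is_derive (K := R_AbsRing) (V := C_R_NormedModule) (fun u => RtoC (p u) * F u) t
    (RtoC p' * F t + RtoC (p t) * l).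
Proof.
  intros Hp HF. pose proof (is_derive_C_Re F t l HF) as H1. pose proof (is_derive_C_Im F t l HF) as H2.
  apply is_derive_C_components.
  - apply (is_derive_ext (fun u => (p u * Re (F u))%R)). { intros u. destruct (F u); simpl. ring. }
    replace (Re (RtoC p' * F t + RtoC (p t) * l)) with (plus (mult p' (Re (F t))) (mult (p t) (Re l))).
    apply (is_derive_mult (K := R_AbsRing)); auto. intros; apply Rmult_comm.
    unfold plus, mult; destruct (F t), l; simpl. ring.
  - apply (is_derive_ext (fun u => (p u * Im (F u))%R)). { intros u. destruct (F u); simpl. ring. }
    replace (Im (RtoC p' * F t + RtoC (p t) * l)) with (plus (mult p' (Im (F t))) (mult (p t) (Im l))).
    apply (is_derive_mult (K := R_AbsRing)); auto. intros; apply Rmult_comm.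
    unfold plus, mult; destruct (F t), l; simpl. ring.
Qed.

Lemma is_derive_Cexp_real (s : C) (lam : R -> R) (t lam' : R) : is_derive lam t lam' ->
  is_derive (K := R_AbsRing) (V := C_R_NormedModule) (fun u => Cexp (s * RtoC (lam u))) t
    (RtoC lam' * (s * Cexp (s * RtoC (lam t)))).
Proof.
  intros H.
  assert (H1 : is_derive (K := R_AbsRing) (V := C_R_NormedModule) (fun u : R => Cexp (0 + s * RtoC u)) (lam t)
     (s * Cexp (0 + s * RtoC (lam t)))).
  { apply is_derive_line. apply is_cderiv_Cexp. }
  rewrite Cplus_0_l in H1.
  assert (H2 := is_derive_comp (K := R_AbsRing) (V := C_R_NormedModule) _ lam t _ _ H1 H).
  apply (is_derive_ext (fun u => Cexp (0 + s * RtoC (lam u)))). { intros. now rewrite Cplus_0_l. }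
  replace (RtoC lam' * (s * Cexp (s * RtoC (lam t)))) with
    (scal (V := C_R_NormedModule) lam' (s * Cexp (s * RtoC (lam t)))). exact H2.
  destruct (s * Cexp (s * RtoC (lam t))) as [p q]. apply C_eq; simpl; unfold scal; simpl; unfold mult; simpl; ring.
Qed.

(* [(n + 1)^(-s)]: series are indexed from 0. *)
Definition inv_npow (n : nat) (s : C) : C := Cexp (s * RtoC (- ln (INR (S n)))).

Lemma inv_npow_inv (n : nat) (s : C) : inv_npow n s = / Rcpow (INR (S n)) s.
Proof.
  unfold inv_npow, Rcpow. rewrite <- Cexp_opp. f_equal. rewrite RtoC_opp. ring.
Qed.

Lemma Cmod_inv_npow (n : nat) (s : C) : Cmod (inv_npow n s) = exp (- (Re s * ln (INR (S n)))).
Proof. unfold inv_npow. rewrite Cmod_Cexp, Re_scal_r. f_equal. ring. Qed.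

Lemma exp_le (x y : R) : (x <= y)%R -> (exp x <= exp y)%R.
Proof. intros [H|H]. left; now apply exp_increasing. rewrite H; lra. Qed.

Lemma ln_S_pos (n : nat) : (0 <= ln (INR (S n)))%R.
Proof.
  rewrite <- ln_1. destruct n. simpl. lra. left. apply ln_increasing. lra.
  apply (lt_INR 1). lia.
Qed.

(** Comparison with the integral of [x^(-p)] in telescoping form: [(n + 1)^(-p) <= (n^(-q) - (n +
    1)^(-q)) / q] with [q = p - 1], again from [1 + x <= exp x]. *)
Lemma summable_power (p : R) : (1 < p)%R -> summable (fun n => exp (- (p * ln (INR (S n))))).
Proof.
  intros Hp. split. { intros n; left; apply exp_pos. }
  set (q := (p - 1)%R).
  exists (1 + / q)%R. intros N.
  assert (H : (rsum (fun n => exp (- (p * ln (INR (S n))))) (S N) <= 1 + / q * (1 - exp (- (q * ln (INR (S N))))))%R).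
  { induction N.
    - simpl. rewrite ln_1, !Rmult_0_r, Ropp_0, exp_0. lra.
    - remember (S N) as M. cbn [rsum]. assert (E : (exp (- (p * ln (INR (S M)))) <=
        / q * (exp (- (q * ln (INR M))) - exp (- (q * ln (INR (S M))))))%R).
      { assert (HM : (0 < INR M)%R) by (apply lt_0_INR; lia).
        assert (HS : (INR (S M) = INR M + 1)%R) by apply S_INR.
        set (r := (INR (S M) / INR M)%R).
        assert (Hr : (0 < r)%R) by (apply Rdiv_lt_0_compat; lra).
        assert (Er : (ln (INR M) = ln (INR (S M)) - ln r)%R).
        { unfold r. rewrite ln_div by lra. ring. }
        rewrite Er. set (L := ln (INR (S M))).
        replace (- (p * L))%R with (- (q * L) + - L)%R by (unfold q; ring).
        replace (- (q * (L - ln r)))%R with (- (q * L) + q * ln r)%R by ring.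
        rewrite !exp_plus. set (X := exp (- (q * L))).
        assert (HX : (0 < X)%R) by apply exp_pos.
        assert (E1 : (exp (- L) = / INR (S M))%R). { rewrite exp_Ropp. unfold L. rewrite exp_ln by lra. reflexivity. }
        assert (E2 : (1 - / r <= ln r)%R).
        { pose proof (exp_ineq1_le (- ln r)). rewrite exp_Ropp, exp_ln in H by auto. lra. }
        assert (E3 : (1 - / r = / INR (S M))%R). { unfold r. rewrite HS. field. lra. }
        pose proof (exp_ineq1_le (q * ln r)).
        rewrite E1. assert (Hq : (0 < q)%R) by (unfold q; lra).
        apply Rmult_le_reg_l with q; auto. rewrite <- Rmult_assoc, <- Rmult_assoc, Rinv_r, Rmult_1_l by lra.
        assert (q * / INR (S M) <= exp (q * ln r) - 1)%R by nra. nra. }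
      lra. }
  assert (H2 : (rsum (fun n => exp (- (p * ln (INR (S n))))) N <= rsum (fun n => exp (- (p * ln (INR (S n))))) (S N))%R).
  { apply rsum_incr. intros; left; apply exp_pos. lia. }
  pose proof (exp_pos (- (q * ln (INR (S N))))).
  assert (0 < / q)%R by (apply Rinv_0_lt_compat; unfold q; lra). nra.
Qed.

Lemma power_tends_0 (q eps : R) : (0 < q)%R -> (0 < eps)%R -> exists N, forall n, (N <= n)%nat ->
  (exp (- (q * ln (INR (S n)))) < eps)%R.
Proof.
  intros Hq He. destruct (INR_unbounded (exp (- ln eps / q))) as [N HN]. exists N. intros n Hn.
  assert (INR N <= INR (S n))%R by (apply le_INR; lia).
  rewrite <- (exp_ln eps) at 1 by auto. apply exp_increasing.
  assert (K : (- ln eps / q < ln (INR (S n)))%R).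
  { rewrite <- (ln_exp (- ln eps / q)). apply ln_increasing. apply exp_pos. lra. }
  apply Rmult_lt_compat_l with (r := q) in K; auto.
  replace (q * (- ln eps / q))%R with (- ln eps)%R in K by (field; lra). lra.
Qed.

(* Carries no meaning when the partial sums diverge. *)
Definition csum_lim (f : nat -> C) : C := epsilon (inhabits (RtoC 0)) (Clim (csum f)).

Lemma csum_lim_correct (f : nat -> C) (a : nat -> R) : summable a -> (forall n, (Cmod (f n) <= a n)%R) ->
  Clim (csum f) (csum_lim f).
Proof. intros Hs H. unfold csum_lim. apply epsilon_spec. now apply (csum_converges f a). Qed.

Lemma csum_cdiff (f : nat -> C -> C) (n : nat) (z : C) : (forall k, cdiff (f k) z) ->
  cdiff (fun z => csum (fun k => f k z) n) z.
Proof.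
  intros H. induction n; simpl. apply cdiff_const.
  apply (cdiff_plus (fun z => csum (fun k => f k z) n) (f n)); auto.
Qed.

(** On the square of half side [r = (Re z - 1) / 2] about [z] the real part is at least [1 + r], so
    one convergent series bounds all partial sums there. *)
Lemma csum_lim_cdiff (f : nat -> C -> C) (z : C) :
  (forall n w, cdiff (f n) w) ->
  (forall n w, (1 < Re w)%R -> (Cmod (f n w) <= exp (- (Re w * ln (INR (S n)))))%R) ->
  (1 < Re z)%R -> cdiff (fun w => csum_lim (fun n => f n w)) z.
Proof.
  intros Hd Hb Hz. set (r := ((Re z - 1) / 2)%R).
  destruct (summable_power (1 + r)) as [Ha [B HB]]. { unfold r; lra. }
  assert (Hb' : forall w n, (Re z - r <= Re w)%R -> (Cmod (f n w) <= exp (- ((1 + r) * ln (INR (S n)))))%R).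
  { intros w n Hw. eapply Rle_trans. apply Hb. unfold r in Hw; lra. apply exp_le.
    pose proof (ln_S_pos n). unfold r in *. nra. }
  apply (cdiff_limit (fun N w => csum (fun n => f n w) N) _ z r B). unfold r; lra.
  - intros n w _. apply csum_cdiff. auto.
  - intros n w [[Hw _] _]. eapply Rle_trans; [|apply (HB n)].
    apply csum_bound. intros k. apply Hb'; auto.
  - intros w [[Hw _] _]. apply (csum_lim_correct _ (fun n => exp (- ((1 + r) * ln (INR (S n)))))%R).
    apply summable_power. unfold r; lra. intros; auto.
Qed.

Definition zeta_series (s : C) : C := csum_lim (fun n => inv_npow n s).

Lemma zeta_series_lim (s : C) : (1 < Re s)%R -> Clim (csum (fun n => inv_npow n s)) (zeta_series s).
Proof.
  intros Hs. apply (csum_lim_correct _ _ (summable_power (Re s) Hs)). intros n. rewrite Cmod_inv_npow. lra.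
Qed.

(* With [M_k(s) = sum_n int_0^1 (1-u)^k/k! (n+u)^(-s) du], integration by parts gives
   [M_k(s) = zeta(s)/(k+1)! - s M_(k+1)(s+1)], while [M_0(s) = 1/(s-1)]: knowing all [M_k] on a
   half-plane yields [zeta], and then all [M_k], one unit further to the left. *)
Definition moment_weight (k : nat) (u : R) : R := ((1 - u) ^ k / INR (fact k))%R.
Definition neg_ln_shift (n : nat) (u : R) : R := (- ln (INR (S n) + u))%R.
Definition unit_moment (k n : nat) (s : C) : C := CInt (fun u => RtoC (moment_weight k u) * Cexp (s * RtoC (neg_ln_shift n u))) 0 1.

Lemma INR_S_pos (n : nat) : (0 < INR (S n))%R.
Proof. apply lt_0_INR; lia. Qed.

Lemma moment_weight_continuous (k : nat) (u : R) : continuous (moment_weight k) u.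
Proof.
  apply (ex_derive_continuous (K := R_AbsRing) (V := R_NormedModule)). unfold moment_weight. auto_derive; [exact I|..].
Qed.

Lemma neg_ln_shift_derive (n : nat) (u : R) : (0 <= u)%R -> is_derive (neg_ln_shift n) u (- / (INR (S n) + u))%R.
Proof.
  intros Hu. unfold neg_ln_shift. generalize (INR (S n)) (INR_S_pos n). intros N HN.
  auto_derive. lra. field. lra.
Qed.

Lemma neg_ln_shift_continuous (n : nat) (u : R) : (0 <= u)%R -> continuous (neg_ln_shift n) u.
Proof.
  intros Hu. apply (ex_derive_continuous (K := R_AbsRing) (V := R_NormedModule)).
  eexists. now apply neg_ln_shift_derive.
Qed.

Lemma unit_moment_ccont (k n : nat) (s : C) (u : R) : (0 <= u)%R ->
  ccont (fun u => RtoC (moment_weight k u) * Cexp (s * RtoC (neg_ln_shift n u))) u.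
Proof.
  intros Hu. apply (ccont_exp_kernel (fun u => RtoC (moment_weight k u))).
  apply ccont_RtoC, moment_weight_continuous. now apply neg_ln_shift_continuous.
Qed.

Lemma unit_moment_cintble (k n : nat) (s : C) : cintble (fun u => RtoC (moment_weight k u) * Cexp (s * RtoC (neg_ln_shift n u))) 0 1.
Proof.
  apply cintble_cont. rewrite Rmin_left, Rmax_right by lra. intros. apply unit_moment_ccont. lra.
Qed.

Lemma unit_moment_cdiff (k n : nat) (s : C) : cdiff (unit_moment k n) s.
Proof.
  apply (CInt_exp_cdiff (fun u => RtoC (moment_weight k u)) (neg_ln_shift n) 0 1). lra.
  intros; apply ccont_RtoC, moment_weight_continuous. intros. apply neg_ln_shift_continuous. lra.
Qed.

(** The weight is at most 1 and [n + 1 + u >= n + 1]: the moments share the majorant of the zeta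
    series. *)
Lemma unit_moment_bound (k n : nat) (s : C) : (1 < Re s)%R -> (Cmod (unit_moment k n s) <= exp (- (Re s * ln (INR (S n)))))%R.
Proof.
  intros Hs. replace (exp (- (Re s * ln (INR (S n)))))%R with ((1 - 0) * exp (- (Re s * ln (INR (S n)))))%R by ring.
  apply CInt_bound. lra. apply unit_moment_cintble. intros u Hu.
  rewrite Cmod_mult, Cmod_R, Cmod_Cexp, Re_scal_r. unfold moment_weight, neg_ln_shift.
  assert (0 <= (1 - u) ^ k)%R by (apply pow_le; lra).
  assert ((1 - u) ^ k <= 1)%R. { apply Rle_trans with (1 ^ k)%R. apply pow_incr; lra. rewrite pow1; lra. }
  assert (Hf : (1 <= INR (fact k))%R). { apply (le_INR 1). pose proof (lt_O_fact k). lia. }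
  assert ((1 - u) ^ k / INR (fact k) <= 1)%R.
  { apply Rmult_le_reg_r with (INR (fact k)). lra. unfold Rdiv. rewrite Rmult_assoc, Rinv_l, Rmult_1_r by lra. lra. }
  rewrite Rabs_pos_eq. 2: { apply Rdiv_le_0_compat; lra. }
  replace (exp (- (Re s * ln (INR (S n)))))%R with (1 * exp (- (Re s * ln (INR (S n)))))%R by ring.
  apply Rmult_le_compat. apply Rdiv_le_0_compat; lra. left; apply exp_pos. auto.
  apply exp_le. pose proof (INR_S_pos n).
  assert (ln (INR (S n)) <= ln (INR (S n) + u))%R.
  { destruct (Req_dec u 0) as [->|Hn]. rewrite Rplus_0_r; lra. left. apply ln_increasing; lra. }
  nra.
Qed.

Lemma Cexp_neg_ln_shift_div (s : C) (n : nat) (u : R) : (0 <= u)%R ->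
  Cexp ((s + 1) * RtoC (neg_ln_shift n u)) = RtoC (/ (INR (S n) + u)) * Cexp (s * RtoC (neg_ln_shift n u)).
Proof.
  intros Hu. replace ((s + 1) * RtoC (neg_ln_shift n u)) with (RtoC (neg_ln_shift n u) + s * RtoC (neg_ln_shift n u)) by ring.
  rewrite Cexp_plus, Cexp_RtoC. unfold neg_ln_shift. rewrite exp_Ropp, exp_ln. reflexivity.
  pose proof (INR_S_pos n). lra.
Qed.

Lemma RtoC_neq (x : R) : x <> 0%R -> RtoC x <> 0.
Proof. intros H E. apply RtoC_inj in E. auto. Qed.

(** Integration by parts: [moment_weight (S k)] is a primitive of [- moment_weight k] that vanishes
    at 1, and the boundary term at 0 is [(n + 1)^(-s) / (k + 1)!]. *)
Lemma unit_moment_parts (k n : nat) (s : C) :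
  unit_moment k n s = inv_npow n s * RtoC (/ INR (fact (S k))) - s * unit_moment (S k) n (s + 1).
Proof.
  assert (E : CInt (fun u => RtoC (moment_weight k u) * Cexp (s * RtoC (neg_ln_shift n u))
      + s * (RtoC (moment_weight (S k) u) * Cexp ((s + 1) * RtoC (neg_ln_shift n u)))) 0 1 =
     inv_npow n s * RtoC (/ INR (fact (S k)))).
  { rewrite (CInt_derive (fun u => RtoC (- moment_weight (S k) u) * Cexp (s * RtoC (neg_ln_shift n u)))).
    - unfold moment_weight, neg_ln_shift, inv_npow. rewrite Rplus_0_r. replace (1 - 1)%R with 0%R by ring.
      rewrite pow_i by lia. rewrite Rminus_0_r, pow1.
      replace (- (0 / INR (fact (S k))))%R with 0%R by (unfold Rdiv; ring).
      replace (- (1 / INR (fact (S k))))%R with (- / INR (fact (S k)))%R by (unfold Rdiv; ring).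
      rewrite (RtoC_opp (/ INR (fact (S k)))). Ceq. ring.
    - rewrite Rmin_left, Rmax_right by lra. intros u Hu.
      assert (Dw : is_derive (fun u => - moment_weight (S k) u)%R u (moment_weight k u)).
      { unfold moment_weight. auto_derive; [exact I|..].
        change (fact k + k * fact k)%nat with (S k * fact k)%nat. rewrite mult_INR. pose proof (INR_fact_neq_0 k). pose proof (INR_S_pos k).
        simpl pred. change (match k with O => 1 | S _ => INR k + 1 end)%R with (INR (S k)).
        change (1 + - u)%R with (1 - u)%R. field. split; auto; lra. }
      assert (De := is_derive_Cexp_real s (neg_ln_shift n) u _ (neg_ln_shift_derive n u ltac:(lra))).
      assert (Dm := is_derive_RtoC_mult _ _ _ _ _ Dw De).
      replace (RtoC (moment_weight k u) * Cexp (s * RtoC (neg_ln_shift n u)) + s * (RtoC (moment_weight (S k) u) * Cexp ((s + 1) * RtoC (neg_ln_shift n u))))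
        with (RtoC (moment_weight k u) * Cexp (s * RtoC (neg_ln_shift n u)) +
        RtoC (- moment_weight (S k) u) * (RtoC (- / (INR (S n) + u)) * (s * Cexp (s * RtoC (neg_ln_shift n u))))).
      exact Dm. rewrite Cexp_neg_ln_shift_div by lra. rewrite !RtoC_opp. Ceq. ring.
    - rewrite Rmin_left, Rmax_right by lra. intros u Hu. apply ccont_plus. apply unit_moment_ccont; lra.
      apply ccont_mult. apply ccont_const. apply unit_moment_ccont; lra. }
  rewrite CInt_plus, CInt_scal in E.
  - fold (unit_moment k n s) in E. fold (unit_moment (S k) n (s + 1)) in E. rewrite <- E. ring.
  - apply unit_moment_cintble.
  - apply unit_moment_cintble.
  - apply cintble_scal, unit_moment_cintble.
Qed.

Lemma unit_moment_0 (n : nat) (s : C) : (1 - s) * unit_moment 0 n s = inv_npow (S n) (s - 1) - inv_npow n (s - 1).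
Proof.
  unfold unit_moment. rewrite <- CInt_scal by apply unit_moment_cintble.
  rewrite (CInt_derive (fun u => Cexp ((s - 1) * RtoC (neg_ln_shift n u)))).
  - unfold neg_ln_shift, inv_npow. rewrite Rplus_0_r. rewrite (S_INR (S n)). reflexivity.
  - rewrite Rmin_left, Rmax_right by lra. intros u Hu.
    assert (De := is_derive_Cexp_real (s - 1) (neg_ln_shift n) u _ (neg_ln_shift_derive n u ltac:(lra))).
    replace ((1 - s) * (RtoC (moment_weight 0 u) * Cexp (s * RtoC (neg_ln_shift n u)))) with
      (RtoC (- / (INR (S n) + u)) * ((s - 1) * Cexp ((s - 1) * RtoC (neg_ln_shift n u)))). exact De.
    replace (s * RtoC (neg_ln_shift n u)) with ((s - 1 + 1) * RtoC (neg_ln_shift n u)) by (f_equal; ring).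
    rewrite Cexp_neg_ln_shift_div by lra. unfold moment_weight. simpl. replace (1 / 1)%R with 1%R by field. rewrite RtoC_opp. Ceq. ring.
  - rewrite Rmin_left, Rmax_right by lra. intros u Hu.
    apply ccont_mult. apply ccont_const. apply unit_moment_ccont; lra.
Qed.

Definition moment_series (k : nat) (s : C) : C := csum_lim (fun n => unit_moment k n s).

Lemma moment_series_lim (k : nat) (s : C) : (1 < Re s)%R -> Clim (csum (fun n => unit_moment k n s)) (moment_series k s).
Proof.
  intros Hs. apply (csum_lim_correct _ _ (summable_power (Re s) Hs)). intros n. now apply unit_moment_bound.
Qed.

Lemma moment_series_parts (k : nat) (s : C) : (1 < Re s)%R ->
  moment_series k s = zeta_series s * RtoC (/ INR (fact (S k))) - s * moment_series (S k) (s + 1).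
Proof.
  intros Hs. apply (Clim_unique (csum (fun n => unit_moment k n s))). now apply moment_series_lim.
  apply (Clim_ext (fun N => RtoC (/ INR (fact (S k))) * csum (fun n => inv_npow n s) N
     - s * csum (fun n => unit_moment (S k) n (s + 1)) N)).
  - intros N. rewrite <- !csum_scal. induction N; cbn [csum]. ring. rewrite <- IHN, (unit_moment_parts k N). ring.
  - rewrite (Cmult_comm (zeta_series s)). apply Clim_minus; apply Clim_scal. now apply zeta_series_lim.
    apply moment_series_lim. reim. lra.
Qed.

(** The sum telescopes: together the unit intervals make up the integral of [x^(-s)] over
    [x > 1]. *)
Lemma moment_series_0 (s : C) : (1 < Re s)%R -> (s - 1) * moment_series 0 s = 1.
Proof.
  intros Hs. apply (Clim_unique (fun N => (s - 1) * csum (fun n => unit_moment 0 n s) N)).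
  - apply Clim_scal. now apply moment_series_lim.
  - apply (Clim_ext (fun N => 1 - inv_npow N (s - 1))).
    + intros N. rewrite <- csum_scal. induction N.
      * simpl. unfold inv_npow. simpl. rewrite ln_1, Ropp_0, Cmult_0_r, Cexp_0. ring.
      * cbn [csum]. rewrite <- IHN. replace ((s - 1) * unit_moment 0 N s) with (- ((1 - s) * unit_moment 0 N s)) by ring.
        rewrite unit_moment_0. ring.
    + intros eps He. destruct (power_tends_0 (Re s - 1) eps) as [N HN]; try lra. exists N. intros n Hn.
      replace (1 - inv_npow n (s - 1) - 1) with (- inv_npow n (s - 1)) by ring. rewrite Cmod_opp, Cmod_inv_npow.
      reim. auto.
Qed.

(* [zeta_num m] continues [(s - 1) zeta s] to [Re s > - m], and [moment_cont m k] continues [(s - 1) moment_series k s] to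
   [Re s > 1 - m]; the factor [s - 1] removes the only pole. *)
Fixpoint moment_cont (m k : nat) (s : C) : C :=
  match m with
  | O => (s - 1) * moment_series k s
  | S m' => (1 + (s - 1) * moment_cont m' 1 (s + 1)) * RtoC (/ INR (fact (S k))) - (s - 1) * moment_cont m' (S k) (s + 1)
  end.
Definition zeta_num (m : nat) (s : C) : C := 1 + (s - 1) * moment_cont m 1 (s + 1).

Lemma moment_cont_cdiff (m : nat) : forall k s, (1 - INR m < Re s)%R -> cdiff (moment_cont m k) s.
Proof.
  induction m as [|m IH]; intros k s Hs; simpl moment_cont.
  - simpl in Hs. apply (cdiff_mult (fun s => s - 1)). cdiff_tac.
    apply (csum_lim_cdiff (unit_moment k)). intros; apply unit_moment_cdiff. intros; now apply unit_moment_bound. lra.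
  - rewrite S_INR in Hs.
    assert (D : forall j, cdiff (fun s => moment_cont m j (s + 1)) s).
    { intros j. apply (cdiff_comp (moment_cont m j) (fun s => s + 1)). apply IH. reim. lra. cdiff_tac. }
    cdiff_tac; apply D.
Qed.

Lemma zeta_num_cdiff (m : nat) (s : C) : (- INR m < Re s)%R -> cdiff (zeta_num m) s.
Proof.
  intros Hs. unfold zeta_num. cdiff_tac. apply (cdiff_comp (moment_cont m 1) (fun s => s + 1)).
  apply moment_cont_cdiff. reim. lra. cdiff_tac.
Qed.

Lemma zeta_num_0 (s : C) : (1 < Re s)%R -> zeta_num 0 s = (s - 1) * zeta_series s.
Proof.
  intros Hs. unfold zeta_num. simpl moment_cont. pose proof (moment_series_parts 0 s Hs) as E. pose proof (moment_series_0 s Hs) as E0.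
  simpl in E. replace (/ 1)%R with 1%R in E by field.
  replace (1 + (s - 1) * ((s + 1 - 1) * moment_series 1 (s + 1))) with ((s - 1) * moment_series 0 s + (s - 1) * (s * moment_series 1 (s + 1))).
  rewrite E. ring. rewrite E0. ring.
Qed.

(** Successive continuations agree where both are meaningful: at the base by integration by parts,
    afterwards because the recursion carries the equality one unit to the left. *)
Lemma moment_cont_S (m : nat) : forall k s, (1 - INR m < Re s)%R -> moment_cont (S m) k s = moment_cont m k s.
Proof.
  induction m as [|m IH]; intros k s Hs.
  - simpl in Hs. assert (Hs' : (1 < Re s)%R) by lra.
    change (zeta_num 0 s * RtoC (/ INR (fact (S k))) - (s - 1) * ((s + 1 - 1) * moment_series (S k) (s + 1)) = (s - 1) * moment_series k s).
    rewrite zeta_num_0, (moment_series_parts k) by auto. ring.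
  - rewrite S_INR in Hs.
    change ((1 + (s - 1) * moment_cont (S m) 1 (s + 1)) * RtoC (/ INR (fact (S k))) - (s - 1) * moment_cont (S m) (S k) (s + 1) = moment_cont (S m) k s).
    rewrite !IH by (reim; lra). reflexivity.
Qed.

Lemma zeta_num_add (m j : nat) (s : C) : (- INR m < Re s)%R -> zeta_num (m + j) s = zeta_num m s.
Proof.
  intros Hs. induction j. now rewrite Nat.add_0_r. rewrite <- IHj, Nat.add_succ_r. unfold zeta_num. rewrite moment_cont_S. reflexivity.
  rewrite plus_INR. reim. pose proof (pos_INR j). lra.
Qed.

(** [Gamma_shift s] merely supplies some [m] with [Re s > - m]; by [zeta_num_add] a larger one gives
    the same value, so a fixed one can be used near a point. *)
Definition zeta_cont (s : C) : C := zeta_num (Gamma_shift s) s / (s - 1).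

Lemma zeta_cont_eq (n : nat) (s : C) : (- INR n < Re s)%R -> zeta_cont s = zeta_num n s / (s - 1).
Proof.
  intros Hn. destruct (Gamma_shift_spec s) as [H1 H2]. specialize (H2 n ltac:(lra)).
  unfold zeta_cont. f_equal. replace n with (Gamma_shift s + (n - Gamma_shift s))%nat by lia.
  rewrite zeta_num_add. reflexivity. lra.
Qed.

Lemma is_series_Clim (f : nat -> C) (l : C) :
  Clim (csum f) l <-> is_series (K := C_AbsRing) (V := C_NormedModule) f l.
Proof.
  split.
  - intros H P [eps HP]. destruct (H eps (cond_pos eps)) as [N HN]. exists N. intros n Hn.
    apply HP. apply C_NormedModule_mixin_compat1. 
    change (Cmod (sum_n (G := C_AbelianMonoid) f n - l) < eps)%R. rewrite csum_sum_n. apply HN. lia.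
  - intros H eps He. assert (He2 : (0 < eps / 2)%R) by lra.
    destruct (H (fun z => ball (M := C_UniformSpace) l (mkposreal _ He2) z)) as [N HN].
    { exists (mkposreal _ He2). auto. }
    exists (S N). intros n Hn. destruct n; [lia|]. specialize (HN n ltac:(lia)).
    apply (C_NormedModule_mixin_compat2 l _ (mkposreal _ He2)) in HN.
    change (Cmod (sum_n (G := C_AbelianMonoid) f n - l) < sqrt 2 * (eps / 2))%R in HN.
    rewrite csum_sum_n in HN. eapply Rlt_le_trans. exact HN.
    assert (sqrt 2 <= 2)%R.
    { rewrite <- (sqrt_Rsqr 2) at 2 by lra. apply sqrt_le_1_alt. unfold Rsqr; lra. }
    nra.
Qed.

Lemma zeta_cont_right (s : C) : (1 < Re s)%R -> zeta_cont s = zeta_series s.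
Proof.
  intros Hs. rewrite (zeta_cont_eq 0) by (simpl; lra). rewrite zeta_num_0 by auto. field.
  apply Cminus_neq_0, Cneq_by_re. reim. lra.
Qed.

Lemma is_zeta_exists : is_zeta zeta_cont.
Proof.
  split.
  - intros s Hs. apply is_series_Clim. rewrite zeta_cont_right by auto.
    apply (Clim_ext (csum (fun n => inv_npow n s))). intros n. apply csum_ext. intros; apply inv_npow_inv.
    now apply zeta_series_lim.
  - intros s Hs. apply cdiff_holomorphic. destruct (INR_unbounded (1 - Re s)) as [n Hn].
    apply (cdiff_ext_loc (fun w => zeta_num n w / (w - 1)) _ s 1). lra.
    + intros w Hw. symmetry. apply zeta_cont_eq. pose proof (re_le_Cmod (w - s)).
      apply Rabs_le_between in H. rewrite Re_minus in H. lra.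
    + cdiff_tac. now apply Cminus_neq_0. apply zeta_num_cdiff. lra.
Qed.

(** [zeta] is a choice and is known through [is_zeta] alone; [zeta_cont] serves to show that there
    is something to choose. *)
Lemma zeta_is_zeta : is_zeta zeta.
Proof. unfold zeta. apply epsilon_spec. exists zeta_cont. apply is_zeta_exists. Qed.

Lemma zeta_right (s : C) : (1 < Re s)%R -> zeta s = zeta_series s.
Proof.
  intros Hs. destruct zeta_is_zeta as [H _]. specialize (H s Hs). apply is_series_Clim in H.
  apply (Clim_unique (csum (fun n => inv_npow n s))); [|now apply zeta_series_lim].
  revert H. apply Clim_ext. intros n. apply csum_ext. intros. now rewrite inv_npow_inv.
Qed.

Lemma zeta_cdiff (s : C) : s <> 1 -> cdiff zeta s.
Proof. intros Hs. apply cdiff_holomorphic. now apply zeta_is_zeta. Qed.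

(** * Theta *)

(** The residue rule for a simple zero of [f]: with [v = f w / (w - z0)] close to [l], the error
    splits into [(p w - p z0) / v] and [p z0 (v - l) / (v l)]. *)
Lemma punctured_limit_quotient (f p : C -> C) (z0 l : C) : is_cderiv f z0 l -> f z0 = 0 -> l <> 0 ->
  cdiff p z0 -> punctured_limit (fun w => (w - z0) * (p w / f w)) z0 (p z0 / l).
Proof.
  intros Hf H0 Hl Hp eps He.
  assert (Hm : (0 < Cmod l)%R) by now apply Cmod_gt_0. set (m := Cmod l) in *.
  set (Q := Cmod (p z0)). assert (HQ : (0 <= Q)%R) by apply Cmod_ge_0.
  (* [m / 2] ensures [|v| >= m / 2]; the other bound makes the second part of the error at most
     [eps / 2]. *)
  set (e1 := Rmin (m / 2) (eps * (m * m) / (4 * (Q + 1)))).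
  assert (He1 : (0 < e1)%R).
  { apply Rmin_pos. lra. apply Rdiv_lt_0_compat; [|lra]. repeat apply Rmult_lt_0_compat; lra. }
  assert (He1a : (e1 <= m / 2)%R) by apply Rmin_l.
  assert (He1b : (e1 * (4 * (Q + 1)) <= eps * (m * m))%R).
  { replace (eps * (m * m))%R with (eps * (m * m) / (4 * (Q + 1)) * (4 * (Q + 1)))%R by (field; lra).
    apply Rmult_le_compat_r. lra. apply Rmin_r. }
  destruct (Hf e1 He1) as [d1 [Hd1 D1]].
  assert (He2 : (0 < eps * m / 4)%R) by nra.
  destruct (cderiv_cont p z0 Hp (eps * m / 4)%R He2) as [d2 [Hd2 D2]].
  exists (Rmin d1 d2). split. now apply Rmin_pos. intros w Hw Hwd.
  specialize (D1 w (Rlt_le_trans _ _ _ Hwd (Rmin_l _ _))).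
  specialize (D2 w (Rlt_le_trans _ _ _ Hwd (Rmin_r _ _))).
  assert (Hw0 := Cminus_neq_0 _ _ Hw). assert (Hwp : (0 < Cmod (w - z0))%R) by now apply Cmod_gt_0.
  set (v := f w / (w - z0)).
  assert (Ev : (Cmod (v - l) <= e1)%R).
  { rewrite H0 in D1. replace (f w - 0 - l * (w - z0)) with ((v - l) * (w - z0)) in D1 by (unfold v; field; auto).
    rewrite Cmod_mult in D1. eapply Rmult_le_reg_r; eauto. }
  assert (Hv : (m / 2 <= Cmod v)%R).
  { pose proof (Cmod_rev_triangle l v). rewrite Cmod_sub_sym in H. fold m in H. lra. }
  assert (Hv0 : v <> 0) by (apply Cmod_gt_0; lra).
  assert (Hfw : f w <> 0). { intros E. apply Hv0. unfold v. rewrite E. unfold Cdiv. ring. }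
  replace ((w - z0) * (p w / f w) - p z0 / l) with ((p w - p z0) * / v - p z0 * (v - l) * / (v * l))
    by (unfold v; field; auto).
  eapply Rle_trans. apply Cmod_le_sum. rewrite !Cmod_mult, !Cmod_inv, Cmod_mult by (auto; now apply Cmult_neq_0).
  fold m Q. assert (/ Cmod v <= 2 / m)%R.
  { replace (2 / m)%R with (/ (m / 2))%R by (field; lra). apply Rinv_le_contravar; lra. }
  assert (0 < / Cmod v)%R by (apply Rinv_0_lt_compat; lra).
  assert (A1 : (Cmod (p w - p z0) * / Cmod v <= eps / 2)%R).
  { replace (eps / 2)%R with (eps * m / 4 * (2 / m))%R by (field; lra).
    apply Rmult_le_compat; try lra. apply Cmod_ge_0. }
  assert (A2 : (Q * Cmod (v - l) * / (Cmod v * m) <= eps / 2)%R).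
  { rewrite Rinv_mult. apply Rle_trans with (Q * e1 * (2 / m * / m))%R.
    - apply Rmult_le_compat.
      + apply Rmult_le_pos; auto. apply Cmod_ge_0.
      + apply Rmult_le_pos; [lra|]. left; apply Rinv_0_lt_compat; lra.
      + apply Rmult_le_compat_l; auto.
      + apply Rmult_le_compat_r; auto. left; apply Rinv_0_lt_compat; lra.
    - apply Rmult_le_reg_r with (m * m)%R. nra.
      replace (Q * e1 * (2 / m * / m) * (m * m))%R with (2 * Q * e1)%R by (field; lra). nra. }
  lra.
Qed.

Lemma strip_small_dominated (f : C -> C) (s1 s2 K : R) :
  (forall x y, (s1 <= x <= s2)%R -> (Cmod (f (x, y)) <= K / (1 + y * y))%R) -> strip_small f s1 s2.
Proof.
  intros H eps He. exists (Rabs K / eps + 1)%R. intros x y Hx Hy.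
  eapply Rle_trans. apply H; auto. pose proof (Rabs_pos K). pose proof (Rle_abs K).
  assert (0 <= Rabs K / eps)%R by (apply Rdiv_le_0_compat; lra).
  assert (Ey : (y * y = Rabs y * Rabs y)%R). { rewrite <- Rabs_mult. symmetry. apply Rabs_pos_eq. nra. }
  apply Rmult_le_reg_r with (1 + y * y)%R. nra.
  unfold Rdiv at 1. rewrite Rmult_assoc, Rinv_l, Rmult_1_r by nra.
  assert (Rabs K = eps * (Rabs K / eps))%R by (field; lra).
  assert (Rabs K / eps <= y * y)%R by nra. nra.
Qed.

Lemma cos_sin_2PI_n (n : nat) : cos (2 * PI * INR n) = 1%R /\ sin (2 * PI * INR n) = 0%R.
Proof.
  replace (2 * PI * INR n)%R with (0 + 2 * INR n * PI)%R by ring.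
  rewrite cos_period, sin_period. now rewrite cos_0, sin_0.
Qed.

Section Theta.
Variable x : R.
Hypothesis Hx : (0 < x)%R.

Let px : (0 < PI * x)%R. Proof. apply Rmult_lt_0_compat; auto. apply PI_RGT_0. Qed.

(* [exp (pi x w^2) / (exp (2 pi w) - 1)] has the poles [w = i n] with residues
   [exp (- pi x n^2) / (2 pi)]; on the lines [Re w = 1] and [Re w = -1] the denominator is expanded
   into a geometric series, whose terms integrate to Gaussians. *)
Definition gauss (w : C) : C := Cexp (RtoC (PI * x) * (w * w)).
Definition exp_2pi (w : C) : C := Cexp (RtoC (2 * PI) * w).
Definition theta_quotient (w : C) : C := gauss w / (exp_2pi w - 1).

Lemma gauss_cdiff w : cdiff gauss w.
Proof. unfold gauss. cdiff_tac. Qed.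
Lemma exp_2pi_cdiff w : cdiff exp_2pi w.
Proof. unfold exp_2pi. cdiff_tac. Qed.

Lemma Cmod_gauss (c y : R) : Cmod (gauss (c, y)) = exp (PI * x * (c * c) - PI * x * (y * y)).
Proof. unfold gauss. rewrite Cmod_Cexp. f_equal. simpl. ring. Qed.

(** A constant with [1 / (1 + pi x y^2) <= gauss_const / (1 + y^2)], where the left side dominates
    [exp (- pi x y^2)]. *)
Definition gauss_const : R := (1 + / (PI * x))%R.

Lemma gauss_const_pos : (0 < gauss_const)%R.
Proof. unfold gauss_const. pose proof (Rinv_0_lt_compat _ px). lra. Qed.

Lemma exp_neg_sq (y : R) : (exp (- (PI * x * (y * y))) <= gauss_const / (1 + y * y))%R.
Proof.
  rewrite exp_Ropp. pose proof (exp_ineq1_le (PI * x * (y * y))).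
  assert (0 <= y * y)%R by nra. assert (Hi := Rinv_0_lt_compat _ px).
  assert (E : (PI * x * / (PI * x) = 1)%R) by (apply Rinv_r; lra).
  assert (0 < 1 + PI * x * (y * y))%R by nra.
  apply Rle_trans with (/ (1 + PI * x * (y * y)))%R. apply Rinv_le_contravar; lra.
  apply Rmult_le_reg_r with (1 + y * y)%R. nra.
  unfold Rdiv. rewrite (Rmult_assoc gauss_const), Rinv_l, Rmult_1_r by nra.
  apply Rmult_le_reg_l with (1 + PI * x * (y * y))%R. auto. 
  rewrite <- Rmult_assoc, Rinv_r, Rmult_1_l by lra. unfold gauss_const.
  set (Y := (y * y)%R) in *. set (i := (/ (PI * x))%R) in *. set (P := (PI * x)%R) in *.
  replace ((1 + P * Y) * (1 + i))%R with (1 + P * Y + i + P * i * Y)%R by ring. rewrite E. nra.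
Qed.

Lemma gauss_bound (c y C0 : R) : (c * c <= C0)%R ->
  (Cmod (gauss (c, y)) <= exp (PI * x * C0) * gauss_const / (1 + y * y))%R.
Proof.
  intros Hc. rewrite Cmod_gauss. unfold Rminus. rewrite exp_plus. unfold Rdiv. rewrite (Rmult_assoc (exp (PI * x * C0))).
  apply Rmult_le_compat; try (left; apply exp_pos). apply exp_le. nra. apply exp_neg_sq.
Qed.

Lemma gauss_dominated (c : R) : dominated (fun y => gauss (c, y)) (exp (PI * x * (c * c)) * gauss_const).
Proof.
  split. intros t. apply (ccont_vline gauss), gauss_cdiff.
  intros t. apply gauss_bound. lra.
Qed.

(** Its value [1 / sqrt x] is never computed directly: independence of [c], the scaling in [x] and
    theta itself at [x = 1] determine it. *)
Definition gauss_integral (c : R) : C := LInt (fun y => gauss (c, y)).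

Lemma gauss_integral_lt (c1 c2 : R) : (c1 < c2)%R -> gauss_integral c1 = gauss_integral c2.
Proof.
  intros Hc. apply (strip_shift gauss c1 c2); auto.
  - intros; apply gauss_cdiff.
  - apply (strip_small_dominated _ _ _ (exp (PI * x * (c1 * c1 + c2 * c2)) * gauss_const)). intros u y Hu.
    apply gauss_bound. destruct (Rle_dec 0 u); nra.
  - apply (LInt_correct _ _ (gauss_dominated c1)).
  - apply (LInt_correct _ _ (gauss_dominated c2)).
Qed.

Lemma gauss_integral_const (c1 c2 : R) : gauss_integral c1 = gauss_integral c2.
Proof.
  destruct (Rtotal_order c1 c2) as [H|[H|H]]. now apply gauss_integral_lt. now subst. symmetry; now apply gauss_integral_lt.
Qed.

(** Completing the square: [pi x w^2 + 2 pi kap w = pi x (w + kap / x)^2 - pi kap^2 / x], so an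
    exponential factor only moves the line of integration. *)
Lemma gauss_fourier (c kap y : R) :
  gauss (c, y) * Cexp (RtoC (2 * PI * kap) * (c, y)) =
  RtoC (exp (- (PI * (/ x) * (kap * kap)))) * gauss ((c + kap / x)%R, y).
Proof.
  unfold gauss. rewrite <- Cexp_RtoC, <- !Cexp_plus. f_equal.
  apply C_eq; simpl; field; lra.
Qed.

Lemma exp_2pi_ne_1 (c y : R) : (0 < c * c)%R -> exp_2pi (c, y) - 1 <> 0.
Proof.
  intros Hc E. assert (E' : Cmod (exp_2pi (c, y)) = 1%R).
  { replace (exp_2pi (c, y)) with (exp_2pi (c, y) - 1 + 1) by ring. rewrite E, Cplus_0_l. apply Cmod_1. }
  unfold exp_2pi in E'. rewrite Cmod_Cexp in E'. simpl in E'.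
  replace (2 * PI * c - 0 * y)%R with (2 * PI * c)%R in E' by ring.
  assert (2 * PI * c = 0)%R. { apply exp_inv. now rewrite exp_0. }
  pose proof PI_RGT_0. assert (c = 0)%R by nra. subst. lra.
Qed.

Lemma exp_2pi_minus_1_bound (c y : R) : (c = 1 \/ c = -1)%R -> (1 / 2 <= Cmod (exp_2pi (c, y) - 1))%R.
Proof.
  intros Hc.
  assert (E : Cmod (exp_2pi (c, y)) = exp (2 * PI * c)).
  { unfold exp_2pi. rewrite Cmod_Cexp. f_equal. simpl. ring. }
  pose proof PI2_1.
  (* This makes the denominator at least 2 on the right line and at least 2/3 on the left one. *)
  assert (H2 : (3 <= exp (2 * PI))%R) by (pose proof (exp_ineq1_le (2 * PI)); lra).
  destruct Hc as [-> | ->].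
  - pose proof (Cmod_rev_triangle (exp_2pi (1%R, y)) 1). rewrite Cmod_1, E, Rmult_1_r in H0. lra.
  - pose proof (Cmod_rev_triangle 1 (exp_2pi ((-1)%R, y))). rewrite Cmod_1, E, Cmod_sub_sym in H0.
    replace (2 * PI * -1)%R with (- (2 * PI))%R in H0 by ring. rewrite exp_Ropp in H0.
    assert (/ exp (2 * PI) <= / 3)%R by (apply Rinv_le_contravar; lra). lra.
Qed.

Lemma theta_quotient_cdiff w : exp_2pi w - 1 <> 0 -> cdiff theta_quotient w.
Proof.
  intros H. unfold theta_quotient. apply (cdiff_div gauss (fun w => exp_2pi w - 1)); auto.
  apply gauss_cdiff. apply (cdiff_minus exp_2pi). apply exp_2pi_cdiff. apply cdiff_const.
Qed.

Definition theta_const : R := (2 * (exp (PI * x) * gauss_const))%R.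

Lemma theta_quotient_bound (c y : R) : (c = 1 \/ c = -1)%R -> (Cmod (theta_quotient (c, y)) <= theta_const / (1 + y * y))%R.
Proof.
  intros Hc. unfold theta_quotient. assert (Hcc : (c * c = 1)%R) by (destruct Hc; subst; ring).
  assert (H1 := exp_2pi_minus_1_bound c y Hc).
  rewrite Cmod_div by (apply exp_2pi_ne_1; lra).
  assert (H2 := gauss_bound c y 1 ltac:(lra)). rewrite Rmult_1_r in H2.
  unfold theta_const. replace (2 * (exp (PI * x) * gauss_const) / (1 + y * y))%R with (exp (PI * x) * gauss_const / (1 + y * y) * 2)%R by (unfold Rdiv; ring).
  unfold Rdiv at 1. apply Rmult_le_compat; auto. apply Cmod_ge_0. left; apply Rinv_0_lt_compat; lra.
  replace 2%R with (/ (1 / 2))%R by field. apply Rinv_le_contravar; lra.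
Qed.

Lemma theta_quotient_dominated (c : R) : (c = 1 \/ c = -1)%R -> dominated (fun y => theta_quotient (c, y)) theta_const.
Proof.
  intros Hc. split. intros t. apply (ccont_vline theta_quotient), theta_quotient_cdiff, exp_2pi_ne_1. destruct Hc; subst; lra.
  intros t. now apply theta_quotient_bound.
Qed.

Definition theta_line_right : C := LInt (fun y => theta_quotient (1%R, y)).
Definition theta_line_left : C := LInt (fun y => theta_quotient ((-1)%R, y)).

(** [1 / (q - 1) + 1 / (1 / q - 1) = - 1]. It expresses the integral along [Re w = -1] by the one
    along [Re w = 1], so that a single expansion suffices. *)
Lemma theta_quotient_opp (w : C) : exp_2pi w - 1 <> 0 -> theta_quotient (- w) = (- (1)) * gauss w + (- (1)) * theta_quotient w.
Proof.
  intros H. unfold theta_quotient. replace (gauss (- w)) with (gauss w) by (unfold gauss; f_equal; ring).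
  assert (E : exp_2pi (- w) = / exp_2pi w).
  { unfold exp_2pi. rewrite <- Cexp_opp. f_equal. ring. }
  assert (Hw : exp_2pi w <> 0) by apply Cexp_neq_0.
  rewrite E. field. repeat split; auto. intros E1. apply H.
  replace (exp_2pi w - 1) with (- (1 - exp_2pi w)) by ring. rewrite E1. ring.
Qed.

Lemma theta_line_left_eq : theta_line_left = - gauss_integral 1 - theta_line_right.
Proof.
  unfold theta_line_left.
  rewrite (LInt_unique _ (LInt (fun y => (- (1)) * gauss (1%R, y) + (- (1)) * theta_quotient (1%R, y)))).
  - rewrite (LInt_plus _ _ _ _ (dominated_scal _ _ _ (gauss_dominated 1)) (dominated_scal _ _ _ (theta_quotient_dominated 1 (or_introl eq_refl)))).
    rewrite (LInt_scal _ _ _ (gauss_dominated 1)), (LInt_scal _ _ _ (theta_quotient_dominated 1 (or_introl eq_refl))).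
    unfold gauss_integral, theta_line_right. ring.
  - assert (D := dominated_plus _ _ _ _ (dominated_scal _ _ (- (1)) (gauss_dominated 1)) (dominated_scal _ _ (- (1)) (theta_quotient_dominated 1 (or_introl eq_refl)))).
    assert (H := is_line_reflect _ _ (proj1 D) (LInt_correct _ _ D)).
    revert H. apply is_line_ext. intros t. cbv beta.
    rewrite <- theta_quotient_opp by (apply exp_2pi_ne_1; lra). f_equal. apply C_eq; simpl; ring.
Qed.

Definition theta_term (y : R) (n : nat) : R := exp (- (PI * y * (INR (S n) * INR (S n)))).

Lemma geometric_remainder (w : C) (K : nat) : exp_2pi w - 1 <> 0 ->
  / (exp_2pi w - 1) = csum (fun k => Cexp (RtoC (2 * PI * - INR (S k)) * w)) K
     + Cexp (RtoC (2 * PI * - INR K) * w) / (exp_2pi w - 1).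
Proof.
  intros H. induction K.
  - simpl. replace (RtoC (2 * PI * - 0) * w) with (RtoC 0).
    2: { replace (2 * PI * - 0)%R with 0%R by ring. ring. }
    rewrite Cexp_0. field. auto.
  - cbn [csum]. rewrite IHK at 1.
    assert (E : Cexp (RtoC (2 * PI * - INR K) * w) = Cexp (RtoC (2 * PI * - INR (S K)) * w) * exp_2pi w).
    { unfold exp_2pi. rewrite <- Cexp_plus. f_equal. rewrite S_INR, <- Cmult_plus_distr_r, <- RtoC_plus.
      f_equal. f_equal. ring. }
    rewrite E. field. auto.
Qed.

(** By [gauss_fourier] the [k]-th term of the geometric series is a Gaussian on another vertical
    line times [theta_term (/ x) k]; the remainder after [K] terms carries the factor
    [exp (- 2 pi K)]. *)
Lemma theta_line_right_lim : Clim (csum (fun k => gauss_integral 1 * RtoC (theta_term (/ x) k))) theta_line_right.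
Proof.
  set (T := fun k y => gauss (1%R, y) * Cexp (RtoC (2 * PI * - INR (S k)) * (1%R, y))).
  assert (ET : forall k y, T k y = RtoC (theta_term (/ x) k) * gauss ((1 + - INR (S k) / x)%R, y)).
  { intros k y. unfold T. rewrite gauss_fourier. f_equal. unfold theta_term. do 3 f_equal. ring. }
  assert (DT : forall k, exists L, dominated (T k) L).
  { intros k. eexists. pose proof (dominated_scal _ _ (RtoC (theta_term (/ x) k)) (gauss_dominated (1 + - INR (S k) / x))) as [D1 D2].
    split. intros t. eapply ccont_ext; [|apply D1]. intros; symmetry; apply ET.
    intros t. rewrite ET. apply D2. }
  assert (IT : forall k, LInt (T k) = gauss_integral 1 * RtoC (theta_term (/ x) k)).
  { intros k. rewrite (LInt_ext _ _ (ET k)), (LInt_scal _ _ _ (gauss_dominated _)).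
    rewrite Cmult_comm. f_equal. apply gauss_integral_const. }
  assert (Sum : forall K, (exists L, dominated (fun y => csum (fun k => T k y) K) L) /\
     LInt (fun y => csum (fun k => T k y) K) = csum (fun k => gauss_integral 1 * RtoC (theta_term (/ x) k)) K).
  { intros K. 
    (* Some majorant for each term; a finite sum asks for no uniformity. *)
    set (a := fun k => epsilon (inhabits 0%R) (fun L => dominated (T k) L)).
    assert (Da : forall k, dominated (T k) (a k)). { intros k. unfold a. apply epsilon_spec, DT. }
    split. eexists. apply (dominated_csum T a K Da).
    rewrite (LInt_csum T a K Da). apply csum_ext. intros; apply IT. }
  apply (Clim_squeeze _ _ (fun K => (4 * theta_const) * (/ exp (2 * PI)) ^ K)%R).
  - intros K. destruct (Sum K) as [[L DL] EL]. rewrite <- EL.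
    rewrite Cmod_sub_sym. set (P := fun y => csum (fun k => T k y) K) in *.
    set (rem := fun y => theta_quotient (1%R, y) * Cexp (RtoC (2 * PI * - INR K) * (1%R, y))).
    assert (Er : forall y, theta_quotient (1%R, y) = P y + rem y).
    { intros y. unfold P, rem, theta_quotient, T. rewrite csum_scal. unfold Cdiv at 1.
      rewrite (geometric_remainder (1%R, y) K) at 1 by (apply exp_2pi_ne_1; lra). field. apply exp_2pi_ne_1; lra. }
    assert (Dr : dominated rem (theta_const * (/ exp (2 * PI)) ^ K)).
    { split.
      - intros t. apply ccont_mult. apply (theta_quotient_dominated 1). auto.
        apply (ccont_vline (fun w => Cexp (RtoC (2 * PI * - INR K) * w))). cdiff_tac.
      - intros t. unfold rem. rewrite Cmod_mult, Cmod_Cexp.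
        replace (Re (RtoC (2 * PI * - INR K) * (1%R, t))) with (- (2 * PI) * INR K)%R by (simpl; ring).
        replace (exp (- (2 * PI) * INR K)) with ((/ exp (2 * PI)) ^ K)%R.
        2: { rewrite <- exp_Ropp. clear. induction K. simpl. rewrite Rmult_0_r, exp_0. auto.
          simpl pow. rewrite IHK, <- exp_plus. f_equal. rewrite S_INR. ring. }
        pose proof (theta_quotient_bound 1 t (or_introl eq_refl)).
        replace (theta_const * (/ exp (2 * PI)) ^ K / (1 + t * t))%R with (theta_const / (1 + t * t) * (/ exp (2 * PI)) ^ K)%R by (unfold Rdiv; ring).
        apply Rmult_le_compat_r; auto. apply pow_le. left; apply Rinv_0_lt_compat, exp_pos. }
    replace (theta_line_right - LInt P) with (LInt rem).
    2: { unfold theta_line_right. rewrite (LInt_ext _ _ Er), (LInt_plus _ _ _ _ DL Dr). ring. }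
    eapply Rle_trans. apply (LInt_bound _ _ Dr). right; ring.
  - replace (Finite 0) with (Rbar_mult (4 * theta_const)%R (Finite 0)) by (simpl; f_equal; ring).
    apply is_lim_seq_scal_l. apply is_lim_seq_geom.
    rewrite Rabs_pos_eq by (left; apply Rinv_0_lt_compat, exp_pos).
    rewrite <- Rinv_1. apply Rinv_lt_contravar. rewrite Rmult_1_l; apply exp_pos.
    pose proof PI_RGT_0. pose proof (exp_ineq1_le (2 * PI)). lra.
Qed.

Lemma exp_2pi_int (r : R) : cos (2 * PI * r) = 1%R -> sin (2 * PI * r) = 0%R -> exp_2pi (0%R, r) = 1.
Proof.
  intros Hc Hs. unfold exp_2pi, Cexp. simpl. 
  replace (2 * PI * 0 - 0 * r)%R with 0%R by ring. replace (2 * PI * r + 0 * 0)%R with (2 * PI * r)%R by ring.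
  rewrite exp_0, Hc, Hs. apply C_eq; simpl; ring.
Qed.

(** The modulus forces [c = 0]; then [1 - cos (2 pi t) = 2 sin^2 (pi t)] vanishes for [|t| <= 1 / 2]
    only at 0. *)
Lemma exp_2pi_eq_1 (c t : R) : (- / 2 <= t <= / 2)%R -> exp_2pi (c, t) = 1 -> c = 0%R /\ t = 0%R.
Proof.
  intros Ht E. pose proof PI_RGT_0.
  assert (Hc : c = 0%R).
  { destruct (Req_dec c 0); auto. exfalso. apply (exp_2pi_ne_1 c t). nra. rewrite E. ring. }
  subst. split; auto. unfold exp_2pi, Cexp in E. apply (f_equal Re) in E. simpl in E.
  replace (2 * PI * 0 - 0 * t)%R with 0%R in E by ring. replace (2 * PI * t + 0 * 0)%R with (2 * (PI * t))%R in E by ring.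
  rewrite exp_0, cos_2a_sin in E.
  assert (S0 : (sin (PI * t) = 0)%R) by nra.
  destruct (Req_dec t 0) as [|Hn]; auto. exfalso.
  destruct (Rle_dec 0 t).
  - assert (0 < sin (PI * t))%R. { apply sin_gt_0; nra. } lra.
  - assert (0 < sin (PI * - t))%R. { apply sin_gt_0; nra. }
    replace (PI * - t)%R with (- (PI * t))%R in H0 by ring. rewrite sin_neg in H0. lra.
Qed.

(** The hypotheses on [cos] and [sin] say that [r] is an integer of either sign, without a cast. The
    box of height 1 about [i r] contains this pole alone. *)
Lemma theta_quotient_box (r : R) : cos (2 * PI * r) = 1%R -> sin (2 * PI * r) = 0%R ->
  rect_integral theta_quotient (-1) 1 (r - / 2) (r + / 2) = Ci * RtoC (exp (- (PI * x * (r * r)))).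
Proof.
  intros Hc Hs. pose proof PI_RGT_0. assert (HPI : RtoC (2 * PI) <> 0) by (apply RtoC_neq; lra).
  assert (Hw1 := exp_2pi_int r Hc Hs).
  rewrite (rect_residue theta_quotient (-1) 1 (r - / 2) (r + / 2) (0%R, r) (gauss (0%R, r) / RtoC (2 * PI))).
  - replace (gauss (0%R, r)) with (RtoC (exp (- (PI * x * (r * r))))).
    field. auto. unfold gauss. rewrite <- Cexp_RtoC. f_equal. apply C_eq; simpl; ring.
  - simpl. lra.
  - simpl. lra.
  - intros [c y] [Z1 Z2] Hne. simpl in Z1, Z2. apply theta_quotient_cdiff. intros E.
    destruct (exp_2pi_eq_1 c (y - r)) as [E1 E2]. lra.
    + replace (exp_2pi (c, (y - r)%R)) with (exp_2pi (c, y) * / exp_2pi (0%R, r)).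
      rewrite Hw1. replace (exp_2pi (c, y)) with (exp_2pi (c, y) - 1 + 1) by ring. rewrite E. field.
      unfold exp_2pi. rewrite <- Cexp_opp, <- Cexp_plus. f_equal. apply C_eq; simpl; ring.
    + apply Hne. apply C_eq; simpl; lra.
  - apply (punctured_limit_quotient (fun w => exp_2pi w - 1) gauss).
    + replace (RtoC (2 * PI)) with ((0 * (0%R, r) + RtoC (2 * PI) * 1) * exp_2pi (0%R, r) + 0) by (rewrite Hw1; ring).
      apply (is_cderiv_plus exp_2pi (fun _ => - (1))). 2: apply is_cderiv_const.
      apply (is_cderiv_comp Cexp (fun w => RtoC (2 * PI) * w)). apply is_cderiv_Cexp.
      apply (is_cderiv_mult (fun _ => RtoC (2 * PI)) (fun w => w)). apply is_cderiv_const. apply is_cderiv_id.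
    + rewrite Hw1. ring.
    + auto.
    + apply gauss_cdiff.
Qed.

(** Boxes are stacked symmetrically; the poles [i n] and [- i n] have equal residues, whence the
    factor 2. *)
Lemma theta_quotient_boxes (N : nat) :
  rect_integral theta_quotient (-1) 1 (- (INR N + / 2)) (INR N + / 2) =
  Ci * (1 + 2 * csum (fun n => RtoC (theta_term x n)) N).
Proof.
  assert (Side : forall t, cdiff theta_quotient ((-1)%R, t) /\ cdiff theta_quotient (1%R, t)).
  { intros t. split; apply theta_quotient_cdiff, exp_2pi_ne_1; lra. }
  induction N.
  - replace (- (INR 0 + / 2))%R with (0 - / 2)%R by (simpl; ring). simpl INR. rewrite theta_quotient_box.
    simpl. rewrite !Rmult_0_r, Ropp_0, exp_0. ring.
    rewrite Rmult_0_r; apply cos_0. rewrite Rmult_0_r; apply sin_0.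
  - pose proof (pos_INR N). assert (ES : INR (S N) = (INR N + 1)%R) by apply S_INR.
    rewrite (rect_split_y theta_quotient (-1) 1 _ (- (INR N + / 2)) _) by (auto; lra).
    rewrite (rect_split_y theta_quotient (-1) 1 (- (INR N + / 2)) (INR N + / 2) _) by (auto; lra).
    rewrite IHN. destruct (cos_sin_2PI_n (S N)) as [C1 S1].
    replace (- (INR N + / 2))%R with (- INR (S N) + / 2)%R at 1 by (rewrite ES; field).
    replace (- (INR (S N) + / 2))%R with (- INR (S N) - / 2)%R by field.
    replace (rect_integral theta_quotient (-1) 1 (INR N + / 2) (INR (S N) + / 2)) with
      (rect_integral theta_quotient (-1) 1 (INR (S N) - / 2) (INR (S N) + / 2)) by (f_equal; rewrite ES; field).
    rewrite !theta_quotient_box; auto.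
    + replace (- INR (S N) * - INR (S N))%R with (INR (S N) * INR (S N))%R by ring.
      cbn [csum]. change (exp (- (PI * x * (INR (S N) * INR (S N))))) with (theta_term x N). ring.
    + replace (2 * PI * - INR (S N))%R with (- (2 * PI * INR (S N)))%R by ring. now rewrite cos_neg.
    + replace (2 * PI * - INR (S N))%R with (- (2 * PI * INR (S N)))%R by ring. rewrite sin_neg, S1. ring.
Qed.

(** At half-integral heights [exp_2pi] is real and negative, so the denominator has modulus at least
    1 on the whole side. *)
Lemma theta_quotient_horizontal (N : nat) (y : R) : (y = INR N + / 2 \/ y = - (INR N + / 2))%R ->
  (Cmod (CInt (fun u => theta_quotient (u, y)) (-1) 1) <= 2 * (exp (PI * x) * gauss_const / (1 + y * y)))%R.
Proof.
  intros Hy. destruct (cos_sin_2PI_n N) as [C1 S1].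
  assert (Hcs : cos (2 * PI * y) = (-1)%R /\ sin (2 * PI * y) = 0%R).
  { destruct Hy as [-> | ->].
    - replace (2 * PI * (INR N + / 2))%R with (2 * PI * INR N + PI)%R by field.
      rewrite neg_cos, neg_sin, C1, S1. split; ring.
    - replace (2 * PI * - (INR N + / 2))%R with (- (2 * PI * INR N + PI))%R by field.
      rewrite cos_neg, sin_neg, neg_cos, neg_sin, C1, S1. split; ring. }
  destruct Hcs as [Hc Hs].
  assert (W : forall u, exp_2pi (u, y) = RtoC (- exp (2 * PI * u))).
  { intros u. unfold exp_2pi, Cexp. simpl.
    replace (2 * PI * u - 0 * y)%R with (2 * PI * u)%R by ring. replace (2 * PI * y + 0 * u)%R with (2 * PI * y)%R by ring.
    rewrite Hc, Hs. apply C_eq; simpl; ring. }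
  assert (W1 : forall u, (1 <= Cmod (exp_2pi (u, y) - 1))%R).
  { intros u. rewrite W, <- RtoC_minus, Cmod_R. pose proof (exp_pos (2 * PI * u)). rewrite Rabs_left; lra. }
  replace 2%R with (1 - -1)%R by ring.
  assert (W0 : forall u, exp_2pi (u, y) - 1 <> 0). { intros u. apply Cmod_gt_0. pose proof (W1 u). lra. }
  apply CInt_bound. lra.
  - apply (cintble_hline theta_quotient). lra. intros u Hu. now apply theta_quotient_cdiff.
  - intros u Hu. unfold theta_quotient. rewrite Cmod_div by auto.
    assert (B := gauss_bound u y 1 ltac:(nra)). rewrite Rmult_1_r in B.
    eapply Rle_trans; [|exact B]. unfold Rdiv. rewrite <- (Rmult_1_r (Cmod (gauss (u, y)))) at 2.
    apply Rmult_le_compat_l. apply Cmod_ge_0. apply Rle_trans with (/ 1)%R; [|rewrite Rinv_1; lra]. apply Rinv_le_contravar. lra. apply W1.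
Qed.

Lemma theta_residues : Clim (fun N => 1 + 2 * csum (fun n => RtoC (theta_term x n)) N) (theta_line_right - theta_line_left).
Proof.
  intros eps He.
  destruct (LInt_correct _ _ (theta_quotient_dominated 1 (or_introl eq_refl)) (eps / 4)%R ltac:(lra)) as [M1 H1].
  destruct (LInt_correct _ _ (theta_quotient_dominated (-1) (or_intror eq_refl)) (eps / 4)%R ltac:(lra)) as [M2 H2].
  fold theta_line_right in H1. fold theta_line_left in H2.
  set (Q := (exp (PI * x) * gauss_const)%R). assert (HQ : (0 < Q)%R) by (apply Rmult_lt_0_compat; [apply exp_pos|apply gauss_const_pos]).
  destruct (INR_unbounded (Rabs M1 + Rabs M2 + 16 * Q / eps)) as [N HN].
  assert (0 < 16 * Q / eps)%R by (apply Rdiv_lt_0_compat; lra).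
  pose proof (Rabs_pos M1). pose proof (Rabs_pos M2). pose proof (Rle_abs M1). pose proof (Rle_abs M2).
  exists N. intros n Hn. apply le_INR in Hn.
  set (T := (INR n + / 2)%R). assert (HT : (0 < T)%R) by (unfold T; pose proof (pos_INR n); lra).
  assert (E := theta_quotient_boxes n). fold T in E. unfold rect_integral in E.
  specialize (H1 (- T)%R T ltac:(unfold T; lra) ltac:(unfold T; lra)).
  specialize (H2 (- T)%R T ltac:(unfold T; lra) ltac:(unfold T; lra)).
  assert (B1 := theta_quotient_horizontal n T (or_introl eq_refl)).
  assert (B2 := theta_quotient_horizontal n (- T) (or_intror eq_refl)).
  replace (- T * - T)%R with (T * T)%R in B2 by ring. fold Q in B1, B2.
  assert (Small : (Q / (1 + T * T) <= eps / 16)%R).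
  { apply Rmult_le_reg_r with (1 + T * T)%R. nra. unfold Rdiv at 1. rewrite Rmult_assoc, Rinv_l, Rmult_1_r by nra.
    assert (16 * Q / eps <= 1 + T * T)%R. { assert (16 * Q / eps <= T)%R by (unfold T; lra). nra. }
    replace Q with (eps / 16 * (16 * Q / eps))%R by (field; lra).
    apply Rmult_le_compat_l; lra. }
  set (X := 1 + 2 * csum (fun n => RtoC (theta_term x n)) n) in *.
  set (h1 := CInt (fun u => theta_quotient (u, (- T)%R)) (-1) 1) in *. set (h2 := CInt (fun u => theta_quotient (u, T)) (-1) 1) in *.
  set (v1 := CInt (fun y => theta_quotient (1%R, y)) (- T) T) in *. set (v2 := CInt (fun y => theta_quotient ((-1)%R, y)) (- T) T) in *.
  assert (HCi : Ci <> 0). { intros E0. apply (f_equal Im) in E0. simpl in E0. lra. }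
  assert (EX : X - (theta_line_right - theta_line_left) = / Ci * (h1 - h2) + ((v1 - theta_line_right) - (v2 - theta_line_left))).
  { replace X with (/ Ci * (Ci * X)) by (field; auto). rewrite <- E. field. auto. }
  rewrite EX. eapply Rle_lt_trans. apply Cmod_triangle. rewrite Cmod_mult, Cmod_inv, Cmod_Ci by auto.
  pose proof (Cmod_le_sum h1 h2). pose proof (Cmod_le_sum (v1 - theta_line_right) (v2 - theta_line_left)). lra.
Qed.

End Theta.

(** * The transformation of theta *)

Lemma theta_term_summable (x : R) : (0 < x)%R -> summable (theta_term x).
Proof.
  intros Hx. split. intros; left; apply exp_pos.
  destruct (summable_power 2 ltac:(lra)) as [_ [B HB]].
  assert (Hpx : (0 < PI * x)%R) by (apply Rmult_lt_0_compat; auto; apply PI_RGT_0).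
  exists (B * / (PI * x))%R. intros N.
  eapply Rle_trans; [|apply Rmult_le_compat_r; [left; now apply Rinv_0_lt_compat|apply (HB N)]].
  rewrite <- rsum_scal_r. induction N; simpl. lra.
  apply Rplus_le_compat; auto. change (match N with O => 1 | S _ => INR N + 1 end)%R with (INR (S N)).
  unfold theta_term. set (m := INR (S N)). assert (Hm : (0 < m)%R) by apply INR_S_pos.
  replace (- (2 * ln m))%R with (- (ln (m * m)))%R by (rewrite ln_mult by auto; ring).
  rewrite (exp_Ropp (ln (m * m))), exp_ln by nra. rewrite exp_Ropp, <- Rinv_mult.
  pose proof (exp_ineq1_le (PI * x * (m * m))). apply Rinv_le_contravar.
  { apply Rmult_lt_0_compat; auto. nra. } { lra. }
Qed.

(** Riemann's psi, the half of theta over [n >= 1]: theta is [1 + 2 psi]. *)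
Definition psi (x : R) : C := csum_lim (fun n => RtoC (theta_term x n)).

Lemma Cmod_theta_term (x : R) (n : nat) : Cmod (RtoC (theta_term x n)) = theta_term x n.
Proof. rewrite Cmod_R, Rabs_pos_eq; auto. left; apply exp_pos. Qed.

Lemma psi_lim (x : R) : (0 < x)%R -> Clim (csum (fun n => RtoC (theta_term x n))) (psi x).
Proof.
  intros Hx. apply (csum_lim_correct _ _ (theta_term_summable x Hx)). intros n. rewrite Cmod_theta_term. lra.
Qed.

(** The right line minus the left one is twice the right line plus the bare Gaussian integral, and
    the right line is that Gaussian integral times [psi (/ x)]. *)
Lemma theta_raw (x : R) : (0 < x)%R -> 1 + 2 * psi x = gauss_integral x 1 * (1 + 2 * psi (/ x)).
Proof.
  intros Hx. assert (Hi : (0 < / x)%R) by now apply Rinv_0_lt_compat.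
  assert (E1 : theta_line_right x = gauss_integral x 1 * psi (/ x)).
  { apply (Clim_unique _ _ _ (theta_line_right_lim x Hx)).
    apply (Clim_ext (fun N => gauss_integral x 1 * csum (fun n => RtoC (theta_term (/ x) n)) N)).
    intros n. now rewrite csum_scal. apply Clim_scal. now apply psi_lim. }
  transitivity (theta_line_right x - theta_line_left x).
  - apply (Clim_unique (fun N => 1 + 2 * csum (fun n => RtoC (theta_term x n)) N)); [|now apply theta_residues].
    apply Clim_plus. apply Clim_const. apply Clim_scal. now apply psi_lim.
  - rewrite theta_line_left_eq, E1 by auto. ring.
Qed.

Lemma gauss_integral_scale (x : R) : (0 < x)%R -> gauss_integral 1 0 = RtoC (sqrt x) * gauss_integral x 0.
Proof.
  intros Hx. assert (Hq : (0 < sqrt x)%R) by now apply sqrt_lt_R0.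
  assert (Eq : (sqrt x * sqrt x = x)%R) by (apply sqrt_sqrt; lra).
  set (f := fun y => gauss 1 (0%R, y)).
  assert (D := gauss_dominated 1 Rlt_0_1 0). fold f in D.
  assert (Dx := gauss_dominated x Hx 0).
  apply (is_line_unique f). apply (LInt_correct _ _ D).
  intros eps He. destruct (LInt_correct _ _ Dx (eps / sqrt x)%R) as [M HM]. { apply Rdiv_lt_0_compat; auto. }
  fold (gauss_integral x 0) in HM.
  exists (M * sqrt x)%R. intros a b Ha Hb.
  assert (E : RtoC (sqrt x) * CInt (fun y => gauss x (0%R, y)) (a / sqrt x) (b / sqrt x) = CInt f a b).
  { pose proof (CInt_comp_lin f (sqrt x) 0 (a / sqrt x) (b / sqrt x)) as K.
    replace (sqrt x * (a / sqrt x) + 0)%R with a in K by (field; lra).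
    replace (sqrt x * (b / sqrt x) + 0)%R with b in K by (field; lra).
    rewrite <- K by (apply cintble_cont'; apply D). f_equal. apply CInt_ext. intros y _.
    unfold f, gauss. f_equal. rewrite <- Eq at 1. apply C_eq; simpl; ring. }
  rewrite <- E. rewrite <- (Cmult_comm (gauss_integral x 0)), (Cmult_comm (RtoC (sqrt x))).
  replace (CInt (fun y => gauss x (0%R, y)) (a / sqrt x) (b / sqrt x) * RtoC (sqrt x) - gauss_integral x 0 * RtoC (sqrt x))
    with ((CInt (fun y => gauss x (0%R, y)) (a / sqrt x) (b / sqrt x) - gauss_integral x 0) * RtoC (sqrt x)) by ring.
  rewrite Cmod_mult, Cmod_R, Rabs_pos_eq by lra.
  replace eps with (eps / sqrt x * sqrt x)%R by (field; lra). apply Rmult_le_compat_r. lra.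
  apply HM.
  - apply Rmult_le_reg_r with (sqrt x); auto. replace (a / sqrt x * sqrt x)%R with a by (field; lra). lra.
  - apply Rmult_le_reg_r with (sqrt x); auto. replace (b / sqrt x * sqrt x)%R with b by (field; lra). lra.
Qed.

Lemma theta_functional (x : R) : (0 < x)%R ->
  RtoC (sqrt x) * (1 + 2 * psi x) = 1 + 2 * psi (/ x).
Proof.
  intros Hx.
  (* Theta at 1 can be divided by: its terms are positive and the constant one is 1. *)
  assert (Hne : 1 + 2 * psi 1 <> 0).
  { intros E. assert (HR : (1 <= Re (1 + 2 * psi 1))%R).
    { apply Rnot_lt_le. intros Hlt.
      assert (L : Clim (fun N => 1 + 2 * csum (fun n => RtoC (theta_term 1 n)) N) (1 + 2 * psi 1)).
      { apply Clim_plus. apply Clim_const. apply Clim_scal. apply psi_lim. lra. }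
      destruct (L (1 - Re (1 + 2 * psi 1))%R ltac:(lra)) as [N HN]. specialize (HN N (le_n N)).
      pose proof (re_le_Cmod (1 + 2 * csum (fun n => RtoC (theta_term 1 n)) N - (1 + 2 * psi 1))) as HR.
      rewrite Re_minus in HR. apply Rabs_le_between in HR.
      assert (P : forall n, (0 <= Re (csum (fun n => RtoC (theta_term 1 n)) n))%R).
      { induction n. simpl. lra. cbn [csum]. rewrite Re_plus, Re_RtoC. pose proof (exp_pos (- (PI * 1 * (INR (S n) * INR (S n))))).
        unfold theta_term at 2. lra. }
      assert (1 <= Re (1 + 2 * csum (fun n => RtoC (theta_term 1 n)) N))%R.
      { rewrite Re_plus, Re_RtoC. replace (Re (2 * csum (fun n => RtoC (theta_term 1 n)) N)) with (2 * Re (csum (fun n => RtoC (theta_term 1 n)) N))%R.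
        specialize (P N). lra. destruct (csum (fun n => RtoC (theta_term 1 n)) N). simpl. ring. }
      lra. }
    rewrite E in HR. simpl in HR. lra. }
  (* theta at the fixed point x = 1 evaluates the Gaussian integral *)
  assert (A1 : gauss_integral 1 0 = 1).
  { pose proof (theta_raw 1 Rlt_0_1) as H. rewrite Rinv_1 in H. rewrite (gauss_integral_const 1 Rlt_0_1 0 1).
    replace (gauss_integral 1 1) with (gauss_integral 1 1 * (1 + 2 * psi 1) / (1 + 2 * psi 1)) by (field; auto).
    rewrite <- H. field. auto. }
  rewrite (theta_raw x Hx), (gauss_integral_const x Hx 1 0).
  rewrite Cmult_assoc, <- gauss_integral_scale by auto. rewrite A1. ring.
Qed.

(** * The entire function Xi *)

(** The maximum of [y^p exp (- y)] is attained at [y = p], which is where the constant comes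
    from. *)
Lemma exp_neg_power (p y : R) : (0 < p)%R -> (0 < y)%R ->
  (exp (- y) <= exp (p * ln p - p) * exp (- (p * ln y)))%R.
Proof.
  intros Hp Hy. rewrite <- exp_plus. apply exp_le.
  assert (H : (ln (y / p) <= y / p - 1)%R).
  { pose proof (exp_ineq1_le (ln (y / p))). rewrite exp_ln in H. lra. now apply Rdiv_lt_0_compat. }
  rewrite ln_div in H by auto. apply Rmult_le_compat_l with (r := p) in H; [|lra].
  replace (p * (y / p - 1))%R with (y - p)%R in H by (field; lra). lra.
Qed.

(** As [pi >= 2], one copy of [exp (- X)] can be split off [exp (- pi X m^2)], with [X = e^u] and
    [m = n + 1]. The rest is traded for the power [(X m^2)^(-p)], which separates [n] from [u]. *)
Lemma theta_term_bound (p u : R) (n : nat) : (0 < p)%R ->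
  (theta_term (exp u) n <= exp (p * ln p - p) * exp (- (2 * p * ln (INR (S n)))) * (exp (- exp u) * exp (- (p * u))))%R.
Proof.
  intros Hp. unfold theta_term. set (m := INR (S n)).
  assert (Hm : (1 <= m)%R). { apply (le_INR 1). lia. }
  pose proof (exp_pos u). pose proof PI2_1.
  set (X := exp u) in *. assert (Hmm : (1 <= m * m)%R) by nra.
  apply Rle_trans with (exp (- (X * (m * m))) * exp (- X))%R.
  - rewrite <- exp_plus. apply exp_le.
    assert (X <= X * (m * m))%R by nra. assert (2 * (X * (m * m)) <= PI * (X * (m * m)))%R.
    { apply Rmult_le_compat_r; nra. } lra.
  - assert (B := exp_neg_power p (X * (m * m)) Hp ltac:(nra)).
    rewrite ln_mult in B by nra. unfold X in B at 2. rewrite ln_exp, ln_mult in B by lra.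
    apply Rle_trans with (exp (p * ln p - p) * exp (- (p * (u + (ln m + ln m)))) * exp (- X))%R.
    apply Rmult_le_compat_r; auto. left; apply exp_pos.
    right. replace (- (p * (u + (ln m + ln m))))%R with (- (2 * p * ln m) + - (p * u))%R by ring.
    rewrite exp_plus. ring.
Qed.

Definition psi_exp (u : R) : C := psi (exp u).

Lemma theta_term_kernel_dominated (z : C) : (/ 2 < Re z)%R -> exists a, summable a /\
  forall n, dominated (fun u => RtoC (theta_term (exp u) n) * Cexp (z * RtoC u)) (a n).
Proof.
  (* [2 p > 1] makes the sum over [n] converge, and [p < Re z] the integral at [u -> - oo]. *)
  intros Hz. set (p := ((Re z + / 2) / 2)%R).
  assert (Hp : (/ 2 < p < Re z)%R) by (unfold p; lra).
  destruct (exp_exp_dominated (Re z - p)) as [K HK]. lra.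
  assert (HK0 : (0 <= K)%R).
  { specialize (HK 0%R). pose proof (exp_pos (- exp 0)). pose proof (exp_pos ((Re z - p) * 0)).
    replace (K / (1 + 0 * 0))%R with K in HK by field. nra. }
  set (c := (exp (p * ln p - p) * K)%R).
  assert (Hc : (0 <= c)%R). { apply Rmult_le_pos; auto. left; apply exp_pos. }
  destruct (summable_power (2 * p)) as [Ha [B HB]]. lra.
  exists (fun n => exp (- (2 * p * ln (INR (S n)))) * c)%R. split.
  - split. intros n. apply Rmult_le_pos; auto.
    exists (B * c)%R. intros n. rewrite rsum_scal_r. apply Rmult_le_compat_r; auto.
  - intros n. split.
    + intros t. apply (ccont_exp_kernel (fun u => RtoC (theta_term (exp u) n)) (fun u => u)).
      * apply ccont_RtoC. unfold theta_term. apply (ex_derive_continuous (K := R_AbsRing) (V := R_NormedModule)).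
        auto_derive. auto.
      * apply continuous_id.
    + intros u. rewrite Cmod_mult, Cmod_theta_term, Cmod_Cexp, Re_scal_r.
      eapply Rle_trans. apply Rmult_le_compat_r. left; apply exp_pos. apply (theta_term_bound p). lra.
      specialize (HK u).
      replace (exp ((Re z - p) * u)) with (exp (- (p * u)) * exp (Re z * u))%R in HK.
      2: { rewrite <- exp_plus. f_equal. ring. }
      set (A := exp (p * ln p - p)) in *. set (W := exp (- (2 * p * ln (INR (S n))))).
      assert (0 < A)%R by apply exp_pos. assert (0 < W)%R by apply exp_pos.
      replace (A * W * (exp (- exp u) * exp (- (p * u))) * exp (Re z * u))%R with
        (W * (A * (exp (- exp u) * (exp (- (p * u)) * exp (Re z * u)))))%R by ring.
      unfold c. replace (W * (A * K) / (1 + u * u))%R with (W * (A * (K / (1 + u * u))))%R by (unfold Rdiv; ring).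
      apply Rmult_le_compat_l; [lra|]. apply Rmult_le_compat_l; lra.
Qed.

(** A translation of [u] by [ln (pi m^2)], with [m = n + 1], in Euler's integral; it produces the
    factor [(pi m^2)^(-z)]. *)
Lemma LInt_theta_term (z : C) (n : nat) : (/ 2 < Re z)%R ->
  LInt (fun u => RtoC (theta_term (exp u) n) * Cexp (z * RtoC u)) = Rcpow PI (- z) * Euler_laplace z * inv_npow n (2 * z).
Proof.
  intros Hz. destruct (Euler_laplace_dominated z) as [K DK]. lra.
  set (m := INR (S n)). assert (Hm : (0 < m)%R) by apply INR_S_pos. pose proof PI_RGT_0.
  set (v := (ln PI + 2 * ln m)%R).
  assert (Ev : exp v = (PI * (m * m))%R).
  { unfold v. replace (2 * ln m)%R with (ln m + ln m)%R by ring. rewrite !exp_plus, !exp_ln by auto. ring. }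
  assert (L := is_line_shift _ _ v (proj1 DK) (LInt_correct _ _ DK)). fold (Euler_laplace z) in L.
  set (c := Cexp (- z * RtoC v)).
  assert (Ec : c = Rcpow PI (- z) * inv_npow n (2 * z)).
  { unfold c, Rcpow, inv_npow. rewrite <- Cexp_plus. f_equal. fold m. unfold v. rewrite RtoC_plus, RtoC_mult, RtoC_opp. ring. }
  assert (Cs : forall t, ccont (fun t => euler_kernel (t + v) * Cexp (z * RtoC (t + v))) t).
  { intros t. apply (ccont_comp_real (fun t => euler_kernel t * Cexp (z * RtoC t)) (fun t => (t + v)%R)). apply DK.
    apply (continuous_plus (V := R_NormedModule)). apply continuous_id. apply continuous_const. }
  assert (L2 := is_line_scal _ _ c Cs L).
  rewrite (LInt_unique _ (c * Euler_laplace z)).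
  - rewrite Ec. ring.
  - revert L2. apply is_line_ext. intros t. unfold euler_kernel, theta_term. fold m. rewrite exp_plus, Ev.
    replace (PI * exp t * (m * m))%R with (exp t * (PI * (m * m)))%R by ring.
    unfold c. rewrite RtoC_plus. replace (z * (RtoC t + RtoC v)) with (z * RtoC t + z * RtoC v) by ring.
    rewrite Cexp_plus. replace (- z * RtoC v) with (- (z * RtoC v)) by ring. rewrite Cexp_opp.
    field. apply Cexp_neq_0.
Qed.

(** In the variable [x = e^u] this is Riemann's Mellin transform of psi, obtained by integrating
    term by term. *)
Lemma psi_exp_mellin (z : C) : (/ 2 < Re z)%R ->
  (exists K, dominated (fun u => psi_exp u * Cexp (z * RtoC u)) K) /\
  LInt (fun u => psi_exp u * Cexp (z * RtoC u)) = Rcpow PI (- z) * Euler_laplace z * zeta_series (2 * z).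
Proof.
  intros Hz. destruct (theta_term_kernel_dominated z Hz) as [a [Sa Da]].
  assert (HS : forall u, Clim (csum (fun n => RtoC (theta_term (exp u) n) * Cexp (z * RtoC u))) (psi_exp u * Cexp (z * RtoC u))).
  { intros u. rewrite (Cmult_comm (psi_exp u)).
    apply (Clim_ext (fun N => Cexp (z * RtoC u) * csum (fun n => RtoC (theta_term (exp u) n)) N)).
    - intros N. rewrite <- csum_scal. apply csum_ext. intros; ring.
    - apply Clim_scal. apply psi_lim, exp_pos. }
  destruct (LInt_series _ _ a Sa Da HS) as [D L]. split; auto.
  apply (Clim_unique _ _ _ L).
  apply (Clim_ext (fun N => (Rcpow PI (- z) * Euler_laplace z) * csum (fun n => inv_npow n (2 * z)) N)).
  - intros N. rewrite <- csum_scal. apply csum_ext. intros. now rewrite LInt_theta_term.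
  - apply Clim_scal. apply zeta_series_lim. destruct z; simpl in *. lra.
Qed.

(** Continuity is read off the dominated integrand at [z = 1], multiplied by [exp (- u)]. *)
Lemma psi_exp_ccont (u : R) : ccont psi_exp u.
Proof.
  destruct (psi_exp_mellin 1) as [[K [H _]] _]. { simpl. lra. }
  apply (ccont_ext (fun u => psi_exp u * Cexp (1 * RtoC u) * Cexp (- (1) * RtoC u))).
  - intros t. rewrite <- Cmult_assoc, <- Cexp_plus. replace (1 * RtoC t + - (1) * RtoC t) with (RtoC 0) by ring.
    rewrite Cexp_0. ring.
  - apply ccont_mult. apply H. apply (ccont_comp_holo (fun w => Cexp (- (1) * w)) RtoC). cdiff_tac.
    apply ccont_RtoC, continuous_id.
Qed.

Lemma psi_exp_bound : exists B, (0 <= B)%R /\ forall u, (0 <= u)%R -> (Cmod (psi_exp u) <= B * exp (- exp u))%R.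
Proof.
  destruct (summable_power 2 ltac:(lra)) as [_ [B HB]].
  set (c := exp (1 * ln 1 - 1)).
  exists (c * B)%R. split.
  { apply Rmult_le_pos. left; apply exp_pos. specialize (HB O). exact HB. }
  intros u Hu. apply (Clim_bound _ _ _ (psi_lim _ (exp_pos u))). intros n.
  eapply Rle_trans. apply (csum_bound _ (fun n => exp (- (2 * ln (INR (S n)))) * (c * exp (- exp u)))%R).
  - intros k. rewrite Cmod_theta_term. eapply Rle_trans. apply (theta_term_bound 1). lra.
    fold c. replace (2 * 1)%R with 2%R by ring.
    assert (exp (- (1 * u)) <= 1)%R. { apply Rle_trans with (exp 0). apply exp_le; lra. rewrite exp_0; lra. }
    set (W := exp (- (2 * ln (INR (S k))))). assert (0 < W)%R by apply exp_pos.
    pose proof (exp_pos (- exp u)). assert (0 < c)%R by apply exp_pos.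
    replace (c * W * (exp (- exp u) * exp (- (1 * u))))%R with (W * (c * exp (- exp u)) * exp (- (1 * u)))%R by ring.
    rewrite <- (Rmult_1_r (W * (c * exp (- exp u)))) at 2. apply Rmult_le_compat_l; auto.
    apply Rmult_le_pos; [lra|]. apply Rmult_le_pos; lra.
  - rewrite rsum_scal_r. specialize (HB n). replace (c * B * exp (- exp u))%R with (B * (c * exp (- exp u)))%R by ring.
    apply Rmult_le_compat_r; auto. apply Rmult_le_pos; left; apply exp_pos.
Qed.

(* The kernel: [psi (e^u)] for [u >= 0], made symmetric by theta's functional equation; for [u < 0]
   it differs from [psi (e^u)] by the elementary term producing the poles at 0 and 1. *)
Definition ramp (u : R) : R := (Rmax (exp (- (u / 2)) - 1) 0 / 2)%R.
Definition xi_kernel (u : R) : C := psi_exp u - RtoC (ramp u).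

Lemma ramp_pos (u : R) : (0 <= u)%R -> ramp u = 0%R.
Proof.
  intros Hu. unfold ramp. rewrite Rmax_right. field.
  assert (exp (- (u / 2)) <= exp 0)%R by (apply exp_le; lra). rewrite exp_0 in H. lra.
Qed.
Lemma ramp_neg (u : R) : (u <= 0)%R -> ramp u = ((exp (- (u / 2)) - 1) / 2)%R.
Proof.
  intros Hu. unfold ramp. rewrite Rmax_left. reflexivity.
  assert (exp 0 <= exp (- (u / 2)))%R by (apply exp_le; lra). rewrite exp_0 in H. lra.
Qed.

Lemma ramp_continuous (u : R) : continuous ramp u.
Proof.
  apply (continuous_ext (fun u => ((exp (- (u / 2)) - 1) + Rabs (exp (- (u / 2)) - 1)) / 4)%R).
  - intros t. unfold ramp, Rmax. destruct (Rle_dec (exp (- (t / 2)) - 1) 0) as [r|r].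
    + rewrite Rabs_left1 by auto. match goal with |- ?x = ?y => change (@eq R x y) end. field.
    + rewrite Rabs_pos_eq by lra. match goal with |- ?x = ?y => change (@eq R x y) end. field.
  - assert (C1 : continuous (fun u => (exp (- (u / 2)) - 1)%R) u).
    { apply (ex_derive_continuous (K := R_AbsRing) (V := R_NormedModule)). auto_derive. auto. }
    apply (continuous_mult (K := R_AbsRing) (fun u => ((exp (- (u / 2)) - 1) + Rabs (exp (- (u / 2)) - 1))%R) (fun _ => / 4)%R).
    apply (continuous_plus (V := R_NormedModule)); auto.
    apply (continuous_comp (fun u => (exp (- (u / 2)) - 1)%R) Rabs); auto. apply continuous_Rabs.
    apply continuous_const.
Qed.

Lemma xi_kernel_ccont (u : R) : ccont xi_kernel u.
Proof. apply ccont_minus. apply psi_exp_ccont. apply ccont_RtoC, ramp_continuous. Qed.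

(** The theta relation reads [psi (e^(-u)) = e^(u/2) psi (e^u) + (e^(u/2) - 1) / 2], and the last
    term is [ramp (- u)]. *)
Lemma xi_kernel_sym_pos (u : R) : (0 <= u)%R -> xi_kernel (- u) = RtoC (exp (u / 2)) * xi_kernel u.
Proof.
  intros Hu. unfold xi_kernel, psi_exp. rewrite (ramp_pos u Hu), (ramp_neg (- u)) by lra.
  pose proof (theta_functional (exp u) (exp_pos u)) as H. rewrite <- exp_Ropp in H.
  assert (E : sqrt (exp u) = exp (u / 2)).
  { replace u with (u / 2 + u / 2)%R at 1 by field. rewrite exp_plus. apply sqrt_square. left; apply exp_pos. }
  rewrite E in H. replace (- (- u / 2))%R with (u / 2)%R by field.
  replace (psi (exp (- u))) with ((1 + 2 * psi (exp (- u)) - 1) / 2) by field.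
  rewrite <- H. replace (RtoC ((exp (u / 2) - 1) / 2)) with ((RtoC (exp (u / 2)) - 1) / 2).
  field. rewrite RtoC_div, RtoC_minus. reflexivity. lra.
Qed.

Lemma xi_kernel_sym (u : R) : xi_kernel (- u) = RtoC (exp (u / 2)) * xi_kernel u.
Proof.
  destruct (Rle_dec 0 u) as [H|H]. now apply xi_kernel_sym_pos.
  pose proof (xi_kernel_sym_pos (- u) ltac:(lra)) as K. rewrite Ropp_involutive in K. rewrite K.
  rewrite Cmult_assoc, <- RtoC_mult, <- exp_plus. replace (u / 2 + - u / 2)%R with 0%R by field.
  rewrite exp_0. ring.
Qed.

(** By symmetry the kernel decays doubly exponentially at both ends, so every strip is allowed and
    the transform is entire. *)
Lemma xi_kernel_laplace (al be : R) : exists K, laplace_dominated xi_kernel al be K.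
Proof.
  destruct psi_exp_bound as [B [HB0 HB]].
  (* The extra [1 / 2] pays for the factor [exp (v / 2)] that the reflection brings at negative
     [u]. *)
  set (c := (Rabs al + Rabs be + / 2)%R).
  pose proof (Rabs_pos al). pose proof (Rabs_pos be).
  destruct (exp_exp_dominated c) as [K HK]. unfold c; lra.
  exists (2 * B * K)%R. split. apply xi_kernel_ccont.
  intros u. set (v := Rabs u). assert (Hv : (0 <= v)%R) by apply Rabs_pos.
  assert (Ev : (u * u = v * v)%R). { unfold v. rewrite <- Rabs_mult. symmetry. apply Rabs_pos_eq. nra. }
  assert (Hk : (Cmod (xi_kernel u) <= B * exp (- exp v) * exp (v / 2))%R).
  { assert (P : forall t, (0 <= t)%R -> (Cmod (xi_kernel t) <= B * exp (- exp t))%R).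
    { intros t Ht. unfold xi_kernel. rewrite (ramp_pos t Ht). replace (psi_exp t - 0) with (psi_exp t) by ring. auto. }
    unfold v, Rabs. destruct (Rcase_abs u).
    - replace u with (- - u)%R at 1 by ring. rewrite xi_kernel_sym, Cmod_mult, Cmod_R, Rabs_pos_eq by (left; apply exp_pos).
      rewrite Rmult_comm. apply Rmult_le_compat_r. left; apply exp_pos. apply P. lra.
    - eapply Rle_trans. apply P. lra. 
      assert (1 <= exp (u / 2))%R. { rewrite <- exp_0. apply exp_le. lra. }
      assert (0 <= B * exp (- exp u))%R. { apply Rmult_le_pos; auto. left; apply exp_pos. } nra. }
  assert (He : forall t, (Rabs t <= Rabs al + Rabs be)%R -> (exp (t * u) <= exp ((c - / 2) * v))%R).
  { intros t Ht. apply exp_le. eapply Rle_trans. apply Rle_abs. rewrite Rabs_mult. fold v. unfold c.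
    apply Rmult_le_compat_r; lra. }
  pose proof (He al ltac:(lra)). pose proof (He be ltac:(lra)). specialize (HK v).
  replace (exp (c * v)) with (exp (v / 2) * exp ((c - / 2) * v))%R in HK by (rewrite <- exp_plus; f_equal; field).
  rewrite Ev. set (D := exp ((c - / 2) * v)) in *. assert (0 < D)%R by apply exp_pos.
  apply Rle_trans with (B * exp (- exp v) * exp (v / 2) * (2 * D))%R.
  - apply Rmult_le_compat; auto. apply Cmod_ge_0. pose proof (exp_pos (al * u)). pose proof (exp_pos (be * u)). lra. lra.
  - replace (2 * B * K / (1 + v * v))%R with (2 * B * (K / (1 + v * v)))%R by (unfold Rdiv; ring).
    replace (B * exp (- exp v) * exp (v / 2) * (2 * D))%R with (2 * B * (exp (- exp v) * (exp (v / 2) * D)))%R by ring.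
    apply Rmult_le_compat_l; lra.
Qed.

Definition xi_laplace (z : C) : C := LInt (fun u => xi_kernel u * Cexp (z * RtoC u)).

Lemma xi_kernel_dominated (z : C) : exists K, dominated (fun u => xi_kernel u * Cexp (z * RtoC u)) K.
Proof.
  destruct (xi_kernel_laplace (Re z) (Re z)) as [K HK]. exists K. apply (laplace_kernel_dominated xi_kernel (Re z) (Re z)); auto. lra.
Qed.

Lemma xi_laplace_cdiff (z : C) : cdiff xi_laplace z.
Proof.
  destruct (xi_kernel_laplace (Re z - 1) (Re z + 1)) as [K HK].
  apply (laplace_cdiff xi_kernel (Re z - 1) (Re z + 1) K); auto. lra.
Qed.

Lemma xi_laplace_bound (al be : R) : exists K, (0 <= K)%R /\ forall z, (al <= Re z <= be)%R -> (Cmod (xi_laplace z) <= K)%R.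
Proof.
  destruct (xi_kernel_laplace al be) as [K HK]. exists (Rmax 0 (4 * K)). split. apply Rmax_l.
  intros z Hz. eapply Rle_trans; [|apply Rmax_r]. apply LInt_bound.
  now apply (laplace_kernel_dominated xi_kernel al be).
Qed.

Lemma xi_laplace_sym (z : C) : xi_laplace (/ 2 - z) = xi_laplace z.
Proof.
  destruct (xi_kernel_dominated (/ 2 - z)) as [K D].
  symmetry. apply LInt_unique.
  pose proof (is_line_reflect _ _ (proj1 D) (LInt_correct _ _ D)) as H.
  revert H. apply is_line_ext. intros u. cbv beta. rewrite xi_kernel_sym.
  rewrite <- Cexp_RtoC. rewrite (Cmult_comm (Cexp _)), <- Cmult_assoc, <- Cexp_plus. f_equal. f_equal.
  rewrite RtoC_opp, RtoC_div. field. lra.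
Qed.

(** For [u < 0] the integrand is a difference of two exponentials. At [z = s / 2] the result has the
    poles [s = 1] and [s = 0] of Riemann's formula. *)
Lemma ramp_transform (z : C) : (/ 2 < Re z)%R ->
  is_line (fun u => RtoC (ramp u) * Cexp (z * RtoC u)) ((/ (z - / 2) - / z) / 2).
Proof.
  intros Hz.
  assert (Hz0 : z <> 0). { intros E. subst. simpl in Hz. lra. }
  assert (Hz1 : z - / 2 <> 0). { apply Cminus_neq_0, Cneq_by_re. rewrite <- RtoC_inv by lra. reim. lra. }
  set (c1 := / (z - / 2)). set (c2 := / z).
  assert (Cc : forall t, ccont (fun u => RtoC (ramp u) * Cexp (z * RtoC u)) t).
  { intros t. apply (ccont_exp_kernel (fun u => RtoC (ramp u)) (fun u => u)). apply ccont_RtoC, ramp_continuous. apply continuous_id. }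
  assert (Cp : forall w t, ccont (fun u => Cexp (w * RtoC u)) t).
  { intros w t. apply (ccont_comp_holo (fun v => Cexp (w * v)) RtoC). cdiff_tac. apply ccont_RtoC, continuous_id. }
  assert (Pr : forall (w : C) (a : R), w <> 0 -> CInt (fun u => Cexp (w * RtoC u)) a 0 = / w * (1 - Cexp (w * RtoC a))).
  { intros w a Hw. rewrite (CInt_derive (fun u => / w * Cexp (w * RtoC u))).
    - rewrite Cmult_0_r, Cexp_0. Ceq. ring.
    - intros t _.
      assert (H := is_derive_line (fun v => / w * Cexp v) 0 w (/ w * Cexp (0 + w * RtoC t)) t).
      apply (is_derive_ext (fun u : R => / w * Cexp (0 + w * RtoC u))). { intros. now rewrite Cplus_0_l. }
      replace (Cexp (w * RtoC t)) with (w * (/ w * Cexp (0 + w * RtoC t))). apply H.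
      replace (/ w * Cexp (0 + w * RtoC t)) with (0 * Cexp (0 + w * RtoC t) + / w * Cexp (0 + w * RtoC t)) by ring.
      apply (is_cderiv_mult (fun _ => / w) Cexp). apply is_cderiv_const. apply is_cderiv_Cexp.
      rewrite Cplus_0_l. Ceq. field. exact Hw.
    - intros t _. apply Cp. }
  assert (Val : forall a b, (a <= 0)%R -> (0 <= b)%R -> CInt (fun u => RtoC (ramp u) * Cexp (z * RtoC u)) a b =
     (c1 * (1 - Cexp ((z - / 2) * RtoC a)) - c2 * (1 - Cexp (z * RtoC a))) / 2).
  { intros a b Ha Hb. rewrite <- (CInt_Chasles _ a 0 b) by (apply cintble_cont'; auto).
    rewrite (CInt_ext _ (fun _ => RtoC 0) 0 b).
    2: { rewrite Rmin_left, Rmax_right by auto. intros t Ht. rewrite ramp_pos by lra. ring. }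
    rewrite CInt_const.
    rewrite (CInt_ext _ (fun u => / 2 * Cexp ((z - / 2) * RtoC u) - / 2 * Cexp (z * RtoC u)) a 0).
    - assert (I1 := cintble_cont' _ a 0 (Cp (z - / 2))). assert (I2 := cintble_cont' _ a 0 (Cp z)).
      rewrite CInt_minus by (apply cintble_scal; assumption).
      rewrite (CInt_scal _ _ _ _ I1), (CInt_scal _ _ _ _ I2), (Pr _ _ Hz1), (Pr _ _ Hz0).
      fold c1 c2. rewrite Cmult_0_r. field.
    - rewrite Rmin_left, Rmax_right by auto. intros t Ht. rewrite ramp_neg by lra.
      replace ((z - / 2) * RtoC t) with (z * RtoC t + RtoC (- (t / 2))).
      rewrite Cexp_plus, Cexp_RtoC, RtoC_div, RtoC_minus. field. lra.
      rewrite RtoC_opp, RtoC_div. field. lra. }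
  set (d := (Re z - / 2)%R).
  set (M := (Cmod c1 + Cmod c2)%R). assert (HM : (0 <= M)%R) by (unfold M; pose proof (Cmod_ge_0 c1); pose proof (Cmod_ge_0 c2); lra).
  intros eps He. exists (Rmax 1 (M / (eps * d))). intros a b Ha Hb.
  pose proof (Rmax_l 1 (M / (eps * d))). pose proof (Rmax_r 1 (M / (eps * d))).
  rewrite Val by lra. fold c1 c2.
  replace ((c1 * (1 - Cexp ((z - / 2) * RtoC a)) - c2 * (1 - Cexp (z * RtoC a))) / 2 - (c1 - c2) / 2)
    with (/ 2 * (c2 * Cexp (z * RtoC a) - c1 * Cexp ((z - / 2) * RtoC a))) by field.
  assert (Hd : (0 < d)%R) by (unfold d; lra).
  assert (E1 : (exp (d * a) <= / (d * - a))%R).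
  { replace (d * a)%R with (- (d * - a))%R by ring. rewrite exp_Ropp. apply Rinv_le_contravar. nra.
    pose proof (exp_ineq1_le (d * - a)). lra. }
  assert (E2 : (M * / (d * - a) <= eps)%R).
  { apply Rmult_le_reg_r with (d * - a)%R. nra. rewrite Rmult_assoc, Rinv_l, Rmult_1_r by nra.
    apply Rle_trans with (eps * d * (M / (eps * d)))%R. right. field. split; lra.
    rewrite <- Rmult_assoc. apply Rmult_le_compat_l. nra. lra. }
  rewrite Cmod_mult. eapply Rle_trans. apply Rmult_le_compat_l. apply Cmod_ge_0. apply Cmod_le_sum.
  rewrite !Cmod_mult, !Cmod_Cexp, !Re_scal_r.
  replace (Cmod (/ 2)) with (/ 2)%R. 2: { rewrite <- RtoC_inv by lra. rewrite Cmod_R, Rabs_pos_eq; lra. }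
  assert (E3 : (exp (Re z * a) <= exp (d * a))%R) by (apply exp_le; unfold d; nra).
  assert (E4 : exp (Re (z - / 2) * a) = exp (d * a)).
  { f_equal. f_equal. unfold d. rewrite Re_minus. f_equal. rewrite <- RtoC_inv by lra. reflexivity. }
  rewrite E4. pose proof (Cmod_ge_0 c1). pose proof (Cmod_ge_0 c2). pose proof (exp_pos (d * a)).
  assert (Cmod c2 * exp (Re z * a) + Cmod c1 * exp (d * a) <= M * exp (d * a))%R by (unfold M; nra).
  assert (M * exp (d * a) <= M * / (d * - a))%R by (apply Rmult_le_compat_l; auto). lra.
Qed.

(* Riemann's formula for xi. *)
Definition Xi (s : C) : C := / 2 + s * (s - 1) / 2 * xi_laplace (s / 2).

Lemma Xi_cdiff (s : C) : cdiff Xi s.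
Proof.
  assert (H2 : RtoC 2 <> 0) by (apply RtoC_neq; lra).
  unfold Xi. cdiff_tac; auto. apply (cdiff_comp xi_laplace (fun s => s / 2)). apply xi_laplace_cdiff. cdiff_tac.
Qed.

Lemma Xi_sym (s : C) : Xi (1 - s) = Xi s.
Proof.
  unfold Xi. replace ((1 - s) / 2) with (/ 2 - s / 2) by field. rewrite xi_laplace_sym. field.
Qed.

Lemma g_right (s : C) : (0 < Re s)%R -> g s = Rcpow PI (- (s / 2)) * (s - 1) * (s / 2 * Euler_laplace (s / 2)).
Proof.
  intros Hs. unfold g. rewrite Gamma_right by (reim; lra). rewrite Euler_laplace_rec. reflexivity. reim; lra.
Qed.

(** Since [psi_exp] is [xi_kernel] plus [ramp], its transform is [xi_laplace] plus the polar terms;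
    the factor [s (s - 1) / 2] turns the latter into the constant [1 / 2]. *)
Lemma g_zeta_right (s : C) : (1 < Re s)%R -> g s * zeta s = Xi s.
Proof.
  intros Hs. rewrite zeta_right, g_right by lra.
  assert (Hz : (/ 2 < Re (s / 2))%R) by (reim; lra).
  destruct (psi_exp_mellin (s / 2) Hz) as [[K D] E]. replace (2 * (s / 2)) with s in E by field.
  assert (Hs0 : s <> 0). { intros E0. subst. simpl in Hs. lra. }
  assert (Hs1 : s - 1 <> 0). { apply Cminus_neq_0, Cneq_by_re. reim. lra. }
  assert (E2 : Rcpow PI (- (s / 2)) * Euler_laplace (s / 2) * zeta_series s = xi_laplace (s / 2) + (/ (s / 2 - / 2) - / (s / 2)) / 2).
  { rewrite <- E. apply LInt_unique. destruct (xi_kernel_dominated (s / 2)) as [K' D'].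
    apply (is_line_ext (fun u => xi_kernel u * Cexp (s / 2 * RtoC u) + RtoC (ramp u) * Cexp (s / 2 * RtoC u))).
    - intros u. unfold xi_kernel. ring.
    - apply is_line_plus. apply D'.
      + intros t. apply (ccont_exp_kernel (fun u => RtoC (ramp u)) (fun u => u)). apply ccont_RtoC, ramp_continuous. apply continuous_id.
      + apply (LInt_correct _ _ D').
      + now apply ramp_transform. }
  transitivity ((s - 1) * (s / 2) * (Rcpow PI (- (s / 2)) * Euler_laplace (s / 2) * zeta_series s)). ring.
  rewrite E2. unfold Xi. field. repeat split; auto.
Qed.

(** * Identification of xi *)

(** The pole of zeta and the poles of [Gamma (w / 2 + 1)], where the factors have arbitrary
    values. *)
Definition g_zeta_singular (w : C) : Prop := w = 1 \/ exists k : nat, w = - RtoC (2 * INR k + 2).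

Lemma g_zeta_cdiff (w : C) : ~ g_zeta_singular w -> cdiff (fun w => g w * zeta w) w.
Proof.
  intros H. apply cdiff_mult.
  - apply g_cdiff. intros k E. apply H. right. exists k.
    replace w with (2 * (w / 2 + 1) - 2) by field. rewrite E.
    rewrite RtoC_plus, RtoC_mult. ring.
  - apply zeta_cdiff. intros E. apply H. now left.
Qed.

Lemma singular_real (w : C) : g_zeta_singular w -> Im w = 0%R.
Proof. intros [-> | [k ->]]; simpl; ring. Qed.

(** All singular points are real, so a strip of half height [|Im w| / 2] about [w] avoids them; its
    right edge [Re = 2] lies where the series is available. *)
Lemma g_zeta_nonreal (w : C) : Im w <> 0%R -> g w * zeta w = Xi w.
Proof.
  intros Hw. destruct (Rlt_dec 1 (Re w)) as [H|H]. now apply g_zeta_right.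
  destruct w as [u v]. simpl in *.
  assert (Hv : (0 < Rabs v)%R) by now apply Rabs_pos_lt.
  assert (E : (fun w => g w * zeta w - Xi w) (u, v) = 0).
  { apply (vanish_from_right_edge (fun w => g w * zeta w - Xi w) (u - 1) u 2 v (Rabs v / 2)); try lra.
    - intros z [_ Hz]. apply cdiff_minus; [|apply Xi_cdiff]. apply g_zeta_cdiff.
      intros Hs. apply singular_real in Hs. rewrite Hs in Hz.
      unfold Rabs in *. destruct (Rcase_abs v); lra.
    - intros y _. cbv beta. rewrite g_zeta_right by (simpl; lra). ring. }
  cbv beta in E. replace (g (u, v) * zeta (u, v)) with (g (u, v) * zeta (u, v) - Xi (u, v) + Xi (u, v)) by ring.
  rewrite E. ring.
Qed.

(** Regular points of the real axis are reached from non-real ones by continuity. *)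
Lemma g_zeta_regular (w : C) : ~ g_zeta_singular w -> g w * zeta w = Xi w.
Proof.
  intros Hs. destruct (Req_dec (Im w) 0) as [Hi|Hi]; [|now apply g_zeta_nonreal].
  set (D := fun w => g w * zeta w - Xi w).
  assert (HD : cdiff D w). { apply cdiff_minus. now apply g_zeta_cdiff. apply Xi_cdiff. }
  assert (E : D w = 0).
  { apply Cmod_eq_0. apply Rle_antisym; [|apply Cmod_ge_0]. apply le_epsilon. intros e He.
    destruct (cderiv_cont D w HD e He) as [d [Hd Hc]].
    specialize (Hc (w + Ci * RtoC (d / 2))).
    replace (w + Ci * RtoC (d / 2) - w) with (Ci * RtoC (d / 2)) in Hc by ring.
    rewrite Cmod_mult, Cmod_Ci, Cmod_R, Rabs_pos_eq in Hc by lra.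
    specialize (Hc ltac:(lra)).
    assert (E0 : D (w + Ci * RtoC (d / 2)) = 0).
    { unfold D. rewrite g_zeta_nonreal. ring. rewrite Im_plus, Hi. simpl. lra. }
    rewrite E0 in Hc. replace (0 - D w) with (- D w) in Hc by ring. rewrite Cmod_opp in Hc. lra. }
  unfold D in E. replace (g w * zeta w) with (g w * zeta w - Xi w + Xi w) by ring. rewrite E. ring.
Qed.

Lemma singular_separated (p q : C) : g_zeta_singular p -> g_zeta_singular q -> p <> q -> (2 <= Cmod (p - q))%R.
Proof.
  assert (Far : forall j k, INR j <> INR k -> (1 <= Rabs (INR j - INR k))%R).
  { intros j k H. destruct (Nat.lt_total j k) as [L|[L|L]].
    - apply le_INR in L. rewrite S_INR in L. rewrite Rabs_left1; lra.
    - subst. lra.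
    - apply le_INR in L. rewrite S_INR in L. rewrite Rabs_pos_eq; lra. }
  intros [-> | [j ->]] [-> | [k ->]] H.
  - congruence.
  - replace (1 - - RtoC (2 * INR k + 2)) with (RtoC (1 + (2 * INR k + 2))) by (rewrite RtoC_plus; ring).
    rewrite Cmod_R. pose proof (pos_INR k). rewrite Rabs_pos_eq; lra.
  - replace (- RtoC (2 * INR j + 2) - 1) with (RtoC (- (1 + (2 * INR j + 2)))) by (rewrite RtoC_opp, RtoC_plus; ring).
    rewrite Cmod_R, Rabs_Ropp. pose proof (pos_INR j). rewrite Rabs_pos_eq; lra.
  - replace (- RtoC (2 * INR j + 2) - - RtoC (2 * INR k + 2)) with (RtoC (- (2 * (INR j - INR k)))).
    + rewrite Cmod_R, Rabs_Ropp, Rabs_mult, (Rabs_pos_eq 2) by lra.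
      assert (INR j <> INR k). { intros E. apply H. now rewrite E. } pose proof (Far j k H0). lra.
    + apply C_eq; simpl; ring.
Qed.

(** Singular points are at least 2 apart, so at most one other than [s] lies within distance 1; the
    radius stops short of it. *)
Lemma regular_punctured (s : C) : exists r, (0 < r)%R /\
  forall w, w <> s -> (Cmod (w - s) < r)%R -> ~ g_zeta_singular w.
Proof.
  destruct (classic (exists p, g_zeta_singular p /\ p <> s /\ (Cmod (p - s) < 1)%R)) as [[p (Hp & Hps & Hd)]|No].
  - exists (Cmod (p - s)). split. now apply Cmod_gt_0, Cminus_neq_0.
    intros w Hw Hws Hs. assert (w <> p). { intros ->. lra. }
    pose proof (singular_separated w p Hs Hp H).
    replace (w - p) with ((w - s) - (p - s)) in H0 by ring.
    pose proof (Cmod_le_sum (w - s) (p - s)). lra.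
  - exists 1%R. split. lra. intros w Hw Hws Hs. apply No. now exists w.
Qed.

(** The [iota] in [xi] is determined only if the limit is unique, for which punctured neighbourhoods
    must be non-empty. *)
Lemma locally'_proper (s : C) : ProperFilter' (locally' (T := C_UniformSpace) s).
Proof.
  constructor; [|apply within_filter, locally_filter].
  intros [d Hd]. apply (Hd (s + RtoC (d / 2))).
  - apply C_NormedModule_mixin_compat1. change (Cmod (s + RtoC (d / 2) - s) < d)%R.
    replace (s + RtoC (d / 2) - s) with (RtoC (d / 2)) by ring. pose proof (cond_pos d).
    rewrite Cmod_R, Rabs_pos_eq; lra.
  - intros E. apply (f_equal Re) in E. rewrite Re_plus, Re_RtoC in E. pose proof (cond_pos d). lra.
Qed.

Lemma xi_eq_Xi (s : C) : xi s = Xi s.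
Proof.
  unfold xi. pose proof (locally'_proper s) as PF.
  apply (iota_filterlim_locally (V := C_R_CompleteNormedModule)).
  intros P [eps HP].
  destruct (cderiv_cont Xi s (Xi_cdiff s) eps (cond_pos eps)) as [d [Hd Hc]].
  destruct (regular_punctured s) as [r [Hr Hreg]].
  (* Halved because the neighbourhoods are squares, which exceed the disc by the factor
     [sqrt 2 <= 2]. *)
  set (e := (Rmin d r / 2)%R).
  assert (He : (0 < e)%R). { unfold e. assert (0 < Rmin d r)%R by now apply Rmin_pos. lra. }
  exists (mkposreal e He). intros w Hw Hws.
  apply (C_NormedModule_mixin_compat2 s w (mkposreal e He)) in Hw. 
  change (Cmod (w - s) < sqrt 2 * e)%R in Hw.
  assert (sqrt 2 <= 2)%R.
  { rewrite <- (sqrt_Rsqr 2) at 2 by lra. apply sqrt_le_1_alt. unfold Rsqr; lra. }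
  assert (Hw2 : (Cmod (w - s) < Rmin d r)%R) by (unfold e in *; nra).
  rewrite g_zeta_regular.
  - apply HP. apply C_NormedModule_mixin_compat1. change (Cmod (Xi w - Xi s) < eps)%R.
    apply Hc. eapply Rlt_le_trans; [exact Hw2|apply Rmin_l].
  - apply Hreg; auto. eapply Rlt_le_trans; [exact Hw2|apply Rmin_r].
Qed.

(** * The Dirichlet series of the divisor function *)

Lemma csum_zero (f : nat -> C) (n : nat) : (forall k, (k < n)%nat -> f k = 0) -> csum f n = 0.
Proof.
  intros H. induction n; simpl; auto. rewrite IHn, H by auto. ring.
Qed.

Lemma csum_single (k N : nat) (v : C) :
  csum (fun n => if Nat.eqb n k then v else 0) N = if Nat.ltb k N then v else 0.
Proof.
  induction N; simpl. reflexivity. rewrite IHN.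
  destruct (Nat.ltb_spec k N), (Nat.ltb_spec k (S N)), (Nat.eqb_spec N k); try lia; ring.
Qed.

Lemma csum_exchange (f : nat -> nat -> C) (N M : nat) :
  csum (fun i => csum (fun j => f i j) M) N = csum (fun j => csum (fun i => f i j) N) M.
Proof.
  induction N; simpl.
  - symmetry. apply csum_zero. auto.
  - rewrite IHN, <- csum_plus. reflexivity.
Qed.

Lemma csum_extend (f : nat -> C) (n N : nat) : (forall k, (n <= k)%nat -> f k = 0) -> (n <= N)%nat ->
  csum f N = csum f n.
Proof.
  intros H. induction 1; simpl; auto. rewrite IHle, H by auto. ring.
Qed.

(** Dirichlet convolution of sequences whose index [n] stands for the integer [n + 1]; [pred] turns
    the complementary divisor back into an index. *)
Definition dirichlet_conv (y x : nat -> C) (n : nat) : C :=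
  csum (fun i => if Nat.eqb (Nat.modulo (S n) (S i)) 0 then y i * x (pred (Nat.div (S n) (S i))) else 0) (S n).

(** Divisibility becomes the symmetric condition that the product be [n + 1], at the price of an
    inner sum with at most one non-zero term. *)
Lemma dirichlet_conv_inner (y x : nat -> C) (n i N : nat) : (n < N)%nat ->
  csum (fun j => if Nat.eqb (S i * S j) (S n) then y i * x j else 0) N =
  if Nat.eqb (Nat.modulo (S n) (S i)) 0 then y i * x (pred (Nat.div (S n) (S i))) else 0.
Proof.
  intros Hn. destruct (Nat.eqb_spec (Nat.modulo (S n) (S i)) 0) as [H|H].
  - apply Nat.Div0.div_exact in H. set (q := Nat.div (S n) (S i)) in *.
    assert (Hq : (1 <= q)%nat). { destruct q; [|lia]. rewrite Nat.mul_0_r in H. discriminate. }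
    rewrite (csum_ext _ (fun j => if Nat.eqb j (pred q) then y i * x (pred q) else 0)).
    + rewrite csum_single. destruct (Nat.ltb_spec (pred q) N) as [|Hl]; auto. exfalso. nia.
    + intros j _. rewrite H. destruct (Nat.eqb_spec (S i * S j) (S i * q)), (Nat.eqb_spec j (pred q)).
      * now subst.
      * exfalso. apply Nat.mul_cancel_l in e; lia.
      * exfalso. subst j. apply n0. f_equal. lia.
      * auto.
  - apply csum_zero. intros j _. destruct (Nat.eqb_spec (S i * S j) (S n)) as [E|]; auto.
    exfalso. apply H. rewrite <- E, Nat.mul_comm. apply Nat.Div0.mod_mul.
Qed.

(** Exchanging the sums collects the lattice points under a hyperbola. *)
Lemma dirichlet_conv_partial (y x : nat -> C) (N : nat) :
  csum (dirichlet_conv y x) N =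
  csum (fun i => csum (fun j => if Nat.leb (S i * S j) N then y i * x j else 0) N) N.
Proof.
  rewrite (csum_ext _ (fun n => csum (fun i => csum (fun j => if Nat.eqb (S i * S j) (S n) then y i * x j else 0) N) N)).
  - rewrite csum_exchange. apply csum_ext. intros i Hi. rewrite csum_exchange. apply csum_ext. intros j Hj.
    rewrite (csum_ext _ (fun n => if Nat.eqb n (pred (S i * S j)) then y i * x j else 0)).
    + rewrite csum_single. 
      destruct (Nat.ltb_spec (pred (S i * S j)) N), (Nat.leb_spec (S i * S j) N); auto; lia.
    + intros n _. destruct (Nat.eqb_spec (S i * S j) (S n)), (Nat.eqb_spec n (pred (S i * S j))); auto; lia.
  - intros n Hn. rewrite (csum_ext _ (fun i => if Nat.eqb (Nat.modulo (S n) (S i)) 0 then y i * x (pred (Nat.div (S n) (S i))) else 0)).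
    + unfold dirichlet_conv. symmetry. apply csum_extend; [|lia]. intros k Hk.
      rewrite Nat.mod_small by lia. reflexivity.
    + intros i Hi. now apply dirichlet_conv_inner.
Qed.

Lemma csum_RtoC (a : nat -> R) (n : nat) : csum (fun k => RtoC (a k)) n = RtoC (rsum a n).
Proof. induction n; simpl; auto. now rewrite IHn, RtoC_plus. Qed.

Lemma csum_mult (y x : nat -> C) (N M : nat) :
  csum y N * csum x M = csum (fun i => csum (fun j => y i * x j) M) N.
Proof.
  induction N; simpl. ring. rewrite <- IHN, csum_scal. ring.
Qed.

Lemma Cmod_csum (f : nat -> C) (b : nat -> R) (n : nat) : (forall k, (k < n)%nat -> (Cmod (f k) <= b k)%R) ->
  (Cmod (csum f n) <= rsum b n)%R.
Proof.
  intros H. induction n; simpl. rewrite Cmod_0; lra.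
  eapply Rle_trans. apply Cmod_triangle. apply Rplus_le_compat; auto.
Qed.

Lemma rsum_mult (a b : nat -> R) (N M : nat) :
  (rsum a N * rsum b M)%R = rsum (fun i => rsum (fun j => a i * b j)%R M) N.
Proof.
  induction N; simpl. ring. rewrite <- IHN.
  assert (E : forall m, rsum (fun j => a N * b j)%R m = (a N * rsum b m)%R) by (induction m; simpl; [ring|rewrite IHm; ring]).
  rewrite E. ring.
Qed.

Lemma rsum_minus (a b : nat -> R) (N : nat) : rsum (fun i => a i - b i)%R N = (rsum a N - rsum b N)%R.
Proof. induction N; simpl. ring. rewrite IHN. ring. Qed.

Lemma rsum_zero (N : nat) : rsum (fun _ => 0%R) N = 0%R.
Proof. induction N; simpl; auto. rewrite IHN. ring. Qed.

Lemma rsum_trunc (a : nat -> R) (K N : nat) : (K <= N)%nat ->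
  rsum (fun i => if Nat.ltb i K then a i else 0)%R N = rsum a K.
Proof.
  assert (E : forall n, (n <= K)%nat -> rsum (fun i => if Nat.ltb i K then a i else 0)%R n = rsum a n).
  { induction n; intros Hn; simpl; auto. rewrite IHn by lia. destruct (Nat.ltb_spec n K); auto. lia. }
  induction 1. now apply E. simpl. rewrite IHle. destruct (Nat.ltb_spec m K). lia. ring.
Qed.

(* Off the hyperbola [d m <= N] the pairs lie outside the square [d, m <= K] as soon as [K^2 <= N]. *)
Lemma dirichlet_conv_defect (y x : nat -> C) (al be : nat -> R) (K N : nat) : (K * K <= N)%nat ->
  (forall n, (Cmod (y n) <= al n)%R) -> (forall n, (Cmod (x n) <= be n)%R) ->
  (Cmod (csum y N * csum x N - csum (dirichlet_conv y x) N) <= rsum al N * rsum be N - rsum al K * rsum be K)%R.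
Proof.
  intros HK Hy Hx.
  assert (HKN : (K <= N)%nat) by nia.
  assert (Ha : forall n, (0 <= al n)%R) by (intros n; pose proof (Hy n); pose proof (Cmod_ge_0 (y n)); lra).
  assert (Hb : forall n, (0 <= be n)%R) by (intros n; pose proof (Hx n); pose proof (Cmod_ge_0 (x n)); lra).
  rewrite dirichlet_conv_partial, csum_mult.
  replace (csum (fun i => csum (fun j => y i * x j) N) N -
     csum (fun i => csum (fun j => if Nat.leb (S i * S j) N then y i * x j else 0) N) N) with
    (csum (fun i => csum (fun j => if Nat.leb (S i * S j) N then 0 else y i * x j) N) N).
  2: { set (A := csum (fun i => csum (fun j => if Nat.leb (S i * S j) N then 0 else y i * x j) N) N).
    rewrite (csum_ext (fun i => csum (fun j => y i * x j) N) (fun i =>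
       csum (fun j => if Nat.leb (S i * S j) N then 0 else y i * x j) N +
       csum (fun j => if Nat.leb (S i * S j) N then y i * x j else 0) N)).
    - rewrite csum_plus. fold A. ring.
    - intros i _. rewrite <- csum_plus. apply csum_ext. intros j _. destruct (Nat.leb (S i * S j) N); ring. }
  (* The majorant of all pairs minus that of the square, whose points lie under the hyperbola and
     contribute 0. *)
  apply Rle_trans with (rsum (fun i => rsum (fun j => al i * be j -
     (if Nat.ltb i K then if Nat.ltb j K then al i * be j else 0 else 0)) N) N)%R.
  - apply Cmod_csum. intros i _. apply Cmod_csum. intros j _.
    pose proof (Rmult_le_pos _ _ (Ha i) (Hb j)).
    destruct (Nat.leb_spec (S i * S j) N).
    + rewrite Cmod_0. destruct (Nat.ltb i K), (Nat.ltb j K); lra.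
    + assert (H1 : (Cmod (y i * x j) <= al i * be j)%R).
      { rewrite Cmod_mult. apply Rmult_le_compat; auto; apply Cmod_ge_0. }
      destruct (Nat.ltb_spec i K), (Nat.ltb_spec j K); try lra. exfalso. nia.
  - right. rewrite !rsum_mult.
    transitivity (rsum (fun i => rsum (fun j => al i * be j)%R N - (if Nat.ltb i K then rsum (fun j => al i * be j)%R K else 0))%R N).
    + assert (Ext : forall f h n, (forall k, f k = h k) -> rsum f n = rsum h n).
      { intros f h n E. induction n; simpl; auto. now rewrite IHn, E. }
      apply Ext. intros i. rewrite rsum_minus. f_equal.
      destruct (Nat.ltb i K).
      * apply (rsum_trunc (fun j => al i * be j)%R K N HKN).
      * apply rsum_zero.
    + rewrite rsum_minus. f_equal. apply (rsum_trunc (fun i => rsum (fun j => al i * be j)%R K) K N HKN).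
Qed.

Lemma Clim_mult (u v : nat -> C) (l m : C) : Clim u l -> Clim v m -> Clim (fun n => u n * v n) (l * m).
Proof.
  intros Hu Hv eps He. set (Q := (Cmod l + Cmod m + 1)%R).
  pose proof (Cmod_ge_0 l) as P1. pose proof (Cmod_ge_0 m) as P2.
  set (e := Rmin 1 (eps / (4 * Q))).
  assert (He1 : (0 < e)%R). { apply Rmin_pos. lra. apply Rdiv_lt_0_compat; unfold Q; lra. }
  assert (Ha : (e <= 1)%R) by apply Rmin_l.
  assert (Hb : (e * (4 * Q) <= eps)%R).
  { replace eps with (eps / (4 * Q) * (4 * Q))%R by (field; unfold Q; lra). apply Rmult_le_compat_r. unfold Q; lra. apply Rmin_r. }
  destruct (Hu e He1) as [N1 H1]. destruct (Hv e He1) as [N2 H2]. exists (N1 + N2)%nat. intros n Hn.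
  specialize (H1 n ltac:(lia)). specialize (H2 n ltac:(lia)).
  replace (u n * v n - l * m) with ((u n - l) * (v n - m) + (l * (v n - m) + (u n - l) * m)) by ring.
  eapply Rle_lt_trans. apply Cmod_triangle. eapply Rle_lt_trans. apply Rplus_le_compat_l, Cmod_triangle.
  rewrite !Cmod_mult. set (A := Cmod (u n - l)) in *. set (B := Cmod (v n - m)) in *.
  assert (0 <= A)%R by apply Cmod_ge_0. assert (0 <= B)%R by apply Cmod_ge_0. unfold Q in *.
  assert (A * B <= e)%R by nra. assert (Cmod l * B <= Cmod l * e)%R by nra. assert (A * Cmod m <= e * Cmod m)%R by nra. nra.
Qed.

(** The defect is a difference of products of majorant sums at [N] and at [K]; it is small for
    [N >= K^2] once both tails beyond [K] are small. *)
Lemma dirichlet_conv_lim (y x : nat -> C) (al be : nat -> R) (Y X : C) : summable al -> summable be ->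
  (forall n, (Cmod (y n) <= al n)%R) -> (forall n, (Cmod (x n) <= be n)%R) ->
  Clim (csum y) Y -> Clim (csum x) X -> Clim (csum (dirichlet_conv y x)) (Y * X).
Proof.
  intros Sa Sb Hy Hx LY LX.
  assert (LP := Clim_mult _ _ _ _ LY LX).
  pose proof Sa as [Pa [Ba HBa]]. pose proof Sb as [Pb [Bb HBb]].
  intros eps He. destruct (LP (eps / 2)%R ltac:(lra)) as [N0 HN0].
  assert (HBa0 : (0 <= Ba)%R) by apply (HBa O). assert (HBb0 : (0 <= Bb)%R) by apply (HBb O).
  set (e := (eps / (4 * (Ba + Bb + 1)))%R).
  assert (He' : (0 < e)%R) by (apply Rdiv_lt_0_compat; lra).
  destruct (summable_tail al Sa e He') as [N1 H1]. destruct (summable_tail be Sb e He') as [N2 H2].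
  set (K := (N1 + N2)%nat). exists (N0 + K * K)%nat. intros N HN.
  assert (HK : (K * K <= N)%nat) by lia. assert (HKN : (K <= N)%nat) by nia.
  assert (D := dirichlet_conv_defect y x al be K N HK Hy Hx).
  specialize (HN0 N ltac:(lia)). specialize (H1 K N ltac:(lia) HKN). specialize (H2 K N ltac:(lia) HKN).
  replace (csum (dirichlet_conv y x) N - Y * X) with ((csum y N * csum x N - Y * X) - (csum y N * csum x N - csum (dirichlet_conv y x) N)) by ring.
  eapply Rle_lt_trans. apply Cmod_le_sum.
  assert (rsum al N * rsum be N - rsum al K * rsum be K <= eps / 4)%R; [|lra].
  pose proof (HBa K). pose proof (HBb N). 
  assert (0 <= rsum al K)%R by apply (rsum_incr al 0 K Pa ltac:(lia)).
  assert (0 <= rsum be N)%R by apply (rsum_incr be 0 N Pb ltac:(lia)).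
  replace (rsum al N * rsum be N - rsum al K * rsum be K)%R with
    ((rsum al N - rsum al K) * rsum be N + rsum al K * (rsum be N - rsum be K))%R by ring.
  pose proof (rsum_incr al K N Pa HKN). pose proof (rsum_incr be K N Pb HKN).
  assert ((rsum al N - rsum al K) * rsum be N <= e * Bb)%R by (apply Rmult_le_compat; lra).
  assert (rsum al K * (rsum be N - rsum be K) <= Ba * e)%R by (apply Rmult_le_compat; lra).
  assert (e * (4 * (Ba + Bb + 1)) = eps)%R by (unfold e; field; lra). nra.
Qed.

Lemma inv_npow_mult (i j n : nat) (s : C) : (S i * S j = S n)%nat -> inv_npow i s * inv_npow j s = inv_npow n s.
Proof.
  intros H. unfold inv_npow. rewrite <- Cexp_plus. f_equal. rewrite <- H, mult_INR, ln_mult by apply INR_S_pos.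
  rewrite !RtoC_opp, RtoC_plus. ring.
Qed.

Lemma inv_npow_shift (i a : nat) (s : C) : RtoC (INR (S i ^ a)) * inv_npow i s = inv_npow i (s - RtoC (INR a)).
Proof.
  unfold inv_npow. replace (RtoC (INR (S i ^ a))) with (Cexp (RtoC (INR a * ln (INR (S i))))).
  - rewrite <- Cexp_plus. f_equal. rewrite RtoC_mult, RtoC_opp. ring.
  - rewrite Cexp_RtoC, pow_INR. f_equal. rewrite <- (exp_ln (INR (S i))) at 2 by apply INR_S_pos.
    generalize (ln (INR (S i))). intros L. clear. induction a. simpl. now rewrite Rmult_0_l, exp_0.
    rewrite S_INR. simpl pow. rewrite <- IHa, <- exp_plus. f_equal. ring.
Qed.

Lemma divisor_sigma_csum (a n : nat) :
  RtoC (INR (divisor_sigma a n)) =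
  csum (fun i => if Nat.eqb (Nat.modulo n (S i)) 0 then RtoC (INR (S i ^ a)) else 0) n.
Proof.
  unfold divisor_sigma.
  assert (E : forall m, RtoC (INR (list_sum (map (fun d => Nat.pow d a) (filter (fun d => Nat.eqb (Nat.modulo n d) 0) (seq 1 m)))))
    = csum (fun i => if Nat.eqb (Nat.modulo n (S i)) 0 then RtoC (INR (S i ^ a)) else 0) m).
  { induction m. reflexivity. rewrite seq_S, filter_app, map_app, list_sum_app, plus_INR, RtoC_plus, IHm.
    cbn [csum]. f_equal. replace (1 + m)%nat with (S m) by lia. cbn [filter].
    destruct (Nat.eqb (Nat.modulo n (S m)) 0); cbn [map list_sum fold_right]. now rewrite Nat.add_0_r. reflexivity. }
  apply E.
Qed.

(** [sigma_a] is the convolution of [d^a] with 1, and [d^a] is absorbed by replacing [s] with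
    [s - a]; both factors are then terms of zeta series. *)
Lemma divisor_sigma_dirichlet_conv (a n : nat) (s : C) :
  RtoC (INR (divisor_sigma a (S n))) * inv_npow n s =
  dirichlet_conv (fun i => inv_npow i (s - RtoC (INR a))) (fun j => inv_npow j s) n.
Proof.
  rewrite divisor_sigma_csum, Cmult_comm, <- csum_scal. unfold dirichlet_conv. apply csum_ext. intros i Hi.
  destruct (Nat.eqb_spec (Nat.modulo (S n) (S i)) 0) as [H|H]; [|ring].
  rewrite <- inv_npow_shift.
  rewrite <- (inv_npow_mult i (pred (Nat.div (S n) (S i))) n s). ring.
  apply Nat.Div0.div_exact in H. destruct (Nat.div (S n) (S i)) as [|q]; [|simpl pred; lia].
  rewrite Nat.mul_0_r in H. discriminate.
Qed.

Lemma divisor_series (a : nat) (s : C) : (INR a + 1 < Re s)%R ->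
  Clim (csum (fun n => RtoC (INR (divisor_sigma a (S n))) * inv_npow n s)) (zeta_series (s - RtoC (INR a)) * zeta_series s).
Proof.
  intros Hs. pose proof (pos_INR a).
  apply (Clim_ext (csum (dirichlet_conv (fun i => inv_npow i (s - RtoC (INR a))) (fun j => inv_npow j s)))).
  - intros N. apply csum_ext. intros; symmetry; apply divisor_sigma_dirichlet_conv.
  - apply (dirichlet_conv_lim _ _ (fun n => exp (- (Re (s - RtoC (INR a)) * ln (INR (S n)))))%R (fun n => exp (- (Re s * ln (INR (S n)))))%R).
    + apply summable_power. reim. lra.
    + apply summable_power. lra.
    + intros. rewrite Cmod_inv_npow. lra.
    + intros. rewrite Cmod_inv_npow. lra.
    + apply zeta_series_lim. reim. lra.
    + apply zeta_series_lim. lra.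
Qed.

(** The terms are non-negative, so convergence at the real point [p] bounds the partial sums. This
    replaces an estimate of [divisor_sigma]. *)
Lemma divisor_summable (a : nat) (p : R) : (INR a + 1 < p)%R ->
  summable (fun n => INR (divisor_sigma a (S n)) * exp (- (p * ln (INR (S n)))))%R.
Proof.
  intros Hp. set (t := fun n => (INR (divisor_sigma a (S n)) * exp (- (p * ln (INR (S n)))))%R).
  assert (Ht : forall n, (0 <= t n)%R).
  { intros n. apply Rmult_le_pos. apply pos_INR. left; apply exp_pos. }
  split; auto. 
  assert (L := divisor_series a (RtoC p) Hp).
  set (l := zeta_series (RtoC p - RtoC (INR a)) * zeta_series (RtoC p)) in *.
  exists (Cmod l + 1)%R. intros n.
  destruct (L 1%R Rlt_0_1) as [N HN]. specialize (HN (n + N)%nat ltac:(lia)).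
  assert (E : csum (fun n => RtoC (INR (divisor_sigma a (S n))) * inv_npow n (RtoC p)) (n + N) = RtoC (rsum t (n + N))).
  { rewrite <- csum_RtoC. apply csum_ext. intros k _. unfold t, inv_npow. rewrite <- RtoC_mult, Cexp_RtoC, <- RtoC_mult.
    do 3 f_equal. ring. }
  rewrite E in HN. pose proof (Cmod_rev_triangle (RtoC (rsum t (n + N))) l).
  rewrite Cmod_R in H. pose proof (Rle_abs (rsum t (n + N))).
  pose proof (rsum_incr t n (n + N) Ht ltac:(lia)). lra.
Qed.

(** * Cauchy's formula on a strip *)

Lemma cdiff_pow (f : C -> C) (n : nat) (z : C) : cdiff f z -> cdiff (fun w => (f w) ^ n) z.
Proof.
  intros H. induction n; simpl. apply cdiff_const. apply (cdiff_mult f (fun w => f w ^ n)); auto.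
Qed.

(** Induction on [1 - u^(n+1) = (1 - u) + u (1 - u^n)], with [1 + 2 * 3^n <= 3^(n+1)]. *)
Lemma one_minus_pow_bound (u : C) (n : nat) : (Cmod u <= 2)%R ->
  (Cmod (1 - u ^ n) <= 3 ^ n * Cmod (1 - u))%R.
Proof.
  intros Hu. pose proof (Cmod_ge_0 (1 - u)). induction n.
  - simpl. replace (1 - 1) with (RtoC 0) by ring. rewrite Cmod_0. lra.
  - replace (1 - u ^ S n) with ((1 - u) + u * (1 - u ^ n)) by (simpl; ring).
    eapply Rle_trans. apply Cmod_triangle. rewrite Cmod_mult.
    assert (1 <= 3 ^ n)%R by (apply pow_R1_Rle; lra).
    pose proof (Cmod_ge_0 u). pose proof (Cmod_ge_0 (1 - u ^ n)).
    assert (Cmod u * Cmod (1 - u ^ n) <= 2 * (3 ^ n * Cmod (1 - u)))%R by (apply Rmult_le_compat; auto).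
    simpl pow. nra.
Qed.

Section StripCauchy.
Variables (F : C -> C) (s0 : C) (c K K1 K2 : R).
Hypothesis HF : forall s, cdiff F s.
Hypothesis Hs0 : (1 - c < Re s0 < c)%R.
Hypothesis HK : forall x y, (1 - c <= x <= c)%R -> (Cmod (F (x, y)) <= K * (1 + y * y) ^ 4)%R.
(** [f1] belongs to the right edge; [f2] is the integrand of the left edge [Re s = 1 - c] with the
    sign reversed, carried to [Re s = c] by [s -> 1 - s]. *)
Let f1 (t : R) : C := F (c, t) / ((c, t) - s0).
Let f2 (t : R) : C := F (1 - (c, t)) / ((c, t) - 1 + s0).
Hypothesis H1 : forall t, (Cmod (f1 t) <= K1 / (1 + t * t) ^ 2)%R.
Hypothesis H2 : forall t, (Cmod (f2 t) <= K2 / (1 + t * t) ^ 2)%R.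

Let W : R := (2 * c - 1)%R.
Let HW : (0 < W)%R. Proof. unfold W. lra. Qed.

(* F is only known to grow polynomially in the strip; this factor restores the decay needed on the
   horizontal edges and tends to 1 with [eps -> 0]. *)
Definition regulator (eps : R) (s : C) : C := (/ (1 + RtoC eps * (s - s0))) ^ 10.

(** The pole [s0 - 1 / eps] stays to the left of the strip: [Re (s - s0) >= - W] there, and
    [eps W <= 1 / 2]. *)
Lemma regulator_den (eps : R) (s : C) : (0 < eps)%R -> (eps * (2 * W) <= 1)%R -> (1 - c <= Re s <= c)%R ->
  (1 / 2 <= Re (1 + RtoC eps * (s - s0)))%R.
Proof.
  intros He HeW Hs. rewrite Re_plus, Re_RtoC, Cmult_comm, Re_scal_r, Re_minus.
  assert (- W <= Re s - Re s0)%R by (unfold W; lra). nra.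
Qed.

Lemma regulator_den_neq (eps : R) (s : C) : (0 < eps)%R -> (eps * (2 * W) <= 1)%R -> (1 - c <= Re s <= c)%R ->
  1 + RtoC eps * (s - s0) <> 0.
Proof.
  intros He HeW Hs E. pose proof (regulator_den eps s He HeW Hs) as H. rewrite E in H. simpl in H. lra.
Qed.

Lemma regulator_cdiff (eps : R) (s : C) : (0 < eps)%R -> (eps * (2 * W) <= 1)%R -> (1 - c <= Re s <= c)%R ->
  cdiff (regulator eps) s.
Proof.
  intros He HeW Hs. apply (cdiff_pow (fun s => / (1 + RtoC eps * (s - s0)))).
  cdiff_tac. now apply regulator_den_neq.
Qed.

Lemma regulator_inv_bound (eps : R) (s : C) : (0 < eps)%R -> (eps * (2 * W) <= 1)%R -> (1 - c <= Re s <= c)%R ->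
  (Cmod (/ (1 + RtoC eps * (s - s0))) <= 2)%R.
Proof.
  intros He HeW Hs. rewrite Cmod_inv by now apply regulator_den_neq.
  replace 2%R with (/ (1 / 2))%R by field. apply Rinv_le_contravar. lra.
  pose proof (regulator_den eps s He HeW Hs). pose proof (re_le_Cmod (1 + RtoC eps * (s - s0))).
  pose proof (Rle_abs (Re (1 + RtoC eps * (s - s0)))). lra.
Qed.

Lemma regulator_bound (eps : R) (s : C) : (0 < eps)%R -> (eps * (2 * W) <= 1)%R -> (1 - c <= Re s <= c)%R ->
  (Cmod (regulator eps s) <= 1024)%R.
Proof.
  intros He HeW Hs. unfold regulator. rewrite Cmod_pow.
  apply Rle_trans with (2 ^ 10)%R; [|lra]. apply pow_incr. split. apply Cmod_ge_0. now apply regulator_inv_bound.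
Qed.

Lemma regulator_close (eps : R) (s : C) : (0 < eps)%R -> (eps * (2 * W) <= 1)%R -> (1 - c <= Re s <= c)%R ->
  (Cmod (1 - regulator eps s) <= 3 ^ 10 * (2 * (eps * Cmod (s - s0))))%R.
Proof.
  intros He HeW Hs. unfold regulator. eapply Rle_trans. apply one_minus_pow_bound. now apply regulator_inv_bound.
  apply Rmult_le_compat_l. apply pow_le; lra.
  assert (Hn := regulator_den_neq eps s He HeW Hs).
  replace (1 - / (1 + RtoC eps * (s - s0))) with (/ (1 + RtoC eps * (s - s0)) * (RtoC eps * (s - s0))) by (field; auto).
  rewrite !Cmod_mult, Cmod_R, Rabs_pos_eq by lra. apply Rmult_le_compat_r.
  apply Rmult_le_pos. lra. apply Cmod_ge_0. now apply regulator_inv_bound.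
Qed.

Lemma linear_growth (p : C) (x t : R) : (Rabs (x - Re p) <= W + 1)%R ->
  (Cmod ((x, t) - p) <= (W + 2 + Rabs (Im p)) * (1 + t * t))%R.
Proof.
  intros Hx. eapply Rle_trans. apply Cmod_le_abs. rewrite Re_minus, Im_minus, Re_pair, Im_pair.
  assert (Rabs (t - Im p) <= Rabs t + Rabs (Im p))%R.
  { replace (t - Im p)%R with (t + - Im p)%R by ring. eapply Rle_trans. apply Rabs_triang. rewrite Rabs_Ropp. lra. }
  assert (Rabs t <= 1 + t * t)%R. { unfold Rabs. destruct (Rcase_abs t); nra. }
  pose proof (Rabs_pos (Im p)). nra.
Qed.

(** The exponent 10 of [regulator] is worth [(1 + y^2)^(-5)], one power more than the growth of [F]
    consumes. *)
Lemma regulator_strip_small (eps : R) : (0 < eps)%R -> (eps * (2 * W) <= 1)%R ->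
  strip_small (fun s => F s * regulator eps s / (s - s0)) (1 - c) c.
Proof.
  intros He HeW. set (y0 := Im s0).
  (* For [|y| >= Y] one has [|y - y0| >= |y| / 2 + 1], whence
     [|1 + eps (s - s0)|^2 >= d (1 + y^2)]. *)
  set (d := (eps * eps / 4)%R). assert (Hd : (0 < d)%R) by (unfold d; nra).
  set (Y := (2 * Rabs y0 + 2)%R).
  assert (HK0 : (0 <= K)%R).
  { pose proof (HK c 0%R ltac:(lra)). pose proof (Cmod_ge_0 (F (c, 0%R))). 
    replace (1 + 0 * 0)%R with 1%R in H by ring. rewrite pow1 in H. lra. }
  assert (Main : forall x y, (1 - c <= x <= c)%R -> (Y <= Rabs y)%R ->
     (Cmod (F (x, y) * regulator eps (x, y) / ((x, y) - s0)) <= (K / d ^ 5) / (1 + y * y))%R).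
  { intros x y Hx Hy.
    assert (Hy1 : (Rabs y / 2 + 1 <= Rabs (y - y0))%R).
    { pose proof (Rabs_triang_inv y y0). unfold Y in Hy. lra. }
    pose proof (Rabs_pos y0) as Hy0. unfold Y in Hy.
    assert (Hv : (1 <= Cmod ((x, y) - s0))%R).
    { eapply Rle_trans; [|apply im_le_Cmod]. rewrite Im_minus, Im_pair. fold y0. lra. }
    assert (Hne : (x, y) - s0 <> 0) by (apply Cmod_gt_0; lra).
    assert (Hden : (d * (1 + y * y) <= Cmod (1 + RtoC eps * ((x, y) - s0)) * Cmod (1 + RtoC eps * ((x, y) - s0)))%R).
    { pose proof (im_le_Cmod (1 + RtoC eps * ((x, y) - s0))) as B.
      rewrite Im_plus, Im_RtoC, Cmult_comm, Im_scal_r, Im_minus, Im_pair in B. fold y0 in B.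
      rewrite Rplus_0_l, Rabs_mult, (Rabs_pos_eq eps) in B by lra.
      rewrite (Cmult_comm (RtoC eps)). set (m := Cmod (1 + ((x, y) - s0) * RtoC eps)) in *.
      assert (Ey : (y * y = Rabs y * Rabs y)%R). { rewrite <- Rabs_mult. symmetry. apply Rabs_pos_eq. nra. }
      assert (B2 : ((Rabs y / 2 + 1) * eps <= m)%R) by nra.
      rewrite Ey. unfold d. pose proof (Rabs_pos y).
      apply Rle_trans with (((Rabs y / 2 + 1) * eps) * ((Rabs y / 2 + 1) * eps))%R.
      - replace ((Rabs y / 2 + 1) * eps * ((Rabs y / 2 + 1) * eps))%R with (eps * eps * ((Rabs y / 2 + 1) * (Rabs y / 2 + 1)))%R by ring.
        replace (eps * eps / 4 * (1 + Rabs y * Rabs y))%R with (eps * eps * ((1 + Rabs y * Rabs y) / 4))%R by field.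
        apply Rmult_le_compat_l; nra.
      - apply Rmult_le_compat; nra. }
    set (D := (1 + y * y)%R) in *. assert (HD : (1 <= D)%R) by (unfold D; nra).
    rewrite Cmod_div, Cmod_mult by auto. unfold regulator. rewrite Cmod_pow, Cmod_inv by (apply regulator_den_neq; auto).
    set (m := Cmod (1 + RtoC eps * ((x, y) - s0))) in *.
    assert (HdD : (0 < d * D)%R) by nra.
    assert (Hm : (0 < m)%R). { apply Cmod_gt_0, regulator_den_neq; auto. }
    assert (Hpow : ((/ m) ^ 10 <= / (d * D) ^ 5)%R).
    { rewrite pow_inv. apply Rinv_le_contravar. apply pow_lt; auto.
      replace (m ^ 10)%R with ((m * m) ^ 5)%R by ring. apply pow_incr. lra. }
    apply Rle_trans with (K * D ^ 4 * / (d * D) ^ 5 * 1)%R.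
    - unfold Rdiv. apply Rmult_le_compat.
      + apply Rmult_le_pos. apply Cmod_ge_0. apply pow_le. left; now apply Rinv_0_lt_compat.
      + left. apply Rinv_0_lt_compat. lra.
      + apply Rmult_le_compat; auto. apply Cmod_ge_0. apply pow_le. left; now apply Rinv_0_lt_compat.
      + rewrite <- Rinv_1. apply Rinv_le_contravar; lra.
    - right. field. lra. }
  (* The estimate holds only away from the pole [s0]; the function is cut off at low heights, which
     smallness at large [|y|] does not see. *)
  intros e Hee. destruct (strip_small_dominated (fun s => if Rle_dec Y (Rabs (Im s)) then F s * regulator eps s / (s - s0) else 0)
    (1 - c) c (K / d ^ 5)) with (eps := e) as [M HM]; auto.
  - intros x y Hx. simpl Im. destruct (Rle_dec Y (Rabs y)). now apply Main.
    rewrite Cmod_0. apply Rdiv_le_0_compat. apply Rdiv_le_0_compat; auto. now apply pow_lt. nra.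
  - exists (Rmax M Y). intros x y Hx Hy. pose proof (Rmax_l M Y). pose proof (Rmax_r M Y).
    specialize (HM x y Hx ltac:(lra)). simpl Im in HM. destruct (Rle_dec Y (Rabs y)); [exact HM|lra].
Qed.

Lemma edge_ne_s0 (t : R) : (c, t) - s0 <> 0.
Proof. apply Cminus_neq_0, Cneq_by_re. reim. lra. Qed.
Lemma edge_ne_refl_s0 (t : R) : (c, t) - 1 + s0 <> 0.
Proof.
  intros E. apply (f_equal Re) in E. rewrite Re_plus, Re_minus, Re_pair, !Re_RtoC in E. lra.
Qed.

Lemma cauchy_edge_ccont (t : R) : ccont f1 t.
Proof.
  apply (ccont_vline (fun s => F s / (s - s0)) c t). cdiff_tac. apply edge_ne_s0. apply HF.
Qed.
Lemma cauchy_refl_edge_ccont (t : R) : ccont f2 t.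
Proof.
  apply (ccont_vline (fun s => F (1 - s) / (s - 1 + s0)) c t). apply cdiff_div. apply edge_ne_refl_s0.
  apply (cdiff_comp F (fun s => 1 - s)). apply HF. cdiff_tac. cdiff_tac.
Qed.

Lemma quad_le (M t : R) : (0 <= M)%R -> (M / (1 + t * t) ^ 2 <= M / (1 + t * t))%R.
Proof.
  intros HM. unfold Rdiv. apply Rmult_le_compat_l; auto. apply Rinv_le_contravar. nra. simpl. nra.
Qed.

Lemma nonneg_of_bound (f : R -> C) (M : R) : (forall t, (Cmod (f t) <= M / (1 + t * t) ^ 2)%R) -> (0 <= M)%R.
Proof.
  intros H. specialize (H 0%R). pose proof (Cmod_ge_0 (f 0%R)).
  replace (1 + 0 * 0)%R with 1%R in H by ring. rewrite pow1 in H. unfold Rdiv in H. rewrite Rinv_1 in H. lra.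
Qed.

Lemma dominated_of_quad (f : R -> C) (M : R) : (forall t, ccont f t) ->
  (forall t, (Cmod (f t) <= M / (1 + t * t) ^ 2)%R) -> dominated f M.
Proof.
  intros Hc H. split; auto. intros t. eapply Rle_trans. apply H. apply quad_le.
  now apply (nonneg_of_bound f).
Qed.

(** Passing from [f] to [f * h] costs [f * (1 - h)]. As [1 - h] may grow like [e (1 + t^2)], one of
    the two powers of decay of [f] pays for it and the other leaves a dominated integrand. *)
Lemma regulated_close (f h : R -> C) (M B e : R) : (forall t, ccont f t) -> (forall t, ccont h t) ->
  (forall t, (Cmod (f t) <= M / (1 + t * t) ^ 2)%R) -> (0 <= B)%R ->
  (forall t, (Cmod (h t) <= B)%R) ->
  (forall t, (Cmod (1 - h t) <= e * (1 + t * t))%R) ->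
  dominated (fun t => f t * h t) (M * B) /\ (Cmod (LInt f - LInt (fun t => f t * h t)%C) <= 4 * (M * e))%R.
Proof.
  intros Cf Ch Hf HB0 HB Hh. pose proof (nonneg_of_bound f M Hf) as HM. assert (Df := dominated_of_quad f M Cf Hf).
  assert (Dfh : dominated (fun t => f t * h t) (M * B)).
  { split. intros t. now apply ccont_mult. intros t. rewrite Cmod_mult.
    replace (M * B / (1 + t * t))%R with (M / (1 + t * t) * B)%R by (unfold Rdiv; ring).
    apply Rmult_le_compat; auto; try apply Cmod_ge_0. apply Df. }
  split; auto.
  assert (Dr : dominated (fun t => f t * (1 - h t)) (M * e)).
  { split. intros t. apply ccont_mult; auto. apply ccont_minus; auto. apply ccont_const.
    intros t. rewrite Cmod_mult. assert (0 < 1 + t * t)%R by nra.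
    replace (M * e / (1 + t * t))%R with (M / (1 + t * t) ^ 2 * (e * (1 + t * t)))%R by (field; lra).
    apply Rmult_le_compat; auto; apply Cmod_ge_0. }
  replace (LInt f - LInt (fun t => f t * h t)) with (LInt (fun t => f t * (1 - h t))).
  - now apply LInt_bound.
  - rewrite (LInt_ext f (fun t => f t * (1 - h t) + f t * h t)) by (intros; ring).
    rewrite (LInt_plus _ _ _ _ Dr Dfh). ring.
Qed.

(** For each small [eps] the regulated integrand obeys the residue theorem on the strip with the
    exact residue [F s0], the regulator being 1 at [s0]; removing it from both edges costs
    [O(eps)]. *)
Lemma strip_cauchy : LInt f1 + LInt f2 = RtoC (2 * PI) * F s0.
Proof.
  set (Q := (3 ^ 10 * (2 * (W + 2 + Rabs (Im s0))))%R).
  assert (HQ : (0 < Q)%R). { pose proof (Rabs_pos (Im s0)). apply Rmult_lt_0_compat. apply pow_lt; lra. lra. }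
  pose proof (nonneg_of_bound f1 K1 H1) as HK1. pose proof (nonneg_of_bound f2 K2 H2) as HK2.
  set (N := (4 * (K1 * Q) + 4 * (K2 * Q))%R). assert (HN : (0 <= N)%R) by (unfold N; nra).
  assert (Step : forall eps, (0 < eps)%R -> (eps * (2 * W) <= 1)%R ->
    (Cmod (LInt f1 + LInt f2 - RtoC (2 * PI) * F s0) <= N * eps)%R).
  { intros eps He HeW.
    set (h1 := fun t => regulator eps (c, t)). set (h2 := fun t => regulator eps (1 - (c, t))).
    assert (S1 : forall t, (1 - c <= Re (c, t) <= c)%R) by (intros; simpl; lra).
    assert (S2 : forall t, (1 - c <= Re (1 - (c, t)) <= c)%R) by (intros; rewrite Re_minus, Re_RtoC, Re_pair; lra).
    destruct (regulated_close f1 h1 K1 1024 (Q * eps)) as [D1 B1].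
    { apply cauchy_edge_ccont. }
    { intros t. apply (ccont_vline (regulator eps)). now apply regulator_cdiff. }
    { auto. } { lra. }
    { intros t. apply regulator_bound; auto. }
    { intros t. eapply Rle_trans. apply regulator_close; auto. unfold Q.
      replace (3 ^ 10 * (2 * (W + 2 + Rabs (Im s0))) * eps * (1 + t * t))%R with
        (3 ^ 10 * (2 * (eps * ((W + 2 + Rabs (Im s0)) * (1 + t * t)))))%R by ring.
      apply Rmult_le_compat_l. apply pow_le; lra. apply Rmult_le_compat_l; [lra|]. apply Rmult_le_compat_l; [lra|].
      apply linear_growth. apply Rabs_le. unfold W. lra. }
    destruct (regulated_close f2 h2 K2 1024 (Q * eps)) as [D2 B2].
    { apply cauchy_refl_edge_ccont. }
    { intros t. apply (ccont_vline (fun s => regulator eps (1 - s))). apply (cdiff_comp (regulator eps) (fun s => 1 - s)).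
      now apply regulator_cdiff. cdiff_tac. }
    { auto. } { lra. }
    { intros t. apply regulator_bound; auto. }
    { intros t. eapply Rle_trans. apply regulator_close; auto. unfold Q.
      replace (3 ^ 10 * (2 * (W + 2 + Rabs (Im s0))) * eps * (1 + t * t))%R with
        (3 ^ 10 * (2 * (eps * ((W + 2 + Rabs (Im s0)) * (1 + t * t)))))%R by ring.
      apply Rmult_le_compat_l. apply pow_le; lra. apply Rmult_le_compat_l; [lra|]. apply Rmult_le_compat_l; [lra|].
      replace (1 - (c, t) - s0) with (- ((c, t) - (1 - s0))) by ring. rewrite Cmod_opp.
      replace (Rabs (Im s0)) with (Rabs (Im (1 - s0))).
      apply linear_growth. rewrite Re_minus, Re_RtoC. apply Rabs_le. unfold W. lra.
      rewrite Im_minus, Im_RtoC, Rminus_0_l, Rabs_Ropp. reflexivity. }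
    set (f := fun s => F s * regulator eps s / (s - s0)).
    (* Under [t -> - t] the function [f2 * h2] becomes minus the regulated integrand on
       [Re s = 1 - c], which explains the two minus signs. *)
    assert (E : LInt (fun t => f1 t * h1 t) - (- LInt (fun t => f2 t * h2 t)) = RtoC (2 * PI) * F s0).
    { apply (strip_residue f (1 - c) c s0); auto.
      - intros z Hz Hne. unfold f. apply cdiff_div. now apply Cminus_neq_0.
        apply cdiff_mult. apply HF. now apply regulator_cdiff. cdiff_tac.
      - intros e Hee.
        assert (Dr : cdiff (fun s => F s * regulator eps s) s0).
        { apply cdiff_mult. apply HF. apply regulator_cdiff; auto. lra. }
        destruct (cdiff_punctured _ _ Dr e Hee) as [d [Hd Hlim]]. exists d. split; auto.
        intros w Hw Hwd. unfold f. replace ((w - s0) * (F w * regulator eps w / (w - s0))) with (F w * regulator eps w).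
        replace (F s0) with (F s0 * regulator eps s0). now apply Hlim.
        unfold regulator. replace (s0 - s0) with (RtoC 0) by ring. replace (/ (1 + RtoC eps * 0)) with (RtoC 1) by (field; intros E; apply RtoC_inj in E; lra).
        simpl. ring. field. now apply Cminus_neq_0.
      - now apply regulator_strip_small.
      - pose proof (is_line_reflect _ _ (proj1 D2) (LInt_correct _ _ D2)) as L.
        assert (Cr : forall t, ccont (fun t => f2 (- t)%R * h2 (- t)%R) t).
        { intros t. apply (ccont_comp_real (fun t => f2 t * h2 t) Ropp). apply D2.
          apply (continuous_opp (V := R_NormedModule)), continuous_id. }
        pose proof (is_line_scal _ _ (- (1)) Cr L) as L'.
        replace (- LInt (fun t => f2 t * h2 t)) with (- (1) * LInt (fun t => f2 t * h2 t)) by ring.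
        revert L'. apply is_line_ext. intros t. unfold f, f2, h2.
        replace (1 - (c, (- t)%R)) with (((1 - c)%R, t) : C) by (apply C_eq; simpl; ring).
        replace ((c, (- t)%R) - 1 + s0) with (- (((1 - c)%R, t) - s0)) by (apply C_eq; simpl; ring).
        field. apply Cminus_neq_0, Cneq_by_re. reim. lra.
      - pose proof (LInt_correct _ _ D1) as L. revert L. apply is_line_ext. intros t. unfold f, f1, h1.
        field. apply edge_ne_s0. }
    rewrite <- E.
    replace (LInt f1 + LInt f2 - (LInt (fun t => f1 t * h1 t) - - LInt (fun t => f2 t * h2 t))) with
      ((LInt f1 - LInt (fun t => f1 t * h1 t)) + (LInt f2 - LInt (fun t => f2 t * h2 t))) by ring.
    eapply Rle_trans. apply Cmod_triangle. unfold N. lra. }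
  assert (Z : LInt f1 + LInt f2 - RtoC (2 * PI) * F s0 = 0).
  { apply Cmod_eq_0. apply Rle_antisym; [|apply Cmod_ge_0]. apply le_epsilon. intros e He.
    set (eps := Rmin (/ (2 * W)) (e / (N + 1))).
    assert (0 < / (2 * W))%R by (apply Rinv_0_lt_compat; lra).
    assert (He' : (0 < eps)%R) by (apply Rmin_pos; [lra|apply Rdiv_lt_0_compat; lra]).
    assert (A1 : (eps <= / (2 * W))%R) by apply Rmin_l. assert (A2 : (eps <= e / (N + 1))%R) by apply Rmin_r.
    assert (A3 : (eps * (2 * W) <= 1)%R).
    { replace 1%R with (/ (2 * W) * (2 * W))%R by (field; lra). apply Rmult_le_compat_r; lra. }
    assert (A4 : (eps * (N + 1) <= e)%R).
    { replace e with (e / (N + 1) * (N + 1))%R by (field; lra). apply Rmult_le_compat_r; lra. }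
    specialize (Step eps He' A3). nra. }
  replace (LInt f1 + LInt f2) with (LInt f1 + LInt f2 - RtoC (2 * PI) * F s0 + RtoC (2 * PI) * F s0) by ring.
  rewrite Z. ring.
Qed.
End StripCauchy.

(** * Moving the lines and summing *)

(* [|f s| = O((1 + (Im s)^2)^(n - m))] uniformly on the strip [s1 <= Re s <= s2] *)
Definition strip_growth (s1 s2 : R) (n m : nat) (f : C -> C) : Prop :=
  exists K, (0 <= K)%R /\ forall s, (s1 <= Re s <= s2)%R ->
    (Cmod (f s) * (1 + Im s * Im s) ^ m <= K * (1 + Im s * Im s) ^ n)%R.

Lemma strip_growth_mult (s1 s2 : R) (n1 m1 n2 m2 : nat) (f h : C -> C) :
  strip_growth s1 s2 n1 m1 f -> strip_growth s1 s2 n2 m2 h -> strip_growth s1 s2 (n1 + n2) (m1 + m2) (fun s => f s * h s).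
Proof.
  intros [K [HK H1]] [L [HL H2]]. exists (K * L)%R. split. now apply Rmult_le_pos.
  intros s Hs. specialize (H1 s Hs). specialize (H2 s Hs). set (D := (1 + Im s * Im s)%R) in *.
  assert (HD : (1 <= D)%R) by (unfold D; nra).
  rewrite Cmod_mult, !pow_add.
  replace (Cmod (f s) * Cmod (h s) * (D ^ m1 * D ^ m2))%R with ((Cmod (f s) * D ^ m1) * (Cmod (h s) * D ^ m2))%R by ring.
  replace (K * L * (D ^ n1 * D ^ n2))%R with ((K * D ^ n1) * (L * D ^ n2))%R by ring.
  assert (0 <= D ^ m1)%R by (apply pow_le; lra). assert (0 <= D ^ m2)%R by (apply pow_le; lra).
  apply Rmult_le_compat; auto; apply Rmult_le_pos; auto; apply Cmod_ge_0.
Qed.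

Lemma strip_growth_plus (s1 s2 : R) (n m : nat) (f h : C -> C) :
  strip_growth s1 s2 n m f -> strip_growth s1 s2 n m h -> strip_growth s1 s2 n m (fun s => f s + h s).
Proof.
  intros [K [HK H1]] [L [HL H2]]. exists (K + L)%R. split. lra.
  intros s Hs. specialize (H1 s Hs). specialize (H2 s Hs). set (D := (1 + Im s * Im s)%R) in *.
  assert (HD : (1 <= D)%R) by (unfold D; nra). assert (0 <= D ^ m)%R by (apply pow_le; lra).
  pose proof (Cmod_triangle (f s) (h s)). nra.
Qed.

Lemma strip_growth_bounded (s1 s2 M : R) (f : C -> C) : (forall s, (s1 <= Re s <= s2)%R -> (Cmod (f s) <= M)%R) -> strip_growth s1 s2 0 0 f.
Proof.
  intros H. exists (Rmax 0 M). split. apply Rmax_l. intros s Hs. simpl. rewrite !Rmult_1_r.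
  eapply Rle_trans; [|apply Rmax_r]. auto.
Qed.

Lemma strip_growth_weaken (s1 s2 : R) (k n m : nat) (f : C -> C) : strip_growth s1 s2 n m f -> strip_growth s1 s2 (k + n) m f.
Proof.
  intros [K [HK H]]. exists K. split; auto. intros s Hs. specialize (H s Hs).
  set (D := (1 + Im s * Im s)%R) in *. assert (HD : (1 <= D)%R) by (unfold D; nra).
  eapply Rle_trans. apply H. apply Rmult_le_compat_l; auto. apply Rle_pow; auto. lia.
Qed.

Lemma strip_growth_linear (s1 s2 : R) (p : C) : strip_growth s1 s2 1 0 (fun s => s - p).
Proof.
  exists (Rabs s1 + Rabs s2 + Cmod p + 1)%R. pose proof (Rabs_pos s1). pose proof (Rabs_pos s2). pose proof (Cmod_ge_0 p).
  split. lra. intros s Hs. rewrite pow_O, Rmult_1_r, pow_1.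
  eapply Rle_trans. apply Cmod_le_sum.
  assert (Cmod s <= Rabs s1 + Rabs s2 + Rabs (Im s))%R.
  { eapply Rle_trans. apply Cmod_le_abs. apply Rplus_le_compat_r. apply Rabs_le.
    pose proof (Rle_abs s2). pose proof (Rabs_maj2 s1). lra. }
  assert (Rabs (Im s) <= 1 + Im s * Im s)%R. { unfold Rabs. destruct (Rcase_abs (Im s)); nra. }
  nra.
Qed.

Lemma strip_growth_inv_linear (s1 s2 : R) (p : C) : (Re p < s1)%R -> strip_growth s1 s2 0 0 (fun s => / (s - p)).
Proof.
  intros Hp. apply strip_growth_bounded with (M := (/ (s1 - Re p))%R). intros s Hs.
  assert (B : (s1 - Re p <= Cmod (s - p))%R).
  { eapply Rle_trans; [|apply re_le_Cmod]. eapply Rle_trans; [|apply Rle_abs]. rewrite Re_minus. lra. }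
  rewrite Cmod_inv by (apply Cmod_gt_0; lra). apply Rinv_le_contravar; lra.
Qed.

Lemma strip_growth_rcpow (s1 s2 M : R) (h : C -> C) : (forall s, (s1 <= Re s <= s2)%R -> (Rabs (Re (h s)) <= M)%R) ->
  strip_growth s1 s2 0 0 (fun s => Rcpow PI (h s)).
Proof.
  intros H. apply strip_growth_bounded with (M := exp (M * Rabs (ln PI))). intros s Hs. rewrite Cmod_Rcpow.
  apply exp_le. eapply Rle_trans. apply Rle_abs. rewrite Rabs_mult. apply Rmult_le_compat_r. apply Rabs_pos. auto.
Qed.

(** Order 2 per Gamma factor is enough: two such factors against at most two linear ones leave
    [(1 + y^2)^(-2)]. *)
Lemma strip_growth_Euler_laplace (s1 s2 b : R) : (0 < s1 / 2 + b)%R -> strip_growth s1 s2 0 2 (fun s => Euler_laplace (s / 2 + RtoC b)).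
Proof.
  intros Hb. destruct (Euler_laplace_decay 2 (s1 / 2 + b) (s2 / 2 + b) Hb) as [K [HK H]].
  (* 16 is the square of the 4 in [1 + y^2 <= 4 (1 + (y / 2)^2)]. *)
  exists (16 * K)%R. split. lra. intros s Hs. specialize (H (s / 2 + RtoC b)).
  rewrite Re_plus, Re_RtoC, Re_half, Im_plus, Im_RtoC, Im_half, Rplus_0_r in H. specialize (H ltac:(lra)).
  set (y := Im s) in *. rewrite pow_O, Rmult_1_r.
  set (D := (1 + y / 2 * (y / 2))%R) in *. assert (HD : (1 <= D)%R) by (unfold D; nra).
  assert (E : ((1 + y * y) ^ 2 <= 16 * D ^ 2)%R). { replace (16 * D ^ 2)%R with ((4 * D) ^ 2)%R by ring. apply pow_incr. unfold D. nra. }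
  assert (P : (0 < D ^ 2)%R) by (apply pow_lt; lra).
  apply Rle_trans with (K / D ^ 2 * (16 * D ^ 2))%R.
  - apply Rmult_le_compat; auto. apply Cmod_ge_0. apply pow_le. nra.
  - right. field. lra.
Qed.

Lemma strip_growth_quad (s1 s2 : R) (f : C -> C) : strip_growth s1 s2 2 4 f -> exists K, (0 <= K)%R /\
  forall x y, (s1 <= x <= s2)%R -> (Cmod (f (x, y)) <= K / (1 + y * y) ^ 2)%R.
Proof.
  intros [K [HK H]]. exists K. split; auto. intros x y Hx. specialize (H (x, y) Hx). rewrite Im_pair in H.
  set (D := (1 + y * y)%R) in *. assert (HD : (1 <= D)%R) by (unfold D; nra).
  assert (P : (0 < D ^ 2)%R) by (apply pow_lt; lra).
  apply Rmult_le_reg_r with (D ^ 4)%R. apply pow_lt; lra. eapply Rle_trans. apply H.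
  right. field. lra.
Qed.

(** * The products of g with their poles made explicit *)

(** The quotient of [(s - 1) Gamma ((s - a) / 2 + 1)] by [Gamma ((s + 1) / 2)], where [s - 1] is the
    factor of [g s]; the last case stands for [a = 5]. *)
Definition pole_factor (a : nat) (s : C) : C :=
  match a with 1%nat => s - 1 | 3%nat => 2 | _ => 4 / (s - 3) end.

(* [gg_minus a s = g s * g (s - a)], with the poles of the second factor at 1 (and at 3 for a = 5)
   made explicit, the one at 1 cancelled against the zero of [g]. *)
Definition gg_minus (a : nat) (s : C) : C :=
  Rcpow PI (- (s / 2)) * Rcpow PI (- ((s - RtoC (INR a)) / 2)) * pole_factor a s * (s - (RtoC (INR a) + 1))
  * (Euler_laplace (s / 2 + RtoC 1) * Euler_laplace (s / 2 + RtoC (/ 2))).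
(** Written with differences [s - p], so that the growth lemmas are shared with [gg_minus]. *)
Definition gg_plus (a : nat) (s : C) : C :=
  Rcpow PI (- (s / 2)) * Rcpow PI (- ((s - RtoC (- INR a)) / 2)) * (s - 1) * (s - (1 - RtoC (INR a)))
  * (Euler_laplace (s / 2 + RtoC 1) * Euler_laplace (s / 2 + RtoC (INR a / 2 + 1))).

(** A line beyond both [Re s0] and [1 - Re s0] lies beyond [1 / 2]; the last clause keeps clear of
    the pole at 3. *)
Definition admissible (a : nat) (s1 : R) : Prop :=
  (a = 1%nat \/ a = 3%nat \/ a = 5%nat) /\ (/ 2 < s1)%R /\ (a = 5%nat -> (3 < s1)%R).

(** The recursion of Gamma is applied until the argument is [(s + 1) / 2]: no step for [a = 1], one
    for 3, two for 5. For [a = 3] the point [s = 1] is a pole of the Gamma factor, and the left side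
    has an arbitrary factor there. *)
Lemma gg_minus_eq (a : nat) (s1 : R) (s : C) : admissible a s1 -> (s1 <= Re s)%R -> s <> 1 ->
  g s * g (s - RtoC (INR a)) = gg_minus a s.
Proof.
  intros (Ha & H1 & H5) Hs Hne.
  assert (G1 : g s = Rcpow PI (- (s / 2)) * (s - 1) * Euler_laplace (s / 2 + RtoC 1)).
  { unfold g. rewrite Gamma_right by (reim; lra). reflexivity. }
  assert (Key : (s - 1) * Gamma ((s - RtoC (INR a)) / 2 + 1) = pole_factor a s * Euler_laplace (s / 2 + RtoC (/ 2))).
  { assert (Hs1 : s - 1 <> 0) by now apply Cminus_neq_0.
    assert (E2 : RtoC (/ 2) = / 2) by (apply RtoC_inv; lra).
    destruct Ha as [-> | [-> | ->]].
    - simpl pole_factor. rewrite Gamma_right by (simpl INR; reim; lra). do 2 f_equal. rewrite E2. simpl INR. field.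
    - set (z := (s - RtoC (INR 3)) / 2 + 1).
      assert (Ez : z = (s - 1) / 2). { unfold z. replace (INR 3) with 3%R by (simpl; ring). field. }
      assert (Hz : z <> 0). { rewrite Ez. intros E. apply Hs1. replace (s - 1) with (2 * ((s - 1) / 2)) by field. rewrite E. ring. }
      rewrite (Gamma_eq z 1).
      + simpl rising. replace (z + RtoC (INR 1)) with (s / 2 + RtoC (/ 2)).
        2: { rewrite Ez, E2. simpl INR. field. }
        simpl pole_factor. simpl INR. rewrite Ez. field. auto.
      + rewrite Ez. simpl INR. reim. lra.
      + simpl. replace (1 * (z + 0)) with z by ring. auto.
    - assert (Hs3 : s - 3 <> 0). { apply Cminus_neq_0, Cneq_by_re. reim. specialize (H5 eq_refl). lra. }
      set (z := (s - RtoC (INR 5)) / 2 + 1).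
      assert (Ez : z = (s - 3) / 2). { unfold z. replace (INR 5) with 5%R by (simpl; ring). field. }
      assert (Hr : rising z 2 = (s - 3) / 2 * ((s - 1) / 2)).
      { simpl rising. simpl INR. rewrite Ez. field. }
      rewrite (Gamma_eq z 2).
      + rewrite Hr. replace (z + RtoC (INR 2)) with (s / 2 + RtoC (/ 2)).
        2: { rewrite Ez, E2. replace (INR 2) with 2%R by (simpl; ring). field. }
        simpl pole_factor. field. auto.
      + rewrite Ez. replace (INR 2) with 2%R by (simpl; ring). reim. specialize (H5 eq_refl). lra.
      + rewrite Hr. intros E. apply Hs3. replace (s - 3) with (4 * ((s - 3) / 2 * ((s - 1) / 2)) / (s - 1)) by (field; auto).
        rewrite E. unfold Cdiv. ring. }
  rewrite G1. unfold gg_minus. unfold g.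
  transitivity (Rcpow PI (- (s / 2)) * Euler_laplace (s / 2 + RtoC 1) * Rcpow PI (- ((s - RtoC (INR a)) / 2)) * (s - RtoC (INR a) - 1)
     * ((s - 1) * Gamma ((s - RtoC (INR a)) / 2 + 1))). ring.
  rewrite Key. ring.
Qed.

Lemma gg_plus_eq (a : nat) (s : C) : (0 < Re s)%R -> g s * g (s + RtoC (INR a)) = gg_plus a s.
Proof.
  intros Hs. pose proof (pos_INR a). unfold g, gg_plus. rewrite !Gamma_right by (reim; lra).
  replace (s - RtoC (- INR a)) with (s + RtoC (INR a)) by (rewrite RtoC_opp; ring).
  replace ((s + RtoC (INR a)) / 2 + 1) with (s / 2 + RtoC (INR a / 2 + 1)).
  2: { rewrite RtoC_plus, RtoC_div by lra. field. }
  ring.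
Qed.

Lemma strip_growth_Euler_laplace_pair (s1 s2 b : R) : (0 < s1)%R -> (0 < b)%R ->
  strip_growth s1 s2 0 4 (fun s => Euler_laplace (s / 2 + RtoC 1) * Euler_laplace (s / 2 + RtoC b)).
Proof.
  intros Hs Hb. apply (strip_growth_mult s1 s2 0 2 0 2 (fun s => Euler_laplace (s / 2 + RtoC 1)) (fun s => Euler_laplace (s / 2 + RtoC b)));
    apply strip_growth_Euler_laplace; lra.
Qed.

Lemma strip_growth_rcpow_line (s1 s2 b : R) : strip_growth s1 s2 0 0 (fun s => Rcpow PI (- ((s - RtoC b) / 2))).
Proof.
  apply strip_growth_rcpow with (M := (Rabs s1 + Rabs s2 + Rabs b)%R). intros s Hs. reim. rewrite Rabs_Ropp.
  pose proof (Rle_abs s2). pose proof (Rabs_maj2 s1). pose proof (Rle_abs b). pose proof (Rabs_maj2 b).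
  pose proof (Rabs_pos s1). pose proof (Rabs_pos s2). pose proof (Rabs_pos b).
  apply Rabs_le. lra.
Qed.

Lemma strip_growth_rcpow_line0 (s1 s2 : R) : strip_growth s1 s2 0 0 (fun s => Rcpow PI (- (s / 2))).
Proof.
  apply strip_growth_rcpow with (M := (Rabs s1 + Rabs s2)%R). intros s Hs. reim. rewrite Rabs_Ropp.
  pose proof (Rle_abs s2). pose proof (Rabs_maj2 s1).
  pose proof (Rabs_pos s1). pose proof (Rabs_pos s2). apply Rabs_le. lra.
Qed.

Lemma strip_growth_pole_factor (a : nat) (s1 s2 : R) : admissible a s1 -> strip_growth s1 s2 1 0 (pole_factor a).
Proof.
  intros (Ha & H1 & H5). destruct Ha as [-> | [-> | ->]]; simpl.
  - apply strip_growth_linear.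
  - apply (strip_growth_weaken s1 s2 1 0 0). apply strip_growth_bounded with (M := Cmod 2). intros; apply Rle_refl.
  - apply (strip_growth_weaken s1 s2 1 0 0). apply (strip_growth_mult s1 s2 0 0 0 0 (fun _ => RtoC 4) (fun s => / (s - 3))).
    apply strip_growth_bounded with (M := Cmod 4). intros; apply Rle_refl.
    apply strip_growth_inv_linear. simpl. auto.
Qed.

Ltac strip_growth_split n1 m1 n2 m2 :=
  lazymatch goal with
  | |- strip_growth ?s1 ?s2 _ _ (fun s => @?f s * @?h s) =>
      let H := fresh in pose proof (strip_growth_mult s1 s2 n1 m1 n2 m2 f h) as H; cbv beta in H; simpl Nat.add in H; refine (H _ _); clear H
  end.

Lemma strip_growth_gg_minus (a : nat) (s1 s2 : R) : admissible a s1 -> strip_growth s1 s2 2 4 (gg_minus a).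
Proof.
  intros Ha. pose proof Ha as (_ & H1 & _). unfold gg_minus.
  strip_growth_split 2%nat 0%nat 0%nat 4%nat. 2: { apply strip_growth_Euler_laplace_pair; lra. }
  strip_growth_split 1%nat 0%nat 1%nat 0%nat. 2: apply strip_growth_linear.
  strip_growth_split 0%nat 0%nat 1%nat 0%nat. 2: exact (strip_growth_pole_factor a s1 s2 Ha).
  strip_growth_split 0%nat 0%nat 0%nat 0%nat. apply strip_growth_rcpow_line0. apply strip_growth_rcpow_line.
Qed.

Lemma strip_growth_gg_plus (a : nat) (s1 s2 : R) : (0 < s1)%R -> strip_growth s1 s2 2 4 (gg_plus a).
Proof.
  intros H1. pose proof (pos_INR a). unfold gg_plus.
  strip_growth_split 2%nat 0%nat 0%nat 4%nat. 2: { apply strip_growth_Euler_laplace_pair; lra. }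
  strip_growth_split 1%nat 0%nat 1%nat 0%nat. 2: apply strip_growth_linear.
  strip_growth_split 0%nat 0%nat 1%nat 0%nat. 2: apply strip_growth_linear.
  strip_growth_split 0%nat 0%nat 0%nat 0%nat. apply strip_growth_rcpow_line0. apply strip_growth_rcpow_line.
Qed.

Lemma C2_neq_0 : RtoC 2 <> 0.
Proof. apply RtoC_neq. lra. Qed.

Lemma Euler_laplace_line_cdiff (b : R) (s : C) : (0 < Re s / 2 + b)%R -> cdiff (fun s => Euler_laplace (s / 2 + RtoC b)) s.
Proof.
  intros H. apply (cdiff_comp Euler_laplace (fun s => s / 2 + RtoC b)). apply Euler_laplace_cdiff. reim. lra.
  cdiff_tac. apply C2_neq_0.
Qed.

Lemma Rcpow_line_cdiff (p s : C) : cdiff (fun s => Rcpow PI (- ((s - p) / 2))) s.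
Proof. apply Rcpow_cdiff. cdiff_tac. apply C2_neq_0. Qed.
Lemma Rcpow_line0_cdiff (s : C) : cdiff (fun s => Rcpow PI (- (s / 2))) s.
Proof. apply Rcpow_cdiff. cdiff_tac. apply C2_neq_0. Qed.

Lemma gg_minus_cdiff (a : nat) (s1 : R) (s : C) : admissible a s1 -> (s1 <= Re s)%R -> cdiff (gg_minus a) s.
Proof.
  intros (Ha & H1 & H5) Hs. unfold gg_minus. cdiff_tac.
  - apply Rcpow_line0_cdiff.
  - apply Rcpow_line_cdiff.
  - destruct Ha as [-> | [-> | ->]]; simpl; cdiff_tac.
    apply Cminus_neq_0, Cneq_by_re. reim. specialize (H5 eq_refl). lra.
  - apply Euler_laplace_line_cdiff. lra.
  - apply Euler_laplace_line_cdiff. lra.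
Qed.

Lemma gg_plus_cdiff (a : nat) (s : C) : (0 < Re s)%R -> cdiff (gg_plus a) s.
Proof.
  intros Hs. pose proof (pos_INR a). unfold gg_plus. cdiff_tac.
  - apply Rcpow_line0_cdiff.
  - apply Rcpow_line_cdiff.
  - apply Euler_laplace_line_cdiff. lra.
  - apply Euler_laplace_line_cdiff. lra.
Qed.

Lemma inv_npow_cdiff (k : nat) (f : C -> C) (s : C) : cdiff f s -> cdiff (fun s => inv_npow k (f s)) s.
Proof. intros H. unfold inv_npow. cdiff_tac. Qed.

(** [xi_laplace] is bounded on vertical strips, so only [s (s - 1)] grows; each linear factor is
    counted as a full power of [1 + y^2]. *)
Lemma Xi_strip_growth (s1 s2 : R) : strip_growth s1 s2 2 0 Xi.
Proof.
  unfold Xi. destruct (xi_laplace_bound (s1 / 2) (s2 / 2)) as [K [HK H]].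
  apply strip_growth_plus.
  - apply (strip_growth_weaken s1 s2 2 0 0). apply strip_growth_bounded with (M := Cmod (/ 2)). intros; apply Rle_refl.
  - apply (strip_growth_mult s1 s2 2 0 0 0 (fun s => s * (s - 1) / 2) (fun s => xi_laplace (s / 2))).
    + apply (strip_growth_mult s1 s2 2 0 0 0 (fun s => s * (s - 1)) (fun s => / 2)).
      apply (strip_growth_mult s1 s2 1 0 1 0 (fun s => s) (fun s => s - 1)).
      * destruct (strip_growth_linear s1 s2 0) as [L [HL B]]. exists L. split; auto. intros s Hs.
        specialize (B s Hs). replace (s - 0) with s in B by ring. exact B.
      * apply strip_growth_linear.
      * apply strip_growth_bounded with (M := Cmod (/ 2)). intros; apply Rle_refl.
    + apply strip_growth_bounded with (M := K). intros s Hs. apply H. reim. lra.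
Qed.

Lemma zeta_series_bounded (p : R) : (1 < p)%R -> exists B, forall s, (p <= Re s)%R -> (Cmod (zeta_series s) <= B)%R.
Proof.
  intros Hp. destruct (summable_power p Hp) as [_ [B HB]]. exists B. intros s Hs.
  apply (Clim_bound _ _ _ (zeta_series_lim s ltac:(lra))). intros n. eapply Rle_trans; [|apply (HB n)].
  apply csum_bound. intros k. rewrite Cmod_inv_npow. apply exp_le. pose proof (ln_S_pos k). nra.
Qed.

(** A line through [s = 1] meets the removed pole at height 0. Splitting the interval there makes
    the exceptional point an endpoint, which the integral ignores. *)
Lemma is_RInt_gen_except_0 (f h : R -> C) (l : C) : (forall t, ccont h t) -> is_line h l ->
  (forall t, t <> 0%R -> f t = h t) ->
  is_RInt_gen (V := C_R_NormedModule) f (Rbar_locally m_infty) (Rbar_locally p_infty) l.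
Proof.
  intros Ch Hh E P [eps HP].
  destruct (Hh (eps / 2)%R) as [M HM]. { pose proof (cond_pos eps). lra. }
  (* The maximum with 0 keeps the splitting point between the ends. *)
  exists (fun a => (a < - Rmax M 0)%R) (fun b => (Rmax M 0 < b)%R).
  { exists (- Rmax M 0)%R. auto. } { exists (Rmax M 0). auto. }
  pose proof (Rmax_l M 0). pose proof (Rmax_r M 0).
  intros a b Ha Hb. simpl. exists (CInt h a b). split.
  - rewrite <- (CInt_Chasles h a 0 b) by (apply cintble_cont'; auto).
    apply (is_RInt_Chasles (V := C_R_NormedModule) f a 0 b).
    + apply (is_RInt_ext h). 2: apply CInt_correct, cintble_cont'; auto.
      intros t. rewrite Rmin_left, Rmax_right by lra. intros Ht. symmetry. apply E. lra.
    + apply (is_RInt_ext h). 2: apply CInt_correct, cintble_cont'; auto.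
      intros t. rewrite Rmin_left, Rmax_right by lra. intros Ht. symmetry. apply E. lra.
  - apply HP. apply C_NormedModule_mixin_compat1. change (Cmod (CInt h a b - l) < eps)%R.
    eapply Rle_lt_trans. apply HM; lra. pose proof (cond_pos eps). lra.
Qed.

(** * From the given line to the region of convergence *)

Section Main.
Variables (a : nat) (s0 : C) (sg : R).
Hypothesis Hadm : admissible a sg.
Hypothesis Hs0 : (Re s0 < sg)%R.
Hypothesis Hs1 : (Re (1 - s0) < sg)%R.
Let A : C := RtoC (INR a).

(** The continued form of the first part of the integrand, holomorphic on the closed half-plane
    [sg <= Re s] even where the value of [g] is arbitrary. *)
Definition kernel_minus (s : C) : C := gg_minus a s * / (s - s0).
Definition kernel_plus (s : C) : C := gg_plus a s * / (s - (1 - s0)).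
Definition summand (k : nat) (s : C) : C :=
  RtoC (INR (divisor_sigma a (S k))) * (kernel_minus s * inv_npow k s + kernel_plus s * inv_npow k (s + A)).

Lemma sigma_gt_half : (/ 2 < sg)%R. Proof. apply Hadm. Qed.

Lemma kernel_strip_growth (s2 : R) : exists K, (0 <= K)%R /\ forall x y, (sg <= x <= s2)%R ->
  (Cmod (kernel_minus (x, y)) <= K / (1 + y * y) ^ 2)%R /\ (Cmod (kernel_plus (x, y)) <= K / (1 + y * y) ^ 2)%R.
Proof.
  pose proof sigma_gt_half.
  destruct (strip_growth_quad sg s2 kernel_minus) as [K1 [HK1 B1]].
  { apply (strip_growth_mult sg s2 2 4 0 0 (gg_minus a) (fun s => / (s - s0))). now apply strip_growth_gg_minus. now apply strip_growth_inv_linear. }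
  destruct (strip_growth_quad sg s2 kernel_plus) as [K2 [HK2 B2]].
  { apply (strip_growth_mult sg s2 2 4 0 0 (gg_plus a) (fun s => / (s - (1 - s0)))). apply strip_growth_gg_plus. lra. now apply strip_growth_inv_linear. }
  exists (K1 + K2)%R. split. lra. intros x y Hx.
  assert (P : (0 < / (1 + y * y) ^ 2)%R) by (apply Rinv_0_lt_compat, pow_lt; nra).
  split. eapply Rle_trans. apply B1; auto. unfold Rdiv. nra.
  eapply Rle_trans. apply B2; auto. unfold Rdiv. nra.
Qed.

Lemma kernel_minus_cdiff (s : C) : (sg <= Re s)%R -> cdiff kernel_minus s.
Proof.
  intros Hs. unfold kernel_minus. cdiff_tac. now apply (gg_minus_cdiff a sg). apply Cminus_neq_0, Cneq_by_re. lra.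
Qed.
Lemma kernel_plus_cdiff (s : C) : (sg <= Re s)%R -> cdiff kernel_plus s.
Proof.
  intros Hs. pose proof sigma_gt_half. unfold kernel_plus. cdiff_tac. apply gg_plus_cdiff. lra. apply Cminus_neq_0, Cneq_by_re. lra.
Qed.

Lemma summand_cdiff (k : nat) (s : C) : (sg <= Re s)%R -> cdiff (summand k) s.
Proof.
  intros Hs. unfold summand. cdiff_tac; try (now apply kernel_minus_cdiff); try (now apply kernel_plus_cdiff).
  apply inv_npow_cdiff. cdiff_tac. apply inv_npow_cdiff. cdiff_tac.
Qed.

Lemma inv_npow_A_le (k : nat) (s : C) : (Cmod (inv_npow k (s + A)) <= Cmod (inv_npow k s))%R.
Proof.
  rewrite !Cmod_inv_npow. apply exp_le. unfold A. reim. pose proof (ln_S_pos k). pose proof (pos_INR a). nra.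
Qed.

(** The factor [(k + 1)^(-x)] is kept: bounded by 1 it serves the shift of a single integral, and at
    [x = c] it makes the sum over [k] converge. *)
Lemma summand_bound (s2 : R) : exists K, (0 <= K)%R /\ forall k x y, (sg <= x <= s2)%R ->
  (Cmod (summand k (x, y)) <= INR (divisor_sigma a (S k)) * exp (- (x * ln (INR (S k)))) * K / (1 + y * y))%R.
Proof.
  destruct (kernel_strip_growth s2) as [K [HK B]]. exists (2 * K)%R. split. lra.
  intros k x y Hx. destruct (B x y Hx) as [B1 B2].
  unfold summand. rewrite Cmod_mult, Cmod_R, Rabs_pos_eq by apply pos_INR.
  unfold Rdiv. rewrite !Rmult_assoc. apply Rmult_le_compat_l. apply pos_INR.
  eapply Rle_trans. apply Cmod_triangle. rewrite !Cmod_mult.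
  pose proof (inv_npow_A_le k (x, y)) as N1. assert (N2 : Cmod (inv_npow k (x, y)) = exp (- (x * ln (INR (S k))))).
  { now rewrite Cmod_inv_npow. }
  rewrite N2 in *. set (e := exp (- (x * ln (INR (S k))))) in *. assert (He : (0 < e)%R) by apply exp_pos.
  assert (Q : (K / (1 + y * y) ^ 2 <= K / (1 + y * y))%R).
  { unfold Rdiv. apply Rmult_le_compat_l; auto. apply Rinv_le_contravar. nra. simpl. nra. }
  set (q := (K / (1 + y * y))%R) in *. 
  pose proof (Cmod_ge_0 (kernel_minus (x, y))). pose proof (Cmod_ge_0 (kernel_plus (x, y))). pose proof (Cmod_ge_0 (inv_npow k ((x, y) + A))).
  assert (Cmod (kernel_minus (x, y)) * e <= q * e)%R by (apply Rmult_le_compat; lra).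
  assert (Cmod (kernel_plus (x, y)) * Cmod (inv_npow k ((x, y) + A)) <= q * e)%R by (apply Rmult_le_compat; lra).
  replace (e * (2 * (K * / (1 + y * y))))%R with (q * e + q * e)%R by (unfold q, Rdiv; ring). lra.
Qed.

Lemma summand_dominated (k : nat) (x : R) : (sg <= x)%R -> exists K, dominated (fun t => summand k (x, t)) K.
Proof.
  intros Hx. destruct (summand_bound x) as [K [HK B]]. eexists. split.
  - intros t. apply (ccont_vline (summand k)). now apply summand_cdiff.
  - intros t. apply B. lra.
Qed.

Lemma summand_shift (k : nat) (s2 : R) : (sg < s2)%R ->
  LInt (fun t => summand k (sg, t)) = LInt (fun t => summand k (s2, t)).
Proof.
  intros Hs. destruct (summand_bound s2) as [K [HK B]]. pose proof sigma_gt_half.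
  destruct (summand_dominated k sg ltac:(lra)) as [D1 HD1]. destruct (summand_dominated k s2 ltac:(lra)) as [D2 HD2].
  apply (strip_shift (summand k) sg s2); auto.
  - intros z Hz. apply summand_cdiff. lra.
  - apply (strip_small_dominated _ _ _ (INR (divisor_sigma a (S k)) * K)). intros x y Hx.
    eapply Rle_trans. now apply B. 
    assert (exp (- (x * ln (INR (S k)))) <= 1)%R.
    { rewrite <- exp_0. apply exp_le. pose proof (ln_S_pos k). nra. }
    pose proof (pos_INR (divisor_sigma a (S k))). unfold Rdiv. apply Rmult_le_compat_r.
    left; apply Rinv_0_lt_compat; nra. apply Rmult_le_compat_r; auto. pose proof (exp_pos (- (x * ln (INR (S k))))). nra.
  - apply (LInt_correct _ _ HD1).
  - apply (LInt_correct _ _ HD2).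
Qed.

(** Beyond [INR a + 1], where both zeta series converge, and beyond [sg], so that
    [1 - c < Re s0 < c]. *)
Let c : R := (sg + INR a + 2)%R.
Let F (s : C) : C := Xi s * Xi (s - A).
Let f1 (t : R) : C := F (c, t) / ((c, t) - s0).
Let f2 (t : R) : C := F (1 - (c, t)) / ((c, t) - 1 + s0).

Lemma abscissa_gt : (sg < c /\ INR a + 1 < c)%R.
Proof. unfold c. pose proof (pos_INR a). pose proof sigma_gt_half. lra. Qed.

(** For the second identity two reflections turn [Xi (1 - s) Xi (1 - (s + a))] into
    [Xi s Xi (s + a)], whose Gamma factors are those of [gg_plus]. *)
Lemma kernel_zeta_eq (t : R) :
  kernel_minus (c, t) * (zeta_series ((c, t) - A) * zeta_series (c, t)) = f1 t /\
  kernel_plus (c, t) * (zeta_series ((c, t) + A - A) * zeta_series ((c, t) + A)) = f2 t.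
Proof.
  destruct abscissa_gt as [C1 C2]. pose proof (pos_INR a). pose proof sigma_gt_half.
  set (s := (c, t) : C). assert (Hc : Re s = c) by reflexivity.
  assert (HA : Re A = INR a) by reflexivity.
  assert (Hne : s <> 1). { apply Cneq_by_re. rewrite Hc, Re_RtoC. lra. }
  split.
  - unfold f1, F, kernel_minus. fold s. rewrite <- (gg_minus_eq a sg s) by (auto; lra). fold A.
    rewrite <- (g_zeta_right s), <- (g_zeta_right (s - A)), (zeta_right s), (zeta_right (s - A)) by (rewrite ?Re_minus, ?HA; lra).
    unfold Cdiv. ring.
  - unfold f2, F, kernel_plus. fold s. rewrite <- (gg_plus_eq a s) by lra. fold A.
    replace (s + A - A) with s by ring. rewrite Xi_sym.
    replace (1 - s - A) with (1 - (s + A)) by ring. rewrite Xi_sym.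
    rewrite <- (g_zeta_right s), <- (g_zeta_right (s + A)), (zeta_right s), (zeta_right (s + A)) by (rewrite ?Re_plus, ?HA; lra).
    replace (s - 1 + s0) with (s - (1 - s0)) by ring. unfold Cdiv. ring.
Qed.

(** The polynomial bound for [Xi] would not give decay; on the edges the Gamma factors decay and the
    zeta factors are bounded. *)
Lemma edge_integrand_bounds : exists K, (0 <= K)%R /\
  (forall t, (Cmod (f1 t) <= K / (1 + t * t) ^ 2)%R) /\ (forall t, (Cmod (f2 t) <= K / (1 + t * t) ^ 2)%R).
Proof.
  destruct abscissa_gt as [C1 C2]. pose proof (pos_INR a). destruct (kernel_strip_growth c) as [K [HK B]].
  destruct (zeta_series_bounded (c - INR a)) as [Z HZ]. lra.
  assert (HZ0 : (0 <= Z)%R).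
  { specialize (HZ (c, 0%R) ltac:(reim; lra)). pose proof (Cmod_ge_0 (zeta_series (c, 0%R))). lra. }
  assert (HA : Re A = INR a) by reflexivity.
  exists (K * (Z * Z))%R. split. apply Rmult_le_pos; nra.
  split; intros t; destruct (kernel_zeta_eq t) as [E1 E2]; destruct (B c t ltac:(lra)) as [B1 B2].
  - rewrite <- E1, !Cmod_mult. replace (K * (Z * Z) / (1 + t * t) ^ 2)%R with (K / (1 + t * t) ^ 2 * (Z * Z))%R by (unfold Rdiv; ring).
    apply Rmult_le_compat; auto. apply Cmod_ge_0. apply Rmult_le_pos; apply Cmod_ge_0.
    apply Rmult_le_compat; try apply Cmod_ge_0; apply HZ; reim; rewrite ?HA; lra.
  - rewrite <- E2, !Cmod_mult. replace (K * (Z * Z) / (1 + t * t) ^ 2)%R with (K / (1 + t * t) ^ 2 * (Z * Z))%R by (unfold Rdiv; ring).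
    apply Rmult_le_compat; auto. apply Cmod_ge_0. apply Rmult_le_pos; apply Cmod_ge_0.
    apply Rmult_le_compat; try apply Cmod_ge_0; apply HZ; reim; rewrite ?HA; lra.
Qed.

Lemma Xi_pair_cdiff (s : C) : cdiff F s.
Proof.
  unfold F. apply (cdiff_mult Xi (fun s => Xi (s - A))). apply Xi_cdiff.
  apply (cdiff_comp Xi (fun s => s - A)). apply Xi_cdiff. cdiff_tac.
Qed.

Lemma Xi_pair_growth : exists K, forall x y, (1 - c <= x <= c)%R -> (Cmod (F (x, y)) <= K * (1 + y * y) ^ 4)%R.
Proof.
  assert (B : strip_growth (1 - c) c 4 0 F).
  { apply (strip_growth_mult (1 - c) c 2 0 2 0 Xi (fun s => Xi (s - A))). apply Xi_strip_growth.
    destruct (Xi_strip_growth (1 - c - INR a) (c - INR a)) as [K [HK H]]. exists K. split; auto. intros s Hs.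
    specialize (H (s - A)). unfold A in *. rewrite Re_minus, Im_minus, Re_RtoC, Im_RtoC, Rminus_0_r in H. apply H. lra. }
  destruct B as [K [HK H]]. exists K. intros x y Hx. specialize (H (x, y) Hx). rewrite pow_O, Rmult_1_r in H. exact H.
Qed.

Lemma total_integral : Clim (csum (fun k => LInt (fun t => summand k (sg, t)))) (RtoC (2 * PI) * (Xi s0 * Xi (s0 - A))).
Proof.
  destruct abscissa_gt as [C1 C2]. pose proof (pos_INR a). pose proof sigma_gt_half.
  destruct edge_integrand_bounds as [K [HK [B1 B2]]]. destruct Xi_pair_growth as [KF HKF].
  assert (Hs0' : (1 - c < Re s0 < c)%R). { rewrite Re_minus, Re_RtoC in Hs1. lra. }
  assert (E := strip_cauchy F s0 c KF K K Xi_pair_cdiff Hs0' HKF B1 B2).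
  change (LInt f1 + LInt f2 = RtoC (2 * PI) * (Xi s0 * Xi (s0 - A))) in E. rewrite <- E.
  destruct (summand_bound c) as [KT [HKT BT]].
  destruct (divisor_summable a c C2) as [Da [DB HDB]].
  set (w := fun k => (INR (divisor_sigma a (S k)) * exp (- (c * ln (INR (S k)))))%R) in *.
  assert (Sw : summable (fun k => w k * KT)%R).
  { split. intros k. apply Rmult_le_pos; auto. apply Da. exists (DB * KT)%R. intros n. rewrite rsum_scal_r.
    apply Rmult_le_compat_r; auto. }
  destruct (LInt_series (fun k t => summand k (c, t)) (fun t => f1 t + f2 t) (fun k => w k * KT)%R Sw) as [_ L].
  - intros k. split. intros t. apply (ccont_vline (summand k)). apply summand_cdiff. reim; lra.
    intros t. apply BT. lra.
  (* The divisor series is summed at [s] and at [s + A]; the latter yields the zeta values at [s]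
     and [s + A]. *)
  - intros t. destruct (kernel_zeta_eq t) as [<- <-]. set (s := (c, t) : C).
    apply (Clim_ext (fun N => kernel_minus s * csum (fun k => RtoC (INR (divisor_sigma a (S k))) * inv_npow k s) N
       + kernel_plus s * csum (fun k => RtoC (INR (divisor_sigma a (S k))) * inv_npow k (s + A)) N)).
    + intros N. rewrite <- !csum_scal, <- csum_plus. apply csum_ext. intros k _. unfold summand. ring.
    + apply Clim_plus; apply Clim_scal; apply divisor_series; unfold s, A; reim; lra.
  - rewrite <- (LInt_plus f1 f2 K K).
    (* The sum was formed on the line [c]; each integral is now carried back to [sg]. *)
    + revert L. apply Clim_ext. intros N. apply csum_ext. intros k _. symmetry. now apply summand_shift.
    + apply (dominated_of_quad f1 K). intros t. apply (cauchy_edge_ccont F s0 c Xi_pair_cdiff Hs0'). auto.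
    + apply (dominated_of_quad f2 K). intros t. apply (cauchy_refl_edge_ccont F s0 c Xi_pair_cdiff Hs0'). auto.
Qed.

(** Off height 0 the point differs from 1 whatever [sg] is, so the product of [g] values equals its
    continued form. *)
Lemma integrand_summand (k : nat) (t : R) : t <> 0%R ->
  let s := RtoC sg + Ci * RtoC t in
  RtoC (INR (divisor_sigma a (S k))) *
    (g s * g (s - A) / (s - s0) * (1 / Rcpow (INR (S k)) s)
     + g s * g (s + A) / (s - 1 + s0) * (1 / Rcpow (INR (S k)) (s + A))) * Ci
  = Ci * summand k (sg, t).
Proof.
  intros Ht s. pose proof sigma_gt_half. assert (Es : s = (sg, t)) by (unfold s; apply C_eq; simpl; ring).
  rewrite Es. set (w := (sg, t) : C).
  assert (Hr : Re w = sg) by reflexivity.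
  unfold A. rewrite (gg_minus_eq a sg w), (gg_plus_eq a w) by (auto; try lra; apply Cneq_by_im; simpl; lra).
  unfold summand, kernel_minus, kernel_plus. rewrite !inv_npow_inv. fold A.
  replace (w - 1 + s0) with (w - (1 - s0)) by ring. unfold Cdiv. ring.
Qed.

End Main.

Theorem corollary2 :
  forall (a : nat) (s0 : C) (sigma : R),
    (a = 1%nat \/ a = 3%nat \/ a = 5%nat) ->
    (Re s0 < sigma)%R ->
    (Re (1 - s0) < sigma)%R ->
    (a = 5%nat -> (3 < sigma)%R) ->
    exists (J : nat -> C) (L : C),
      (forall n : nat, (1 <= n)%nat ->
         is_vertical_integral
           (fun s : C =>
              RtoC (INR (divisor_sigma a n)) *
              (g s * g (s - RtoC (INR a)) / (s - s0)
                 * (1 / Rcpow (INR n) s)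
               + g s * g (s + RtoC (INR a)) / (s - 1 + s0)
                 * (1 / Rcpow (INR n) (s + RtoC (INR a)))))
           sigma (J n)) /\
      is_series (K := C_AbsRing) (V := C_NormedModule)
        (fun k : nat => J (k + 1)%nat) L /\
      xi s0 * xi (s0 - RtoC (INR a)) = 1 / (2 * RtoC PI * Ci) * L.
Proof.
  intros a s0 sg Ha Hs0 Hs1 H5.
  assert (Hadm : admissible a sg).
  { split; auto. split; auto. rewrite Re_minus, Re_RtoC in Hs1. lra. }
  (* [Ci] comes from [ds = i dt]; [pred] appears because [summand k] belongs to the integer
     [k + 1]. *)
  exists (fun n => Ci * LInt (fun t => summand a s0 (pred n) (sg, t))).
  exists (Ci * (RtoC (2 * PI) * (Xi s0 * Xi (s0 - RtoC (INR a))))).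
  split; [|split].
  - intros n Hn. destruct n as [|k]; [lia|]. simpl pred.
    destruct (summand_dominated a s0 sg Hadm Hs0 Hs1 k sg (Rle_refl _)) as [K D].
    unfold is_vertical_integral.
    apply (is_RInt_gen_except_0 _ (fun t => Ci * summand a s0 k (sg, t))).
    + intros t. apply ccont_mult. apply ccont_const. apply D.
    + apply is_line_scal. apply D. apply (LInt_correct _ _ D).
    + intros t Ht. apply (integrand_summand a s0 sg Hadm k t Ht).
  - apply is_series_Clim.
    apply (Clim_ext (fun N => Ci * csum (fun k => LInt (fun t => summand a s0 k (sg, t))) N)).
    + intros N. rewrite <- csum_scal. apply csum_ext. intros k _. replace (k + 1)%nat with (S k) by lia. reflexivity.
    + apply Clim_scal. now apply total_integral.
  - rewrite !xi_eq_Xi. rewrite RtoC_mult. field. split.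
    + intros E. apply (f_equal Im) in E. simpl in E. lra.
    + apply RtoC_neq. pose proof PI_RGT_0. lra.
Qed.
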